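(* For every pair $(m,n)$ of non-negative integers, there is a complex infinite-dimensional Banach space $X$ for which $K_0(\mathcal{B}(X))\cong\mathbb{Z}^m$ and $K_1(\mathcal{B}(X))\cong\mathbb{Z}^n$ (as groups), where $\mathbb{Z}^0:=\{0\}$ is the trivial group.
   Context: $\mathcal{B}(X)$ is the unital Banach algebra of all continuous linear maps $X\to X$. $K_0$: for a unital complex algebra $A$, let $\operatorname{IP}_n(A)$ be the set of idempotents in $M_n(A)$ and $\operatorname{IP}_\infty(A)=\bigcup_{n\ge 1}\operatorname{IP}_n(A)$. For $P\in\operatorname{IP}_m(A)$ and $Q\in\operatorname{IP}_n(A)$ write $P\sim_0 Q$ if there are $R\in M_{m,n}(A)$, $T\in M_{n,m}(A)$ with $P=RT$ and $Q=TR$. The quotient $V(A)=\operatorname{IP}_\infty(A)/{\sim_0}$ is a commutative semigroup under $[P]+[Q]=[\operatorname{diag}(P,Q)]$, and $K_0(A)$ is its Grothendieck group. $K_1$: for a unital Banach algebra $A$, let $\operatorname{Inv}_n(A)$ be the group of invertible elements of $M_n(A)$ and $\operatorname{Inv}_\infty(A)=\bigcup_{n\ge 1}\operatorname{Inv}_n(A)$. For $U\in\operatorname{Inv}_m(A)$ and $V\in\operatorname{Inv}_n(A)$ write $U\sim_1 V$ if for some $k>\max\{m,n\}$ there is a continuous path in $\operatorname{Inv}_k(A)$ from $\operatorname{diag}(U,I^{(k-m)})$ to $\operatorname{diag}(V,I^{(k-n)})$, where $I^{(j)}$ is the identity of $M_j(A)$. Then $K_1(A)=\operatorname{Inv}_\infty(A)/{\sim_1}$,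 a commutative group under $[U]_1+[V]_1=[\operatorname{diag}(U,V)]_1$. *)

(* Defs.v *)
From HB Require Import structures.
From mathcomp Require Import all_boot all_order all_algebra.
From mathcomp Require Import generic_quotient complex.
From mathcomp Require Import all_classical all_reals all_analysis.

Set Implicit Arguments.
Unset Strict Implicit.
Unset Printing Implicit Defensive.

Import Order.TTheory GRing.Theory Num.Theory.
Import numFieldNormedType.Exports.

Local Open Scope quotient_scope.
Local Open Scope ring_scope.

(* The Grothendieck group of a commutative monoid S: the class of (a, b) stands
   for the formal difference a - b. *)
Section Grothendieck.
Variable S : nmodType.

Definition groth_rel (p q : S * S) : bool :=
  `[< exists e, p.1 + q.2 + e = q.1 + p.2 + e >].

Lemma groth_rel_refl : reflexive groth_rel.
Proof. by move=> p; apply/asboolP; exists 0. Qed.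

Lemma groth_rel_sym : symmetric groth_rel.
Proof. by move=> p q; apply/asboolP/asboolP => -[e ?]; exists e. Qed.

Lemma groth_rel_trans : transitive groth_rel.
Proof.
move=> q p r /asboolP [e he] /asboolP [f hf]; apply/asboolP.
exists (q.1 + q.2 + e + f).
transitivity ((p.1 + q.2 + e) + (q.1 + r.2 + f)).
  by rewrite (AC (2*4) ((1*4*5)*(3*2*6))).
by rewrite he hf (AC (3*3) ((4*2)*(1*5*3*6))).
Qed.

Canonical groth_equiv :=
  EquivRel groth_rel groth_rel_refl groth_rel_sym groth_rel_trans.

Definition groth := {eq_quot groth_equiv}.
HB.instance Definition _ := Choice.on groth.

Lemma groth_piP (p q : S * S) :
  (exists e, p.1 + q.2 + e = q.1 + p.2 + e) <-> \pi_groth p = \pi_groth q.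
Proof. by split=> [h|/eqmodP/asboolP//]; apply/eqmodP/asboolP. Qed.

Lemma groth_surj (u : groth) : exists p, u = \pi_groth p.
Proof. by exists (repr u); rewrite reprK. Qed.

Definition groth_add (u v : groth) : groth := \pi_groth (repr u + repr v).
Definition groth_opp (u : groth) : groth := \pi_groth ((repr u).2, (repr u).1).
Definition groth_zero : groth := \pi_groth 0.

Lemma groth_repr (p : S * S) : exists e,
  (repr (\pi_groth p)).1 + p.2 + e = p.1 + (repr (\pi_groth p)).2 + e.
Proof. by apply/groth_piP; rewrite reprK. Qed.

Lemma groth_addE p q :
  groth_add (\pi_groth p) (\pi_groth q) = \pi_groth (p + q).
Proof.
have [e he] := groth_repr p; have [f hf] := groth_repr q.
apply/groth_piP; exists (e + f) => /=.
move: (repr (\pi_groth p)) (repr (\pi_groth q)) he hf => p' q' he hf.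
transitivity ((p'.1 + p.2 + e) + (q'.1 + q.2 + f)).
  by rewrite (AC (2*2*2) ((1*3*5)*(2*4*6))).
by rewrite he hf (AC (3*3) ((1*4)*(2*5)*(3*6))).
Qed.

Lemma groth_oppE p : groth_opp (\pi_groth p) = \pi_groth (p.2, p.1).
Proof.
have [e he] := groth_repr p; apply/groth_piP; exists e => /=.
by rewrite [X in X + _ = _]addrC -he [X in X + _ = _]addrC.
Qed.

Lemma groth_addA : associative groth_add.
Proof.
move=> u v w; have [p ->] := groth_surj u; have [q ->] := groth_surj v.
have [r ->] := groth_surj w.
by rewrite !groth_addE addrA.
Qed.

Lemma groth_addC : commutative groth_add.
Proof.
move=> u v; have [p ->] := groth_surj u; have [q ->] := groth_surj v.
by rewrite !groth_addE addrC.
Qed.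

Lemma groth_add0 : left_id groth_zero groth_add.
Proof. by move=> u; have [p ->] := groth_surj u; rewrite groth_addE add0r. Qed.

Lemma groth_addN : left_inverse groth_zero groth_opp groth_add.
Proof.
move=> u; have [p ->] := groth_surj u; rewrite groth_oppE groth_addE; apply/groth_piP.
by exists 0; rewrite /= !addr0 add0r addrC.
Qed.

HB.instance Definition _ :=
  GRing.isZmodule.Build groth groth_addA groth_addC groth_add0 groth_addN.

End Grothendieck.

(* Only the ring structure of A matters here. Rings in which 1 = 0 are allowed:
   the algebra of operators on the zero space is one. *)
Section K0.
Variable A : pzRingType.

(* The union of the sets of idempotents of 'M[A]_n, for n >= 1. *)
Record idem_mx := IdemMx {
  idem_dim : nat;
  idem_dim_gt0 : (0 < idem_dim)%N;
  idem_val :> 'M[A]_idem_dim;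
  idem_valP : idem_val *m idem_val = idem_val }.

HB.instance Definition _ := gen_eqMixin idem_mx.
HB.instance Definition _ := gen_choiceMixin idem_mx.

Definition sim0 (P Q : idem_mx) : bool :=
  `[< exists (R : 'M[A]_(idem_dim P, idem_dim Q))
             (T : 'M[A]_(idem_dim Q, idem_dim P)),
        idem_val P = R *m T /\ idem_val Q = T *m R >].

Lemma sim0_refl : reflexive sim0.
Proof. by case=> n n0 P PP; apply/asboolP; exists P, P; rewrite /= PP. Qed.

Lemma sim0_sym : symmetric sim0.
Proof.
by move=> P Q; apply/asboolP/asboolP => -[R [T [h1 h2]]]; exists T, R.
Qed.

Lemma sim0_trans : transitive sim0.
Proof.
move=> [n n0 Q QQ] [m m0 P PP] [p p0 S SS].
move=> /asboolP [/= R [T [hP hQ]]] /asboolP [/= R' [T' [hQ' hS]]].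
apply/asboolP; exists (R *m R'), (T' *m T) => /=; split.
  rewrite mulmxA -(mulmxA R) -hQ' hQ.
  by rewrite !mulmxA -hP -mulmxA -hP PP.
rewrite mulmxA -(mulmxA T') -hQ hQ'.
by rewrite !mulmxA -hS -mulmxA -hS SS.
Qed.

Canonical sim0_equiv := EquivRel sim0 sim0_refl sim0_sym sim0_trans.

(* The semigroup V(A) always has a neutral element, the class of 0 in 'M[A]_1. *)
Definition V0 := {eq_quot sim0_equiv}.
HB.instance Definition _ := Choice.on V0.

Lemma idem_diagP (P Q : idem_mx) :
  block_mx P 0 0 Q *m block_mx P 0 0 Q = block_mx P 0 0 Q.
Proof.
by rewrite mulmx_block !mul0mx !mulmx0 !addr0 !add0r !idem_valP.
Qed.

Lemma idem_diag_gt0 (P Q : idem_mx) : (0 < idem_dim P + idem_dim Q)%N.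
Proof. by rewrite addn_gt0 idem_dim_gt0. Qed.

Definition idem_diag (P Q : idem_mx) : idem_mx :=
  IdemMx (idem_diag_gt0 P Q) (idem_diagP P Q).

Definition idem_zero : idem_mx :=
  @IdemMx 1 isT 0 (mulmx0 _ _).

Lemma V0_piP (P Q : idem_mx) :
  (exists (R : 'M[A]_(idem_dim P, idem_dim Q))
          (T : 'M[A]_(idem_dim Q, idem_dim P)),
     idem_val P = R *m T /\ idem_val Q = T *m R) <-> \pi_V0 P = \pi_V0 Q.
Proof. by split=> [h|/eqmodP/asboolP//]; apply/eqmodP/asboolP. Qed.

Lemma V0_surj (u : V0) : exists P, u = \pi_V0 P.
Proof. by exists (repr u); rewrite reprK. Qed.

Definition V0_add (u v : V0) : V0 := \pi_V0 (idem_diag (repr u) (repr v)).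
Definition V0_zero : V0 := \pi_V0 idem_zero.

Lemma V0_addE P Q : V0_add (\pi_V0 P) (\pi_V0 Q) = \pi_V0 (idem_diag P Q).
Proof.
have /V0_piP [R [T [h1 h2]]] : \pi_V0 (repr (\pi_V0 P)) = \pi_V0 P.
  by rewrite reprK.
have /V0_piP [R' [T' [h3 h4]]] : \pi_V0 (repr (\pi_V0 Q)) = \pi_V0 Q.
  by rewrite reprK.
apply/V0_piP; exists (block_mx R 0 0 R'), (block_mx T 0 0 T') => /=.
by rewrite !mulmx_block !mul0mx !mulmx0 !addr0 !add0r h1 h2 h3 h4.
Qed.

Lemma V0_cast (P Q : idem_mx) (e : idem_dim P = idem_dim Q) :
  castmx (e, e) (idem_val P) = idem_val Q -> \pi_V0 P = \pi_V0 Q.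
Proof.
case: P Q e => m m0 P PP [n n0 Q QQ] /= e hPQ; apply/V0_piP => /=.
subst n; exists P, P; rewrite -hPQ castmx_id PP; by split.
Qed.

Lemma V0_addA : associative V0_add.
Proof.
move=> u v w; have [P ->] := V0_surj u; have [Q ->] := V0_surj v.
have [R ->] := V0_surj w.
rewrite !V0_addE; apply/esym.
apply: (@V0_cast (idem_diag (idem_diag P Q) R) (idem_diag P (idem_diag Q R))
  (esym (addnA _ _ _))).
rewrite /= -[X in _ = block_mx _ X _ _]row_mx0 -[X in _ = block_mx _ _ X _]col_mx0.
rewrite block_mxA row_mx0 col_mx0.
by congr (castmx (_, _) _); apply: eq_irrelevance.
Qed.

Lemma V0_addC : commutative V0_add.
Proof.
move=> u v; have [P ->] := V0_surj u; have [Q ->] := V0_surj v; rewrite !V0_addE; apply/V0_piP => /=.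
exists (block_mx 0 P Q 0), (block_mx 0 Q P 0).
by rewrite !mulmx_block !mul0mx !mulmx0 !addr0 !add0r !idem_valP.
Qed.

Lemma V0_add0 : left_id V0_zero V0_add.
Proof.
move=> u; have [P ->] := V0_surj u; rewrite V0_addE; apply/V0_piP => /=.
exists (col_mx 0 P), (row_mx 0 P).
by rewrite mul_col_row mul_row_col !mul0mx !mulmx0 add0r idem_valP.
Qed.

HB.instance Definition _ :=
  GRing.isNmodule.Build V0 V0_addA V0_addC V0_add0.

Definition K0 : zmodType := groth V0.

End K0.

(* Unital Banach algebras, the zero algebra included. The product is part of the
   mixin, rather than inherited from a ring structure, because a structure below
   both rings and normed groups would need a join below Num.NumDomain. *)
HB.mixin Record isBanachAlgebra (K : numFieldType) A
    & CompleteNormedModule K A := {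
  banach_one : A;
  banach_mul : A -> A -> A;
  banach_mulA : associative banach_mul;
  banach_mul1r : left_id banach_one banach_mul;
  banach_mulr1 : right_id banach_one banach_mul;
  banach_mulDl : left_distributive banach_mul +%R;
  banach_mulDr : right_distributive banach_mul +%R;
  banach_scalerAl : forall (a : K) (x y : A),
    a *: banach_mul x y = banach_mul (a *: x) y;
  banach_scalerAr : forall (a : K) (x y : A),
    a *: banach_mul x y = banach_mul x (a *: y);
  banach_normrM : forall x y : A, `|banach_mul x y| <= `|x| * `|y|
}.

#[short(type="banachAlgType")]
HB.structure Definition BanachAlgebra (K : numFieldType) :=
  {A of CompleteNormedModule K A & isBanachAlgebra K A}.

#[non_forgetful_inheritance]
HB.instance Definition _ (K : numFieldType) (A : banachAlgType K) :=
  GRing.Zmodule_isPzRing.Build A (@banach_mulA K A) (@banach_mul1r K A)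
    (@banach_mulr1 K A) (@banach_mulDl K A) (@banach_mulDr K A).

(* unitmx only applies over commutative rings. *)
Definition invertible_mx (A : pzRingType) n (U : 'M[A]_n) : Prop :=
  exists V : 'M[A]_n, U *m V = 1%:M /\ V *m U = 1%:M.

Section InvertibleMatrix.
Variable A : pzRingType.

Lemma invertible_mx1 n : invertible_mx (1%:M : 'M[A]_n).
Proof. by exists 1%:M; rewrite !mul1mx. Qed.

Lemma invertible_mxM n (U V : 'M[A]_n) :
  invertible_mx U -> invertible_mx V -> invertible_mx (U *m V).
Proof.
move=> [U' [h1 h2]] [V' [h3 h4]]; exists (V' *m U'); split.
  by rewrite mulmxA -(mulmxA U) h3 mulmx1.
by rewrite mulmxA -(mulmxA V') h2 mulmx1.
Qed.

Lemma invertible_mx_diag m n (U : 'M[A]_m) (V : 'M[A]_n) :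
  invertible_mx U -> invertible_mx V -> invertible_mx (block_mx U 0 0 V).
Proof.
move=> [U' [h1 h2]] [V' [h3 h4]]; exists (block_mx U' 0 0 V').
by rewrite !mulmx_block !mul0mx !mulmx0 !addr0 !add0r h1 h2 h3 h4 -scalar_mx_block.
Qed.

Lemma invertible_mx_upper m n (B : 'M[A]_(m, n)) :
  invertible_mx (block_mx 1%:M B 0 1%:M).
Proof.
exists (block_mx 1%:M (- B) 0 1%:M).
rewrite !mulmx_block !mul0mx !mulmx0 !mul1mx !mulmx1 !addr0 !add0r.
by rewrite subrr addNr -scalar_mx_block.
Qed.

Lemma invertible_mx_lower m n (B : 'M[A]_(m, n)) :
  invertible_mx (block_mx 1%:M 0 B 1%:M).
Proof.
exists (block_mx 1%:M 0 (- B) 1%:M).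
rewrite !mulmx_block !mul0mx !mulmx0 !mul1mx !mulmx1 !addr0 !add0r.
by rewrite subrr addNr -scalar_mx_block.
Qed.

(* diag(U, I) in 'M[A]_k, where I is the identity matrix of size k - m. *)
Definition stab_mx m k (mk : (m <= k)%N) (U : 'M[A]_m) : 'M[A]_k :=
  castmx (subnKC mk, subnKC mk) (block_mx U 0 0 (1%:M : 'M[A]_(k - m))).

(* A square matrix, extended by the identity to an infinite matrix. *)
Definition ext_mx m (U : 'M[A]_m) (i j : nat) : A :=
  if insub i is Some a then
    if insub j is Some b then U a b else 0
  else (i == j)%:R.

Definition pad_mx m k (U : 'M[A]_m) : 'M[A]_k := \matrix_(i, j) ext_mx U i j.

Lemma ext_mxE m (U : 'M[A]_m) (i j : 'I_m) : ext_mx U i j = U i j.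
Proof. by rewrite /ext_mx !valK. Qed.

Lemma ext_mx_ge m (U : 'M[A]_m) i j :
  (m <= i)%N || (m <= j)%N -> ext_mx U i j = (i == j)%:R.
Proof.
rewrite /ext_mx; case: insubP => [a am ai|//].
case: insubP => [b bm bj|jm].
  by rewrite (leqNgt m i) (leqNgt m j) am bm.
by move=> _; case: eqP => // e; rewrite -e am in jm.
Qed.

Lemma pad_mxK m k l (U : 'M[A]_m) :
  (m <= k)%N -> pad_mx l (pad_mx k U) = pad_mx l U.
Proof.
move=> mk; apply/matrixP => i j; rewrite !mxE.
have [ik|ik] := ltnP i k; last first.
  by rewrite !ext_mx_ge ?ik ?(leq_trans mk ik).
have [jk|jk] := ltnP j k; last first.
  by rewrite !ext_mx_ge ?jk ?(leq_trans mk jk) ?orbT.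
by rewrite (ext_mxE _ (Ordinal ik) (Ordinal jk)) mxE.
Qed.

Lemma pad_mx_id m (U : 'M[A]_m) : pad_mx m U = U.
Proof. by apply/matrixP => i j; rewrite mxE ext_mxE. Qed.

Lemma pad_mx_block m i (U : 'M[A]_m) : pad_mx (m + i) U = block_mx U 0 0 1%:M.
Proof.
apply/matrixP => a b; rewrite !mxE; case: (splitP a) => a' ea; rewrite !mxE.
  case: (splitP b) => b' eb; rewrite ?mxE ea eb; first by rewrite ext_mxE.
  rewrite ext_mx_ge ?leq_addr ?orbT// ; case: eqP => // e.
  by have := ltn_ord a'; rewrite e ltnNge leq_addr.
case: (splitP b) => b' eb; rewrite ?mxE ea eb ext_mx_ge ?leq_addr ?orbT//.
  case: eqP => // e.
  by have := ltn_ord b'; rewrite -e ltnNge leq_addr.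
by rewrite eqn_add2l.
Qed.

Lemma pad_mx_stab m k (mk : (m <= k)%N) (U : 'M[A]_m) :
  stab_mx mk U = pad_mx k U.
Proof.
rewrite /stab_mx; move: (subnKC mk); move: (k - m)%N => i e.
by subst k; rewrite castmx_id pad_mx_block.
Qed.

Lemma pad_mx1 m k : (m <= k)%N -> pad_mx k (1%:M : 'M[A]_m) = 1%:M.
Proof.
by move=> mk; rewrite -(subnKC mk) pad_mx_block -scalar_mx_block.
Qed.

Lemma invertible_pad_mx m k (U : 'M[A]_m) :
  (m <= k)%N -> invertible_mx U -> invertible_mx (pad_mx k U).
Proof.
move=> mk hU; rewrite -(subnKC mk) pad_mx_block.
by apply: invertible_mx_diag => //; exact: invertible_mx1.
Qed.

End InvertibleMatrix.

Section ContinuousMatrix.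
Local Open Scope classical_set_scope.
Variables (R : realType) (A : banachAlgType R[i]).

Lemma cvg_mxP (T : topologicalType) m n (F : set_system T) (FF : Filter F)
    (f : T -> 'M[A]_(m, n)) (M : 'M[A]_(m, n)) :
  (forall i j, (fun t => f t i j) @ F --> M i j) -> f @ F --> M.
Proof.
move=> h P [Q QM QP].
have : \forall t \near F, forall ij : 'I_m * 'I_n, Q ij.1 ij.2 (f t ij.1 ij.2).
  by apply: filter_forall => -[i j]; exact: (h i j _ (QM i j)).
by apply: filterS => t ht; apply: QP => i j; exact: (ht (i, j)).
Qed.

Lemma coord_continuous_mx m n i j :
  continuous (fun M : 'M[A]_(m, n) => M i j).
Proof.
move=> M P MP.
exists (fun i' j' => if (i' == i) && (j' == j) then P else setT).
  move=> i' j'; case: ifPn => [/andP[/eqP-> /eqP->]//|_].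
  exact: filterT.
by move=> N /(_ i j); rewrite !eqxx.
Qed.

Lemma continuous_mxP (T : topologicalType) m n (f : T -> 'M[A]_(m, n)) :
  (forall i j, continuous (fun t => f t i j)) <-> continuous f.
Proof.
split=> [h t|h i j t]; first by apply: cvg_mxP => i j; exact: h.
by apply: (@continuous_comp _ _ _ f (fun M : 'M[A]_(m, n) => M i j));
  [exact: h | exact: coord_continuous_mx].
Qed.

Lemma continuous_mulA (T : topologicalType) (f g : T -> A) :
  continuous f -> continuous g -> continuous (fun t => f t * g t).
Proof.
move=> cf cg x; apply/cvgrPdist_lt => _/posnumP[e]; near +oo_(R[i]) => M.
near=> t; have M0 : 0 < M by [].
rewrite (@distm_lt_split _ _ (f x * g t))// -?mulrBr -?mulrBl.
  rewrite (le_lt_trans (banach_normrM _ _))//.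
  rewrite (@le_lt_trans _ _ (M * `|g x - g t|)) ?ler_wpM2r -?ltr_pdivlMl//.
  by near: t; apply: cvgr_dist_lt; [exact: cg|rewrite mulr_gt0 ?invr_gt0].
rewrite (le_lt_trans (banach_normrM _ _))//.
rewrite (@le_lt_trans _ _ (`|f x - f t| * M)) ?ler_wpM2l -?ltr_pdivlMr//.
  by near: t; near: M; apply: cvg_bounded (cg x).
by near: t; apply: cvgr_dist_lt; [exact: cf|rewrite divr_gt0].
Unshelve. all: by end_near. Qed.

Lemma continuous_sumA (T : topologicalType) (I : Type) (r : seq I)
    (f : I -> T -> A) :
  (forall i, continuous (f i)) -> continuous (fun t => \sum_(i <- r) f i t).
Proof.
move=> cf; elim: r => [|i r ih] t.
  by under eq_fun do rewrite big_nil; exact: cvg_cst.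
under eq_fun do rewrite big_cons.
by apply: cvgD; [exact: cf|exact: ih].
Qed.

Lemma continuous_mulmx (T : topologicalType) m n p
    (f : T -> 'M[A]_(m, n)) (g : T -> 'M[A]_(n, p)) :
  continuous f -> continuous g -> continuous (fun t => f t *m g t).
Proof.
move=> /continuous_mxP cf /continuous_mxP cg; apply/continuous_mxP => i j.
under eq_fun do rewrite mxE.
by apply: continuous_sumA => k; apply: continuous_mulA.
Qed.

Lemma continuous_block_mx (T : topologicalType) m1 m2 n1 n2
    (f1 : T -> 'M[A]_(m1, n1)) (f2 : T -> 'M[A]_(m1, n2))
    (f3 : T -> 'M[A]_(m2, n1)) (f4 : T -> 'M[A]_(m2, n2)) :
  continuous f1 -> continuous f2 -> continuous f3 -> continuous f4 ->
  continuous (fun t => block_mx (f1 t) (f2 t) (f3 t) (f4 t)).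
Proof.
move=> /continuous_mxP c1 /continuous_mxP c2 /continuous_mxP c3.
move=> /continuous_mxP c4; apply/continuous_mxP => i j.
case: (split_ordP i) => i' ->; case: (split_ordP j) => j' ->.
- by under eq_fun do rewrite block_mxEul; exact: c1.
- by under eq_fun do rewrite block_mxEur; exact: c2.
- by under eq_fun do rewrite block_mxEdl; exact: c3.
- by under eq_fun do rewrite block_mxEdr; exact: c4.
Qed.

Lemma continuous_scale_line (a : A) : continuous (fun t : R => t%:C%C *: a).
Proof.
move=> x; apply/cvgrPdist_lt => e e0.
have eR : e = (complex.Re e)%:C%C.
  by apply/esym/RRe_real/gtr0_real.
have Re0 : 0 < complex.Re e by rewrite -ltcR -eR.
have aR : `|a| = (complex.Re `|a|)%:C%C by apply/esym/RRe_real; rewrite normr_real.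
have a0 : 0 <= complex.Re `|a| by rewrite -lecR -aR; exact: normr_ge0.
have d0 : 0 < complex.Re e / (complex.Re `|a| + 1).
  by rewrite divr_gt0// ltr_wpDl.
near=> t.
rewrite -scalerBl normrZ -rmorphB /= normc_def /= expr0n addr0 sqrtr_sqr.
rewrite aR eR -rmorphM ltcR.
apply: (@le_lt_trans _ _ (`|x - t| * (complex.Re `|a| + 1))).
  by rewrite ler_wpM2l// lerDl.
rewrite -ltr_pdivlMr; last by rewrite ltr_wpDl.
near: t; apply: (@cvgr_dist_lt _ _ _ _ _ id) => //.
Unshelve. all: by end_near. Qed.

End ContinuousMatrix.

Section InvertiblePath.
Local Open Scope classical_set_scope.
Variables (R : realType) (A : banachAlgType R[i]).

(* 'M[A]_k carries the entrywise topology, which is its topology as a Banach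
   algebra. *)
Definition inv_path k (U V : 'M[A]_k) : Prop :=
  exists g : R -> 'M[A]_k,
    [/\ {within `[0, 1], continuous g},
        forall t, 0 <= t <= 1 -> invertible_mx (g t),
        g 0 = U & g 1 = V].

Lemma inv_pathP k (U V : 'M[A]_k) : inv_path U V <->
  exists g : R -> 'M[A]_k,
    [/\ continuous g, forall t, invertible_mx (g t), g 0 = U & g 1 = V].
Proof.
split=> -[g [cg ig g0 g1]]; last first.
  by exists g; split=> // ; exact: continuous_subspaceT.
pose c (t : R) := Num.min 1 (Num.max 0 t).
have c01 t : 0 <= c t <= 1.
  rewrite /c le_min ler01 le_max lexx /=.
  by rewrite ge_min lexx.
have c01' t : `[0, 1] (c t) by rewrite /= in_itv /=; exact: c01.
have cc : continuous c.
  move=> t; apply: (@continuous_min R R (fun=> 1) (fun t => Num.max 0 t)).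
    exact: cvg_cst.
  apply: (@continuous_max R R (fun=> 0) id); first exact: cvg_cst.
  exact: cvg_id.
exists (g \o c); split=> [t|t||].
- move/subspace_continuousP : cg => /(_ (c t)) cg.
  have {}cg := cg (c01' t).
  apply: cvg_trans cg => P hP.
  have hP' : nbhs t (fun s => `[0, 1] (c s) -> P (g (c s))) := cc t _ hP.
  change (nbhs t (fun s => P (g (c s)))).
  by apply: filterS hP' => s; apply; exact: c01'.
- exact: ig.
- by rewrite /= /c maxxx (min_idPr _)// ler01.
- by rewrite /= /c (max_idPr _) ?ler01// minxx.
Qed.

Lemma inv_path_refl k (U : 'M[A]_k) : invertible_mx U -> inv_path U U.
Proof. by move=> iU; apply/inv_pathP; exists (fun=> U); split=> // t; exact: cvg_cst. Qed.

Lemma inv_path_sym k (U V : 'M[A]_k) : inv_path U V -> inv_path V U.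
Proof.
move=> /inv_pathP[g [cg ig g0 g1]]; apply/inv_pathP.
exists (fun t => g (1 - t)); split=> [t|t||//]; rewrite ?subr0 ?subrr//.
apply: (@cvg_comp _ _ _ (fun t => 1 - t) g _ (nbhs (1 - t))); last exact: cg.
by apply: cvgB; [exact: cvg_cst|exact: cvg_id].
Qed.

Lemma inv_pathM k (U V U' V' : 'M[A]_k) :
  inv_path U V -> inv_path U' V' -> inv_path (U *m U') (V *m V').
Proof.
move=> /inv_pathP[g [cg ig g0 g1]] /inv_pathP[h [ch ih h0 h1]].
apply/inv_pathP; exists (fun t => g t *m h t).
split=> [|t||]; [exact: continuous_mulmx|exact: invertible_mxM| |].
  by rewrite g0 h0.
by rewrite g1 h1.
Qed.

Lemma inv_path_inv k (U V : 'M[A]_k) :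
  inv_path U V -> invertible_mx U /\ invertible_mx V.
Proof. by move=> /inv_pathP[g [_ ig <- <-]]. Qed.

Lemma inv_path_trans k (U V W : 'M[A]_k) :
  inv_path U V -> inv_path V W -> inv_path U W.
Proof.
move=> UV VW; have [iU [V' [VV' V'V]]] := inv_path_inv UV.
have iV' : inv_path V' V' by apply: inv_path_refl; exists V.
have := inv_pathM (inv_pathM UV iV') VW.
by rewrite -mulmxA V'V mulmx1 VV' mul1mx.
Qed.

Lemma inv_path_diag m n (U V : 'M[A]_m) (W : 'M[A]_n) :
  invertible_mx W -> inv_path U V ->
  inv_path (block_mx U 0 0 W) (block_mx V 0 0 W).
Proof.
move=> iW /inv_pathP[g [cg ig <- <-]]; apply/inv_pathP.
exists (fun t => block_mx (g t) 0 0 W); split=> // [|t].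
  by apply: continuous_block_mx => // t; exact: cvg_cst.
exact: invertible_mx_diag.
Qed.

Let line m n (B : 'M[A]_(m, n)) (t : R) : 'M[A]_(m, n) :=
  \matrix_(i, j) (t%:C%C *: B i j).

Let line0 m n (B : 'M[A]_(m, n)) : line B 0 = 0.
Proof. by apply/matrixP => i j; rewrite !mxE scale0r. Qed.

Let line1 m n (B : 'M[A]_(m, n)) : line B 1 = B.
Proof. by apply/matrixP => i j; rewrite !mxE scale1r. Qed.

Let line_continuous m n (B : 'M[A]_(m, n)) : continuous (line B).
Proof.
apply/continuous_mxP => i j; under eq_fun do rewrite mxE.
exact: continuous_scale_line.
Qed.

Lemma inv_path_upper m n (B : 'M[A]_(m, n)) :
  inv_path 1%:M (block_mx 1%:M B 0 1%:M).
Proof.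
apply/inv_pathP; exists (fun t => block_mx 1%:M (line B t) 0 1%:M).
split=> [|t||]; [|exact: invertible_mx_upper| |by rewrite line1].
  by apply: continuous_block_mx => //; move=> t; exact: cvg_cst.
by rewrite line0 -scalar_mx_block.
Qed.

Lemma inv_path_lower m n (B : 'M[A]_(m, n)) :
  inv_path 1%:M (block_mx 1%:M 0 B 1%:M).
Proof.
apply/inv_pathP; exists (fun t => block_mx 1%:M 0 (line B t) 1%:M).
split=> [|t||]; [|exact: invertible_mx_lower| |by rewrite line1].
  by apply: continuous_block_mx => //; move=> t; exact: cvg_cst.
by rewrite line0 -scalar_mx_block.
Qed.

(* Whitehead's lemma, by the usual factorization into elementary matrices. *)
Lemma inv_path_whitehead m (U U' : 'M[A]_m) : U *m U' = 1%:M ->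
  U' *m U = 1%:M -> inv_path 1%:M (block_mx U 0 0 U').
Proof.
move=> UU' U'U.
have H := inv_pathM (inv_pathM (inv_pathM (inv_path_upper U)
  (inv_path_lower (- U'))) (inv_path_upper U))
  (inv_pathM (inv_pathM (inv_path_upper (- 1%:M : 'M[A]_m))
  (inv_path_lower (1%:M : 'M[A]_m))) (inv_path_upper (- 1%:M : 'M[A]_m))).
move: H; rewrite !mul1mx !mulmx_block.
rewrite !(mul0mx, mulmx0, mul1mx, mulmx1, addr0, add0r, mulNmx, mulmxN).
rewrite !(mulNmx, mulmxN, UU', U'U, mulmx1, mul1mx, opprK, subrr, addNr,
          addr0, add0r, mul0mx, mulmx0, oppr0).
by [].
Qed.

Lemma inv_path_pad k l (U V : 'M[A]_k) : (k <= l)%N ->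
  inv_path U V -> inv_path (pad_mx l U) (pad_mx l V).
Proof.
move=> kl UV; rewrite -(subnKC kl) !pad_mx_block.
by apply: inv_path_diag => //; exact: invertible_mx1.
Qed.

Definition stab_path m n (U : 'M[A]_m) (V : 'M[A]_n) : Prop :=
  exists K, forall k, (K <= k)%N -> inv_path (pad_mx k U) (pad_mx k V).

Lemma stab_pathI m n k (U : 'M[A]_m) (V : 'M[A]_n) :
  (m <= k)%N -> (n <= k)%N ->
  inv_path (pad_mx k U) (pad_mx k V) -> stab_path U V.
Proof.
move=> mk nk UV; exists k => l kl.
by have := inv_path_pad kl UV; rewrite !pad_mxK.
Qed.

Lemma stab_pathE m (U V : 'M[A]_m) : inv_path U V -> stab_path U V.
Proof. by move=> UV; apply: (@stab_pathI _ _ m); rewrite // !pad_mx_id. Qed.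

Lemma stab_path_refl m (U : 'M[A]_m) : invertible_mx U -> stab_path U U.
Proof. by move=> iU; apply: stab_pathE; exact: inv_path_refl. Qed.

Lemma stab_path_sym m n (U : 'M[A]_m) (V : 'M[A]_n) :
  stab_path U V -> stab_path V U.
Proof. by move=> [K h]; exists K => k /h /inv_path_sym. Qed.

Lemma stab_path_trans m n p (U : 'M[A]_m) (V : 'M[A]_n) (W : 'M[A]_p) :
  stab_path U V -> stab_path V W -> stab_path U W.
Proof.
move=> [K h] [L g]; exists (maxn K L) => k; rewrite geq_max => /andP[/h Uk /g].
exact: inv_path_trans.
Qed.

Lemma stab_path_diag1 m i (U : 'M[A]_m) : invertible_mx U ->
  stab_path U (block_mx U 0 0 (1%:M : 'M[A]_i)).
Proof.
move=> iU; apply: (@stab_pathI _ _ (m + i)); rewrite ?leq_addr//.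
rewrite pad_mx_id pad_mx_block; apply: inv_path_refl.
by apply: invertible_mx_diag => //; exact: invertible_mx1.
Qed.

Lemma stab_path_cast m n (e : m = n) (U : 'M[A]_m) : invertible_mx U ->
  stab_path U (castmx (e, e) U).
Proof. by move=> iU; subst n; rewrite castmx_id; exact: stab_path_refl. Qed.

Lemma stab_path_conj m n (e : m = n) (S : 'M[A]_(m, n)) (T : 'M[A]_(n, m))
    (V : 'M[A]_m) : S *m T = 1%:M -> T *m S = 1%:M -> invertible_mx V ->
  stab_path V (T *m V *m S).
Proof.
subst n => ST TS iV; apply: (@stab_pathI _ _ (m + m)); rewrite ?leq_addr//.
rewrite !pad_mx_block.
have iV1 : invertible_mx (block_mx V 0 0 (1%:M : 'M[A]_m)).
  by apply: invertible_mx_diag => //; exact: invertible_mx1.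
have := inv_pathM (inv_pathM (inv_path_whitehead TS ST) (inv_path_refl iV1))
  (inv_path_whitehead ST TS).
rewrite mulmx1 mul1mx !mulmx_block.
by rewrite !(mul0mx, mulmx0, mul1mx, mulmx1, addr0, add0r) ST.
Qed.

Lemma stab_path_diagC m n (U : 'M[A]_m) (V : 'M[A]_n) :
  invertible_mx U -> invertible_mx V ->
  stab_path (block_mx U 0 0 V) (block_mx V 0 0 U).
Proof.
move=> iU iV.
have := @stab_path_conj _ _ (addnC m n) (block_mx 0 1%:M 1%:M 0)
  (block_mx 0 1%:M 1%:M 0) (block_mx U 0 0 V).
rewrite !mulmx_block !(mul0mx, mulmx0, mul1mx, mulmx1, addr0, add0r).
rewrite -!scalar_mx_block; apply=> //; exact: invertible_mx_diag.
Qed.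

Lemma stab_path_diagA m n p (U : 'M[A]_m) (V : 'M[A]_n) (W : 'M[A]_p) :
  invertible_mx U -> invertible_mx V -> invertible_mx W ->
  stab_path (block_mx U 0 0 (block_mx V 0 0 W))
            (block_mx (block_mx U 0 0 V) 0 0 W).
Proof.
move=> iU iV iW; apply: stab_path_sym.
have := @stab_path_cast _ _ (esym (addnA m n p)) (block_mx (block_mx U 0 0 V) 0 0 W).
have -> : castmx (esym (addnA m n p), esym (addnA m n p))
    (block_mx (block_mx U 0 0 V) 0 0 W) = block_mx U 0 0 (block_mx V 0 0 W).
  have := @block_mxA A _ _ _ _ _ _ U 0 0 0 V 0 0 0 W.
  rewrite !row_mx0 !col_mx0 => ->.
  by congr (castmx (_, _) _); apply: eq_irrelevance.
by apply; do 2?apply: invertible_mx_diag.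
Qed.

Lemma stab_path_diag_pad m n i (U : 'M[A]_m) (V : 'M[A]_n) :
  invertible_mx U -> invertible_mx V ->
  stab_path (block_mx U 0 0 V)
            (block_mx (block_mx U 0 0 (1%:M : 'M[A]_i)) 0 0 V).
Proof.
move=> iU iV; have i1 := invertible_mx1 A i.
apply: stab_path_trans (stab_path_diagA iU i1 iV).
apply: stab_path_trans (stab_path_diag1 i _) _; first exact: invertible_mx_diag.
apply: stab_path_trans (stab_path_sym (stab_path_diagA iU iV i1)) _.
have := @stab_path_conj _ _ (congr1 (addn m) (addnC n i))
  (block_mx 1%:M 0 0 (block_mx 0 1%:M 1%:M 0))
  (block_mx 1%:M 0 0 (block_mx 0 1%:M 1%:M 0))
  (block_mx U 0 0 (block_mx V 0 0 1%:M)).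
rewrite !mulmx_block !(mul0mx, mulmx0, mul1mx, mulmx1, addr0, add0r).
rewrite !mulmx_block !(mul0mx, mulmx0, mul1mx, mulmx1, addr0, add0r).
rewrite -!scalar_mx_block; apply=> //.
by do 2?apply: invertible_mx_diag.
Qed.

Lemma stab_path_diagl m m' n (U : 'M[A]_m) (U' : 'M[A]_m') (V : 'M[A]_n) :
  invertible_mx U -> invertible_mx U' -> invertible_mx V ->
  stab_path U U' -> stab_path (block_mx U 0 0 V) (block_mx U' 0 0 V).
Proof.
move=> iU iU' iV [K hK]; pose k := maxn K (maxn m m').
have mk : (m <= k)%N by rewrite !leq_max leqnn orbT.
have mk' : (m' <= k)%N by rewrite !leq_max leqnn !orbT.
have pad_diag q (W : 'M[A]_q) : invertible_mx W -> (q <= k)%N ->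
    stab_path (block_mx W 0 0 V) (block_mx (pad_mx k W) 0 0 V).
  move=> iW qk; rewrite -(subnKC qk) pad_mx_block.
  exact: stab_path_diag_pad.
apply: stab_path_trans (pad_diag _ _ iU mk) _.
apply: stab_path_trans (stab_path_sym (pad_diag _ _ iU' mk')).
by apply: stab_pathE; apply: inv_path_diag => //; apply: hK; exact: leq_maxl.
Qed.

End InvertiblePath.

Section K1.
Variables (R : realType) (A : banachAlgType R[i]).

(* The union of the groups of invertible elements of 'M[A]_n, for n >= 1. *)
Record inv_mx := InvMx {
  inv_dim : nat;
  inv_dim_gt0 : (0 < inv_dim)%N;
  inv_val :> 'M[A]_inv_dim;
  inv_valP : invertible_mx inv_val }.

HB.instance Definition _ := gen_eqMixin inv_mx.
HB.instance Definition _ := gen_choiceMixin inv_mx.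

Definition sim1 (U V : inv_mx) : bool :=
  `[< exists k (Uk : (inv_dim U < k)%N) (Vk : (inv_dim V < k)%N),
        inv_path (stab_mx (ltnW Uk) U) (stab_mx (ltnW Vk) V) >].

Lemma sim1P (U V : inv_mx) : reflect (stab_path U V) (sim1 U V).
Proof.
apply: (iffP (asboolP _)) => [[k [Uk [Vk]]]|[K hK]].
  rewrite !pad_mx_stab; apply: stab_pathI; exact: ltnW.
pose k := maxn K (maxn (inv_dim U) (inv_dim V)).+1.
have Uk : (inv_dim U < k)%N by rewrite leq_max ltnS leq_maxl orbT.
have Vk : (inv_dim V < k)%N by rewrite leq_max ltnS leq_maxr orbT.
by exists k, Uk, Vk; rewrite !pad_mx_stab; apply: hK; exact: leq_maxl.
Qed.

Lemma sim1_refl : reflexive sim1.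
Proof. by move=> U; apply/sim1P/stab_path_refl/inv_valP. Qed.

Lemma sim1_sym : symmetric sim1.
Proof. by move=> U V; apply/sim1P/sim1P => /stab_path_sym. Qed.

Lemma sim1_trans : transitive sim1.
Proof.
by move=> V U W /sim1P UV /sim1P VW; apply/sim1P; exact: stab_path_trans VW.
Qed.

Canonical sim1_equiv := EquivRel sim1 sim1_refl sim1_sym sim1_trans.

Definition K1 := {eq_quot sim1_equiv}.
HB.instance Definition _ := Choice.on K1.

Lemma inv_diag_gt0 (U V : inv_mx) : (0 < inv_dim U + inv_dim V)%N.
Proof. by rewrite addn_gt0 inv_dim_gt0. Qed.

Definition inv_diag (U V : inv_mx) : inv_mx :=
  InvMx (inv_diag_gt0 U V) (invertible_mx_diag (inv_valP U) (inv_valP V)).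

Definition inv_one : inv_mx := @InvMx 1 isT 1%:M (invertible_mx1 A 1).

Lemma inv_invP (U : inv_mx) : invertible_mx (projT1 (cid (inv_valP U))).
Proof. by case: cid => V [h1 h2] /=; exists U. Qed.

Definition inv_inv (U : inv_mx) : inv_mx :=
  InvMx (inv_dim_gt0 U) (inv_invP U).

Lemma K1_piP (U V : inv_mx) : stab_path U V <-> \pi_K1 U = \pi_K1 V.
Proof. by split=> [h|/eqmodP/sim1P//]; apply/eqmodP/sim1P. Qed.

Lemma K1_surj (u : K1) : exists U, u = \pi_K1 U.
Proof. by exists (repr u); rewrite reprK. Qed.

Definition K1_add (u v : K1) : K1 := \pi_K1 (inv_diag (repr u) (repr v)).
Definition K1_opp (u : K1) : K1 := \pi_K1 (inv_inv (repr u)).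
Definition K1_zero : K1 := \pi_K1 inv_one.

Lemma K1_addC_pi U V : \pi_K1 (inv_diag U V) = \pi_K1 (inv_diag V U).
Proof. by apply/K1_piP; apply: stab_path_diagC; exact: inv_valP. Qed.

Lemma K1_diagl U U' V : \pi_K1 U = \pi_K1 U' ->
  \pi_K1 (inv_diag U V) = \pi_K1 (inv_diag U' V).
Proof.
by move/K1_piP => UU'; apply/K1_piP; apply: stab_path_diagl; try exact: inv_valP.
Qed.

Lemma K1_addE U V : K1_add (\pi_K1 U) (\pi_K1 V) = \pi_K1 (inv_diag U V).
Proof.
rewrite /K1_add (@K1_diagl _ U) ?reprK// K1_addC_pi (@K1_diagl _ V) ?reprK//.
exact: K1_addC_pi.
Qed.

Lemma K1_addA : associative K1_add.
Proof.
move=> u v w; have [U ->] := K1_surj u; have [V ->] := K1_surj v.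
have [W ->] := K1_surj w; rewrite !K1_addE; apply/K1_piP.
by apply: stab_path_diagA; exact: inv_valP.
Qed.

Lemma K1_addC : commutative K1_add.
Proof. by move=> u v; exact: K1_addC_pi. Qed.

Lemma K1_add0 : left_id K1_zero K1_add.
Proof.
move=> u; rewrite K1_addC; have [U ->] := K1_surj u; rewrite K1_addE.
by apply/K1_piP/stab_path_sym; apply: stab_path_diag1; exact: inv_valP.
Qed.

Lemma K1_addN : left_inverse K1_zero K1_opp K1_add.
Proof.
move=> u; rewrite -{2}[u]reprK K1_addE; apply/K1_piP.
set U := repr u => /=; case: cid => V [UV VU] /=.
apply: (@stab_path_trans _ _ _ _ _ _ (1%:M : 'M[A]_(inv_dim U + inv_dim U))).
  by apply: stab_pathE; apply: inv_path_sym; exact: inv_path_whitehead.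
have d0 := inv_diag_gt0 U U.
apply: (@stab_pathI _ _ _ _ (inv_dim U + inv_dim U)); rewrite // pad_mx1//.
by rewrite pad_mx1//; exact/inv_path_refl/invertible_mx1.
Qed.

HB.instance Definition _ :=
  GRing.isZmodule.Build K1 K1_addA K1_addC K1_add0 K1_addN.

End K1.

Section BoundedOperators.
Local Open Scope classical_set_scope.
Variables (R : realType) (X : completeNormedModType R[i]).

Record bounded_op := BoundedOp {
  bounded_op_fun :> X -> X;
  bounded_op_linear : linear bounded_op_fun;
  bounded_op_continuous : continuous bounded_op_fun }.

HB.instance Definition _ (f : bounded_op) :=
  GRing.isLinear.Build R[i] X X *:%R f (bounded_op_linear f).

HB.instance Definition _ := gen_eqMixin bounded_op.
HB.instance Definition _ := gen_choiceMixin bounded_op.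

Lemma bounded_opP (f g : bounded_op) : f =1 g -> f = g.
Proof.
case: f g => [f lf cf] [g lg cg] /= /funext fg; subst g.
by rewrite (Prop_irrelevance lf lg) (Prop_irrelevance cf cg).
Qed.

Lemma bop_zero_linear : linear (fun _ : X => 0 : X).
Proof. by move=> a x y; rewrite scaler0 addr0. Qed.

Lemma bop_zero_continuous : continuous (fun _ : X => 0 : X).
Proof. by move=> x; exact: cvg_cst. Qed.

Definition bop_zero := BoundedOp bop_zero_linear bop_zero_continuous.

Lemma bop_add_linear (f g : bounded_op) : linear (fun x => f x + g x).
Proof. by move=> a x y; rewrite !linearP scalerDr addrACA. Qed.

Lemma bop_add_continuous (f g : bounded_op) : continuous (fun x => f x + g x).
Proof. by move=> x; apply: cvgD; exact: bounded_op_continuous. Qed.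

Definition bop_add (f g : bounded_op) :=
  BoundedOp (@bop_add_linear f g) (@bop_add_continuous f g).

Lemma bop_opp_linear (f : bounded_op) : linear (fun x => - f x).
Proof. by move=> a x y; rewrite linearP opprD scalerN. Qed.

Lemma bop_opp_continuous (f : bounded_op) : continuous (fun x => - f x).
Proof. by move=> x; apply: cvgN; exact: bounded_op_continuous. Qed.

Definition bop_opp (f : bounded_op) :=
  BoundedOp (@bop_opp_linear f) (@bop_opp_continuous f).

Lemma bop_scale_linear (c : R[i]) (f : bounded_op) : linear (fun x => c *: f x).
Proof. by move=> a x y; rewrite linearP scalerDr !scalerA mulrC. Qed.

Lemma bop_scale_continuous (c : R[i]) (f : bounded_op) :
  continuous (fun x => c *: f x).
Proof. by move=> x; apply: cvgZr; exact: bounded_op_continuous. Qed.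

Definition bop_scale (c : R[i]) (f : bounded_op) :=
  BoundedOp (@bop_scale_linear c f) (@bop_scale_continuous c f).

Lemma bop_id_linear : linear (fun x : X => x).
Proof. by []. Qed.

Lemma bop_id_continuous : continuous (fun x : X => x).
Proof. by move=> x; exact: cvg_id. Qed.

Definition bop_id := BoundedOp bop_id_linear bop_id_continuous.

Lemma bop_comp_linear (f g : bounded_op) : linear (fun x => f (g x)).
Proof. by move=> a x y; rewrite !linearP. Qed.

Lemma bop_comp_continuous (f g : bounded_op) : continuous (fun x => f (g x)).
Proof.
move=> x; apply: (@continuous_comp _ _ _ g f); exact: bounded_op_continuous.
Qed.

Definition bop_comp (f g : bounded_op) :=
  BoundedOp (@bop_comp_linear f g) (@bop_comp_continuous f g).

Lemma bop_addA : associative bop_add.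
Proof. by move=> f g h; apply: bounded_opP => x /=; rewrite addrA. Qed.

Lemma bop_addC : commutative bop_add.
Proof. by move=> f g; apply: bounded_opP => x /=; rewrite addrC. Qed.

Lemma bop_add0 : left_id bop_zero bop_add.
Proof. by move=> f; apply: bounded_opP => x /=; rewrite add0r. Qed.

Lemma bop_addN : left_inverse bop_zero bop_opp bop_add.
Proof. by move=> f; apply: bounded_opP => x /=; rewrite addNr. Qed.

HB.instance Definition _ :=
  GRing.isZmodule.Build bounded_op bop_addA bop_addC bop_add0 bop_addN.

Lemma bop_scaleA a b f : bop_scale a (bop_scale b f) = bop_scale (a * b) f.
Proof. by apply: bounded_opP => x /=; rewrite scalerA. Qed.

Lemma bop_scale1 : left_id 1 bop_scale.
Proof. by move=> f; apply: bounded_opP => x /=; rewrite scale1r. Qed.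

Lemma bop_scaleDr : right_distributive bop_scale +%R.
Proof. by move=> a f g; apply: bounded_opP => x /=; rewrite scalerDr. Qed.

Lemma bop_scaleDl f : {morph bop_scale^~ f : a b / a + b}.
Proof. by move=> a b; apply: bounded_opP => x /=; rewrite scalerDl. Qed.

HB.instance Definition _ := GRing.Zmodule_isLmodule.Build R[i] bounded_op
  bop_scaleA bop_scale1 bop_scaleDr bop_scaleDl.

(* The norms of normed modules over R[i] take their values in R[i]; the supremum
   is taken in R and then embedded in R[i]. *)
Definition opnorm (f : bounded_op) : R[i] :=
  (sup [set complex.Re `|f x| | x in [set x : X | `|x| <= 1]])%:C%C.

Let nrm (x : X) : R := complex.Re `|x|.

Let nrmE (x : X) : `|x| = (nrm x)%:C%C.
Proof. by apply/esym/RRe_real; rewrite normr_real. Qed.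

Let nrm_ge0 (x : X) : 0 <= nrm x.
Proof. by rewrite -lecR -nrmE; exact: normr_ge0. Qed.

Let nrm_gt0 (x : X) : x != 0 -> 0 < nrm x.
Proof. by move=> x0; rewrite -ltcR -nrmE; rewrite normr_gt0. Qed.

Let absE (a : R[i]) : `|a| = (complex.Re `|a|)%:C%C.
Proof. by apply/esym/RRe_real; rewrite normr_real. Qed.

Let abs_ge0 (a : R[i]) : 0 <= complex.Re `|a|.
Proof. by rewrite -lecR -absE; exact: normr_ge0. Qed.

Let nrmZ a x : nrm (a *: x) = complex.Re `|a| * nrm x.
Proof. by apply: complexI; rewrite rmorphM /= -!nrmE -absE normrZ. Qed.

Let nrm0 : nrm 0 = 0.
Proof. by rewrite /nrm normr0. Qed.

Let bop_bounded (f : bounded_op) :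
  exists2 M : R, 0 <= M & forall x, nrm (f x) <= M * nrm x.
Proof.
have /linear_bounded_continuous/linear_boundedP/pinfty_ex_gt0[M M0 hM] :=
  @bounded_op_continuous f.
have ME : M = (complex.Re M)%:C%C by apply/esym/RRe_real/gtr0_real.
exists (complex.Re M); first by rewrite -lecR -ME ltW.
by move=> x; rewrite -lecR rmorphM /= -!nrmE -ME; exact: hM.
Qed.

Let N (f : bounded_op) : R :=
  sup [set complex.Re `|f x| | x in [set x : X | `|x| <= 1]].

Let opnormE f : opnorm f = (N f)%:C%C. Proof. by []. Qed.

Let le1E (x : X) : (`|x| <= 1) = (nrm x <= 1).
Proof. by rewrite nrmE -[1 : R[i]]/((1 : R)%:C%C) lecR. Qed.

Let N_has_sup (f : bounded_op) :
  has_sup [set complex.Re `|f x| | x in [set x : X | `|x| <= 1]].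
Proof.
split; first by exists (nrm (f 0)), 0 => //=; rewrite normr0.
have [M M0 hM] := bop_bounded f.
exists M => _ [x /= x1 <-]; apply: le_trans (hM x) _.
by rewrite -[leRHS]mulr1 ler_wpM2l// -le1E.
Qed.

Let N_ub (f : bounded_op) (M : R) : 0 <= M ->
  (forall x, nrm (f x) <= M * nrm x) -> N f <= M.
Proof.
move=> M0 hM; apply: ge_sup; first by case: (N_has_sup f).
move=> _ [x /= x1 <-]; apply: le_trans (hM x) _.
by rewrite -[leRHS]mulr1 ler_wpM2l// -le1E.
Qed.

Let N_ge0 f : 0 <= N f.
Proof.
have := sup_upper_bound (N_has_sup f); apply; exists 0; rewrite /= ?normr0//.
by rewrite linear0 normr0.
Qed.

Let N_le (f : bounded_op) x : nrm (f x) <= N f * nrm x.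
Proof.
have [->|x0] := eqVneq x 0; first by rewrite linear0 nrm0 mulr0.
have nx := nrm_gt0 x0.
have absV : complex.Re `|((nrm x)^-1)%:C%C| = (nrm x)^-1.
  by rewrite ger0_norm// ler0c invr_ge0.
rewrite -ler_pdivrMr// mulrC -{1}absV -nrmZ -linearZ.
apply: (sup_upper_bound (N_has_sup f)).
exists (((nrm x)^-1)%:C%C *: x) => //=.
by rewrite le1E nrmZ absV mulVf// gt_eqF.
Qed.

Lemma opnorm_ub (f : bounded_op) (M : R[i]) : 0 <= M ->
  (forall x, `|f x| <= M * `|x|) -> opnorm f <= M.
Proof.
move=> M0 hM; have ME : M = (complex.Re M)%:C%C.
  by apply/esym/RRe_real/ger0_real.
rewrite ME opnormE lecR; apply: N_ub; first by rewrite -lecR -ME.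
by move=> x; rewrite -lecR rmorphM /= -!nrmE -ME.
Qed.

Lemma opnorm_le (f : bounded_op) x : `|f x| <= opnorm f * `|x|.
Proof. by rewrite opnormE !nrmE -rmorphM lecR; exact: N_le. Qed.

Lemma opnorm_ge0 f : 0 <= opnorm f.
Proof. by rewrite opnormE ler0c; exact: N_ge0. Qed.

Lemma opnormD f g : opnorm (f + g) <= opnorm f + opnorm g.
Proof.
apply: opnorm_ub; first by rewrite addr_ge0// opnorm_ge0.
move=> x /=; rewrite mulrDl (le_trans (ler_normD _ _))//.
by rewrite lerD// opnorm_le.
Qed.

Let opnormZ_le a f : opnorm (a *: f) <= `|a| * opnorm f.
Proof.
apply: opnorm_ub; first by rewrite mulr_ge0// opnorm_ge0.
by move=> x /=; rewrite normrZ -mulrA ler_wpM2l// opnorm_le.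
Qed.

Lemma opnorm_eq0 f : opnorm f = 0 -> f = 0.
Proof.
move=> f0; apply: bounded_opP => x; apply/eqP; rewrite -normr_le0.
by rewrite (le_trans (opnorm_le f x))// f0 mul0r.
Qed.

Lemma opnormZ a f : opnorm (a *: f) = `|a| * opnorm f.
Proof.
apply/eqP; rewrite eq_le opnormZ_le /=.
have [->|a0] := eqVneq a 0; first by rewrite normr0 mul0r opnorm_ge0.
rewrite -ler_pdivlMl ?normr_gt0//.
have := opnormZ_le a^-1 (a *: f).
by rewrite scalerA mulVf// scale1r normfV.
Qed.

HB.instance Definition _ :=
  Lmodule_isNormed.Build R[i] bounded_op opnormD opnormZ opnorm_eq0.

Lemma bop_normE (f : bounded_op) : `|f| = opnorm f. Proof. by []. Qed.

Lemma bounded_op_complete (F : set_system bounded_op) :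
  ProperFilter F -> cauchy F -> cvg F.
Proof.
move=> FF /cauchy_ballP Fc.
have Fc' (e : R[i]) : 0 < e -> exists2 S : set bounded_op, F S &
    forall f f' x, S f -> S f' -> `|f x - f' x| <= e * `|x|.
  move=> e0; have [[S T] [/= FS FT] ST] := Fc _ e0.
  exists (S `&` T); first exact: filterI.
  move=> f f' x [Sf _] [_ Tf'].
  have := ST (f, f') (conj Sf Tf'); rewrite -ball_normE /= => /ltW ff'.
  apply: le_trans (ler_wpM2r (normr_ge0 x) ff').
  by have := opnorm_le (f - f') x.
have evc x : cvg ((fun f : bounded_op => f x) @ F).
  apply: cauchy_cvg; apply/cauchy_ballP => e e0.
  have x1 : 0 < `|x| + 1 by rewrite ltr_wpDl.
  have [|S FS hS] := Fc' (e / (`|x| + 1)); first by rewrite divr_gt0.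
  have FSx : F [set f : bounded_op | [set f' x | f' in S] (f x)].
    by apply: filterS FS => f Sf; exists f.
  exists ([set f x | f in S], [set f x | f in S]) => /=; first by split.
  move=> [_ _] /= [[f Sf <-] [f' Sf' <-]].
  rewrite -ball_normE /=; apply: le_lt_trans (hS _ _ _ Sf Sf') _.
  by rewrite mulrAC ltr_pdivrMr// ltr_pM2l// ltrDl.
pose g x := lim ((fun f : bounded_op => f x) @ F).
have gE x : (fun f : bounded_op => f x) @ F --> g x by exact: evc.
have lg : linear g.
  move=> a x y; apply: cvg_lim; first exact: norm_hausdorff.
  under eq_fun do rewrite linearP.
  by apply: cvgD; [apply: cvgZr; exact: gE|exact: gE].
have gF (e : R[i]) : 0 < e -> exists2 S : set bounded_op, F S &
    forall f x, S f -> `|f x - g x| <= e * `|x|.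
  move=> e0; have [S FS hS] := Fc' _ e0; exists S => // f x Sf.
  apply/ler_addgt0Pr => d d0.
  have /cvgrPdist_lt/(_ _ d0) Fd := gE x.
  have [f' [Sf' f'd]] := filter_ex (filterI FS Fd).
  rewrite -(subrKA (f' x)) (le_trans (ler_normD _ _))//.
  by rewrite lerD ?hS// distrC ltW.
have cg : continuous g.
  pose gl : {linear X -> X} := HB.pack g (GRing.isLinear.Build R[i] X X *:%R g lg).
  apply: (@bounded_linear_continuous _ _ _ gl).
  apply/linear_boundedP.
  have [S FS hS] := gF 1 ltr01.
  have [f Sf] := filter_ex FS.
  exists (opnorm f + 1); split; first by rewrite ger0_real// addr_ge0 ?opnorm_ge0.
  move=> r /ltW fr x; apply: le_trans (ler_wpM2r (normr_ge0 x) fr).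
  rewrite mulrDl -[gl x](subrK (f x)) addrC (le_trans (ler_normD _ _))//.
  by rewrite lerD ?opnorm_le// distrC hS.
apply/cvg_ex; exists (BoundedOp lg cg); apply/cvgrPdist_lt => e e0.
have [|S FS hS] := gF (e / 2); first by rewrite divr_gt0.
apply: filterS FS => f Sf; rewrite distrC bop_normE.
apply: (@le_lt_trans _ _ (e / 2)); last by rewrite ltr_pdivrMr// ltr_pMr// ltr1n.
apply: opnorm_ub; first by rewrite ltW// divr_gt0.
by move=> x; exact: hS.
Qed.

HB.instance Definition _ := Uniform_isComplete.Build bounded_op
  bounded_op_complete.

Lemma bop_compA : associative bop_comp.
Proof. by move=> f g h; apply: bounded_opP. Qed.

Lemma bop_comp1l : left_id bop_id bop_comp.
Proof. by move=> f; apply: bounded_opP. Qed.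

Lemma bop_comp1r : right_id bop_id bop_comp.
Proof. by move=> f; apply: bounded_opP. Qed.

Lemma bop_compDl : left_distributive bop_comp +%R.
Proof. by move=> f g h; apply: bounded_opP. Qed.

Lemma bop_compDr : right_distributive bop_comp +%R.
Proof. by move=> f g h; apply: bounded_opP => x /=; rewrite linearD. Qed.

Lemma bop_scaleAl (a : R[i]) (f g : bounded_op) :
  a *: bop_comp f g = bop_comp (a *: f) g.
Proof. exact: bounded_opP. Qed.

Lemma bop_scaleAr (a : R[i]) (f g : bounded_op) :
  a *: bop_comp f g = bop_comp f (a *: g).
Proof. by apply: bounded_opP => x /=; rewrite linearZ. Qed.

Lemma opnorm_comp (f g : bounded_op) : `|bop_comp f g| <= `|f| * `|g|.
Proof.
apply: opnorm_ub; first by rewrite mulr_ge0.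
move=> x; apply: le_trans (opnorm_le f (g x)) _; rewrite -mulrA.
exact: ler_wpM2l (opnorm_ge0 f) _ _ (opnorm_le g x).
Qed.

HB.instance Definition _ := isBanachAlgebra.Build R[i] bounded_op
  bop_compA bop_comp1l bop_comp1r bop_compDl bop_compDr
  bop_scaleAl bop_scaleAr opnorm_comp.

HB.instance Definition _ :=
  GRing.PzRing.copy bounded_op (bounded_op : banachAlgType R[i]).

Lemma bounded_op1 (x : X) : (1 : bounded_op) x = x.
Proof. by []. Qed.

Lemma bounded_opM (f g : bounded_op) (x : X) : (f * g) x = f (g x).
Proof. by []. Qed.

End BoundedOperators.

(* No finite family spans V. *)
Definition infinite_dimensional (K : numFieldType) (V : lmodType K) : Prop :=
  forall (n : nat) (b : 'I_n -> V),
    exists x : V, forall c : 'I_n -> K, x <> \sum_(i < n) c i *: b i.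

Definition zmod_isomorphic (U V : zmodType) : Prop :=
  exists f : {additive U -> V}, bijective f.

(* Main.v *)
From HB Require Import structures.
Require Import Defs.
From mathcomp Require Import all_boot all_order all_algebra.
From mathcomp Require Import generic_quotient complex wochoice.
From mathcomp Require Import all_classical all_reals all_analysis.
From mathcomp Require Import zify ring lra.

Set Implicit Arguments.
Unset Strict Implicit.
Unset Printing Implicit Defensive.

Import Order.TTheory GRing.Theory Num.Theory.
Import numFieldNormedType.Exports.

Local Open Scope quotient_scope.
Local Open Scope ring_scope.

(** The space [X] is built so that, modulo a closed ideal without K-theory, its operator algebra is
    $\mathbb{C}^m$ times $n$ copies of the Calkin algebra of $\ell_1$. The scalars have
    $K_0=\mathbb{Z}$ and $K_1=0$; the Calkin algebra of $\ell_1$ has $K_0=0$ and, through the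
    Fredholm index, $K_1=\mathbb{Z}$. Hence $\mathbb{Z}^m$ and $\mathbb{Z}^n$.

    Elements of [X] are functions on lines. Each line is a copy of $\omega_1$ and is named by a
    slot, a type and a number [l]. The functions are limits of combinations of indicators of
    intervals, and the norm is a supremum of variations over [msz s] increments with weight $1/s!$,
    where [s] runs through a residue class fixed by the type. The norm leaves operators little room.
    By [locality], for every operator [S] there is a closed unbounded set of points [al] at which
    the part of [S x] on the slot [Base] depends only on the values of [x] at [al]. By
    [coef_constant] the coefficients of this dependence are eventually constant, and they vanish
    between different types, because variations at interleaved scales grow incomparably. On the slot
    [Base] a type below [m] has one line and yields a character [chi]; each of the next [n] types
    carries $\ell_1$-valued functions and yields a map [Phi] into the operators on $\ell_1$.

    The other slots make the common kernel of these maps a tractable ideal. The slots [LSlot] let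
    rank-one operators on a fibre factor through the projection [ee] onto the slots other than
    [Base]; conversely they act on the $\ell_1$ fibres with uniformly small tails, by a gliding hump
    ([l1_unconditional], [fibre_tail]), so [Phi] is multiplicative modulo compacts ([PhiM]). The
    slots [WSlot F] let operators that vanish on a closed unbounded set factor through [ee]. Thus
    [mem_cideal]: an operator with all [chi] zero and all [Phi] compact lies in the closed ideal
    generated by [ee]. Both kinds of slots come in infinitely many copies, so [ee] has an Eilenberg
    swindle ([ee_swindle]), and the ideal is invisible to K-theory ([kc_cideal], [k1triv_cideal]).

    The record [kmodel] isolates what is left. For $K_0$, an idempotent is replaced modulo the ideal
    by its scalar part plus idempotents over the operators on $\ell_1$; the latter exist because
    idempotents lift modulo compacts ([idempotent_lift]) and die by the swindle of $\ell_1$. Only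
    the ranks of the scalar parts survive ([model_K0]). For $K_1$, the indices of the [Phi] parts
    are homotopy invariants. If they all vanish, the [Phi] parts are invertible modulo compacts up
    to a swindle, the scalar parts are connected to the identity, and the rest is in the ideal
    ([idx0_k1triv]). Conversely a shift on one fibre, whose missing line is supplied by a slot
    [LSlot], is completed to an invertible matrix of index vector [delta_mx 0 j] ([k1_idx_surj]). *)

(** * Enumerable sets and a well-order of type $\omega_1$ *)

Definition enumerable (T : Type) (A : T -> Prop) :=
  exists f : nat -> option T, forall a, A a -> exists k, f k = Some a.

Lemma enumerable_bigcup (T : Type) (A : nat -> T -> Prop) :
  (forall k, enumerable (A k)) -> enumerable (fun a => exists k, A k a).
Proof.
move=> /choice[f hf].
exists (fun n => if unpickle n is Some (k, l) then f k l else None) => a [k /hf[l fl]].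
by exists (pickle (k, l)); rewrite pickleK.
Qed.

Lemma enumerable_sub (T : Type) (A B : T -> Prop) :
  (forall a, A a -> B a) -> enumerable B -> enumerable A.
Proof. by move=> AB [f hf]; exists f => a /AB/hf. Qed.

Lemma enumerable_countType (T : countType) (A : T -> Prop) : enumerable A.
Proof. by exists unpickle => a _; exists (pickle a); rewrite pickleK. Qed.

Lemma enumerable_image (S T : Type) (A : S -> Prop) (g : S -> T) :
  enumerable A -> enumerable (fun b => exists2 a, A a & b = g a).
Proof.
move=> [f hf]; exists (fun n => omap g (f n)) => b [a /hf[k fk] ->].
by exists k; rewrite fk.
Qed.

Lemma enumerable_dep (S T : Type) (A : S -> Prop) (B : S -> T -> Prop) :
  enumerable A -> (forall a, A a -> enumerable (B a)) ->
  enumerable (fun y => exists2 a, A a & B a y).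
Proof.
move=> [f hf] hB.
have [|g hg] := @enumerable_bigcup T (fun k y =>
  exists2 a, f k = Some a & A a /\ B a y).
  move=> k; case fk: (f k) => [a|]; last by exists (fun=> None) => y [].
  have [Aa|nAa] := pselect (A a).
    have [g hg] := hB _ Aa; exists g => y [b [<-] [_]]; exact: hg.
  by exists (fun=> None) => y [b [<-] []].
exists g => y [a Aa By]; apply: hg.
by have [k fk] := hf a Aa; exists k, a.
Qed.

(* Well-orders of type omega_1. *)
Record omega1 := Omega1 {
  om :> Type;
  omega0 : om;
  olt : rel om;
  olt_irr : forall a, olt a a = false;
  olt_trans : forall a b c, olt a b -> olt b c -> olt a c;
  olt_total : forall a b, [\/ olt a b, a = b | olt b a];
  olt_min : forall A : om -> Prop, (exists a, A a) ->
    exists2 a, A a & forall b, A b -> ~~ olt b a;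
  olt_enum : forall b, enumerable (fun a => olt a b);
  olt_bound : forall f : nat -> om, exists b, forall k, olt (f k) b }.

(** Well-order the power set of [nat] and keep the points below every point whose initial segment is
    not enumerable. These points are not enumerable themselves, by minimality of the first bad point
    or, if there is none, by Cantor's theorem; hence no sequence is cofinal in them. *)
Lemma omega1_exists : inhabited omega1.
Proof.
pose T : eqType := set nat.
have [R woR] := well_ordering_principle T.
have wc : wo_chain R predT by move=> A _; exact: woR.
have Rtot x y : R x y || R y x by apply: (wo_chainW wc).
have Rrefl x : R x x by apply: (wo_chain_reflexive wc).
have Ranti x y : R x y -> R y x -> x = y.
  by move=> xy yx; apply: (wo_chain_antisymmetric wc) => //; rewrite xy yx.
have Rmin (A : T -> Prop) : (exists a, A a) -> exists2 a, A a & forall b, A b -> R a b.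
  move=> [a Aa].
  have [|z [[zA zl] _]] := woR [pred x | `[< A x >]].
    by exists a; apply/asboolP.
  exists z; first exact/asboolP.
  by move=> b Ab; apply: zl; apply/asboolP.
pose lt x y := R x y && (x != y).
have lt_irr a : lt a a = false by rewrite /lt eqxx andbF.
have ltN a b : ~~ lt a b = R b a.
  apply/idP/idP => [|Rba].
    rewrite /lt negb_and negbK => /orP[nab|/eqP->//].
    by have := Rtot a b; rewrite (negbTE nab).
  by apply/negP => /andP[Rab /eqP]; apply; exact: Ranti.
have Rtrans a b c : R a b -> R b c -> R a c.
  move=> ab bc.
  have [|z [->|[->|->]] zl] := Rmin (fun x => x = a \/ x = b \/ x = c).
  - by exists a; left.
  - by apply: zl; auto.
  - have -> : a = b by apply: Ranti => //; apply: zl; auto.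
    by [].
  - have <- : b = c by apply: Ranti => //; apply: zl; auto.
    by [].
have lt_trans a b c : lt a b -> lt b c -> lt a c.
  move=> /andP[ab nab] /andP[bc nbc]; rewrite /lt (Rtrans _ _ _ ab bc) /=.
  apply/eqP => e; subst c; move/eqP: nab; apply; exact: Ranti.
have lt_total a b : [\/ lt a b, a = b | lt b a].
  have [->|nab] := eqVneq a b; first by constructor 2.
  have /orP[ab|ba] := Rtot a b; first by constructor 1; rewrite /lt ab.
  by constructor 3; rewrite /lt ba eq_sym.
pose bad x := ~ enumerable (fun a => lt a x).
pose P (y : T) := `[< forall x, bad x -> lt y x >].
have nP : ~ enumerable (fun y : T => P y).
  move=> enP.
  have [[x bx]|nb] := pselect (exists x, bad x).
    have [z bz zl] := Rmin bad (ex_intro _ x bx).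
    apply: bz; apply: enumerable_sub enP => a az; apply/asboolP => y by_.
    have := zl y by_; move: az => /andP[az nz] zy.
    rewrite /lt (Rtrans _ _ _ az zy) /=; apply/eqP => e; subst y.
    by move/eqP: nz; apply; exact: Ranti.
  case: enP => f hf.
  (* Cantor's diagonal set: [D] disagrees at [k] with the set numbered [k]. *)
  pose D : T := [set n | if f n is Some A then ~ A n else False]%classic.
  have [k fk] : exists k, f k = Some D.
    by apply: hf; apply/asboolP => x bx; case: nb; exists x.
  have : D k <-> ~ D k by rewrite {1}/D /= fk.
  by tauto.
pose S := {y : T | P y}.
have enS (y : S) : enumerable (fun a : S => lt (sval a) (sval y)).
  have [f hf] : enumerable (fun a => lt a (sval y)).
    apply: contrapT => by_; have /asboolP/(_ _ by_) := svalP y.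
    by rewrite lt_irr.
  exists (fun n => if f n is Some a then insub a else None) => a /hf[k fk].
  by exists k; rewrite fk; apply: valK.
have [s0] : inhabited S.
  apply: contrapT => nS; apply: nP; exists (fun=> None) => a Pa.
  by case: nS; constructor; exists a.
constructor; apply: (@Omega1 S s0 (fun a b => lt (sval a) (sval b))).
- by move=> a; exact: lt_irr.
- by move=> a b c; exact: lt_trans.
- move=> a b; have [ab|ab|ab] := lt_total (sval a) (sval b).
  + by constructor 1.
  + by constructor 2; exact: val_inj.
  + by constructor 3.
- move=> A [a Aa]; have [|z [b Ab bz] zl] := Rmin (fun x => exists2 b, A b & sval b = x).
    by exists (sval a), a.
  exists b => // c Ac; rewrite ltN bz; apply: zl; by exists c.
- exact: enS.
- move=> f; apply: contrapT => nub; apply: nP.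
  have [g hg] : enumerable (fun a : S => exists k,
      lt (sval a) (sval (f k)) \/ a = f k).
    apply: enumerable_bigcup => k; have [g hg] := enS (f k).
    exists (fun n => if n is n'.+1 then g n' else Some (f k)) => a [/hg[l gl]|->].
      by exists l.+1.
    by exists 0.
  exists (fun n => omap sval (g n)) => a Pa.
  have [k gk] : exists k, g k = Some (exist P a Pa).
    apply: hg; apply: contrapT => na; apply: nub; exists (exist P a Pa) => k /=.
    have [h|h|//] := lt_total a (sval (f k)); case: na; exists k; first by left.
    by right; apply: val_inj.
  by exists k; rewrite gk.
Qed.

(** * Closed unbounded sets *)

Section Omega1Theory.
Variable W : omega1.
Local Notation "a <o b" := (olt a b) (at level 70).
Local Notation "a <=o b" := (~~ olt b a) (at level 70).
Implicit Types (a b c al be : W) (F G : W -> W).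

Lemma ole_refl a : a <=o a. Proof. by rewrite olt_irr. Qed.

Lemma oltW a b : a <o b -> a <=o b.
Proof. by move=> ab; apply/negP => /(olt_trans ab); rewrite olt_irr. Qed.

Lemma ole_eqVlt a b : a <=o b -> a = b \/ a <o b.
Proof. by have [ab|->|ba] := olt_total a b; [right|left|rewrite ba]. Qed.

Lemma ole_lt_trans a b c : a <=o b -> b <o c -> a <o c.
Proof. by move=> /ole_eqVlt[->//|]; exact: olt_trans. Qed.

Lemma olt_le_trans a b c : a <o b -> b <=o c -> a <o c.
Proof. by move=> ab /ole_eqVlt[<-//|]; exact: olt_trans. Qed.

Lemma ole_trans a b c : a <=o b -> b <=o c -> a <=o c.
Proof. by move=> /ole_eqVlt[->//|ab] bc; apply: oltW; exact: olt_le_trans bc. Qed.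

Lemma ole_anti a b : a <=o b -> b <=o a -> a = b.
Proof. by move=> /ole_eqVlt[->//|->]. Qed.


Lemma omaxP a b : exists c, [/\ a <=o c, b <=o c & forall d, a <o d -> b <o d -> c <o d].
Proof.
by have [ab|->|ba] := olt_total a b; [exists b|exists b|exists a]; split=> //;
  rewrite ?olt_irr ?oltW.
Qed.

Lemma enumerable_ub (A : W -> Prop) :
  enumerable A -> exists b, forall a, A a -> a <o b.
Proof.
move=> [f hf]; have [b hb] := olt_bound (fun k => odflt (omega0 W) (f k)).
by exists b => a /hf[k fk]; have := hb k; rewrite fk.
Qed.

Lemma enumerable_le b : enumerable (fun a => a <=o b).
Proof.
have [f hf] := olt_enum b.
exists (fun n => if n is n'.+1 then f n' else Some b) => a /ole_eqVlt[->|/hf[k fk]].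
  by exists 0.
by exists k.+1.
Qed.

Definition olimit al := (exists b, b <o al) /\
  forall b, b <o al -> exists2 c, b <o c & c <o al.

(* The closure points of F: every closed unbounded set contains a set of this form. *)
Definition club F al := (exists b, b <o al) /\ forall b, b <o al -> F b <o al.

Definition inflationary F := forall b, b <o F b.

Lemma club_limit F al : inflationary F -> club F al -> olimit al.
Proof. by move=> iF [al0 cl]; split=> // b /cl bal; exists (F b). Qed.

(** Iterate a function [h] that strictly dominates each point [c] and all values of [F] up to [c];
    the supremum of the iterates is a closure point. *)
Lemma club_unbounded F b : exists2 al, club F al & b <o al.
Proof.
have /choice[h hh] (c : W) : exists d, (c <o d) /\ forall x, x <=o c -> F x <o d.
  have [d1 h1] := enumerable_ub (enumerable_image F (enumerable_le c)).
  have [d2 h2] := @enumerable_ub (fun a => a = c) (ex_intro _ (fun=> Some c)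
    (fun a e => ex_intro _ 0%N (congr1 Some (esym e)))).
  have [d [d1d d2d _]] := omaxP d1 d2; exists d; split.
    exact: olt_le_trans (h2 _ erefl) d2d.
  by move=> x xc; apply: olt_le_trans (h1 _ _) d1d; exists x.
pose s k := iter k h b.
have [|al hal almin] := @olt_min W (fun x => forall k, s k <o x).
  exact: olt_bound.
exists al; last exact: (hal 0%N).
split; first by exists b; exact: (hal 0%N).
move=> c cal.
have [k ck] : exists k, c <=o s k.
  apply: contrapT => nk; have := almin c; rewrite cal; apply: (fun x y => notF (y x)) => k.
  by apply/negPn/negP => ck; apply: nk; exists k.
by apply: olt_trans (hal k.+1); have [_ ->] := hh (s k).
Qed.

Lemma club_sup F (A : W -> Prop) al : (exists b, A b) ->
  (forall b, A b -> club F b) -> (forall b, A b -> b <=o al) ->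
  (forall c, (forall b, A b -> b <=o c) -> al <=o c) -> club F al.
Proof.
move=> [b0 Ab0] AF ub lub; split.
  have [[c cb0] _] := AF _ Ab0; exists c; exact: olt_le_trans (ub _ Ab0).
move=> b bal.
have [d Ad bd] : exists2 d, A d & b <o d.
  apply: contrapT => nd; have := lub b; rewrite bal; apply: (fun x y => notF (y x)) => d Ad.
  by apply/negP => bd; apply: nd; exists d.
by have [_ /(_ _ bd) Fd] := AF _ Ad; apply: olt_le_trans (ub _ Ad).
Qed.

(** A diagonal intersection: [al] only has to be closed under the functions attached to points below
    it. Up to a given point only countably many functions and arguments occur, so their values have
    a common bound, and [G] is such a bound. *)
Lemma club_diagonal (Fs : W -> (W -> W) -> Prop) :
  (forall b, enumerable (Fs b)) ->
  exists2 G, inflationary G &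
    forall al b F, club G al -> b <o al -> Fs b F -> club F al.
Proof.
move=> enF.
have /choice[G hG] (b : W) : exists c, (b <o c) /\
    forall b' b'' F, b' <=o b -> b'' <=o b -> Fs b'' F -> F b' <o c.
  have en1 : enumerable (fun F => exists2 b'', b'' <=o b & Fs b'' F).
    by apply: enumerable_dep (enumerable_le b) _ => a _; exact: enF.
  have en2 : enumerable (fun x => exists2 F, (exists2 b'', b'' <=o b & Fs b'' F) &
      exists2 b', b' <=o b & x = F b').
    by apply: enumerable_dep en1 _ => F _; exact: enumerable_image (enumerable_le b).
  have [c hc] := enumerable_ub en2; have [d hd] := enumerable_ub (enumerable_le b).
  have [e [ce de _]] := omaxP c d; exists e; split.
    by apply: olt_le_trans de; apply: hd; exact: ole_refl.
  move=> b' b'' F b'b b''b FF; apply: olt_le_trans ce; apply: hc.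
  by exists F; [exists b''|exists b'].
exists G; first by move=> b; case: (hG b).
move=> al b F [al0 Gal] bal FF; split=> // b' b'al.
have [c [bc b'c cal]] := omaxP b b'.
have [_ /(_ _ _ _ b'c bc FF) h] := hG c.
by apply: olt_trans h _; apply: Gal; exact: cal.
Qed.

Lemma club_countable (Fs : nat -> W -> W) :
  exists2 G, inflationary G & forall al k, club G al -> club (Fs k) al.
Proof.
have [|G iG hG] := @club_diagonal (fun _ F => exists k, F = Fs k).
  move=> _; exists (fun k => Some (Fs k)) => F [k ->]; by exists k.
by exists G => // al k cG; have [[b bal] _] := cG; apply: hG cG bal _; exists k.
Qed.

Lemma club_and F F' :
  exists2 G, inflationary G & forall al, club G al -> club F al /\ club F' al.
Proof.
have [G iG hG] := club_countable (fun k => if k is 0 then F else F').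
by exists G => // al cG; split; [exact: hG 0%N _|exact: hG 1%N _].
Qed.

End Omega1Theory.

(** * Real-valued moduli and norms *)

Section Modulus.
Variable R : realType.
Local Notation C := R[i].
Implicit Types (z w : C).

(** Norms over [R[i]] have complex values; [cn], and [nrm] for vectors, are their real versions, in
    which suprema and linear arithmetic are carried out. *)
Definition cn z : R := complex.Re `|z|.

Lemma cnE z : `|z| = (cn z)%:C%C.
Proof. by apply/esym/RRe_real; rewrite normr_real. Qed.

Lemma cn_ge0 z : 0 <= cn z.
Proof. by rewrite -lecR -cnE; exact: normr_ge0. Qed.

Lemma cnM z w : cn (z * w) = cn z * cn w.
Proof. by apply: complexI; rewrite rmorphM /= -!cnE normrM. Qed.

Lemma cnD z w : cn (z + w) <= cn z + cn w.
Proof. by rewrite -lecR rmorphD /= -!cnE ler_normD. Qed.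

Lemma cnN z : cn (- z) = cn z.
Proof. by rewrite /cn normrN. Qed.

Lemma cnB z w : cn (z - w) = cn (w - z).
Proof. by rewrite /cn distrC. Qed.

Lemma cn_subr z w : cn (z - w) <= cn z + cn w.
Proof. by rewrite -(cnN w) cnD. Qed.

Lemma cn0 : cn 0 = 0. Proof. by rewrite /cn normr0. Qed.

Lemma cn1 : cn 1 = 1. Proof. by rewrite /cn normr1. Qed.

Lemma cn_eq0 z : (cn z == 0) = (z == 0).
Proof.
apply/eqP/eqP => [z0|->]; last exact: cn0.
by apply/eqP; rewrite -normr_eq0 cnE z0.
Qed.

Lemma cn_gt0 z : (0 < cn z) = (z != 0).
Proof. by rewrite lt_def cn_ge0 andbT cn_eq0. Qed.

Lemma cn_real (r : R) : cn r%:C%C = `|r|.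
Proof. by rewrite /cn normc_def /= expr0n addr0 sqrtr_sqr. Qed.

Lemma cn_sum (I : Type) (r : seq I) (Q : pred I) (F : I -> C) :
  cn (\sum_(i <- r | Q i) F i) <= \sum_(i <- r | Q i) cn (F i).
Proof.
elim/big_rec2: _ => [|i x y _ h]; first by rewrite cn0.
by apply: le_trans (cnD _ _) _; rewrite lerD2l.
Qed.

Lemma cnV z : cn z^-1 = (cn z)^-1.
Proof. by apply: complexI; rewrite fmorphV /= -!cnE normfV. Qed.

Lemma cnX z n : cn (z ^+ n) = cn z ^+ n.
Proof. by elim: n => [|n ih]; rewrite ?expr0 ?cn1// !exprS cnM ih. Qed.

Lemma re_le_cn z : `|complex.Re z| <= cn z.
Proof. by rewrite -lecR -cnE; exact: normc_ge_Re. Qed.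

Lemma im_le_cn z : `|complex.Im z| <= cn z.
Proof.
case: z => a b /=; rewrite /cn normc_def /= -sqrtr_sqr ler_wsqrtr//.
by rewrite lerDr sqr_ge0.
Qed.

Lemma cn_le_re_im z : cn z <= `|complex.Re z| + `|complex.Im z|.
Proof.
case: z => a b /=; rewrite /cn normc_def /= -[leRHS]ger0_norm ?addr_ge0//.
rewrite -sqrtr_sqr ler_wsqrtr// sqrrD !real_normK ?num_real//.
by rewrite addrAC lerDl mulrn_wge0// mulr_ge0.
Qed.

Lemma cn_phase z : exists2 w, cn w = 1 & w * z = (cn z)%:C%C.
Proof.
have [->|z0] := eqVneq z 0; first by exists 1; rewrite ?cn1// mulr0 cn0.
exists (z^-1 * (cn z)%:C%C); last by rewrite mulrAC mulVf// mul1r.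
rewrite cnM cnV cn_real ger0_norm ?cn_ge0// mulVf// cn_eq0 //.
Qed.

End Modulus.

Section RealNorm.
Variables (R : realType) (V : normedModType R[i]).
Implicit Types (x y : V).

Definition nrm x : R := complex.Re `|x|.

Lemma nrmE x : `|x| = (nrm x)%:C%C.
Proof. by apply/esym/RRe_real; rewrite normr_real. Qed.

Lemma nrm_ge0 x : 0 <= nrm x.
Proof. by rewrite -lecR -nrmE; exact: normr_ge0. Qed.

Lemma nrmD x y : nrm (x + y) <= nrm x + nrm y.
Proof. by rewrite -lecR rmorphD /= -!nrmE ler_normD. Qed.

Lemma nrmZ a x : nrm (a *: x) = cn a * nrm x.
Proof. by apply: complexI; rewrite rmorphM /= -!nrmE -cnE normrZ. Qed.

Lemma nrmN x : nrm (- x) = nrm x.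
Proof. by rewrite /nrm normrN. Qed.

Lemma nrmB x y : nrm (x - y) = nrm (y - x).
Proof. by rewrite /nrm distrC. Qed.

Lemma nrm0 : nrm (0 : V) = 0. Proof. by rewrite /nrm normr0. Qed.

Lemma nrm_eq0 x : nrm x = 0 -> x = 0.
Proof. by move=> x0; apply/eqP; rewrite -normr_eq0 nrmE x0. Qed.

Lemma nrm_tri x y z : nrm (x - z) <= nrm (x - y) + nrm (y - z).
Proof. by rewrite -[x - z](subrKA y) nrmD. Qed.

Lemma nrm_sum (I : Type) (r : seq I) (Q : pred I) (F : I -> V) :
  nrm (\sum_(i <- r | Q i) F i) <= \sum_(i <- r | Q i) nrm (F i).
Proof.
elim/big_rec2: _ => [|i x y _ h]; first by rewrite nrm0.
by apply: le_trans (nrmD _ _) _; rewrite lerD2l.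
Qed.

Lemma nrm_small x : (forall e, 0 < e -> nrm x <= e) -> x = 0.
Proof.
move=> h; apply: nrm_eq0; apply/eqP; rewrite eq_le nrm_ge0 andbT.
by apply/ler_addgt0Pr => e e0; rewrite add0r h.
Qed.

End RealNorm.

(** * Banach spaces of functions defined by families of seminorms *)

Section FunctionSpace.
Variable R : realType.
Local Notation C := R[i].

(* A family of seminorms on functions Z -> C, each depending on finitely many
   values, jointly controlling every value, together with a subspace of
   functions on which their supremum is finite. *)
Record fspec := FSpec {
  fs_pt : Type;
  fs_ix : Type;
  fs_p : fs_ix -> (fs_pt -> C) -> R;
  fs_P : (fs_pt -> C) -> Prop;
  fs_pD : forall t x y, fs_p t (fun z => x z + y z) <= fs_p t x + fs_p t y;
  fs_pZ : forall t a x, fs_p t (fun z => a * x z) = cn a * fs_p t x;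
  fs_pfin : forall t, exists zs : seq fs_pt, exists2 K : R, 0 <= K &
    forall u, fs_p t u <= K * \sum_(z <- zs) cn (u z);
  fs_psep : forall z, exists t, exists2 K : R, 0 <= K &
    forall u, cn (u z) <= K * fs_p t u;
  fs_P0 : fs_P (fun=> 0);
  fs_PD : forall x y, fs_P x -> fs_P y -> fs_P (fun z => x z + y z);
  fs_PZ : forall a x, fs_P x -> fs_P (fun z => a * x z);
  fs_Pbd : forall x, fs_P x -> exists M, forall t, fs_p t x <= M }.

Variable s : fspec.
Local Notation Z := (fs_pt s).
Local Notation p := (@fs_p s).
Local Notation P := (@fs_P s).
Implicit Types (x y : Z -> C).

Let pN t x : p t (fun z => - x z) = p t x.
Proof.
have -> : (fun z => - x z) = (fun z => -1 * x z) by apply/funext => z; rewrite mulN1r.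
by rewrite fs_pZ cnN cn1 mul1r.
Qed.

Let p0 t : p t (fun=> 0) = 0.
Proof.
have -> : (fun=> 0) = (fun z : Z => 0 * 0 : C) by apply/funext => z; rewrite mul0r.
by rewrite fs_pZ cn0 mul0r.
Qed.

Let p_ge0 t x : 0 <= p t x.
Proof.
have := fs_pD t x (fun z => - x z); rewrite pN.
have -> : (fun z => x z - x z) = (fun=> 0) by apply/funext => z; rewrite subrr.
by rewrite p0; lra.
Qed.

Let pB t x y : p t (fun z => x z - y z) <= p t x + p t y.
Proof. by rewrite -(pN t y) fs_pD. Qed.

(** The closure of [P] is taken inside the space of all functions and not as an abstract completion,
    so that elements keep their values at points. *)
Definition fs_mem x := forall e : R, 0 < e ->
  exists2 y, P y & forall t, p t (fun z => x z - y z) <= e.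

Lemma fs_memP x : P x -> fs_mem x.
Proof.
move=> Px e e0; exists x => // t.
have -> : (fun z => x z - x z) = (fun=> 0) by apply/funext => z; rewrite subrr.
by rewrite p0 ltW.
Qed.

Lemma fs_mem0 : fs_mem (fun=> 0). Proof. exact/fs_memP/fs_P0. Qed.

Lemma fs_memD x y : fs_mem x -> fs_mem y -> fs_mem (fun z => x z + y z).
Proof.
move=> hx hy e e0; have e2 : 0 < e / 2 by rewrite divr_gt0.
have [x' Px' xx'] := hx _ e2; have [y' Py' yy'] := hy _ e2.
exists (fun z => x' z + y' z); first exact: fs_PD.
move=> t; have -> : (fun z => x z + y z - (x' z + y' z)) =
  (fun z => (x z - x' z) + (y z - y' z)) by apply/funext => z; rewrite opprD addrACA.
by apply: le_trans (fs_pD _ _ _) _; rewrite [leRHS](splitr e) lerD.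
Qed.

Lemma fs_memZ a x : fs_mem x -> fs_mem (fun z => a * x z).
Proof.
move=> hx e e0; have a1 : 0 < cn a + 1 by rewrite ltr_wpDl// cn_ge0.
have [x' Px' xx'] := hx (e / (cn a + 1)) (divr_gt0 e0 a1).
exists (fun z => a * x' z); first exact: fs_PZ.
move=> t; have -> : (fun z => a * x z - a * x' z) = (fun z => a * (x z - x' z)).
  by apply/funext => z; rewrite mulrBr.
rewrite fs_pZ; apply: (@le_trans _ _ ((cn a + 1) * (e / (cn a + 1)))).
  by rewrite ler_pM ?cn_ge0 ?p_ge0// lerDl.
by rewrite mulrC divfK// gt_eqF.
Qed.

Lemma fs_memN x : fs_mem x -> fs_mem (fun z => - x z).
Proof.
have -> : (fun z => - x z) = (fun z => -1 * x z) by apply/funext => z; rewrite mulN1r.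
exact: fs_memZ.
Qed.

Record fspace := FSpace { fval :> Z -> C; fvalP : fs_mem fval }.

HB.instance Definition _ := gen_eqMixin fspace.
HB.instance Definition _ := gen_choiceMixin fspace.

Lemma fspaceP (f g : fspace) : (forall z, f z = g z) -> f = g.
Proof.
case: f g => [f lf] [g lg] /= /funext fg; subst g.
by rewrite (Prop_irrelevance lf lg).
Qed.

Definition fs_zero := FSpace fs_mem0.
Definition fs_add (f g : fspace) := FSpace (fs_memD (fvalP f) (fvalP g)).
Definition fs_opp (f : fspace) := FSpace (fs_memN (fvalP f)).
Definition fs_scale a (f : fspace) := FSpace (fs_memZ a (fvalP f)).

Lemma fs_addA : associative fs_add.
Proof. by move=> f g h; apply: fspaceP => z /=; rewrite addrA. Qed.
Lemma fs_addC : commutative fs_add.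
Proof. by move=> f g; apply: fspaceP => z /=; rewrite addrC. Qed.
Lemma fs_add0 : left_id fs_zero fs_add.
Proof. by move=> f; apply: fspaceP => z /=; rewrite add0r. Qed.
Lemma fs_addN : left_inverse fs_zero fs_opp fs_add.
Proof. by move=> f; apply: fspaceP => z /=; rewrite addNr. Qed.

HB.instance Definition _ :=
  GRing.isZmodule.Build fspace fs_addA fs_addC fs_add0 fs_addN.

Lemma fs_scaleA a b f : fs_scale a (fs_scale b f) = fs_scale (a * b) f.
Proof. by apply: fspaceP => z /=; rewrite mulrA. Qed.
Lemma fs_scale1 : left_id 1 fs_scale.
Proof. by move=> f; apply: fspaceP => z /=; rewrite mul1r. Qed.
Lemma fs_scaleDr : right_distributive fs_scale +%R.
Proof. by move=> a f g; apply: fspaceP => z /=; rewrite mulrDr. Qed.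
Lemma fs_scaleDl f : {morph fs_scale^~ f : a b / a + b}.
Proof. by move=> a b; apply: fspaceP => z /=; rewrite mulrDl. Qed.

HB.instance Definition _ := GRing.Zmodule_isLmodule.Build C fspace
  fs_scaleA fs_scale1 fs_scaleDr fs_scaleDl.

Lemma fval0 z : (0 : fspace) z = 0. Proof. by []. Qed.
Lemma fvalD (f g : fspace) z : (f + g) z = f z + g z. Proof. by []. Qed.
Lemma fvalN (f : fspace) z : (- f) z = - f z. Proof. by []. Qed.
Lemma fvalB (f g : fspace) z : (f - g) z = f z - g z. Proof. by []. Qed.
Lemma fvalZ a (f : fspace) z : (a *: f) z = a * f z. Proof. by []. Qed.
Lemma fval_sum (I : Type) (r : seq I) (Q : pred I) (F : I -> fspace) z :
  (\sum_(i <- r | Q i) F i) z = \sum_(i <- r | Q i) F i z.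
Proof. by elim/big_rec2: _ => // i y x _ <-. Qed.

Let has_ub_p (f : fspace) : has_ubound (range (fun t => p t f)).
Proof.
have [y Py fy] := fvalP f ltr01; have [M hM] := fs_Pbd Py.
exists (1 + M) => _ [t _ <-].
have -> : (f : Z -> C) = (fun z => (f z - y z) + y z).
  by apply/funext => z; rewrite subrK.
by apply: le_trans (fs_pD _ _ _) _; rewrite lerD.
Qed.

Definition fs_norm (f : fspace) : R := sup (range (fun t => p t f)).

Lemma p_le_norm t (f : fspace) : p t f <= fs_norm f.
Proof.
apply: sup_upper_bound; last by exists t.
by split; [exists (p t f), t|exact: has_ub_p].
Qed.

Lemma fs_norm_le (f : fspace) M : 0 <= M -> (forall t, p t f <= M) -> fs_norm f <= M.
Proof.
move=> M0 hM; rewrite /fs_norm; set S := (X in sup X).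
have [->|/set0P S0] := eqVneq S classical_sets.set0; first by rewrite sup0.
by apply: ge_sup => // _ [t _ <-].
Qed.

Lemma fs_norm_ge0 f : 0 <= fs_norm f.
Proof.
rewrite /fs_norm; set S := (X in sup X).
have [->|/set0P [_ [t _ _]]] := eqVneq S classical_sets.set0; first by rewrite sup0.
by apply: le_trans (p_le_norm t f); exact: p_ge0.
Qed.

Let fs_normD f g : fs_norm (f + g) <= fs_norm f + fs_norm g.
Proof.
apply: fs_norm_le; first by rewrite addr_ge0 ?fs_norm_ge0.
by move=> t; apply: le_trans (fs_pD _ _ _) _; rewrite lerD ?p_le_norm.
Qed.

Let fs_normZ a f : fs_norm (a *: f) = cn a * fs_norm f.
Proof.
have le b g : fs_norm (b *: g) <= cn b * fs_norm g.
  apply: fs_norm_le; first by rewrite mulr_ge0 ?fs_norm_ge0 ?cn_ge0.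
  by move=> t; rewrite fs_pZ ler_wpM2l ?cn_ge0 ?p_le_norm.
apply/eqP; rewrite eq_le le /=.
have [->|a0] := eqVneq a 0; first by rewrite cn0 mul0r fs_norm_ge0.
rewrite -ler_pdivlMl ?cn_gt0//; have := le a^-1 (a *: f).
by rewrite scalerA mulVf// scale1r cnV.
Qed.

Let fs_norm_eq0 f : fs_norm f = 0 -> f = 0.
Proof.
move=> f0; apply: fspaceP => z; have [t [K K0 /(_ f) hK]] := fs_psep z.
apply/eqP; rewrite -cn_eq0 eq_le cn_ge0 andbT (le_trans hK)//.
by rewrite -(mulr0 K) ler_wpM2l// -f0 p_le_norm.
Qed.

Let cnorm (f : fspace) : C := (fs_norm f)%:C%C.

Let cnormD f g : cnorm (f + g) <= cnorm f + cnorm g.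
Proof. by rewrite /cnorm -rmorphD lecR. Qed.

Let cnormZ a f : cnorm (a *: f) = `|a| * cnorm f.
Proof. by rewrite /cnorm fs_normZ cnE -rmorphM. Qed.

Let cnorm_eq0 f : cnorm f = 0 -> f = 0.
Proof. by move=> /complexI/fs_norm_eq0. Qed.

HB.instance Definition _ := Lmodule_isNormed.Build C fspace cnormD cnormZ cnorm_eq0.

Lemma fs_nrmE (f : fspace) : nrm f = fs_norm f. Proof. by []. Qed.

Lemma p_le_nrm t (f : fspace) : p t f <= nrm f.
Proof. by rewrite fs_nrmE p_le_norm. Qed.

Lemma nrm_le_p (f : fspace) M : 0 <= M -> (forall t, p t f <= M) -> nrm f <= M.
Proof. by rewrite fs_nrmE; exact: fs_norm_le. Qed.

Lemma fval_bound z : exists2 K : R, 0 <= K & forall f : fspace, cn (f z) <= K * nrm f.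
Proof.
have [t [K K0 hK]] := fs_psep z; exists K => // f.
by apply: le_trans (hK f) _; rewrite ler_wpM2l// p_le_nrm.
Qed.

Lemma fs_dense (f : fspace) (e : R) : 0 < e ->
  exists2 g : fspace, P g & nrm (f - g) <= e.
Proof.
move=> e0; have [y Py hy] := fvalP f e0.
by exists (FSpace (fs_memP Py)) => //; apply: nrm_le_p => //; exact: ltW.
Qed.

Local Open Scope classical_set_scope.

(** Values form Cauchy filters by [fs_psep], which gives a pointwise limit. Uniform estimates pass
    to the limit because each seminorm depends on finitely many values, by [fs_pfin]. *)
Lemma fspace_complete (F : set_system fspace) :
  ProperFilter F -> cauchy F -> cvg F.
Proof.
move=> FF /cauchy_ballP Fc.
have Fc' (e : R) : 0 < e -> exists2 S : set fspace, F S &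
    forall f g, S f -> S g -> nrm (f - g) <= e.
  move=> e0; have e2 : 0 < (e / 2)%:C%C by rewrite ltcR divr_gt0.
  have [[S' T'] [/= FS' FT'] ST'] := Fc _ e2.
  exists (S' `&` T'); first exact: filterI.
  move=> f g [Sf Tf] [Sg Tg].
  have [h [Sh Th]] := filter_ex (filterI FS' FT').
  have := ST' (f, h) (conj Sf Th); rewrite -ball_normE /= nrmE ltcR => fh.
  have := ST' (g, h) (conj Sg Th); rewrite -ball_normE /= nrmE ltcR => gh.
  apply: le_trans (nrm_tri f h g) _; rewrite [leRHS]splitr.
  by apply: lerD; [exact: ltW|rewrite nrmB; exact: ltW].
have cv (q : C -> R) z : (forall a b, `|q a - q b| <= cn (a - b)) ->
    cvg ((fun f : fspace => q (f z)) @ F).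
  move=> hq; apply: cauchy_cvg; apply/cauchy_ballP => e e0.
  have [K K0 hK] := fval_bound z.
  have K1 : 0 < K + 1 by rewrite ltr_wpDl.
  have [S FS hS] := Fc' (e / 2 / (K + 1)) (divr_gt0 (divr_gt0 e0 (ltr0n _ 2)) K1).
  have FSx : F [set f : fspace | [set q (f' z) | f' in S] (q (f z))].
    by apply: filterS FS => f Sf; exists f.
  exists ([set q (f z) | f in S], [set q (f z) | f in S]) => /=; first by split.
  move=> [_ _] /= [[f Sf <-] [g Sg <-]]; rewrite -ball_normE /=.
  apply: le_lt_trans (hq _ _) _; rewrite -fvalB; apply: le_lt_trans (hK _) _.
  apply: (@le_lt_trans _ _ ((K + 1) * (e / 2 / (K + 1)))).
    by apply: ler_pM => //; rewrite ?nrm_ge0 ?lerDl// hS.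
  by rewrite mulrC divfK ?gt_eqF// ltr_pdivrMr// ltr_pMr// ltr1n.
have cRe z : cvg ((fun f : fspace => complex.Re (f z)) @ F).
  by apply: cv => a b; rewrite -raddfB; exact: re_le_cn.
have cIm z : cvg ((fun f : fspace => complex.Im (f z)) @ F).
  by apply: cv => a b; rewrite -raddfB; exact: im_le_cn.
pose g z := (lim ((fun f : fspace => complex.Re (f z)) @ F) +i*
             lim ((fun f : fspace => complex.Im (f z)) @ F))%C.
have gE z (e : R) : 0 < e -> F [set f : fspace | cn (f z - g z) <= e].
  move=> e0; have e2 : 0 < e / 2 by rewrite divr_gt0.
  have /cvgrPdist_lt/(_ _ e2) hr := cRe z.
  have /cvgrPdist_lt/(_ _ e2) hi := cIm z.
  apply: filterS (filterI hr hi) => f [/= fr fi].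
  apply: le_trans (cn_le_re_im _) _; rewrite [leRHS]splitr lerD//.
    by rewrite raddfB /= distrC; exact: ltW fr.
  by rewrite raddfB /= distrC; exact: ltW fi.
have gF (e : R) : 0 < e -> exists2 S : set fspace, F S &
    forall f t, S f -> p t (fun z => f z - g z) <= e.
  move=> e0; have [S FS hS] := Fc' _ e0; exists S => // f t Sf.
  have [zs [K K0 hK]] := fs_pfin t.
  apply/ler_addgt0Pr => d d0.
  pose n : R := (size zs)%:R.
  have n0 : 0 < K * n + 1 by rewrite ltr_wpDl// mulr_ge0 ?ler0n.
  pose q := d / (K * n + 1); have q0 : 0 < q by rewrite divr_gt0.
  (* Seen through [p t], the filter already converges to [g]: closeness at the finitely many points
     [zs] suffices. The bound on [f - h] does not depend on [t], which is what makes the final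
     estimate uniform. *)
  have Fz : F [set h : fspace | \sum_(z <- zs) cn (h z - g z) <= q * n].
    rewrite /n; elim: (zs) => [|z r ih].
      by apply: filterS filterT => h _ /=; rewrite big_nil mulr0.
    apply: filterS (filterI (gE z _ q0) ih) => h [/= h1 h2].
    by rewrite big_cons -[X in X%:R]addn1 natrD addrC mulrDr mulr1 lerD.
  have [h [Sh hz]] := filter_ex (filterI FS Fz).
  have -> : (fun z => f z - g z) = (fun z => (f - h) z + (h z - g z)).
    by apply/funext => z; rewrite fvalB addrA subrK.
  apply: le_trans (fs_pD _ _ _) _; apply: lerD.
    by apply: le_trans (p_le_nrm _ _) _; exact: hS.
  apply: le_trans (hK _) _; apply: le_trans (ler_wpM2l K0 hz) _.
  rewrite mulrCA; apply: (@le_trans _ _ (q * (K * n + 1))).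
    by apply: ler_wpM2l; [exact: ltW|rewrite lerDl].
  by rewrite /q divfK// gt_eqF.
have gmem : fs_mem g.
  move=> e e0; have e2 : 0 < e / 2 by rewrite divr_gt0.
  have [S FS hS] := gF _ e2; have [f Sf] := filter_ex FS.
  have [y Py fy] := fvalP f e2; exists y => // t.
  have -> : (fun z => g z - y z) = (fun z => - (f z - g z) + (f z - y z)).
    by apply/funext => z; rewrite opprB subrKA.
  by apply: le_trans (fs_pD _ _ _) _; rewrite pN [leRHS]splitr lerD ?hS.
apply/cvg_ex; exists (FSpace gmem); apply/cvgrPdist_lt => e e0.
have eE : e = (complex.Re e)%:C%C by apply/esym/RRe_real/gtr0_real.
have e1 : 0 < complex.Re e by rewrite -ltcR -eE.
have [S FS hS] := gF _ (divr_gt0 e1 (ltr0n _ 2)).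
apply: filterS FS => f Sf; rewrite distrC nrmE eE ltcR.
apply: (@le_lt_trans _ _ (complex.Re e / 2)); last by rewrite ltr_pdivrMr// ltr_pMr// ltr1n.
by apply: nrm_le_p => [|t]; [rewrite ltW// divr_gt0|exact: hS].
Qed.

HB.instance Definition _ := Uniform_isComplete.Build fspace fspace_complete.

End FunctionSpace.

Definition fspace_of (R : realType) (s : fspec R) : completeNormedModType R[i] := fspace s.

(** * Convergent sequences and Neumann series *)

Section Sequences.
Variables (R : realType).

Definition tends (V : normedModType R[i]) (u : nat -> V) (l : V) :=
  forall e : R, 0 < e -> exists N, forall n, (N <= n)%N -> nrm (u n - l) <= e.

Lemma cauchy_tends (V : completeNormedModType R[i]) (u : nat -> V) :
  (forall e : R, 0 < e -> exists N, forall n m, (N <= n)%N -> (N <= m)%N ->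
     nrm (u n - u m) <= e) -> exists l, tends u l.
Proof.
move=> hu; have cu : cvg (u @ \oo)%classic.
  apply: cauchy_cvg; apply/cauchy_ballP => e e0.
  have eE : e = (complex.Re e)%:C%C by apply/esym/RRe_real/gtr0_real.
  have e1 : 0 < complex.Re e by rewrite -ltcR -eE.
  have [N hN] := hu _ (divr_gt0 e1 (ltr0n _ 2)).
  pose S : set V := [set u n | n in [set n | (N <= n)%N]]%classic.
  have FS : (u @ \oo)%classic S by exists N => // n /= Nn; exists n.
  exists (S, S) => //= -[_ _] /= [[n Nn <-] [m Nm <-]].
  rewrite -ball_normE /= nrmE eE ltcR; apply: le_lt_trans (hN _ _ Nn Nm) _.
  by rewrite ltr_pdivrMr// ltr_pMr// ltr1n.
exists (lim (u @ \oo)%classic) => e e0.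
have e0' : 0 < e%:C%C by rewrite ltcR.
have /cvgrPdist_lt/(_ _ e0') [N _ hN] := cu.
exists N => n Nn; have := hN n Nn; rewrite distrC /= nrmE ltcR; exact: ltW.
Qed.

Lemma expr_small (r e : R) : 0 <= r < 1 -> 0 < e -> exists n, r ^+ n <= e.
Proof.
move=> /andP[r0 r1] e0.
have : ((GRing.exp r : nat -> R) @ \oo --> (0 : R))%classic by apply: cvg_expr; rewrite ger0_norm.
move=> /cvgrPdist_lt/(_ _ e0) [N _ hN]; exists N.
have := hN N (leqnn _); rewrite /= sub0r normrN ger0_norm ?exprn_ge0//; exact: ltW.
Qed.

End Sequences.

(* A complete submultiplicative norm on a ring, with real values; used for
   Banach algebras and for matrices over them. *)
Record rnorm (R : realType) (B : pzRingType) := RNorm {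
  rn :> B -> R;
  rn_ge0 : forall x, 0 <= rn x;
  rn0 : rn 0 = 0;
  rnD : forall x y, rn (x + y) <= rn x + rn y;
  rnN : forall x, rn (- x) = rn x;
  rnM : forall x y, rn (x * y) <= rn x * rn y;
  rn_eq0 : forall x, rn x = 0 -> x = 0;
  rn_complete : forall u : nat -> B,
    (forall e : R, 0 < e -> exists N, forall n m, (N <= n)%N -> (N <= m)%N ->
      rn (u n - u m) <= e) ->
    exists l, forall e : R, 0 < e -> exists N, forall n, (N <= n)%N ->
      rn (u n - l) <= e }.

Section RNorm.
Variables (R : realType) (B : pzRingType) (N : rnorm R B).
Implicit Types x y : B.

Definition rtends (u : nat -> B) (l : B) :=
  forall e : R, 0 < e -> exists k, forall n, (k <= n)%N -> N (u n - l) <= e.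

Lemma rnB x y : N (x - y) = N (y - x).
Proof. by rewrite -rnN opprB. Qed.

Lemma rn_tri x y z : N (x - z) <= N (x - y) + N (y - z).
Proof. by rewrite -[x - z](subrKA y) rnD. Qed.

Lemma rn_small x : (forall e : R, 0 < e -> N x <= e) -> x = 0.
Proof.
move=> h; apply: (@rn_eq0 _ _ N); apply/eqP; rewrite eq_le rn_ge0 andbT.
by apply/ler_addgt0Pr => e e0; rewrite add0r h.
Qed.

(** The factor [N 1] covers exponent 0: in the entry-sum norm on matrices the identity may have norm
    above 1. *)
Lemma rnX x n : N (x ^+ n) <= N 1 * N x ^+ n.
Proof.
elim: n => [|n ih]; first by rewrite !expr0 mulr1.
rewrite !exprSr mulrA; apply: le_trans (rnM _ _ _) _.
by rewrite ler_wpM2r ?rn_ge0.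
Qed.

Lemma rn_geometric (u : nat -> B) (K r : R) : 0 <= r < 1 -> 0 <= K ->
  (forall n, N (u n.+1 - u n) <= K * r ^+ n) -> exists l, rtends u l.
Proof.
move=> /andP[r0 r1] K0 hu.
have r1' : 0 < 1 - r by rewrite subr_gt0.
have h n k : N (u (n + k)%N - u n) <= K * r ^+ n * ((1 - r ^+ k) / (1 - r)).
  elim: k => [|k ih]; first by rewrite addn0 subrr rn0 expr0 subrr mul0r mulr0.
  apply: le_trans (rn_tri _ (u (n + k)%N) _) _; rewrite addnS.
  apply: le_trans (lerD (hu _) ih) _; rewrite exprD mulrA -mulrDr.
  rewrite ler_wpM2l ?mulr_ge0 ?exprn_ge0//.
  have -> : r ^+ k + (1 - r ^+ k) / (1 - r) = (1 - r ^+ k.+1) / (1 - r).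
    by rewrite exprS; field; rewrite gt_eqF.
  by [].
have h' n k : (n <= k)%N -> N (u k - u n) <= K / (1 - r) * r ^+ n.
  move=> nk; rewrite -(subnKC nk); apply: le_trans (h _ _) _.
  rewrite -mulrA [leRHS]mulrAC -mulrA ler_wpM2l// ler_wpM2l ?exprn_ge0//.
  by rewrite ler_pdivrMr// mulVf ?gt_eqF// gerBl exprn_ge0.
apply: (@rn_complete _ _ N) => e e0.
have q0 : 0 < K / (1 - r) + 1 by rewrite ltr_wpDl// divr_ge0// ltW.
have rr : 0 <= r < 1 by rewrite r0.
have [n0 hn0] := expr_small rr (divr_gt0 (divr_gt0 e0 (ltr0n _ 2)) q0).
have h2 m : (n0 <= m)%N -> N (u m - u n0) <= e / 2.
  move=> /h' /le_trans; apply.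
  apply: (@le_trans _ _ ((K / (1 - r) + 1) * (e / 2 / (K / (1 - r) + 1)))).
    by apply: ler_pM => //; rewrite ?exprn_ge0 ?lerDl// divr_ge0// ltW.
  by rewrite mulrC divfK// gt_eqF.
exists n0 => n m /h2 n1 /h2 m1; apply: le_trans (rn_tri _ (u n0) _) _.
by rewrite [leRHS]splitr lerD// rnB.
Qed.

Lemma rtendsMl (u : nat -> B) l x : rtends u l -> rtends (fun n => x * u n) (x * l).
Proof.
move=> ul e e0; have q0 : 0 < N x + 1 by rewrite ltr_wpDl// rn_ge0.
have [k hk] := ul _ (divr_gt0 e0 q0); exists k => n /hk h.
rewrite -mulrBr; apply: le_trans (rnM _ _ _) _.
apply: (@le_trans _ _ ((N x + 1) * (e / (N x + 1)))).
  by apply: ler_pM; rewrite ?rn_ge0 ?lerDl.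
by rewrite mulrC divfK// gt_eqF.
Qed.

Lemma rtendsMr (u : nat -> B) l x : rtends u l -> rtends (fun n => u n * x) (l * x).
Proof.
move=> ul e e0; have q0 : 0 < N x + 1 by rewrite ltr_wpDl// rn_ge0.
have [k hk] := ul _ (divr_gt0 e0 q0); exists k => n /hk h.
rewrite -mulrBl; apply: le_trans (rnM _ _ _) _.
apply: (@le_trans _ _ (e / (N x + 1) * (N x + 1))).
  by apply: ler_pM; rewrite ?rn_ge0 ?lerDl.
by rewrite divfK// gt_eqF.
Qed.

Lemma rtendsD (u v : nat -> B) l m : rtends u l -> rtends v m ->
  rtends (fun n => u n + v n) (l + m).
Proof.
move=> ul vm e e0; have e2 : 0 < e / 2 by rewrite divr_gt0.
have [k hk] := ul _ e2; have [j hj] := vm _ e2; exists (maxn k j) => n.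
rewrite geq_max => /andP[/hk h1 /hj h2].
by rewrite opprD addrACA [leRHS]splitr (le_trans (rnD _ _ _))// lerD.
Qed.

Lemma rtendsN (u : nat -> B) l : rtends u l -> rtends (fun n => - u n) (- l).
Proof. by move=> ul e /ul[k hk]; exists k => n /hk; rewrite -opprD rnN. Qed.

Lemma rtends_cst x : rtends (fun=> x) x.
Proof. by move=> e e0; exists 0%N => n _; rewrite subrr rn0 ltW. Qed.

Lemma rtends_uniq (u : nat -> B) l m : rtends u l -> rtends u m -> l = m.
Proof.
move=> ul um; apply/eqP; rewrite -subr_eq0; apply/eqP/rn_small => e e0.
have e2 : 0 < e / 2 by rewrite divr_gt0.
have [k hk] := ul _ e2; have [j hj] := um _ e2.
apply: le_trans (rn_tri _ (u (maxn k j)) _) _; rewrite [leRHS]splitr lerD//.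
  by rewrite rnB hk// leq_maxl.
by rewrite hj// leq_maxr.
Qed.

Lemma rtends_ext (u v : nat -> B) l : u =1 v -> rtends u l -> rtends v l.
Proof. by move=> /funext ->. Qed.

Lemma rtends_shift (u : nat -> B) l : rtends u l -> rtends (fun n => u n.+1) l.
Proof. by move=> ul e /ul[k hk]; exists k => n kn; apply: hk; exact: leqW. Qed.

Definition rinvertible x := exists y, x * y = 1 /\ y * x = 1.

Lemma rinvertibleM x y : rinvertible x -> rinvertible y -> rinvertible (x * y).
Proof.
move=> [x' [xx' x'x]] [y' [yy' y'y]]; exists (y' * x'); split.
  by rewrite mulrA -(mulrA x) yy' mulr1.
by rewrite mulrA -(mulrA y') x'x mulr1.
Qed.

Lemma neumann x : N x < 1 -> rinvertible (1 - x).
Proof.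
move=> x1; pose u n := \sum_(k < n) x ^+ k.
have rr : 0 <= N x < 1 by rewrite rn_ge0.
have [|l ul] := rn_geometric (u := u) rr (rn_ge0 N 1).
  by move=> n; rewrite /u big_ord_recr /= addrAC subrr add0r rnX.
have u1 n : u n.+1 = 1 + x * u n.
  rewrite /u big_ord_recl expr0 mulr_sumr; congr (_ + _); apply: eq_bigr => i _.
  by rewrite /= /bump /= exprS.
have u2 n : u n.+1 = 1 + u n * x.
  rewrite /u big_ord_recl expr0 mulr_suml; congr (_ + _); apply: eq_bigr => i _.
  by rewrite /= /bump /= exprSr.
have l1 : l = 1 + x * l.
  apply: rtends_uniq (rtends_shift ul) _; apply: rtends_ext (fun n => esym (u1 n)) _.
  exact: rtendsD (rtends_cst 1) (rtendsMl x ul).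
have l2 : l = 1 + l * x.
  apply: rtends_uniq (rtends_shift ul) _; apply: rtends_ext (fun n => esym (u2 n)) _.
  exact: rtendsD (rtends_cst 1) (rtendsMr x ul).
exists l; split; first by rewrite mulrBl mul1r {1}l1 addrK.
by rewrite mulrBr mulr1 {1}l2 addrK.
Qed.

Lemma rinvertible_near x : rinvertible x ->
  exists2 e : R, 0 < e & forall y, N (y - x) < e -> rinvertible y.
Proof.
move=> [x' [xx' x'x]]; have q0 : 0 < N x' + 1 by rewrite ltr_wpDl// rn_ge0.
exists (N x' + 1)^-1; first by rewrite invr_gt0.
move=> y hy; have -> : y = x * (1 - x' * (x - y)).
  by rewrite (mulrBr x) mulr1 mulrA xx' mul1r opprB addrC subrK.
apply: rinvertibleM; first by exists x'.
apply: neumann; apply: le_lt_trans (rnM _ _ _) _; rewrite rnB.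
apply: (@le_lt_trans _ _ ((N x' + 1) * N (y - x))).
  by rewrite ler_wpM2r ?rn_ge0// lerDl.
by rewrite mulrC -ltr_pdivlMr// div1r.
Qed.

End RNorm.

(** * Norms on Banach algebras and on their matrix algebras *)

Section BanachAlgebraNorm.
Variables (R : realType) (A : banachAlgType R[i]).

Lemma nrmM (x y : A) : nrm (x * y) <= nrm x * nrm y.
Proof. by rewrite -lecR rmorphM /= -!nrmE; exact: banach_normrM. Qed.

Lemma banach_complete (u : nat -> A) :
  (forall e : R, 0 < e -> exists N, forall n m, (N <= n)%N -> (N <= m)%N ->
     nrm (u n - u m) <= e) ->
  exists l, forall e : R, 0 < e -> exists N, forall n, (N <= n)%N -> nrm (u n - l) <= e.
Proof. exact: cauchy_tends. Qed.

Definition banach_rnorm : rnorm R A :=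
  @RNorm R A (@nrm R A) (@nrm_ge0 R A) (@nrm0 R A) (@nrmD R A) (@nrmN R A) nrmM
    (@nrm_eq0 R A) banach_complete.

Variable k : nat.

(** A crude norm, but it is submultiplicative and complete, and it induces the entrywise topology
    used for paths. *)
Definition mxnrm (M : 'M[A]_k) : R := \sum_i \sum_j nrm (M i j).

Lemma mxnrm_ge0 M : 0 <= mxnrm M.
Proof. by apply: sumr_ge0 => i _; apply: sumr_ge0 => j _; exact: nrm_ge0. Qed.

Lemma mxnrm0 : mxnrm 0 = 0.
Proof. by apply: big1 => i _; apply: big1 => j _; rewrite mxE nrm0. Qed.

Lemma mxnrmD M M' : mxnrm (M + M') <= mxnrm M + mxnrm M'.
Proof.
rewrite /mxnrm -big_split; apply: ler_sum => i _; rewrite -big_split.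
by apply: ler_sum => j _; rewrite mxE nrmD.
Qed.

Lemma mxnrmN M : mxnrm (- M) = mxnrm M.
Proof. by apply: eq_bigr => i _; apply: eq_bigr => j _; rewrite mxE nrmN. Qed.

Lemma nrm_le_mxnrm (M : 'M[A]_k) i j : nrm (M i j) <= mxnrm M.
Proof.
rewrite /mxnrm (bigD1 i)//= (bigD1 j)//= -addrA lerDl addr_ge0//.
  by apply: sumr_ge0 => l _; exact: nrm_ge0.
by apply: sumr_ge0 => l _; apply: sumr_ge0 => l' _; exact: nrm_ge0.
Qed.

Lemma mxnrmM (M M' : 'M[A]_k) : mxnrm (M *m M') <= mxnrm M * mxnrm M'.
Proof.
rewrite /mxnrm [leRHS]mulr_suml; apply: ler_sum => i _.
apply: (@le_trans _ _ (\sum_j \sum_l nrm (M i l) * nrm (M' l j))).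
  apply: ler_sum => j _; rewrite mxE; apply: le_trans (nrm_sum _ _ _) _.
  by apply: ler_sum => l _; exact: nrmM.
rewrite exchange_big /= mulr_suml; apply: ler_sum => l _.
rewrite -mulr_sumr ler_wpM2l ?nrm_ge0//.
rewrite [leRHS](bigD1 l)//= lerDl.
by apply: sumr_ge0 => i' _; apply: sumr_ge0 => j' _; exact: nrm_ge0.
Qed.

Lemma mxnrm_eq0 M : mxnrm M = 0 -> M = 0.
Proof.
move=> M0; apply/matrixP => i j; rewrite mxE; apply: nrm_eq0; apply/eqP.
by rewrite eq_le nrm_ge0 andbT -M0 nrm_le_mxnrm.
Qed.

Lemma mxnrm_le (M : 'M[A]_k) (e : R) : (forall i j, nrm (M i j) <= e) ->
  mxnrm M <= (k * k)%:R * e.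
Proof.
move=> h; apply: (@le_trans _ _ (\sum_(i < k) \sum_(j < k) e)).
  by apply: ler_sum => i _; apply: ler_sum => j _; exact: h.
by rewrite !sumr_const !card_ord -mulrnA mulr_natl.
Qed.

Lemma mx_complete (u : nat -> 'M[A]_k) :
  (forall e : R, 0 < e -> exists N, forall n m, (N <= n)%N -> (N <= m)%N ->
     mxnrm (u n - u m) <= e) ->
  exists l, forall e : R, 0 < e -> exists N, forall n, (N <= n)%N -> mxnrm (u n - l) <= e.
Proof.
move=> hu.
have /choice[l hl] (ij : 'I_k * 'I_k) : exists l, tends (fun n => u n ij.1 ij.2) l.
  apply: cauchy_tends => e /hu[N hN]; exists N => n m nN mN.
  by apply: le_trans (hN _ _ nN mN); have := nrm_le_mxnrm (u n - u m) ij.1 ij.2; rewrite !mxE.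
exists (\matrix_(i, j) l (i, j)) => e e0.
have q0 : 0 < (k * k)%:R + 1 :> R by rewrite ltr_wpDl// ler0n.
have /choice[f hf] (ij : 'I_k * 'I_k) := hl ij _ (divr_gt0 e0 q0).
exists (\max_ij f ij) => n hn.
apply: (@le_trans _ _ ((k * k)%:R * (e / ((k * k)%:R + 1)))).
  apply: mxnrm_le => i j; rewrite !mxE; apply: (hf (i, j)).
  by apply: leq_trans hn; exact: (leq_bigmax (i, j)).
rewrite mulrCA ler_piMr//; first exact: ltW.
by rewrite ler_pdivrMr// mul1r lerDl.
Qed.

Definition mx_rnorm : rnorm R 'M[A]_k :=
  @RNorm R 'M[A]_k mxnrm mxnrm_ge0 mxnrm0 mxnrmD mxnrmN mxnrmM mxnrm_eq0 mx_complete.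

Lemma invertible_mx_near (U : 'M[A]_k) : invertible_mx U ->
  exists2 e : R, 0 < e & forall V, mxnrm (V - U) < e -> invertible_mx V.
Proof. exact: (@rinvertible_near R 'M[A]_k mx_rnorm U). Qed.

End BanachAlgebraNorm.

Section RectangularInverse.
Variable A : pzRingType.

(** If $V$ inverts $1+RT$, then $1-TVR$ inverts $1+TR$. *)
Lemma invertible_mx1DC k l (R : 'M[A]_(k, l)) (T : 'M[A]_(l, k)) :
  invertible_mx (1%:M + R *m T) -> invertible_mx (1%:M + T *m R).
Proof.
move=> [V [h1 h2]]; exists (1%:M - T *m V *m R); split.
  rewrite mulmxDl mul1mx mulmxBr mulmx1.
  have -> : T *m R *m (T *m V *m R) = T *m ((1%:M + R *m T) *m V) *m R - T *m V *m R.
    by rewrite mulmxDl mul1mx mulmxDr mulmxDl addrAC subrr add0r !mulmxA.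
  by rewrite h1 mulmx1 opprB [X in _ + X]addrC !subrK.
rewrite mulmxBl mul1mx mulmxDr mulmx1.
have -> : T *m V *m R *m (T *m R) = T *m (V *m (1%:M + R *m T)) *m R - T *m V *m R.
  by rewrite mulmxDr mulmx1 mulmxDr mulmxDl addrAC subrr add0r !mulmxA.
by rewrite h2 mulmx1 [_ + (_ - _)]addrC subrK addrK.
Qed.

End RectangularInverse.

(** * Stable paths of invertible matrices and the K1 swindle *)

Section K1Paths.
Variables (R : realType) (A : banachAlgType R[i]).

(* diag(1 + ST, 1) and diag(1, 1 + TS) differ by elementary factors. *)
Lemma stab_path_1DC k l (S : 'M[A]_(k, l)) (T : 'M[A]_(l, k)) :
  invertible_mx (1%:M + S *m T) -> stab_path (1%:M + S *m T) (1%:M + T *m S).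
Proof.
move=> iST; have iTS := invertible_mx1DC iST.
have i1 q := invertible_mx1 A q.
set D1 := block_mx (1%:M + S *m T) 0 0 (1%:M : 'M[A]_l).
set D2 := block_mx (1%:M : 'M[A]_k) 0 0 (1%:M + T *m S).
have iD1 : invertible_mx D1 by exact: invertible_mx_diag.
have iD2 : invertible_mx D2 by exact: invertible_mx_diag.
have eqD : block_mx 1%:M S 0 1%:M *m D1 *m block_mx 1%:M 0 (- T) 1%:M =
           block_mx 1%:M 0 (- T) 1%:M *m D2 *m block_mx 1%:M S 0 1%:M.
  rewrite /D1 /D2 !mulmx_block.
  rewrite !(mul0mx, mulmx0, mul1mx, mulmx1, addr0, add0r, mulNmx, mulmxN).
  by congr block_mx; [rewrite addrK|rewrite addrCA addNr addr0].
have p1 := inv_pathM (inv_pathM (inv_path_upper S) (inv_path_refl iD1))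
  (inv_path_lower (- T)).
have p2 := inv_pathM (inv_pathM (inv_path_lower (- T)) (inv_path_refl iD2))
  (inv_path_upper S).
rewrite !mul1mx !mulmx1 in p1 p2; rewrite eqD in p1.
have p := inv_path_trans p1 (inv_path_sym p2).
apply: stab_path_trans (stab_path_diag1 l iST) _.
apply: stab_path_trans (stab_pathE p) _.
apply: stab_path_trans (stab_path_diagC (i1 k) iTS) _.
exact/stab_path_sym/stab_path_diag1.
Qed.

(** The straight segment from [U] to [V] stays in a ball of invertible matrices. *)
Lemma inv_path_near k (U : 'M[A]_k) : invertible_mx U ->
  exists2 e : R, 0 < e & forall V, mxnrm (V - U) < e -> inv_path U V.
Proof.
move=> iU; have [e e0 he] := invertible_mx_near iU; exists e => // V hV.
pose g (t : R) : 'M[A]_k := U + \matrix_(i, j) (t%:C%C *: (V - U) i j).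
exists g; split.
- apply: continuous_subspaceT; apply/continuous_mxP => i j.
  under eq_fun do rewrite !mxE.
  move=> t; apply: cvgD; first exact: cvg_cst.
  exact: continuous_scale_line.
- move=> t /andP[t0 t1]; apply: he; rewrite /g addrAC subrr add0r.
  apply: le_lt_trans hV; apply: ler_sum => i _; apply: ler_sum => j _.
  by rewrite mxE nrmZ cn_real ger0_norm// ler_piMl ?nrm_ge0.
- rewrite /g; apply/matrixP => i j; rewrite !mxE scale0r addr0 //.
- by rewrite /g; apply/matrixP => i j; rewrite !mxE scale1r addrC subrK.
Qed.

Definition k1triv k (U : 'M[A]_k) := stab_path U (1%:M : 'M[A]_1).

Lemma stab_path_11 k : stab_path (1%:M : 'M[A]_k) (1%:M : 'M[A]_1).
Proof.
apply: (@stab_pathI _ _ _ _ k.+1) => //; rewrite !pad_mx1//.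
exact/inv_path_refl/invertible_mx1.
Qed.

Definition k1c (U : inv_mx A) : K1 A := \pi_(K1 A) U.

Lemma k1trivP k (k0 : (0 < k)%N) (U : 'M[A]_k) (iU : invertible_mx U) :
  k1triv U <-> k1c (InvMx k0 iU) = 0.
Proof. exact: (@K1_piP _ _ (InvMx k0 iU) (inv_one A)). Qed.

Lemma k1triv1 k : k1triv (1%:M : 'M[A]_k). Proof. exact: stab_path_11. Qed.

Lemma k1_addE (U V : inv_mx A) :
  k1c U + k1c V = k1c (inv_diag U V).
Proof. exact: K1_addE. Qed.

(** Whitehead: $\mathrm{diag}(V,1)$ is joined to $\mathrm{diag}(1,V)$ by a path, so
    $\mathrm{diag}(UV,1)$ is joined to $\mathrm{diag}(U,V)$. *)
Lemma k1_mul k (k0 : (0 < k)%N) (U V : 'M[A]_k) (iU : invertible_mx U)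
    (iV : invertible_mx V) (iUV : invertible_mx (U *m V)) :
  k1c (InvMx k0 iUV) = k1c (InvMx k0 iU) + k1c (InvMx k0 iV).
Proof.
rewrite k1_addE; apply/K1_piP => /=.
apply: stab_path_trans (stab_path_diag1 k iUV) _.
have i1 := invertible_mx1 A k.
have -> : block_mx (U *m V) 0 0 (1%:M : 'M[A]_k) =
    block_mx U 0 0 1%:M *m block_mx V 0 0 1%:M.
  by rewrite mulmx_block !(mul0mx, mulmx0, mul1mx, addr0, add0r).
have -> : block_mx U 0 0 V = block_mx U 0 0 1%:M *m block_mx 1%:M 0 0 V.
  by rewrite mulmx_block !(mul0mx, mulmx0, mul1mx, mulmx1, addr0, add0r).
apply: stab_pathE; apply: inv_pathM.
  by apply: inv_path_refl; exact: invertible_mx_diag.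
have [V' [VV' V'V]] := iV.
have w := inv_path_whitehead VV' V'V.
have iV' : invertible_mx V' by exists V.
have := inv_pathM (inv_path_refl (invertible_mx_diag i1 iV)) w.
rewrite mulmx1 mulmx_block !(mul0mx, mulmx0, mul1mx, addr0, add0r) VV'.
exact: inv_path_sym.
Qed.

Lemma k1triv_mul k (k0 : (0 < k)%N) (U V : 'M[A]_k) : invertible_mx U ->
  invertible_mx V -> k1triv U -> k1triv V -> k1triv (U *m V).
Proof.
move=> iU iV /(k1trivP k0 iU) tU /(k1trivP k0 iV) tV.
by apply/(k1trivP k0 (invertible_mxM iU iV)); rewrite (k1_mul k0 iU iV) tU tV addr0.
Qed.

(* ty is an infinite repetition of y. *)
Lemma k1_swindle l (y ty : 'M[A]_l) (s0 t0 s1 t1 : A) : (0 < l)%N ->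
  ty = s0%:M *m y *m t0%:M + s1%:M *m ty *m t1%:M ->
  t0%:M *m (s0%:M *m y) = y -> t0%:M *m (s1%:M *m ty) = 0 ->
  t1%:M *m (s0%:M *m y) = 0 -> t1%:M *m (s1%:M *m ty) = ty ->
  invertible_mx (1%:M + y) -> invertible_mx (1%:M + ty) -> k1triv (1%:M + y).
Proof.
move=> l0 tyE h00 h01 h10 h11 iy ity.
pose S := row_mx (s0%:M *m y) (s1%:M *m ty).
pose T : 'M[A]_(l + l, l) := col_mx t0%:M t1%:M.
have ST : S *m T = ty by rewrite mul_row_col -tyE.
have TS : 1%:M + T *m S = block_mx (1%:M + y) 0 0 (1%:M + ty).
  rewrite mul_col_row h00 h01 h10 h11 scalar_mx_block add_block_mx.
  by rewrite !addr0.
have iST : invertible_mx (1%:M + S *m T) by rewrite ST.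
have := stab_path_1DC iST; rewrite TS ST => p.
apply/(k1trivP l0 iy).
(* The matrix $1+TS$ is $\mathrm{diag}(1+y,1+ty)$ and $1+ST$ is $1+ty$; cancelling the class of
   $1+ty$ leaves zero for $1+y$. *)
have : k1c (InvMx l0 ity) =
    k1c (InvMx l0 iy) + k1c (InvMx l0 ity).
  by rewrite k1_addE; apply/K1_piP.
by rewrite -[LHS]add0r => /addIr.
Qed.

End K1Paths.

(** * K0 classes of idempotents and the K0 swindle *)

Section K0Classes.
Variable A : pzRingType.

Definition v0c (P : idem_mx A) : V0 A := \pi_(V0 A) P.

Definition kc (P : idem_mx A) : K0 A := \pi_(groth (V0 A)) (v0c P, 0).

Lemma kc_sim (P Q : idem_mx A) : sim0 P Q -> kc P = kc Q.
Proof. by move=> h; rewrite /kc; congr (\pi_(groth (V0 A)) (_, _)); apply/eqmodP. Qed.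

Lemma kcD P Q : kc P + kc Q = kc (idem_diag P Q).
Proof.
rewrite /kc [LHS](groth_addE (v0c P, 0) (v0c Q, 0)); congr (\pi_(groth (V0 A)) (_, _)).
  exact: V0_addE.
by rewrite /= addr0.
Qed.

Lemma kc_zero k (k0 : (0 < k)%N) (z : (0 : 'M[A]_k) *m 0 = 0) : kc (IdemMx k0 z) = 0.
Proof.
rewrite /kc; apply/groth_piP; exists 0; rewrite /= !addr0.
apply/(@V0_piP A (IdemMx k0 z) (idem_zero A)); exists 0, 0.
by rewrite !mulmx0.
Qed.

Lemma groth_diff (u : K0 A) : exists P Q, u = kc P - kc Q.
Proof.
have [[a b] ->] := groth_surj u; have [P ->] := V0_surj a; have [Q ->] := V0_surj b.
exists P, Q; rewrite /kc [X in _ = _ + X](groth_oppE (v0c Q, 0)).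
rewrite [RHS](groth_addE (v0c P, 0) (0, v0c Q)).
by congr (\pi_(groth (V0 A)) (_, _)); rewrite /= ?addr0 ?add0r.
Qed.

Lemma kc_orth k (k0 : (0 < k)%N) (P Q : 'M[A]_k) (hP : P *m P = P) (hQ : Q *m Q = Q)
    (hPQ : (P + Q) *m (P + Q) = P + Q) : P *m Q = 0 -> Q *m P = 0 ->
  kc (IdemMx k0 hPQ) = kc (IdemMx k0 hP) + kc (IdemMx k0 hQ).
Proof.
move=> PQ QP; rewrite kcD; apply: kc_sim; apply/asboolP => /=.
exists (row_mx P Q), (col_mx P Q); rewrite mul_row_col mul_col_row hP hQ PQ QP; split=> //.
Qed.

(** Eilenberg's swindle: the infinite repetition [tf] of [f] is equivalent to $\mathrm{diag}(f,tf)$,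
    and its class cancels in the Grothendieck group. *)
Lemma kc_swindle l (l0 : (0 < l)%N) (f tf : 'M[A]_l) (s0 t0 s1 t1 : A)
    (hf : f *m f = f) :
  tf *m tf = tf ->
  tf = s0%:M *m f *m t0%:M + s1%:M *m tf *m t1%:M ->
  t0%:M *m (s0%:M *m f) = f -> t0%:M *m (s1%:M *m tf) = 0 ->
  t1%:M *m (s0%:M *m f) = 0 -> t1%:M *m (s1%:M *m tf) = tf ->
  kc (IdemMx l0 hf) = 0.
Proof.
move=> htf tfE h00 h01 h10 h11.
have : kc (IdemMx l0 htf) = kc (IdemMx l0 hf) + kc (IdemMx l0 htf).
  rewrite kcD; apply: kc_sim; apply/asboolP => /=.
  exists (row_mx (s0%:M *m f) (s1%:M *m tf)), (col_mx (f *m t0%:M) (tf *m t1%:M)).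
  rewrite mul_row_col mul_col_row; split.
    by rewrite !mulmxA -(mulmxA _ f f) hf -(mulmxA _ tf tf) htf.
  rewrite -!mulmxA h00 h01 h10 h11 !mulmx0 hf htf; reflexivity.
by rewrite -[LHS]add0r => /addIr.
Qed.

End K0Classes.

(** * The closed ideal of an idempotent with a swindle has no K-theory *)

Section IdealClosure.
Variables (R : realType) (A : banachAlgType R[i]) (e : A).
Hypothesis ee : e * e = e.

(* The closed two-sided ideal generated by e. *)
Definition cideal (x : A) := forall d : R, 0 < d ->
  exists n (u v : 'I_n -> A), nrm (x - \sum_i u i * e * v i) <= d.

Lemma cideal0 : cideal 0.
Proof.
move=> d d0; exists 0%N, (fun=> 0), (fun=> 0).
by rewrite big_ord0 subr0 nrm0 ltW.
Qed.

Lemma cidealM u v : cideal (u * e * v).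
Proof.
move=> d d0; exists 1%N, (fun=> u), (fun=> v).
by rewrite big_ord1 subrr nrm0 ltW.
Qed.

Lemma cidealD x y : cideal x -> cideal y -> cideal (x + y).
Proof.
move=> hx hy d d0; have d2 : 0 < d / 2 by rewrite divr_gt0.
have [n [u [v hn]]] := hx _ d2; have [m [u' [v' hm]]] := hy _ d2.
exists (n + m)%N, (fun i => match fintype.split i with inl a => u a | inr b => u' b end),
  (fun i => match fintype.split i with inl a => v a | inr b => v' b end).
rewrite big_split_ord /=.
under eq_bigr do rewrite (unsplitK (inl _)).
under [X in _ - (_ + X)]eq_bigr do rewrite (unsplitK (inr _)).
by rewrite opprD addrACA [leRHS]splitr (le_trans (nrmD _ _))// lerD.
Qed.

Lemma cidealMl a x : cideal x -> cideal (a * x).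
Proof.
move=> hx d d0; have q0 : 0 < nrm a + 1 by rewrite ltr_wpDl// nrm_ge0.
have [n [u [v hn]]] := hx _ (divr_gt0 d0 q0).
exists n, (fun i => a * u i), v.
under eq_bigr do rewrite -!mulrA; rewrite -mulr_sumr -mulrBr.
under eq_bigr do rewrite mulrA.
apply: le_trans (nrmM _ _) _.
apply: (@le_trans _ _ ((nrm a + 1) * (d / (nrm a + 1)))).
  by apply: ler_pM; rewrite ?nrm_ge0 ?lerDl.
by rewrite mulrC divfK// gt_eqF.
Qed.

Lemma cidealMr a x : cideal x -> cideal (x * a).
Proof.
move=> hx d d0; have q0 : 0 < nrm a + 1 by rewrite ltr_wpDl// nrm_ge0.
have [n [u [v hn]]] := hx _ (divr_gt0 d0 q0).
exists n, u, (fun i => v i * a).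
under eq_bigr do rewrite mulrA; rewrite -mulr_suml -mulrBl.
apply: le_trans (nrmM _ _) _.
apply: (@le_trans _ _ (d / (nrm a + 1) * (nrm a + 1))).
  by apply: ler_pM; rewrite ?nrm_ge0 ?lerDl.
by rewrite divfK// gt_eqF.
Qed.

Lemma cidealN x : cideal x -> cideal (- x).
Proof. by rewrite -mulN1r; exact: cidealMl. Qed.

Lemma cidealB x y : cideal x -> cideal y -> cideal (x - y).
Proof. by move=> hx /cidealN; exact: cidealD. Qed.

Lemma cideal_sum (I : Type) (r : seq I) (Q : pred I) (F : I -> A) :
  (forall i, Q i -> cideal (F i)) -> cideal (\sum_(i <- r | Q i) F i).
Proof. by move=> hF; apply: big_ind => //; [exact: cideal0|exact: cidealD]. Qed.

Lemma cideal_closed x : (forall d : R, 0 < d -> exists2 y, cideal y & nrm (x - y) <= d) ->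
  cideal x.
Proof.
move=> hx d d0; have d2 : 0 < d / 2 by rewrite divr_gt0.
have [y /(_ _ d2)[n [u [v hn]]] xy] := hx _ d2; exists n, u, v.
by rewrite [leRHS]splitr (le_trans (nrm_tri _ y _))// lerD.
Qed.

Definition mx_cideal m n (M : 'M[A]_(m, n)) := forall i j, cideal (M i j).

Lemma mx_cidealMl m n p (M : 'M[A]_(m, n)) (N : 'M[A]_(n, p)) :
  mx_cideal N -> mx_cideal (M *m N).
Proof. by move=> hN i j; rewrite mxE; apply: cideal_sum => k _; exact: cidealMl. Qed.

Lemma mx_cidealMr m n p (M : 'M[A]_(m, n)) (N : 'M[A]_(n, p)) :
  mx_cideal M -> mx_cideal (M *m N).
Proof. by move=> hM i j; rewrite mxE; apply: cideal_sum => k _; exact: cidealMr. Qed.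

Lemma mx_cidealD m n (M N : 'M[A]_(m, n)) :
  mx_cideal M -> mx_cideal N -> mx_cideal (M + N).
Proof. by move=> hM hN i j; rewrite mxE; exact: cidealD. Qed.

Lemma mx_cidealN m n (M : 'M[A]_(m, n)) : mx_cideal M -> mx_cideal (- M).
Proof. by move=> hM i j; rewrite mxE; exact: cidealN. Qed.

Lemma mx_cidealB m n (M N : 'M[A]_(m, n)) :
  mx_cideal M -> mx_cideal N -> mx_cideal (M - N).
Proof. by move=> hM hN; apply: mx_cidealD => //; exact: mx_cidealN. Qed.

Lemma mx_cideal_e n : mx_cideal (e%:M : 'M[A]_n).
Proof.
move=> i j; rewrite mxE; case: (i == j); last exact: cideal0.
by rewrite mulr1n -[e]mulr1 -[e]mul1r; exact: cidealM.
Qed.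

(** A finite sum of products through [e] becomes one product through [e] of larger size. The inner
    size [l.+1] is positive because it later serves as the dimension of an idempotent. *)
Let factored k (M : 'M[A]_k) := exists l (S : 'M[A]_(k, l.+1)) (T : 'M[A]_(l.+1, k)),
  M = S *m e%:M *m T.

Let factoredD k (M N : 'M[A]_k) : factored M -> factored N -> factored (M + N).
Proof.
move=> [l [S [T ->]]] [l' [S' [T' ->]]].
exists (l + l'.+1)%N, (row_mx S S'), (col_mx T T').
have H a b (S1 : 'M[A]_(k, a)) (S2 : 'M[A]_(k, b)) (T1 : 'M[A]_(a, k)) (T2 : 'M[A]_(b, k)) :
    S1 *m e%:M *m T1 + S2 *m e%:M *m T2 = row_mx S1 S2 *m e%:M *m col_mx T1 T2.
  by rewrite scalar_mx_block mul_row_block !mulmx0 addr0 add0r mul_row_col.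
exact: (H l.+1 l'.+1).
Qed.

Let factored0 k : factored (0 : 'M[A]_k).
Proof. by exists 0%N, 0, 0; rewrite !mul0mx. Qed.

Let factored_sum k (I : Type) (r : seq I) (F : I -> 'M[A]_k) :
  (forall i, factored (F i)) -> factored (\sum_(i <- r) F i).
Proof.
move=> hF; apply: big_ind => [|M N|i _]; [exact: factored0|exact: factoredD|exact: hF].
Qed.

(** Approximate each entry by a finite sum $\sum u_i e v_i$ and collect the factors of all entries
    into one row block and one column block. *)
Lemma mx_cideal_factor k (M : 'M[A]_k) (d : R) : mx_cideal M -> 0 < d ->
  exists l (S : 'M[A]_(k, l.+1)) (T : 'M[A]_(l.+1, k)),
    mxnrm (M - S *m e%:M *m T) <= d.
Proof.
move=> hM d0; have q0 : 0 < (k * k)%:R + 1 :> R by rewrite ltr_wpDl// ler0n.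
have /choice[N hN] (ij : 'I_k * 'I_k) : exists x : A, factored (x *: delta_mx ij.1 ij.2 : 'M[A]_k)
    /\ nrm (M ij.1 ij.2 - x) <= d / ((k * k)%:R + 1).
  have [n [u [v h]]] := hM ij.1 ij.2 _ (divr_gt0 d0 q0).
  exists (\sum_i u i * e * v i); split=> //; rewrite scaler_suml; apply: factored_sum => r.
  exists 0%N, (\col_i ((i == ij.1)%:R * u r)), (\row_j ((j == ij.2)%:R * v r)).
  apply/matrixP => i j; rewrite !mxE big_ord1 !mxE big_ord1 !mxE /= mulr1n.
  by case: (i == _); case: (j == _); rewrite ?(mul0r, mulr0, mul1r, mulr1).
have [l [S [T hST]]] : factored (\sum_ij (N ij *: delta_mx ij.1 ij.2 : 'M[A]_k)).
  by apply: factored_sum => ij; case: (hN ij).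
exists l, S, T; rewrite -hST; apply: le_trans (mxnrm_le (e := d / ((k * k)%:R + 1)) _) _.
  move=> i j; rewrite !mxE summxE (bigD1 (i, j))//= big1 ?addr0 => [|[i' j'] ne].
    by rewrite !mxE !eqxx mulr1; case: (hN (i, j)).
  rewrite !mxE; case: eqP => [ei|_]; case: eqP => [ej|_]; rewrite ?mulr0//.
  by move: ne; rewrite ei ej eqxx.
rewrite mulrCA ler_piMr//; first exact: ltW.
by rewrite ler_pdivrMr// mul1r lerDl.
Qed.

Definition corner (x : A) := e * x = x /\ x * e = x.

Lemma cornerD x y : corner x -> corner y -> corner (x + y).
Proof. by move=> [x1 x2] [y1 y2]; split; rewrite ?mulrDr ?mulrDl ?x1 ?x2 ?y1 ?y2. Qed.

Lemma corner_mx l (M : 'M[A]_l) : e%:M *m M = M -> M *m e%:M = M ->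
  forall i j, corner (M i j).
Proof.
move=> h1 h2 i j; split.
  move/matrixP: h1 => /(_ i j); rewrite mxE (bigD1 i)//= mxE eqxx mulr1n big1 ?addr0//.
  by move=> i' ne; rewrite mxE eq_sym (negbTE ne) mulr0n mul0r.
move/matrixP: h2 => /(_ i j); rewrite mxE (bigD1 j)//= mxE eqxx mulr1n big1 ?addr0//.
by move=> i' ne; rewrite mxE (negbTE ne) mulr0n mulr0.
Qed.

(* sw_rep x is an infinite direct sum of copies of x, and e absorbs it. *)
Record swindle := Swindle {
  sw_rep : A -> A;
  sw_s0 : A; sw_t0 : A; sw_s1 : A; sw_t1 : A;
  sw_D : forall x y, sw_rep (x + y) = sw_rep x + sw_rep y;
  sw_M : forall x y, corner x -> corner y -> sw_rep (x * y) = sw_rep x * sw_rep y;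
  sw_E : forall x, corner x -> sw_rep x = sw_s0 * x * sw_t0 + sw_s1 * sw_rep x * sw_t1;
  sw_00 : forall x, corner x -> sw_t0 * (sw_s0 * x) = x;
  sw_01 : forall x, corner x -> sw_t0 * (sw_s1 * sw_rep x) = 0;
  sw_10 : forall x, corner x -> sw_t1 * (sw_s0 * x) = 0;
  sw_11 : forall x, corner x -> sw_t1 * (sw_s1 * sw_rep x) = sw_rep x }.

Variable sw : swindle.

Let rep_sum (I : Type) (r : seq I) (F : I -> A) :
  sw_rep sw (\sum_(i <- r) F i) = \sum_(i <- r) sw_rep sw (F i).
Proof.
elim: r => [|i r ih]; last by rewrite !big_cons sw_D ih.
rewrite !big_nil; apply: (@addrI _ (sw_rep sw 0)).
by rewrite -sw_D !addr0.
Qed.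

Let mrep l (M : 'M[A]_l) := map_mx (sw_rep sw) M.

Lemma scalmx l (a : A) (M : 'M[A]_l) i j : (a%:M *m M) i j = a * M i j.
Proof.
rewrite mxE (bigD1 i)//= mxE eqxx mulr1n big1 ?addr0// => i' ne.
by rewrite mxE eq_sym (negbTE ne) mulr0n mul0r.
Qed.

Lemma mxscal l (a : A) (M : 'M[A]_l) i j : (M *m a%:M) i j = M i j * a.
Proof.
rewrite mxE (bigD1 j)//= mxE eqxx mulr1n big1 ?addr0// => i' ne.
by rewrite mxE (negbTE ne) mulr0n mulr0.
Qed.

Let mrepM l (M N : 'M[A]_l) : (forall i j, corner (M i j)) ->
  (forall i j, corner (N i j)) -> mrep (M *m N) = mrep M *m mrep N.
Proof.
move=> hM hN; apply/matrixP => i j; rewrite !mxE rep_sum; apply: eq_bigr => k _.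
by rewrite !mxE sw_M.
Qed.

Let mrepD l (M N : 'M[A]_l) : mrep (M + N) = mrep M + mrep N.
Proof. by apply/matrixP => i j; rewrite !mxE sw_D. Qed.

Let mrep0 l : mrep (0 : 'M[A]_l) = 0.
Proof. by apply: (@addrI _ (mrep 0)); rewrite -mrepD !addr0. Qed.

Let swE l (M : 'M[A]_l) : (forall i j, corner (M i j)) ->
  [/\ mrep M = (sw_s0 sw)%:M *m M *m (sw_t0 sw)%:M +
               (sw_s1 sw)%:M *m mrep M *m (sw_t1 sw)%:M,
      (sw_t0 sw)%:M *m ((sw_s0 sw)%:M *m M) = M,
      (sw_t0 sw)%:M *m ((sw_s1 sw)%:M *m mrep M) = 0,
      (sw_t1 sw)%:M *m ((sw_s0 sw)%:M *m M) = 0 &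
      (sw_t1 sw)%:M *m ((sw_s1 sw)%:M *m mrep M) = mrep M].
Proof.
move=> hM; split; apply/matrixP => i j.
- by rewrite [LHS]mxE [RHS]mxE !mxscal !scalmx [mrep M i j]mxE; exact: sw_E.
- by rewrite !scalmx sw_00.
- by rewrite !scalmx !mxE sw_01.
- by rewrite !scalmx mxE sw_10.
- by rewrite !scalmx !mxE sw_11.
Qed.

(** Write the inverse as $1+z$. Then $z=-yV=-Vy$ lies in the corner too, so the repetitions of $1+y$
    and $1+z$ are inverse to each other and [k1_swindle] applies. *)
Lemma k1triv_corner l (y : 'M[A]_l) : (0 < l)%N -> (forall i j, corner (y i j)) ->
  invertible_mx (1%:M + y) -> k1triv (1%:M + y).
Proof.
move=> l0 hy iy; have [V [h1 h2]] := iy; pose z := V - 1%:M.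
have VE : V = 1%:M + z by rewrite addrC subrK.
have yz : y + z + y *m z = 0.
  move: h1; rewrite VE mulmxDl mul1mx mulmxDr mulmx1 -[RHS]addr0 -addrA => /addrI.
  by rewrite addrA [z + y]addrC.
have zy : y + z + z *m y = 0.
  by move: h2; rewrite VE mulmxDl mul1mx mulmxDr mulmx1 -[RHS]addr0 -addrA => /addrI; rewrite addrA.
have zE1 : z = - (y *m V).
  by apply/eqP; rewrite -addr_eq0 VE mulmxDr mulmx1 addrA [z + y]addrC yz.
have zE2 : z = - (V *m y).
  by apply/eqP; rewrite -addr_eq0 VE mulmxDl mul1mx addrA [z + y]addrC zy.
have hz : forall i j, corner (z i j).
  apply: corner_mx.
    rewrite {1}zE1 mulmxN mulmxA; have -> : e%:M *m y = y; last by rewrite -zE1.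
    by apply/matrixP => i j; rewrite scalmx; case: (hy i j).
  rewrite {1}zE2 mulNmx -mulmxA; have -> : y *m e%:M = y; last by rewrite -zE2.
  by apply/matrixP => i j; rewrite mxscal; case: (hy i j).
have [q1 q2 q3 q4 q5] := swE hy.
apply: (k1_swindle l0 q1 q2 q3 q4 q5 iy); exists (1%:M + mrep z); split.
  rewrite mulmxDl mul1mx mulmxDr mulmx1 -mrepM// -addrA [_ + (_ + mrep (_ *m _))]addrA.
  by rewrite -!mrepD [z + y]addrC yz mrep0 addr0.
rewrite mulmxDl mul1mx mulmxDr mulmx1 -mrepM// -addrA [_ + (_ + mrep (_ *m _))]addrA.
by rewrite -!mrepD zy mrep0 addr0.
Qed.

(** A short path replaces [U] by $1+S'T'$ with $S'T'$ passing through [e]. Exchanging the factors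
    gives $1+T'S'$, whose nontrivial part has entries in the corner of [e]. *)
Lemma k1triv_cideal k (U : 'M[A]_k) : invertible_mx U -> mx_cideal (U - 1%:M) -> k1triv U.
Proof.
move=> iU hU; have [d d0 hd] := inv_path_near iU.
have [l [S [T hST]]] := mx_cideal_factor hU (divr_gt0 d0 (ltr0n _ 2)).
pose S' := S *m e%:M; pose T' := e%:M *m T.
have eeM n : (e%:M : 'M[A]_n) *m e%:M = e%:M by rewrite -scalar_mxM ee.
have S'T' : S' *m T' = S *m e%:M *m T by rewrite /S' /T' mulmxA -(mulmxA S) eeM.
have p : inv_path U (1%:M + S' *m T').
  apply: hd; rewrite S'T' -[X in mxnrm X]opprK mxnrmN.
  have -> : - (1%:M + S *m e%:M *m T - U) = U - 1%:M - S *m e%:M *m T.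
    by rewrite opprB opprD addrA.
  by apply: le_lt_trans hST _; rewrite ltr_pdivrMr// ltr_pMr// ltr1n.
have [_ i1] := inv_path_inv p.
apply: stab_path_trans (stab_pathE p) _.
apply: stab_path_trans (stab_path_1DC i1) _.
apply: k1triv_corner => //; last exact: invertible_mx1DC.
apply: corner_mx.
  by rewrite mulmxA /T' mulmxA eeM.
by rewrite -mulmxA /S' -mulmxA eeM.
Qed.

Lemma kc_corner l (l0 : (0 < l)%N) (f : 'M[A]_l) (hf : f *m f = f) :
  (forall i j, corner (f i j)) -> kc (IdemMx l0 hf) = 0.
Proof.
move=> cf; have [q1 q2 q3 q4 q5] := swE cf.
by apply: kc_swindle q1 q2 q3 q4 q5; rewrite -mrepM// hf.
Qed.

Let sandwich k (P Q : 'M[A]_k) : exists2 d : R, 0 < d &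
  forall D, mxnrm D <= d -> invertible_mx (1%:M - P *m D *m Q).
Proof.
have q0 : 0 < mxnrm P * mxnrm Q + 1 by rewrite ltr_wpDl// mulr_ge0 ?mxnrm_ge0.
exists ((mxnrm P * mxnrm Q + 1)^-1 / 2); first by rewrite divr_gt0 ?invr_gt0.
move=> D hD; apply: (@neumann R 'M[A]_k (mx_rnorm A k)).
apply: (@le_lt_trans _ _ (mxnrm P * ((mxnrm P * mxnrm Q + 1)^-1 / 2) * mxnrm Q)).
  apply: le_trans (mxnrmM _ _) _; rewrite ler_wpM2r ?mxnrm_ge0//.
  by apply: le_trans (mxnrmM _ _) _; rewrite ler_wpM2l ?mxnrm_ge0.
have -> : mxnrm P * ((mxnrm P * mxnrm Q + 1)^-1 / 2) * mxnrm Q =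
  mxnrm P * mxnrm Q / (mxnrm P * mxnrm Q + 1) / 2 by ring.
rewrite ltr_pdivrMr// mul1r (le_lt_trans (y := 1)) ?ltr1n//.
by rewrite ler_pdivrMr// mul1r lerDl.
Qed.

(** Approximating [P] by a product through [e] and correcting by an invertible [w] yields an exact
    factorization $P=S'T'$ through [e]; the equivalent idempotent $T'S'$ has entries in the
    corner. *)
Lemma kc_in_cideal k (k0 : (0 < k)%N) (P : 'M[A]_k) (hP : P *m P = P) :
  mx_cideal P -> kc (IdemMx k0 hP) = 0.
Proof.
move=> JP; have [d d0 hd] := sandwich P P.
have [l [S [T /hd]]] := mx_cideal_factor JP d0.
set x := P *m _ *m P => -[w [w1 w2]].
have Px : P *m x = x by rewrite /x !mulmxA hP.
have xP : x *m P = x by rewrite /x -mulmxA hP.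
have PE : P = (P *m S) *m e%:M *m (T *m P *m w).
  rewrite -{1}[P]mulmx1 -w1 (mulmxA P) mulmxBr mulmx1 Px.
  have -> : P - x = P *m (S *m e%:M *m T) *m P.
    by rewrite /x mulmxBr mulmxBl !hP opprB addrC subrK.
  by rewrite !mulmxA.
have wP : w *m P = P *m w.
  rewrite -[LHS]mulmx1 -w1 mulmxA -(mulmxA w P) mulmxBr mulmx1 Px.
  have -> : P - x = (1%:M - x) *m P by rewrite mulmxBl mul1mx xP.
  by rewrite mulmxA w2 mul1mx.
pose S' := P *m S *m e%:M; pose T' := e%:M *m (T *m P *m w).
have eeM n : (e%:M : 'M[A]_n) *m e%:M = e%:M by rewrite -scalar_mxM ee.
have S'T' : S' *m T' = P by rewrite /S' /T' -[LHS]mulmxA (mulmxA e%:M) eeM mulmxA -PE.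
have PS' : P *m S' = S' by rewrite /S' !mulmxA hP.
have hf : (T' *m S') *m (T' *m S') = T' *m S'.
  by rewrite mulmxA -(mulmxA T') S'T' -mulmxA PS'.
rewrite -(kc_corner (ltn0Sn l) hf); last first.
  by apply: corner_mx; rewrite /S' /T' ?mulmxA ?eeM// -[RHS]mulmxA -!mulmxA eeM.
by apply: kc_sim; apply/asboolP; exists S', T'.
Qed.

Let mx_cideal_block m1 m2 n1 n2 (M1 : 'M[A]_(m1, n1)) (M2 : 'M[A]_(m1, n2))
    (M3 : 'M[A]_(m2, n1)) (M4 : 'M[A]_(m2, n2)) :
  mx_cideal M1 -> mx_cideal M2 -> mx_cideal M3 -> mx_cideal M4 ->
  mx_cideal (block_mx M1 M2 M3 M4).
Proof.
move=> h1 h2 h3 h4 i j; rewrite mxE; case: (fintype.split i) => i'; rewrite mxE;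
by case: (fintype.split j) => j'.
Qed.

(** The idempotent [P] is equivalent to a part [E] of $D=\mathrm{diag}(Q,e)$. The complement $D-E$
    lies over the ideal and [e] has class zero, so both are invisible and [P] has the class of
    [Q]. *)
Lemma kc_cideal k (k0 : (0 < k)%N) (P Q : 'M[A]_k) (hP : P *m P = P) (hQ : Q *m Q = Q) :
  mx_cideal (P - Q) -> kc (IdemMx k0 hP) = kc (IdemMx k0 hQ).
Proof.
move=> JPQ; have [d d0 hd] := sandwich P P.
have [l [S [T /hd]]] := mx_cideal_factor JPQ d0.
have eeM n : (e%:M : 'M[A]_n) *m e%:M = e%:M by rewrite -scalar_mxM ee.
set x := P *m _ *m P => -[w [w1 w2]].
have Px : P *m x = x by rewrite /x !mulmxA hP.
have xP : x *m P = x by rewrite /x -mulmxA hP.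
have wP : w *m P = P *m w.
  rewrite -[LHS]mulmx1 -w1 mulmxA -(mulmxA w P) mulmxBr mulmx1 Px.
  have -> : P - x = (1%:M - x) *m P by rewrite mulmxBl mul1mx xP.
  by rewrite mulmxA w2 mul1mx.
(* The product of [be] with the column without its factor [w] is $P(Q+SeT)P=P-x$, which [w] inverts
   in the corner of [P]; hence [be *m al = P]. *)
pose be := row_mx (P *m Q) (P *m S *m e%:M).
pose al := col_mx (Q *m P *m w) (e%:M *m T *m P *m w).
have beal : be *m al = P.
  rewrite mul_row_col !mulmxA -(mulmxA P Q) hQ -(mulmxA _ e%:M e%:M) eeM -mulmxDl.
  have -> : P *m Q *m P + P *m S *m e%:M *m T *m P = P *m (1%:M - x).
    rewrite mulmxBr mulmx1 Px /x !(mulmxBr, mulmxBl) !mulmxA !hP.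
    by rewrite !opprB [RHS]addrC addrA subrK addrC.
  by rewrite -mulmxA w1 mulmx1.
have alP : al *m P = al by rewrite mul_col_mx -!mulmxA wP !mulmxA -!(mulmxA _ P P) hP.
have Pbe : P *m be = be by rewrite mul_mx_row !mulmxA hP.
pose E := al *m be; pose D := block_mx Q 0 0 (e%:M : 'M[A]_l.+1).
have EE : E *m E = E by rewrite /E mulmxA -(mulmxA al) beal alP.
have DE : D *m E = E.
  rewrite /E mulmxA; congr (_ *m _); rewrite /al /D mul_block_col !mul0mx addr0 add0r.
  by rewrite !mulmxA hQ eeM.
have ED : E *m D = E.
  rewrite /E -mulmxA; congr (_ *m _); rewrite /be /D mul_row_block !mulmx0 addr0 add0r.
  by rewrite -!mulmxA hQ eeM.
have DD : D *m D = D by rewrite /D mulmx_block !mul0mx !mulmx0 !addr0 !add0r hQ eeM.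
pose Z := D - E.
have EZ : E *m Z = 0 by rewrite mulmxBr ED EE subrr.
have ZE : Z *m E = 0 by rewrite mulmxBl DE EE subrr.
have ZZ : Z *m Z = Z by rewrite {2}/Z mulmxBr ZE subr0 /Z mulmxBl DD ED.
have DEZ : E + Z = D by rewrite addrC subrK.
have hEZ : (E + Z) *m (E + Z) = E + Z by rewrite DEZ.
have kl0 : (0 < k + l.+1)%N by rewrite addnS.
have kE : kc (IdemMx k0 hP) = kc (IdemMx kl0 EE).
  by apply: kc_sim; apply/asboolP; exists be, al.
(* Modulo the ideal [e] and [x] vanish, [w] is 1, and $QPQ$ equals [Q], so every block of $D-E$
   vanishes. *)
have kZ : kc (IdemMx kl0 ZZ) = 0.
  apply: kc_in_cideal; rewrite /Z /D /E mul_col_row opp_block_mx add_block_mx.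
  have Je q : mx_cideal (e%:M : 'M[A]_q) by exact: mx_cideal_e.
  have Jx : mx_cideal x.
    apply: mx_cidealMr; apply: mx_cidealMl; apply: mx_cidealB => //.
    by apply: mx_cidealMr; apply: mx_cidealMl.
  have wE : w = 1%:M + x *m w by rewrite -{1}w1 mulmxBl mul1mx subrK.
  apply: mx_cideal_block.
  - have -> : Q - Q *m P *m w *m (P *m Q) =
        Q *m - (P - Q) *m Q - Q *m P *m x *m w *m P *m Q.
      rewrite {1}wE mulmxDr mulmx1 mulmxDl opprD addrA !mulmxA; congr (_ - _).
      by rewrite mulmxN mulNmx mulmxBr mulmxBl hQ hQ opprB -(mulmxA Q P P) hP.
    apply: mx_cidealB.
      by apply: mx_cidealMr; apply: mx_cidealMl; exact: mx_cidealN.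
    by do 3!apply: mx_cidealMr; apply: mx_cidealMl.
  - by rewrite add0r; apply: mx_cidealN; do 2!apply: mx_cidealMl.
  - by rewrite add0r; apply: mx_cidealN; do 4!apply: mx_cidealMr.
  - apply: mx_cidealB => //; by do 2!apply: mx_cidealMl.
have ke : kc (IdemMx (ltn0Sn l) (eeM l.+1)) = 0.
  apply: kc_corner => i j; rewrite mxE; case: (i == j); rewrite ?mulr1n ?mulr0n; split;
  by rewrite ?ee ?mulr0 ?mul0r.
have kD : kc (IdemMx kl0 DD) = kc (IdemMx k0 hQ) + kc (IdemMx (ltn0Sn l) (eeM l.+1)).
  by rewrite kcD; apply: kc_sim; apply/asboolP; exists D, D.
have := kc_orth kl0 EE ZZ hEZ EZ ZE.
rewrite kZ addr0 -kE => <-; rewrite -[RHS]addr0 -ke -kD.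
by apply: kc_sim; apply/asboolP; exists D, D; rewrite /= DEZ DD.
Qed.

End IdealClosure.

(** * Abstract shifts, compact operators and the Fredholm alternative *)

Section ScalarMul.
Variables (R : realType) (A : banachAlgType R[i]).
Implicit Types (a b : R[i]) (x y : A).

Lemma scalAl a x y : a *: (x * y) = (a *: x) * y.
Proof. exact: banach_scalerAl. Qed.

Lemma scalAr a x y : a *: (x * y) = x * (a *: y).
Proof. exact: banach_scalerAr. Qed.

Lemma cauchyX_le1 x n : nrm x <= 1 -> nrm (x ^+ n.+1) <= 1.
Proof.
move=> x1; elim: n => [|n ih]; first by rewrite expr1.
rewrite exprS; apply: le_trans (nrmM _ _) _.
by rewrite -[leRHS]mulr1 ler_pM ?nrm_ge0.
Qed.

End ScalarMul.

(* Abstracts the algebra of operators on l_1 with its shift s and backward shift t. *)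
Record toeplitz (R : realType) (A : banachAlgType R[i]) := Toeplitz {
  tz_s : A; tz_t : A;
  tz_ts : tz_t * tz_s = 1;
  tz_s1 : nrm tz_s <= 1;
  tz_t1 : nrm tz_t <= 1;
  tz_11 : nrm (1 : A) <= 1;
  tz_rank1 : forall c : A, exists a : R[i],
    (1 - tz_s * tz_t) * c * (1 - tz_s * tz_t) = a *: (1 - tz_s * tz_t);
  tz_neq0 : 1 - tz_s * tz_t != 0;
  tz_decay : forall (x : A) (e : R), 0 < e -> exists N,
    nrm (tz_t ^+ N * x * (1 - tz_s * tz_t)) <= e }.

Section Toeplitz.
Variables (R : realType) (A : banachAlgType R[i]) (Z : toeplitz A).
Local Notation s := (tz_s Z).
Local Notation t := (tz_t Z).
Local Notation C := R[i].
Implicit Types (x y k : A).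

Definition tzp : A := 1 - s * t.
Local Notation p := tzp.
Definition tzP N : A := 1 - s ^+ N * t ^+ N.
Local Notation P := tzP.

Lemma tz_tsX N : t ^+ N * s ^+ N = 1.
Proof.
elim: N => [|N ih]; first by rewrite !expr0 mulr1.
by rewrite exprSr exprS mulrA -(mulrA _ t) tz_ts mulr1.
Qed.

Lemma tz_tp : t * p = 0.
Proof. by rewrite mulrBr mulr1 mulrA tz_ts mul1r subrr. Qed.

Lemma tz_ps : p * s = 0.
Proof. by rewrite mulrBl mul1r -mulrA tz_ts mulr1 subrr. Qed.

Lemma tz_pp : p * p = p.
Proof. by rewrite {1}/p mulrBl mul1r -mulrA tz_tp mulr0 subr0. Qed.

Lemma tz_p_neq0 : p != 0. Proof. exact: tz_neq0. Qed.

Lemma tz_p_gt0 : 0 < nrm p.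
Proof.
rewrite lt_def nrm_ge0 andbT; apply/eqP => /nrm_eq0 /eqP.
by rewrite (negbTE tz_p_neq0).
Qed.

Lemma tzP0 : P 0 = 0. Proof. by rewrite /P !expr0 mulr1 subrr. Qed.

Lemma tzPS N : P N.+1 = P N + s ^+ N * p * t ^+ N.
Proof.
rewrite /P /p mulrBr mulrBl mulr1 addrA subrK; congr (_ - _).
by rewrite exprSr exprS !mulrA.
Qed.

Lemma tzP1 : P 1 = p. Proof. by rewrite /P !expr1. Qed.

Lemma tzPE N : P N = \sum_(i < N) s ^+ i * p * t ^+ i.
Proof.
elim: N => [|N ih]; first by rewrite tzP0 big_ord0.
by rewrite tzPS big_ord_recr /= ih.
Qed.

Lemma tz_tP N : t ^+ N * P N = 0.
Proof. by rewrite mulrBr mulr1 mulrA tz_tsX mul1r subrr. Qed.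

Lemma tz_Ps N : P N * s ^+ N = 0.
Proof. by rewrite mulrBl mul1r -mulrA tz_tsX mulr1 subrr. Qed.

Lemma tz_PP N : P N * P N = P N.
Proof. by rewrite {1}/P mulrBl mul1r -mulrA tz_tP mulr0 subr0. Qed.

Lemma tz_split N : 1 = s ^+ N * t ^+ N + P N.
Proof. by rewrite addrC subrK. Qed.

Lemma tz_sX1 N : nrm (s ^+ N) <= 1.
Proof. case: N => [|N]; [exact: (tz_11 Z)|exact/cauchyX_le1/tz_s1]. Qed.

Lemma tz_tX1 N : nrm (t ^+ N) <= 1.
Proof. case: N => [|N]; [exact: (tz_11 Z)|exact/cauchyX_le1/tz_t1]. Qed.

Lemma nrm_tX N x : nrm (t ^+ N * x) <= nrm x.
Proof.
apply: le_trans (nrmM _ _) _; rewrite -[leRHS]mul1r.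
by rewrite ler_wpM2r ?nrm_ge0 ?tz_tX1.
Qed.

Lemma nrm_sX N x : nrm (s ^+ N * x) <= nrm x.
Proof.
apply: le_trans (nrmM _ _) _; rewrite -[leRHS]mul1r.
by rewrite ler_wpM2r ?nrm_ge0 ?tz_sX1.
Qed.

Lemma nrm_tX_mono N M x : (N <= M)%N -> nrm (t ^+ M * x) <= nrm (t ^+ N * x).
Proof. by move=> NM; rewrite -(subnK NM) exprD -mulrA nrm_tX. Qed.

(* The compact operators. *)
Definition kk k := forall e : R, 0 < e -> exists N, nrm (t ^+ N * k) <= e.

Lemma kk_ge k : kk k -> forall e : R, 0 < e ->
  exists N, forall M, (N <= M)%N -> nrm (t ^+ M * k) <= e.
Proof.
by move=> hk e /hk[N hN]; exists N => M NM; apply: le_trans (nrm_tX_mono _ NM) hN.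
Qed.

Lemma kk0 : kk 0.
Proof. by move=> e e0; exists 0%N; rewrite mulr0 nrm0 ltW. Qed.

Lemma kkD x y : kk x -> kk y -> kk (x + y).
Proof.
move=> /kk_ge hx /kk_ge hy e e0; have e2 : 0 < e / 2 by rewrite divr_gt0.
have [N hN] := hx _ e2; have [M hM] := hy _ e2; exists (maxn N M).
rewrite mulrDr [leRHS]splitr (le_trans (nrmD _ _))// lerD ?hN ?hM//.
  exact: leq_maxl.
exact: leq_maxr.
Qed.

Lemma kkMr x y : kk x -> kk (x * y).
Proof.
move=> hx e e0; have q0 : 0 < nrm y + 1 by rewrite ltr_wpDl// nrm_ge0.
have [N hN] := hx _ (divr_gt0 e0 q0); exists N.
rewrite mulrA; apply: le_trans (nrmM _ _) _.
apply: (@le_trans _ _ (e / (nrm y + 1) * (nrm y + 1))).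
  by apply: ler_pM; rewrite ?nrm_ge0 ?lerDl.
by rewrite divfK// gt_eqF.
Qed.

Lemma kkN x : kk x -> kk (- x).
Proof. by move=> hx e /hx[N hN]; exists N; rewrite mulrN nrmN. Qed.

Lemma kkB x y : kk x -> kk y -> kk (x - y).
Proof. by move=> hx /kkN; exact: kkD. Qed.

Lemma kkC x y : kk (x - y) -> kk (y - x).
Proof. by move=> /kkN; rewrite opprB. Qed.

Lemma kk_trans y x z : kk (x - y) -> kk (y - z) -> kk (x - z).
Proof. by move=> h1 h2; rewrite -[x - z](subrKA y); exact: kkD. Qed.

Lemma kkZ a x : kk x -> kk (a *: x).
Proof. by move=> hx; rewrite -[x]mulr1 scalAr; exact: kkMr. Qed.

Lemma kk_closed x : (forall e : R, 0 < e -> exists2 y, kk y & nrm (x - y) <= e) -> kk x.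
Proof.
move=> hx e e0; have e2 : 0 < e / 2 by rewrite divr_gt0.
have [y /(_ _ e2)[N hN] xy] := hx _ e2; exists N.
rewrite -[x](subrK y) mulrDr [leRHS]splitr (le_trans (nrmD _ _))// lerD//.
by apply: le_trans (nrm_tX _ _) _.
Qed.

Lemma kk_sum (I : Type) (r : seq I) (Q : pred I) (F : I -> A) :
  (forall i, Q i -> kk (F i)) -> kk (\sum_(i <- r | Q i) F i).
Proof. by move=> hF; apply: big_ind => //; [exact: kk0|exact: kkD]. Qed.

Lemma kk_p x y : kk (x * p * y).
Proof. by apply: kkMr => e /(tz_decay Z x)[N hN]; exists N; rewrite mulrA. Qed.

Lemma kk_P x N : kk (x * P N).
Proof. by rewrite tzPE mulr_sumr; apply: kk_sum => i _; rewrite !mulrA; exact: kk_p. Qed.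

(** Tails are controlled on the left only, so this side needs approximation: [x * k] is a limit of
    the elements [x * P N * k], which are covered by [tz_decay]. *)
Lemma kkMl x k : kk k -> kk (x * k).
Proof.
move=> hk; apply: kk_closed => e e0.
have q0 : 0 < nrm x + 1 by rewrite ltr_wpDl// nrm_ge0.
have [N hN] := hk _ (divr_gt0 e0 q0); exists (x * P N * k).
  by apply: kkMr; exact: kk_P.
rewrite -{1}[k]mul1r (tz_split N) mulrDl mulrDr -!mulrA addrK.
apply: le_trans (nrmM _ _) _.
apply: (@le_trans _ _ ((nrm x + 1) * (e / (nrm x + 1)))).
  apply: ler_pM; rewrite ?nrm_ge0 ?lerDl//; apply: le_trans (nrm_sX _ _) hN.
by rewrite mulrC divfK// gt_eqF.
Qed.

Lemma kk_mul x y x' y' : kk (x - x') -> kk (y - y') -> kk (x * y - x' * y').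
Proof.
move=> hx hy; have -> : x * y - x' * y' = (x - x') * y + x' * (y - y').
  by rewrite mulrBl mulrBr addrA subrK.
by apply: kkD; [exact: kkMr|exact: kkMl].
Qed.

Lemma kk_st N : kk (s ^+ N * t ^+ N - 1).
Proof. by rewrite -opprB; apply/kkN; rewrite -[X in kk X]mul1r; exact: kk_P. Qed.

(* Finite matrices as operators. *)
Definition eta a b (M : 'M[C]_(a, b)) : A :=
  \sum_(i < a) \sum_(j < b) M i j *: (s ^+ i * p * t ^+ j).

Lemma tz_ptsp i j : p * t ^+ i * (s ^+ j * p) = (i == j)%:R *: p.
Proof.
have [ij|ji|->] := ltngtP i j.
- rewrite -(subnKC (ltnW ij)) exprD !mulrA -(mulrA _ _ (s ^+ i)) tz_tsX mulr1.
  rewrite -(prednK (n := j - i)) ?subn_gt0// exprS !mulrA tz_ps !mul0r scale0r//.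
- rewrite -(subnK (ltnW ji)) exprD !mulrA -(mulrA _ _ (s ^+ j)) tz_tsX mulr1.
  rewrite -(prednK (n := i - j)) ?subn_gt0// exprSr -!mulrA tz_tp !mulr0 scale0r//.
by rewrite mulrA -(mulrA p) tz_tsX mulr1 tz_pp scale1r.
Qed.

Lemma tz_units i j j' l : s ^+ i * p * t ^+ j * (s ^+ j' * p * t ^+ l) =
  (j == j')%:R *: (s ^+ i * p * t ^+ l).
Proof.
have -> : s ^+ i * p * t ^+ j * (s ^+ j' * p * t ^+ l) =
    s ^+ i * (p * t ^+ j * (s ^+ j' * p)) * t ^+ l by rewrite !mulrA.
by rewrite tz_ptsp -scalAr -scalAl.
Qed.

Lemma etaM a b c (M : 'M[C]_(a, b)) (N : 'M[C]_(b, c)) : eta (M *m N) = eta M * eta N.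
Proof.
rewrite /eta mulr_suml; apply: eq_bigr => i _.
under eq_bigr do rewrite mxE scaler_suml.
rewrite exchange_big /= mulr_suml; apply: eq_bigr => j _.
rewrite mulr_sumr (bigD1 j)//= [X in _ = _ + X]big1 ?addr0 => [|j' ne].
  rewrite mulr_sumr; apply: eq_bigr => l _.
  by rewrite -scalAl -scalAr tz_units eqxx scale1r scalerA.
rewrite mulr_sumr big1// => l _; rewrite -scalAl -scalAr tz_units.
by rewrite -val_eqE /= eq_sym in ne; rewrite (negbTE ne) scale0r !scaler0.
Qed.

Lemma etaD a b (M N : 'M[C]_(a, b)) : eta (M + N) = eta M + eta N.
Proof.
rewrite /eta -big_split; apply: eq_bigr => i _; rewrite -big_split; apply: eq_bigr => j _.
by rewrite mxE scalerDl.
Qed.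

Lemma etaN a b (M : 'M[C]_(a, b)) : eta (- M) = - eta M.
Proof. by apply/eqP; rewrite -addr_eq0 -etaD addNr /eta; apply/eqP/big1 => i _; apply: big1 => j _; rewrite mxE scale0r. Qed.

Lemma eta1 N : eta (1%:M : 'M[C]_N) = P N.
Proof.
rewrite tzPE; apply: eq_bigr => i _; rewrite (bigD1 i)//= mxE eqxx scale1r big1 ?addr0//.
by move=> j ne; rewrite mxE eq_sym (negbTE ne) scale0r.
Qed.

(** Since [p] has rank one, the matrix coefficients of [x] between shifted copies of [p] are
    scalars. *)
Lemma eta_corner N x : exists M : 'M[C]_N, P N * x * P N = eta M.
Proof.
have /choice[f hf] (ij : 'I_N * 'I_N) :
  exists a : C, p * (t ^+ ij.1 * x * s ^+ ij.2) * p = a *: p by exact: tz_rank1.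
exists (\matrix_(i, j) f (i, j)); rewrite tzPE /eta !mulr_suml; apply: eq_bigr => i _.
rewrite mulr_sumr; apply: eq_bigr => j _; rewrite mxE.
by have := hf (i, j) => /= h; rewrite scalAl scalAr -h !mulrA.
Qed.

Lemma eta_eq0 N (v : 'cV[C]_N) : eta v = 0 -> v = 0.
Proof.
move=> h; apply/colP => i; rewrite mxE.
have : p * t ^+ i * eta v = v i 0 *: p.
  rewrite /eta mulr_sumr (bigD1 i)//= [X in _ + X]big1 ?addr0 => [|j ne].
    by rewrite big_ord1 -scalAr expr0 mulr1 tz_ptsp eqxx scale1r.
  rewrite -val_eqE /= in ne.
  by rewrite big_ord1 -scalAr expr0 mulr1 tz_ptsp eq_sym (negbTE ne) scale0r scaler0.
rewrite h mulr0 => /esym/eqP; rewrite scaler_eq0 (negbTE tz_p_neq0) orbF.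
by move/eqP.
Qed.

Lemma eta_colp N (v : 'cV[C]_N) : eta v * p = eta v.
Proof.
rewrite /eta mulr_suml; apply: eq_bigr => i _.
by rewrite !big_ord1 -scalAl expr0 mulr1 -mulrA tz_pp.
Qed.

Local Notation inv := (@rinvertible A).

Lemma rinv_1BC x y : inv (1 - x * y) -> inv (1 - y * x).
Proof.
move=> [v [h1 h2]].
have e1 : x * y * v = v - 1 by rewrite -[X in _ = _ - X]h1 mulrBl mul1r opprB addrC subrK.
have e2 : v * (x * y) = v - 1 by rewrite -[X in _ = _ - X]h2 mulrBr mulr1 opprB addrC subrK.
exists (1 + y * v * x); split.
  rewrite mulrBl mul1r mulrDr mulr1.
  have -> : y * x * (y * v * x) = y * (x * y * v) * x by rewrite !mulrA.
  by rewrite e1 mulrBr mulrBl mulr1 [_ + (_ - _)]addrC subrK addrK.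
rewrite mulrDl mul1r mulrBr mulr1.
have -> : y * v * x * (y * x) = y * (v * (x * y)) * x by rewrite !mulrA.
by rewrite e2 mulrBr mulrBl mulr1 opprB [_ + (_ - _)]addrC subrK subrK.
Qed.

Lemma rinv_corner N (M : 'M[C]_N) : 1 - M \in unitmx -> inv (1 - eta M).
Proof.
move=> uM; pose L := invmx (1 - M).
have h1 : (1 - M) *m L = 1%:M by exact: mulmxV.
have h2 : L *m (1 - M) = 1%:M by exact: mulVmx.
have PM : P N * eta M = eta M by rewrite -eta1 -etaM mul1mx.
have MP : eta M * P N = eta M by rewrite -eta1 -etaM mulmx1.
have PL : P N * eta L = eta L by rewrite -eta1 -etaM mul1mx.
have LP : eta L * P N = eta L by rewrite -eta1 -etaM mulmx1.
have e1 : eta M * eta L = eta L - P N.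
  by rewrite -etaM -eta1 -h1 mulmxBl mul1mx etaD etaN opprD opprK addrA subrr add0r.
have e2 : eta L * eta M = eta L - P N.
  by rewrite -etaM -eta1 -h2 mulmxBr mulmx1 etaD etaN opprD opprK addrA subrr add0r.
have H (a b : A) : a + (1 - b) + (b - a) = 1.
  by rewrite addrC addrA subrK addrC subrK.
exists (eta L + (1 - P N)); split.
  rewrite mulrBl mul1r !mulrDr e1 mulr1 mulrN MP subrr addr0 (opprB (eta L) (P N)).
  exact: H.
rewrite mulrBr mulr1 !mulrDl e2 mul1r mulNr PM subrr addr0 (opprB (eta L) (P N)).
exact: H.
Qed.

(** Cutting off the first [N] coordinates reduces the question to a finite matrix, where injectivity
    and invertibility coincide. Vectors are encoded as elements [v] with [v * p = v], that is, as
    operators living on the first coordinate. *)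
Lemma fredholm_alternative k : kk k ->
  inv (1 - k) \/ exists v, [/\ v != 0, v * p = v & k * v = v].
Proof.
move=> hk; have [N hN] := hk 2^-1 ltac:(by rewrite invr_gt0).
have kN : nrm (s ^+ N * t ^+ N * k) < 1.
  rewrite -mulrA; apply: le_lt_trans (nrm_sX _ _) _; apply: le_lt_trans hN _.
  by rewrite invf_lt1// ltr1n.
have [g [g1 g2]] := neumann (N := banach_rnorm A) kN.
pose x := g * P N; pose y := P N * k.
(* The first factor is inverted by a Neumann series. The second is invertible as soon as $1-yx$ is,
   and $yx$ is the finite matrix [M]. *)
have fac : 1 - k = (1 - s ^+ N * t ^+ N * k) * (1 - x * y).
  have e1 : (1 - s ^+ N * t ^+ N * k) * (x * y) = P N * k.
    by rewrite /x /y !mulrA g1 mul1r tz_PP.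
  by rewrite mulrBr mulr1 e1 {1}/P mulrBl mul1r opprB addrA subrK.
have [M hM] := eta_corner N (k * g).
have yx : y * x = eta M by rewrite -hM /x /y !mulrA.
have [uM|nM] := boolP (1 - M \in unitmx).
  left; rewrite fac; apply: rinvertibleM; first by exists g.
  by apply: rinv_1BC; rewrite yx; exact: rinv_corner.
right.
have [v v0 hv] : exists2 v : 'cV[C]_N, v != 0 & M *m v = v.
  have : \det (1 - M)^T == 0 by rewrite det_tr -[_ == 0]negbK -unitfE -unitmxE.
  move=> /det0P[w w0 hw]; exists w^T; first by rewrite -(inj_eq trmx_inj) trmxK trmx0.
  move/(congr1 trmx): hw; rewrite trmx_mul trmxK trmx0 mulmxBl mul1mx.
  by move=> /eqP; rewrite subr_eq0 => /eqP.
have yxv : y * x * eta v = eta v by rewrite yx -etaM hv.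
exists (x * eta v); split.
- apply: contra_neq v0 => xv; apply: eta_eq0.
  by rewrite -yxv -mulrA xv mulr0.
- by rewrite -mulrA eta_colp.
have : (1 - k) * (x * eta v) = 0.
  have e2 : (1 - x * y) * (x * eta v) = 0.
    have H (a b c : A) : b * a * c = c -> (1 - a * b) * (a * c) = 0.
      by move=> h; rewrite mulrBl mul1r -!mulrA (mulrA b) h subrr.
    exact: H yxv.
  by rewrite fac -mulrA e2 mulr0.
by rewrite mulrBl mul1r => /eqP; rewrite subr_eq0 => /eqP.
Qed.

End Toeplitz.

(** Connectedness of the unit interval: a locally constant property spreads from 0 to 1. *)
Lemma clopen01 (R : realType) (Q : R -> Prop) :
  (forall t, 0 <= t <= 1 -> exists2 d : R, 0 < d &
     forall u, 0 <= u <= 1 -> `|u - t| < d -> (Q t <-> Q u)) -> Q 0 -> Q 1.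
Proof.
move=> loc Q0.
pose S := [set t : R | 0 <= t <= 1 /\ forall u, 0 <= u <= t -> Q u]%classic.
have S0 : S 0.
  split; first by rewrite lexx ler01.
  by move=> u u0; have -> : u = 0 by apply/eqP; rewrite eq_le andbC.
have hS : has_sup S by split; [exists 0|exists 1 => t [/andP[]]].
set b := sup S.
have b0 : 0 <= b by exact: sup_upper_bound hS _ S0.
have b1 : b <= 1 by apply: ge_sup; [exists 0|move=> t [/andP[]]].
have b01 : 0 <= b <= 1 by rewrite b0.
have [d d0 hd] := loc b b01.
have [c Sc bc] := sup_adherent d0 hS.
have cb : c <= b by exact: sup_upper_bound hS _ Sc.
have [/andP[c0 c1] hc] := Sc.
have Qb : Q b.
  apply/(hd c); rewrite ?c0//; last by apply: hc; rewrite c0 lexx.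
  by rewrite distrC ger0_norm ?subr_ge0// ltrBlDl -ltrBlDr.
have Qall u : 0 <= u -> u <= 1 -> u < b + d -> Q u.
  move=> u0 u1 ubd; have [uc|cu] := leP u c; first by apply: hc; rewrite u0.
  apply/(hd u) => //; first by rewrite u0.
  rewrite ltr_norml; apply/andP; split; last by rewrite ltrBlDl.
  by rewrite ltrBrDl; apply: lt_trans cu; rewrite addrC; rewrite -/b in bc; lra.
have [e1|b1'] := ltP 1 (b + d); first by apply: Qall.
have : b + d / 2 <= b.
  apply: (sup_upper_bound hS); split; first by apply/andP; split; lra.
  by move=> u /andP[u0 ubd]; apply: Qall => //; lra.
by rewrite gerDl; lra.
Qed.

Lemma pigeonhole_cn (R : realType) N (f : nat -> 'I_N -> R[i]) (B d : R) :
  (forall n i, cn (f n i) <= B) -> 0 < d ->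
  exists m n, (m < n)%N /\ forall i, cn (f n i - f m i) <= d.
Proof.
move=> fB d0.
have d2 : 0 < d / 2 by rewrite divr_gt0.
pose g (r : R) := Num.truncn ((r + B) / (d / 2)).
have [K hK] : exists K : nat, forall r, `|r| <= B -> (g r <= K)%N.
  exists (g B) => r; rewrite ler_norml => /andP[r1 r2].
  apply: Num.Theory.le_truncn; apply: ler_wpM2r; first by rewrite invr_ge0 ltW.
  by rewrite lerD2r.
have hg r r' : `|r| <= B -> `|r'| <= B -> g r = g r' -> `|r - r'| <= d / 2.
  move=> rB rB' e.
  have pos q : `|q| <= B -> 0 <= (q + B) / (d / 2).
    by rewrite ler_norml => /andP[q1 _]; rewrite divr_ge0 ?(ltW d2)//; lra.
  have /andP[h1 h2] := Num.Theory.truncn_itv (pos _ rB).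
  have /andP[h3 h4] := Num.Theory.truncn_itv (pos _ rB').
  rewrite -/(g r) -/(g r') -e in h1 h2 h3 h4.
  have k (x : R) : x = x / (d / 2) * (d / 2) by rewrite divfK// gt_eqF.
  rewrite -[leRHS]mul1r [X in `|X|]k normrM (ger0_norm (ltW d2)) ler_wpM2r ?(ltW d2)//.
  have -> : (r - r') / (d / 2) = (r + B) / (d / 2) - (r' + B) / (d / 2).
    by rewrite -mulrBl; congr (_ / _); lra.
  rewrite -natr1 in h2 h4; rewrite ler_norml; apply/andP; split; lra.
pose F n : {ffun 'I_N -> 'I_K.+1 * 'I_K.+1} := [ffun i =>
  (inord (g (complex.Re (f n i))), inord (g (complex.Im (f n i))))].
have [m [n [mn Fmn]]] : exists m n, (m < n)%N /\ F m = F n.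
  apply: contrapT => nF.
  have injF : injective (fun i : 'I_(#|{ffun 'I_N -> 'I_K.+1 * 'I_K.+1}|.+1) => F i).
    move=> i j Fij; apply: val_inj => /=; have [ij|ji|//] := ltngtP i j; case: nF.
      by exists i, j.
    by exists j, i.
  by have := leq_card _ injF; rewrite card_ord ltnn.
exists m, n; split=> // i.
have reB k : `|complex.Re (f k i)| <= B by apply: le_trans (re_le_cn _) _.
have imB k : `|complex.Im (f k i)| <= B by apply: le_trans (im_le_cn _) _.
move/ffunP: Fmn => /(_ i); rewrite !ffunE => -[/(congr1 val) h1 /(congr1 val) h2].
rewrite /= !inordK ?ltnS ?hK// in h1; rewrite /= !inordK ?ltnS ?hK// in h2.
apply: le_trans (cn_le_re_im _) _; rewrite !raddfB /= [leRHS]splitr.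
by apply: lerD; apply: hg.
Qed.

Lemma cn_nat (R : realType) n : cn (n%:R : R[i]) = n%:R.
Proof. by rewrite -(rmorph_nat (real_complex R)) cn_real ger0_norm. Qed.

(** * Riesz theory and square roots of compact perturbations of 1 *)

Section SquareRoot.
Variables (R : realType) (A : banachAlgType R[i]) (Z : toeplitz A).
Local Notation C := R[i].
Implicit Types (x y k : A).
Local Notation inv := (@rinvertible A).
Local Notation p := (tzp Z).

Lemma nrm_half : cn (2^-1 : C) = 2^-1 :> R.
Proof. by rewrite cnV cn_nat. Qed.

(* The iteration y |-> (h + y^2) / 2 produces r = 1 - y with r^2 = 1 - h. *)
Lemma sqrt_small h : kk Z h -> nrm h <= 2^-1 -> exists r,
  [/\ r * r = 1 - h, kk Z (r - 1) & forall c, c * h = h * c -> c * r = r * c].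
Proof.
move=> kh h2; pose g y := (2^-1 : C) *: (h + y * y); pose u n := iter n g 0.
have u2 n : nrm (u n) <= 2^-1.
  elim: n => [|n ih]; first by rewrite /u /= nrm0 invr_ge0.
  rewrite /u iterS nrmZ nrm_half -[leRHS]mulr1 ler_wpM2l ?invr_ge0//.
  apply: le_trans (nrmD _ _) _.
  have : nrm (u n * u n) <= 2^-1 * 2^-1 by apply: le_trans (nrmM _ _) _; rewrite ler_pM ?nrm_ge0.
  by rewrite -/(u n); lra.
have geo n : nrm (u n.+1 - u n) <= 1 * 2^-1 ^+ n.
  elim: n => [|n ih].
    by rewrite expr0 mulr1 /u /= subr0 nrmZ nrm_half mulr0 addr0; lra.
  have -> : u n.+2 - u n.+1 = (2^-1 : C) *: (u n.+1 * (u n.+1 - u n) + (u n.+1 - u n) * u n).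
    rewrite {1}/u iterS -/(u n.+1) {3}/u iterS -/(u n) /g -scalerBr; congr (_ *: _).
    by rewrite opprD addrACA subrr add0r mulrBr mulrBl addrA subrK.
  rewrite nrmZ nrm_half exprS !mul1r ler_wpM2l ?invr_ge0//.
  apply: le_trans (nrmD _ _) _; rewrite mul1r in ih.
  have h1 : nrm (u n.+1 * (u n.+1 - u n)) <= 2^-1 * 2^-1 ^+ n.
    by apply: le_trans (nrmM _ _) _; rewrite ler_pM ?nrm_ge0.
  have h3 : nrm ((u n.+1 - u n) * u n) <= 2^-1 ^+ n * 2^-1.
    by apply: le_trans (nrmM _ _) _; rewrite ler_pM ?nrm_ge0.
  lra.
have rr : 0 <= (2^-1 : R) < 1 by rewrite invr_ge0 invf_lt1// ltr1n ler0n.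
have [y uy] := rn_geometric (N := banach_rnorm A) rr ler01 geo.
have yE : (2 : C) *: y = h + y * y.
  apply: (rtends_uniq (N := banach_rnorm A) (u := fun n => (2 : C) *: u n.+1)).
    move=> e e0; have [k hk] := uy _ (divr_gt0 e0 (ltr0n _ 2)); exists k => n kn.
    rewrite -scalerBr /= nrmZ cn_nat.
    by rewrite mulrC -ler_pdivlMr//; exact: (hk n.+1 (leqW kn)).
  apply: (rtends_ext (u := fun n => h + u n * u n)) => [n|].
    by rewrite {3}/u iterS -/(u n) /g scalerA mulfV ?scale1r// pnatr_eq0.
  move=> e e0; have q0 : 0 < 2^-1 + nrm y + 1 :> R by rewrite ltr_wpDl// addr_ge0 ?invr_ge0 ?nrm_ge0.
  have [k hk] := uy _ (divr_gt0 e0 q0); exists k => n kn.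
  have -> : h + u n * u n - (h + y * y) = u n * (u n - y) + (u n - y) * y.
    by rewrite opprD addrACA subrr add0r mulrBr mulrBl addrA subrK.
  apply: le_trans (nrmD _ _) _.
  have h1 : nrm (u n * (u n - y)) <= 2^-1 * nrm (u n - y).
    by apply: le_trans (nrmM _ _) _; rewrite ler_wpM2r ?nrm_ge0.
  have h3 : nrm ((u n - y) * y) <= nrm (u n - y) * nrm y by exact: nrmM.
  have h4 : nrm (u n - y) * (2^-1 + nrm y + 1) <= e by rewrite -ler_pdivlMr//; exact: (hk n kn).
  have h5 := nrm_ge0 (u n - y).
  apply: le_trans h4; apply: le_trans (lerD h1 h3) _.
  by rewrite mulrDr mulr1 mulrDr [2^-1 * _]mulrC lerDl.
exists (1 - y); split.
- rewrite mulrBl mul1r mulrBr mulr1 opprB addrA.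
  have -> : 1 - y + y * y - y = 1 - ((2 : C) *: y) + y * y.
    by rewrite scaler_nat mulr2n opprD !addrA addrAC.
  by rewrite yE opprD addrA subrK.
- rewrite addrAC subrr add0r; apply/kkN/kk_closed => e e0.
  have [k hk] := uy _ e0; exists (u k); last by rewrite nrmB hk.
  elim: (k) => [|n ih]; first exact: kk0.
  by rewrite /u iterS; apply/kkZ/kkD => //; exact: kkMr.
move=> c ch; have cu n : c * u n = u n * c.
  elim: n => [|n ih]; first by rewrite /u /= mulr0 mul0r.
  rewrite /u iterS /g -scalAr -scalAl; congr (_ *: _); rewrite mulrDr mulrDl ch -/(u n).
  by rewrite mulrA ih -mulrA ih mulrA.
have cy : c * y = y * c.
  apply: (rtends_uniq (N := banach_rnorm A) (u := fun n => c * u n)); first exact: rtendsMl.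
  by apply: (rtends_ext (u := fun n => u n * c)) => //; exact: rtendsMr.
by rewrite mulrBr mulrBl mulr1 mul1r cy.
Qed.

Lemma rinv_comm x y c : x * y = 1 -> y * x = 1 -> c * x = x * c -> c * y = y * c.
Proof.
move=> xy yx cx; rewrite -[LHS]mul1r -yx -mulrA (mulrA x) -cx -(mulrA c) xy mulr1 //.
Qed.

Variable k : A.
Hypothesis kk_k : kk Z k.

Let good (mu : C) := inv (1 - mu *: k).

Section RieszContradiction.
Variable mu : nat -> C.
Hypothesis mu_inj : injective mu.
Hypothesis mu2 : forall n, cn (mu n) <= 2.
Hypothesis bad : forall n, ~ good (mu n).

(** Riesz's argument. The $1/\mu_n$ are distinct eigenvalues of [k] of modulus at least $1/2$. Unit
    vectors in the growing spans, far from the previous span, are scaled to bounded [z n] whose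
    images under [k] are $1/2$-separated, which compactness forbids. *)
Lemma riesz_false : False.
Proof.
have /choice[v hv] n : exists v, [/\ v != 0, v * p = v & mu n *: k * v = v].
  by have [/bad|] := fredholm_alternative (kkZ (mu n) kk_k).
have v0 n : v n != 0 by case: (hv n).
have vp n : v n * p = v n by case: (hv n).
have vk n : mu n *: k * v n = v n by case: (hv n).
have mu0 n : mu n != 0.
  apply/eqP => m0; have := vk n; rewrite m0 scale0r mul0r => /esym/eqP.
  by rewrite (negbTE (v0 n)).
pose la n := (mu n)^-1.
have kv n : k * v n = la n *: v n.
  by rewrite -{2}(vk n) -scalAl scalerA mulVf// scale1r.
have la_inj m n : la m = la n -> m = n by move=> /invr_inj/mu_inj.
pose inH n x := exists c : nat -> C, x = \sum_(j < n) c j *: v j.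
have inH_k n x : inH n x -> inH n (k * x).
  move=> [c ->]; exists (fun j => c j * la j); rewrite mulr_sumr; apply: eq_bigr => j _.
  by rewrite -scalAr kv scalerA.
have inH_D n x y : inH n x -> inH n y -> inH n (x + y).
  move=> [c ->] [d ->]; exists (fun j => c j + d j); rewrite -big_split; apply: eq_bigr => j _.
  by rewrite scalerDl.
have inH_Z n a x : inH n x -> inH n (a *: x).
  move=> [c ->]; exists (fun j => a * c j); rewrite scaler_sumr; apply: eq_bigr => j _.
  by rewrite scalerA.
have inH_v n : inH n.+1 (v n).
  exists (fun j => (j == n)%:R); rewrite big_ord_recr /= eqxx scale1r big1 ?add0r// => j _.
  by rewrite ltn_eqF// scale0r.
have inH_S n m x : (n <= m)%N -> inH n x -> inH m x.
  move=> nm [c ->]; exists (fun j => if (j < n)%N then c j else 0).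
  rewrite -(subnKC nm) big_split_ord /= [X in _ = _ + X]big1 ?addr0.
    by apply: eq_bigr => j _; rewrite ltn_ord.
  by move=> j _; rewrite ltnNge leq_addr scale0r.
have inH_B n x y : inH n x -> inH n y -> inH n (x - y).
  by move=> hx hy; rewrite -scaleN1r; apply: inH_D => //; exact: inH_Z.
have inH0 n : inH n 0.
  by exists (fun=> 0); rewrite big1// => j _; rewrite scale0r.
(* Distance of v_n to the span of the previous eigenvectors: apply the product of
   the k - la_j, which kills that span. *)
have far n : exists2 d : R, 0 < d & forall h, inH n h -> d <= nrm (v n - h).
  pose q m := \prod_(j < m) (k - la j *: (1 : A)).
  have qv m l : q m * v l = (\prod_(j < m) (la l - la j)) *: v l.
    rewrite /q; elim: m => [|m ih]; first by rewrite !big_ord0 mul1r scale1r.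
    rewrite big_ord_recr big_ord_recr /= -mulrA.
    have -> : (k - la m *: (1 : A)) * v l = (la l - la m) *: v l.
      by rewrite mulrBl kv -scalAl mul1r -scalerBl.
    by rewrite -scalAr ih scalerA mulrC.
  have qH h : inH n h -> q n * h = 0.
    move=> [c ->]; rewrite mulr_sumr big1// => j _.
    rewrite -scalAr qv (bigD1 j)//= subrr mul0r scale0r scaler0 //.
  pose L := \prod_(j < n) (la n - la j).
  have L0 : L != 0.
    apply/prodf_neq0 => j _; rewrite subr_eq0; apply/eqP => /la_inj jn.
    by have := ltn_ord j; rewrite -jn ltnn.
  have vn0 : 0 < nrm (v n).
    by rewrite lt_def nrm_ge0 andbT; apply: contra (v0 n) => /eqP/nrm_eq0 ->.
  have q0 : 0 < nrm (q n) + 1 by rewrite ltr_wpDl// nrm_ge0.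
  exists (cn L * nrm (v n) / (nrm (q n) + 1)).
    by rewrite divr_gt0// mulr_gt0// cn_gt0.
  move=> h Hh; rewrite ler_pdivrMr// -nrmZ -qv -[q n * v n]subr0 -(qH _ Hh) -mulrBr.
  apply: le_trans (nrmM _ _) _; rewrite mulrC ler_wpM2l ?nrm_ge0// lerDl//.
(* Riesz's lemma: [h] nearly realizes the positive distance of [v n] to the previous span, so after
   normalization the distance is at least one half. *)
have /choice[y hy] n : exists y, [/\ nrm y = 1, inH n.+1 y, inH n (k * y - la n *: y)
     & forall h, inH n h -> 2^-1 <= nrm (y - h)].
  have [d d0 hd] := far n.
  pose S := [set r : R | exists2 h, inH n h & r = nrm (v n - h)]%classic.
  have S0 : S (nrm (v n - 0)) by exists 0.
  have hS : has_inf S.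
    by split; [exists (nrm (v n - 0))|exists d => _ [h Hh ->]; exact: hd].
  have i0 : 0 < inf S.
    by apply: lt_le_trans d0 _; apply: lb_le_inf => [|_ [h Hh ->]]; [exists (nrm (v n - 0))|exact: hd].
  have [_ [h Hh ->] hh] := inf_adherent i0 hS.
  set r := nrm (v n - h); have r0 : 0 < r by apply: lt_le_trans d0 _; exact: hd.
  have rV : cn (r^-1)%:C%C = r^-1 by rewrite cn_real ger0_norm// invr_ge0 ltW.
  exists ((r^-1)%:C%C *: (v n - h)); split.
  - by rewrite nrmZ rV mulVf// gt_eqF.
  - by apply/inH_Z/inH_B => //; exact: inH_S Hh.
  - rewrite -scalAr scalerA mulrC -scalerA -scalerBr; apply/inH_Z.
    have -> : k * (v n - h) - la n *: (v n - h) = la n *: h - k * h.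
      by rewrite mulrBr kv scalerBr opprB addrC addrA subrK.
    apply: inH_B; [exact: inH_Z|exact: inH_k].
  move=> h' Hh'.
  have -> : (r^-1)%:C%C *: (v n - h) - h' = (r^-1)%:C%C *: (v n - (h + r%:C%C *: h')).
    rewrite opprD addrA [RHS]scalerBr scalerA -rmorphM mulVf ?gt_eqF// scale1r //.
  rewrite nrmZ rV mulrC ler_pdivlMr//.
  have : inf S <= nrm (v n - (h + r%:C%C *: h')).
    by apply: ge_inf; [case: hS|exists (h + r%:C%C *: h') => //; apply: inH_D => //; exact: inH_Z].
  by rewrite -/r in hh; lra.
pose z n := mu n *: y n.
have y1 n : nrm (y n) = 1 by case: (hy n).
have z2 n : nrm (z n) <= 2 by rewrite nrmZ y1 mulr1.
have sep m n : (m < n)%N -> 2^-1 <= nrm (k * z n - k * z m).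
  move=> mn; have [_ _ h1 h2] := hy n; have [_ h3 _ _] := hy m.
  have hz : inH n (k * z n - y n).
    have -> : k * z n - y n = mu n *: (k * y n - la n *: y n).
      by rewrite /z -scalAr scalerBr scalerA mulfV// scale1r.
    exact: inH_Z.
  have hm : inH n (k * z m).
    by apply/inH_k/inH_Z; exact: inH_S h3.
  have -> : k * z n - k * z m = y n - (k * z m - (k * z n - y n)).
    by rewrite opprB addrA [y n + _]addrC subrK.
  by apply: h2; exact: inH_B.
(* Differences of the [z n] have norm at most 4, so beyond [N] the images differ by at most $1/8$.
   The pigeonhole principle makes two images agree up to $1/8$ on the first [N] coordinates; $1/4$
   is less than the separation $1/2$. *)
have [N hN] := kk_k (e := 2^-1 ^+ 5) ltac:(by rewrite exprn_gt0// invr_gt0).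
pose s := tz_s Z; pose t := tz_t Z.
have /choice[c hc] (ni : nat * nat) : exists a : C, p * (t ^+ ni.2 * k * z ni.1) * p = a *: p.
  exact: tz_rank1.
have inH_p n x : inH n x -> x * p = x.
  by move=> [b ->]; rewrite mulr_suml; apply: eq_bigr => j _; rewrite -scalAl vp.
have zp n : z n * p = z n.
  by have [_ h _ _] := hy n; rewrite /z -scalAl (inH_p _ _ h).
have p0 := tz_p_gt0 Z.
pose B := nrm p * nrm k * 2.
have cB n i : cn (c (n, i)) <= B.
  rewrite -(ler_pM2r p0) -nrmZ -hc /=; apply: le_trans (nrmM _ _) _.
  rewrite ler_wpM2r ?nrm_ge0//; apply: le_trans (nrmM _ _) _; rewrite /B -(mulrA (nrm p)).
  rewrite ler_wpM2l ?nrm_ge0// -mulrA; apply: le_trans (nrm_tX _ _ _) _.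
  by apply: le_trans (nrmM _ _) _; rewrite ler_wpM2l ?nrm_ge0.
have q0 : 0 < 8 * (N%:R * nrm p + 1) :> R.
  by rewrite mulr_gt0// ltr_wpDl// mulr_ge0 ?nrm_ge0.
have [m [n [mn cmn]]] := @pigeonhole_cn R N (fun n i => c (n, val i)) B
  (8 * (N%:R * nrm p + 1))^-1 (fun n i => cB n i) ltac:(by rewrite invr_gt0).
have hP : nrm (tzP Z N * (k * z n - k * z m)) <= 8^-1.
  have -> : tzP Z N * (k * z n - k * z m) =
      \sum_(i < N) (c (n, val i) - c (m, val i)) *: (s ^+ i * p).
    rewrite tzPE mulr_suml; apply: eq_bigr => i _; rewrite scalerBl mulrBr; congr (_ - _).
      rewrite [RHS]scalAr -(hc (n, val i)) /= -{1}(zp n) !mulrA //.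
    by rewrite [RHS]scalAr -(hc (m, val i)) /= -{1}(zp m) !mulrA.
  apply: le_trans (nrm_sum _ _ _) _.
  apply: (@le_trans _ _ (\sum_(i < N) (8 * (N%:R * nrm p + 1))^-1 * nrm p)).
    apply: ler_sum => i _; rewrite nrmZ; apply: ler_pM; rewrite ?cn_ge0 ?nrm_ge0//.
    exact: nrm_sX.
  rewrite sumr_const card_ord -[X in X <= _]mulr_natl invfM -!mulrA mulrCA -[leRHS]mulr1.
  rewrite ler_wpM2l ?invr_ge0// mulrCA mulrC ler_pdivrMr ?mul1r ?lerDl//.
  by rewrite ltr_wpDl// mulr_ge0 ?nrm_ge0.
have hQ : nrm (s ^+ N * (t ^+ N * (k * z n - k * z m))) <= 8^-1.
  apply: le_trans (nrm_sX _ _ _) _; rewrite -mulrBr mulrA; apply: le_trans (nrmM _ _) _.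
  have zz : nrm (z n - z m) <= 4.
    apply: le_trans (nrmD _ _) _; rewrite nrmN.
    have := z2 n; have := z2 m; lra.
  apply: (@le_trans _ _ (2^-1 ^+ 5 * 4)).
    by apply: ler_pM; rewrite ?nrm_ge0.
  by rewrite !exprS expr0; lra.
have := sep m n mn.
rewrite -[k * z n - k * z m]mul1r {1}(tz_split Z N) mulrDl -mulrA => h.
have := le_trans h (nrmD _ _); rewrite -/s -/t; lra.
Qed.

End RieszContradiction.

Lemma good_seq (mu : nat -> C) : injective mu -> (forall n, cn (mu n) <= 2) ->
  exists n, good (mu n).
Proof.
move=> mi m2; apply: contrapT => nb; apply: (riesz_false mi m2) => n gn.
by apply: nb; exists n.
Qed.

(** Arcs from 0 to 1 in the complex plane. Arcs with different heights [y] meet only at their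
    endpoints, so suitable exceptional sets of parameters can be avoided by varying [y]. *)
Definition arc (y u : R) : C := (u +i* (y * (u * (1 - u))))%C.

Lemma arc0 (y : R) : arc y 0 = 0. Proof. by rewrite /arc mul0r mulr0. Qed.
Lemma arc1 (y : R) : arc y 1 = 1. Proof. by rewrite /arc subrr !mulr0. Qed.

Lemma arc_le2 (y u : R) : 0 <= y <= 1 -> 0 <= u <= 1 -> cn (arc y u) <= 2.
Proof.
move=> /andP[y0 y1] /andP[u0 u1]; apply: le_trans (cn_le_re_im _) _ => /=.
have a0 : 0 <= u * (1 - u) by rewrite mulr_ge0 ?subr_ge0.
have a1 : u * (1 - u) <= 1 by rewrite -[leRHS]mulr1 ler_pM ?subr_ge0//; lra.
rewrite (ger0_norm u0) (ger0_norm (mulr_ge0 y0 a0)).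
have : y * (u * (1 - u)) <= 1 * 1 by rewrite ler_pM.
lra.
Qed.

Lemma arc_lip (y u u' : R) : 0 <= y <= 1 -> 0 <= u <= 1 -> 0 <= u' <= 1 ->
  cn (arc y u - arc y u') <= 2 * `|u - u'|.
Proof.
move=> /andP[y0 y1] /andP[u0 u1] /andP[u0' u1'].
apply: le_trans (cn_le_re_im _) _; rewrite !raddfB /=.
have -> : y * (u * (1 - u)) - y * (u' * (1 - u')) = y * (1 - u - u') * (u - u') by ring.
rewrite normrM [2 * _]mulr_natl mulr2n lerD2l ler_piMl// ler_norml.
have h : `|1 - u - u'| <= 1 by rewrite ler_norml; lra.
move: h; rewrite !ler_norml => /andP[h1 h2]; nra.
Qed.

(** If every arc of height $1/(n+1)$ met a bad parameter, these would be infinitely many distinct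
    bad parameters of modulus at most 2, against [good_seq]. *)
Lemma good_arc : good 1 -> exists2 y : R, 0 <= y <= 1 &
  forall u, 0 <= u <= 1 -> good (arc y u).
Proof.
move=> g1; apply: contrapT => nb.
pose y (n : nat) : R := (n.+1%:R)^-1.
have y01 n : 0 <= y n <= 1 by rewrite invr_ge0 ler0n /= invf_le1 ?ltr0n// ler1n.
have /choice[u hu] n : exists u, 0 <= u <= 1 /\ ~ good (arc (y n) u).
  apply: contrapT => nu; apply: nb; exists (y n) => // v v01.
  by apply: contrapT => ng; apply: nu; exists v.
have [n] : exists n, good (arc (y n) (u n)).
  apply: good_seq => [m n|n]; last by apply: arc_le2; case: (hu n).
  rewrite /arc => -[<-]; case: (hu m) => /andP[u0 u1] ng.
  have [e0|n0] := eqVneq (u m) 0.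
    by case: ng; rewrite e0 arc0 /good scale0r subr0; exists 1; rewrite mulr1.
  have [e1|n1] := eqVneq (u m) 1; first by case: ng; rewrite e1 arc1.
  have nz : u m * (1 - u m) != 0 by rewrite mulf_neq0// subr_eq0 eq_sym.
  by move/(mulIf nz)/invr_inj/eqP; rewrite eqr_nat eqSS => /eqP.
by case: (hu n).
Qed.

(** Follow an arc of good parameters. Neighbouring elements differ by a factor $1-h$ with [h] small,
    compact and commuting with all that commutes with [k]; its square root from [sqrt_small] carries
    a root from one parameter to the other, in both directions. *)
Lemma sqrt_compact : good 1 -> exists r,
  [/\ r * r = 1 - k, kk Z (r - 1) & forall c, c * k = k * c -> c * r = r * c].
Proof.
move=> /good_arc[y y01 gy].
pose Q (u : R) := exists r, [/\ r * r = 1 - arc y u *: k, kk Z (r - 1) &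
   forall c, c * k = k * c -> c * r = r * c].
suff : Q 1 by rewrite /Q arc1 scale1r.
apply: (@clopen01 R Q); last first.
  exists 1; rewrite arc0 scale0r subr0 mulr1 subrr; split=> //; first exact: kk0.
  by move=> c _; rewrite mulr1 mul1r.
move=> u u01; have [g [g1 g2]] := gy u u01.
have q0 : 0 < 4 * (nrm k * nrm g + 1) by rewrite mulr_gt0// ltr_wpDl// mulr_ge0 ?nrm_ge0.
exists (4 * (nrm k * nrm g + 1))^-1; first by rewrite invr_gt0.
(* With [arc_lip] the chosen radius makes the norm of [h] at most one half, as [sqrt_small]
   requires. *)
move=> v v01 uv; pose h := (arc y v - arc y u) *: (k * g).
have kh : kk Z h by apply/kkZ/kkMr.
have gk c : c * k = k * c -> c * g = g * c.
  move=> ck; apply: rinv_comm g1 g2 _.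
  by rewrite mulrBr mulrBl mulr1 mul1r -scalAr -scalAl ck.
have hk c : c * k = k * c -> c * h = h * c.
  by move=> ck; rewrite /h -scalAr -scalAl mulrA ck -mulrA (gk _ ck) mulrA.
have h2 : nrm h <= 2^-1.
  rewrite nrmZ; apply: (@le_trans _ _ (2 * (4 * (nrm k * nrm g + 1))^-1 * (nrm k * nrm g + 1))).
    apply: ler_pM; rewrite ?cn_ge0 ?nrm_ge0//; last by apply: le_trans (nrmM _ _) _; rewrite lerDl.
    apply: le_trans (arc_lip y01 v01 u01) _; rewrite ler_wpM2l//; exact: ltW.
  have n0 : nrm k * nrm g + 1 != 0 by rewrite gt_eqF// ltr_wpDl// mulr_ge0 ?nrm_ge0.
  by rewrite invfM mulrA -mulrA mulVf// mulr1; lra.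
have [q [qq kq cq]] := sqrt_small kh h2.
have fac : 1 - arc y v *: k = (1 - arc y u *: k) * (1 - h).
  rewrite mulrBr mulr1 /h -scalAr mulrA.
  have -> : (1 - arc y u *: k) * k * g = k.
    have -> : (1 - arc y u *: k) * k = k * (1 - arc y u *: k).
      by rewrite mulrBl mulrBr mul1r mulr1 -scalAl -scalAr.
    by rewrite -mulrA g1 mulr1.
  by rewrite scalerBl opprB addrA subrK.
have [j [j1 j2]] : inv (1 - h).
  by apply: (neumann (N := banach_rnorm A)); apply: le_lt_trans h2 _; rewrite invf_lt1// ltr1n.
have qj c : c * k = k * c -> c * q = q * c by move=> /hk/cq.
split=> -[r [rr kr cr]].
  have rq : r * q = q * r by apply/qj/esym/cr.
  exists (r * q); split.
  - by rewrite fac -rr -qq mulrA -(mulrA r q r) -rq !mulrA.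
  - have -> : r * q - 1 = (r - 1) * q + (q - 1) by rewrite mulrBl mul1r addrA subrK.
    by apply: kkD => //; exact: kkMr.
  by move=> c ck; rewrite mulrA cr// -!mulrA qj.
(* For the return direction the root is divided by [q]; its inverse is $q(1-h)^{-1}$ because
   $q^2=1-h$. *)
pose q' := q * j.
have q'1 : q * q' = 1 by rewrite /q' mulrA qq j1.
have jq c : c * k = k * c -> c * j = j * c.
  by move=> ck; apply: rinv_comm j1 j2 _; rewrite mulrBr mulrBl mulr1 mul1r hk.
have qk : q * k = k * q by apply/esym/qj.
have q'2 : q' * q = 1 by rewrite /q' -mulrA -(jq _ qk) mulrA qq j1.
have cq' c : c * k = k * c -> c * q' = q' * c.
  by move=> ck; apply: rinv_comm q'1 q'2 _; exact: qj.
have rq : r * q' = q' * r by apply/cq'/esym/cr.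
exists (r * q'); split.
- have -> : r * q' * (r * q') = r * r * (q' * q').
    by rewrite mulrA -(mulrA r q' r) -rq !mulrA.
  rewrite rr fac -qq -mulrA (mulrA (q * q)) -(mulrA q q q') q'1 mulr1 q'1 mulr1 //.
- have -> : r * q' - 1 = (r - 1) * q' + - (q' * (q - 1)).
    by rewrite mulrBl mul1r mulrBr q'2 mulr1 opprB addrA subrK.
  by apply: kkD; [exact: kkMr|apply/kkN/kkMl].
by move=> c ck; rewrite mulrA cr// -(mulrA r c) cq'// mulrA.
Qed.

End SquareRoot.

(** * Idempotents lift modulo compacts *)

Section LiftIdempotent.
Variables (R : realType) (A : banachAlgType R[i]) (Z : toeplitz A).
Local Notation C := R[i].
Implicit Types (x y k : A).
Local Notation inv := (@rinvertible A).

Let prod_lin x (c d : C) :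
  (x - c *: (1 : A)) * (x + d *: (1 : A)) = x * x + (d - c) *: x - (c * d) *: (1 : A).
Proof.
rewrite mulrBl !mulrDr -!scalAr -!scalAl !mulr1 !mul1r scalerA scalerBl [d * c]mulrC.
by rewrite opprD !addrA.
Qed.

(** The symmetry $s_0=2a-1$ satisfies $s_0^2=1-k_0$ with $k_0$ compact. A compact perturbation $s_1$
    of it is invertible; dividing $s_1$ by a square root of $s_1^2$ that is 1 modulo compacts gives
    an exact involution [J], and $(1+J)/2$ is the lift. *)
Lemma idempotent_lift a : kk Z (a * a - a) -> exists2 b, b * b = b & kk Z (b - a).
Proof.
move=> ka; pose s0 := (2 : C) *: a - 1.
pose k0 := (- 4 : C) *: (a * a - a).
have kk0 : kk Z k0 by exact: kkZ.
have s0s0 : s0 * s0 = 1 - k0.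
  rewrite /s0 /k0; set b := (2 : C) *: a.
  have bb : b * b = (4 : C) *: (a * a).
    by rewrite /b -scalAl -scalAr scalerA; congr (_ *: _); ring.
  have b2 : b + b = (4 : C) *: a by rewrite /b -scalerDl; congr (_ *: _); ring.
  have H (x y : A) : x - y + (1 - y) = 1 + (x - (y + y)).
    by rewrite addrACA -opprD [x + 1]addrC addrA.
  by rewrite mulrBl mul1r mulrBr mulr1 opprB scaleNr opprK scalerBr -bb -b2.
(* Infinitely many radii [r], at most one half and with $r\|s_0\|<1$. The parameters $1/(1-r^2)$ are
   distinct and bounded by 2, so one of them is good for [k0]. *)
pose m n : R := (n.+2%:R + nrm s0)^-1.
have den n : 0 < n.+2%:R + nrm s0 by rewrite ltr_wpDr// nrm_ge0.
have m0 n : 0 < m n by rewrite invr_gt0.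
have m2 n : m n <= 2^-1.
  rewrite lef_pV2 ?posrE//; apply: (@le_trans _ _ n.+2%:R); last by rewrite lerDl nrm_ge0.
  by rewrite ler_nat.
have mm n : m n * m n <= 2^-1 * 2^-1 by rewrite ler_pM ?(ltW (m0 n)).
pose mu n : C := ((1 - m n * m n)^-1)%:C%C.
have d0 n : 0 < 1 - m n * m n by have := mm n; lra.
have [|n|n gn] := @good_seq _ _ Z k0 kk0 mu.
- move=> i j /complexI/invr_inj e0.
  have e : m i * m i = m j * m j by move: e0; lra.
  have : m i = m j.
    apply/eqP; rewrite -(eqrXn2 (n := 2)) ?(ltW (m0 _))// !expr2 e //.
  by move=> /invr_inj/addIr/eqP; rewrite eqr_nat !eqSS => /eqP.
- rewrite cn_real ger0_norm; last by rewrite invr_ge0 ltW.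
  rewrite -[leRHS]invrK lef_pV2 ?posrE ?invr_gt0//.
  by have := mm n; lra.
set r := m n; pose rc := r%:C%C : C.
have r0 : 0 < r := m0 n.
pose x1 := s0 - rc *: (1 : A); pose x2 := s0 + rc^-1 *: (1 : A).
have dn : 1 - r * r != 0 by rewrite gt_eqF// d0.
have x1inv : inv x1.
  have [g [g1 g2]] := gn.
  have prod : x1 * (s0 + rc *: (1 : A)) = ((1 - r * r)%:C%C : C) *: (1 - mu n *: k0).
    have e1 : x1 * (s0 + rc *: (1 : A)) = s0 * s0 - (rc * rc) *: (1 : A).
      by rewrite prod_lin subrr scale0r addr0.
    have e2 : ((1 - r * r)%:C%C : C) * mu n = 1 by rewrite /mu -rmorphM divff.
    rewrite e1 s0s0 scalerBr scalerA e2 scale1r rmorphB rmorph1 rmorphM scalerBl scale1r.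
    by rewrite addrAC.
  have prod' : (s0 + rc *: (1 : A)) * x1 = x1 * (s0 + rc *: (1 : A)).
    rewrite [RHS]prod_lin.
    have := prod_lin s0 (- rc) (- rc); rewrite !scaleNr !opprK => ->.
    by rewrite mulrNN addNr subrr.
  pose w := ((1 - r * r)^-1)%:C%C : C.
  have ww : w * (1 - r * r)%:C%C = 1 by rewrite -rmorphM mulVf.
  exists ((s0 + rc *: (1 : A)) * (w *: g)); split.
    by rewrite mulrA prod -scalAr -scalAl scalerA ww scale1r.
  have comm : x1 * (w *: g) = (w *: g) * x1.
    apply: (@rinv_comm _ _ ((1 - r * r)%:C%C *: (1 - mu n *: k0))).
    - by rewrite -scalAl -scalAr scalerA mulrC ww scale1r.
    - by rewrite -scalAl -scalAr scalerA ww scale1r.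
    - by rewrite -prod -[RHS]mulrA prod'.
  by rewrite -mulrA -comm mulrA prod' prod -scalAr -scalAl scalerA ww scale1r.
have rcV : rc^-1 = (r^-1)%:C%C by rewrite fmorphV.
have rc0 : rc != 0 by rewrite -cn_gt0 cn_real ger0_norm// ltW.
have x2inv : inv x2.
  have [g [g1 g2]] : inv (1 - (- rc) *: s0).
    apply: (neumann (N := banach_rnorm A)) => /=; rewrite nrmZ cnN cn_real ger0_norm; last exact: ltW.
    by rewrite /r /m mulrC ltr_pdivrMr// mul1r ltrDr.
  have e : x2 = rc^-1 *: (1 - (- rc) *: s0).
    by rewrite scaleNr opprK scalerDr scalerA mulVf// scale1r addrC.
  exists (rc *: g); rewrite e -!scalAl -!scalAr !scalerA g1 g2.
  by rewrite mulVf// mulfV// scale1r.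
(* This coefficient makes $s_0+\epsilon k_0$ proportional to $(s_0-r)(s_0+1/r)$. The first factor is
   invertible since $(s_0-r)(s_0+r)=(1-r^2)(1-\mu k_0)$, the second since $r\|s_0\|<1$. *)
pose ep : C := (- (r / (1 - r * r)))%:C%C.
pose s1 := s0 + ep *: k0.
have ks1 : kk Z (s1 - s0) by rewrite addrAC subrr add0r; exact: kkZ.
have s1E : s1 = (- ep) *: (x1 * x2).
  rewrite /x1 /x2 prod_lin s0s0 mulfV// scale1r.
  have -> : 1 - k0 + (rc^-1 - rc) *: s0 - 1 = (rc^-1 - rc) *: s0 - k0.
    have H (x y : A) : 1 - x + y - 1 = y - x by rewrite addrC !addrA addNr add0r addrC.
    exact: H.
  rewrite scalerBr scalerA !scaleNr opprK; congr (_ + _).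
  suff -> : - ep * (rc^-1 - rc) = 1 by rewrite scale1r.
  have -> : - ep * (rc^-1 - rc) = (r / (1 - r * r) * (r^-1 - r))%:C%C.
    by rewrite rcV /ep /rc rmorphM rmorphB rmorphN opprK.
  have -> : r / (1 - r * r) * (r^-1 - r) = 1 by field; rewrite dn gt_eqF.
  by rewrite rmorph1.
have s1inv : inv s1.
  have ep0 : - ep != 0.
    rewrite oppr_eq0 -cn_gt0 /ep cn_real normr_gt0 oppr_eq0 mulf_neq0 ?invr_eq0//.
    exact: lt0r_neq0.
  have [g [g1 g2]] := rinvertibleM x1inv x2inv.
  exists ((- ep)^-1 *: g); rewrite s1E -!scalAl -!scalAr !scalerA g1 g2.
  by rewrite mulVf// mulfV// scale1r.
pose k1 := 1 - s1 * s1.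
have kk1 : kk Z k1.
  have -> : k1 = k0 - (s1 * s1 - s0 * s0) by rewrite /k1 s0s0 opprB addrA [k0 + _]addrC subrK.
  by apply: kkB => //; exact: kk_mul.
have s1s1 : s1 * s1 = 1 - k1 by rewrite /k1 subKr.
have [|rt [rr krt crt]] := @sqrt_compact _ _ Z k1 kk1.
  by rewrite scale1r -s1s1; exact: rinvertibleM.
have [s1' [i1 i2]] := s1inv.
have s1k1 : s1 * k1 = k1 * s1 by rewrite /k1 mulrBr mulrBl mulr1 mul1r mulrA.
have s1rt : s1 * rt = rt * s1 by exact: crt.
pose rt' := rt * (s1' * s1').
have rtE : rt * rt = s1 * s1 by rewrite rr s1s1.
have rt1 : rt * rt' = 1.
  by rewrite /rt' mulrA rtE mulrA -(mulrA s1) i1 mulr1 i1.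
have s1'rt : s1' * rt = rt * s1' by apply/esym; exact: (rinv_comm i1 i2 (esym s1rt)).
have rt2 : rt' * rt = 1.
  by rewrite /rt' -!mulrA s1'rt (mulrA s1') s1'rt !mulrA rtE -(mulrA s1) i1 mulr1 i1.
have s1rt' : s1 * rt' = rt' * s1 by exact: (rinv_comm rt1 rt2 s1rt).
(* The root [rt] commutes with [s1], so the square of [J] is $s_1^2\,rt^{-2}=1$. *)
pose J := s1 * rt'.
have JJ : J * J = 1.
  rewrite /J mulrA -(mulrA s1 rt' s1) -s1rt' mulrA -rtE -(mulrA rt rt rt') rt1 mulr1 rt1 //.
have kJ : kk Z (J - s0).
  apply: kk_trans ks1; have -> : J - s1 = - (J * (rt - 1)).
    by rewrite mulrBr mulr1 /J -mulrA rt2 mulr1 opprB.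
  exact/kkN/kkMl.
exists ((2^-1 : C) *: (1 + J)).
  rewrite -scalAl -scalAr scalerA mulrDl mul1r mulrDr mulr1 JJ.
  have -> : 1 + J + (J + 1) = (2 : C) *: (1 + J).
    by rewrite scaler_nat mulr2n; congr (_ + _); rewrite addrC.
  by rewrite scalerA -mulrA mulVf ?mulr1// pnatr_eq0.
have -> : (2^-1 : C) *: (1 + J) - a = (2^-1 : C) *: (J - s0).
  have -> : J - s0 = 1 + J - (2 : C) *: a by rewrite /s0 opprB addrA [J + 1]addrC.
  by rewrite scalerBr scalerA mulVf ?pnatr_eq0// scale1r.
exact: kkZ.
Qed.

End LiftIdempotent.

(** In the rank factorization $M=cr$ the factors have one-sided inverses; cancelling them in
    $crcr=cr$ leaves $rc=1$. *)
Lemma idempotent_mx_factor (F : fieldType) N (M : 'M[F]_N) : M *m M = M ->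
  exists (c : 'M[F]_(N, \rank M)) (r : 'M[F]_(\rank M, N)), c *m r = M /\ r *m c = 1%:M.
Proof.
move=> MM; exists (col_base M), (row_base M).
have [c' cc] : exists c', c' *m col_base M = 1%:M by apply/row_fullP/col_base_full.
have [r' rr] : exists r', row_base M *m r' = 1%:M by apply/row_freeP/row_base_free.
have cr : col_base M *m row_base M = M by exact: mulmx_base.
split=> //; move: (col_base M) (row_base M) cr c' cc r' rr => c r cr c' cc r' rr.
have h : c *m (r *m c) *m r = c *m r by rewrite !mulmxA cr -mulmxA cr MM.
have := congr1 (fun X => c' *m X *m r') h.
by rewrite /= !mulmxA cc !mul1mx -!mulmxA rr mulmx1.
Qed.

(** * The Fredholm index by comparison with powers of the shift *)

Section Index.
Variables (R : realType) (A : banachAlgType R[i]) (Z : toeplitz A).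
Local Notation C := R[i].
Local Notation s := (tz_s Z).
Local Notation t := (tz_t Z).
Local Notation p := (tzp Z).
Local Notation P := (tzP Z).
Local Notation inv := (@rinvertible A).
Implicit Types (x y u v w T S : A).

Lemma tzPdef n : P n = 1 - s ^+ n * t ^+ n. Proof. by []. Qed.

Lemma tzpdef : p = 1 - s * t. Proof. by []. Qed.

Lemma mulDD x y u v : x * v = 0 -> y * u = 0 -> (x + y) * (u + v) = x * u + y * v.
Proof. by move=> h1 h2; rewrite mulrDl !mulrDr h1 h2 addr0 add0r. Qed.

Lemma rinv1 : inv 1. Proof. by exists 1; rewrite mulr1. Qed.

(* s^a T = u s^b modulo compacts with u invertible, so T has Fredholm index a - b. *)
Definition Ind T a b := exists2 u, inv u & kk Z (s ^+ a * T - u * s ^+ b).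

Definition Fred T := exists S, kk Z (S * T - 1) /\ kk Z (T * S - 1).

Lemma shift_push u b : inv u -> exists2 u', inv u' & s ^+ b * u = u' * s ^+ b.
Proof.
move=> [v [uv vu]].
have H x y : x * y = 1 -> (s ^+ b * x * t ^+ b + P b) * (s ^+ b * y * t ^+ b + P b) = 1.
  move=> xy; rewrite mulDD ?tz_PP; last 2 first.
  - by rewrite -mulrA tz_tP mulr0.
  - by rewrite !mulrA tz_Ps !mul0r.
  have -> : s ^+ b * x * t ^+ b * (s ^+ b * y * t ^+ b) = s ^+ b * t ^+ b.
    rewrite !mulrA -(mulrA _ (t ^+ b)) tz_tsX mulr1 -(mulrA (s ^+ b)) xy mulr1 //.
  by rewrite -tz_split.
exists (s ^+ b * u * t ^+ b + P b); first by exists (s ^+ b * v * t ^+ b + P b); split; exact: H.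
by rewrite mulrDl tz_Ps addr0 -!mulrA tz_tsX mulr1.
Qed.

Lemma Ind_congr T T' a b : kk Z (T - T') -> Ind T a b -> Ind T' a b.
Proof.
move=> k1 [u iu k2]; exists u => //; apply: kk_trans k2.
by rewrite -mulrBr; apply/kkMl/kkC.
Qed.

Lemma kk_refl x : kk Z (x - x). Proof. by rewrite subrr; exact: kk0. Qed.

Lemma Ind_mul T T' a b a' b' : Ind T a b -> Ind T' a' b' ->
  Ind (T * T') (a' + a) (b + b').
Proof.
move=> [u iu k1] [u' iu' k2].
have [u1 iu1 e1] := shift_push a' iu; have [u2 iu2 e2] := shift_push b iu'.
exists (u1 * u2); first exact: rinvertibleM.
apply: (kk_trans (y := s ^+ a' * (u * s ^+ b) * T')).
  rewrite exprD -mulrA (mulrA (s ^+ a)) mulrA -mulrBl; apply: kkMr.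
  by rewrite -mulrBr; exact: kkMl.
have -> : s ^+ a' * (u * s ^+ b) * T' = u1 * (s ^+ b * (s ^+ a' * T')).
  by rewrite (mulrA _ u) e1 -!mulrA; congr (_ * _); rewrite !mulrA -!exprD addnC.
have -> : u1 * u2 * s ^+ (b + b') = u1 * (s ^+ b * (u' * s ^+ b')).
  by rewrite (mulrA (s ^+ b)) e2 exprD !mulrA.
by rewrite -!mulrBr; do 2!apply: kkMl.
Qed.

Lemma Ind_unit u : inv u -> Ind u 0 0.
Proof. by move=> iu; exists u => //; rewrite !expr0 mul1r mulr1; exact: kk_refl. Qed.

Lemma Ind_s : Ind s 0 1.
Proof. by exists 1; [exact: rinv1|rewrite expr0 expr1 !mul1r; exact: kk_refl]. Qed.

Lemma Ind_t : Ind t 1 0.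
Proof.
exists 1; [exact: rinv1|rewrite expr0 expr1 mul1r].
by have := kk_st Z 1; rewrite !expr1.
Qed.

Lemma Ind_exp T b n : Ind T 0 b -> Ind (T ^+ n) 0 (n * b).
Proof.
move=> h; elim: n => [|n ih]; first by rewrite expr0; exact/Ind_unit/rinv1.
by rewrite exprS mulSn; exact: (Ind_mul h ih).
Qed.

(** If [v] inverts [w], then $vs^j$ is an injective compact perturbation of 1, hence invertible.
    Then $s^j$ is invertible, so $1-s^jt^j=0$, which is false for positive [j]. *)
Let shift_noninv w j : inv w -> kk Z (w - s ^+ j) -> j = 0%N.
Proof.
move=> [v [wv vw]] k1.
have k2 : kk Z (1 - v * s ^+ j) by rewrite -vw -mulrBr; exact: kkMl.
have [|[x [x0 _ kx]]] := fredholm_alternative k2; last first.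
  case/eqP: x0; move: kx; rewrite mulrBl mul1r => /eqP.
  rewrite -subr_eq0 addrAC subrr add0r oppr_eq0 => /eqP h.
  have : t ^+ j * (w * (v * s ^+ j * x)) = x.
    by rewrite -mulrA (mulrA w) wv mul1r mulrA tz_tsX mul1r.
  by rewrite h !mulr0.
rewrite subKr => -[z [z1 z2]].
have sj : s ^+ j * (z * v) = 1.
  have e : s ^+ j * z = w by rewrite -[LHS]mul1r -wv -mulrA (mulrA v) z1 mulr1.
  by rewrite mulrA e.
have tj : t ^+ j = z * v by rewrite -[LHS]mulr1 -sj mulrA tz_tsX mul1r.
have : P j = 0 by rewrite tzPdef tj sj subrr.
case: j {k1 k2 z1 z2 sj tj} => // j Pj; exfalso.
have : P j.+1 * p = p by rewrite tzPdef mulrBl mul1r -mulrA (exprSr t) -(mulrA _ t) tz_tp !mulr0 subr0.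
by rewrite Pj mul0r => /esym/eqP; rewrite (negbTE (tz_p_neq0 Z)).
Qed.

Let shift_inj w a b : inv w -> kk Z (w * s ^+ a - s ^+ b) -> a = b.
Proof.
move=> iw k; have [ab|ba] := leqP a b.
  suff /eqP : (b - a = 0)%N by rewrite subn_eq0 => ba; apply/eqP; rewrite eqn_leq ab.
  apply: (shift_noninv iw); have k1 := kkMr (t ^+ a) k.
  have sb : s ^+ b = s ^+ (b - a) * s ^+ a by rewrite -exprD subnK.
  rewrite mulrBl sb -!mulrA in k1.
  have k2 : kk Z (w - w * (s ^+ a * t ^+ a)).
    by rewrite -{1}[w]mulr1 -mulrBr; apply/kkMl/kkC/kk_st.
  apply: kk_trans k2 (kk_trans k1 _); rewrite -{2}[s ^+ (b - a)]mulr1 -(mulrBr (s ^+ (b - a))).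
  exact/kkMl/kk_st.
suff : (a - b = 0)%N by lia.
have [v [wv vw]] := iw.
apply: (@shift_noninv v); first by exists w.
have k1 := kkMl v (kkMr (t ^+ b) k).
have sa : s ^+ a = s ^+ (a - b) * s ^+ b by rewrite -exprD subnK// ltnW.
rewrite mulrBl mulrBr sa -!mulrA (mulrA v w) vw mul1r in k1.
apply: kkC; apply: (kk_trans (y := s ^+ (a - b) * (s ^+ b * t ^+ b))).
  rewrite -{1}[s ^+ (a - b)]mulr1 -(mulrBr (s ^+ (a - b))); exact/kkMl/kkC/kk_st.
apply: kk_trans k1 _; rewrite -{2}[v]mulr1 -mulrBr; exact/kkMl/kk_st.
Qed.

(** Both presentations compute $s^{a+a'}T$ modulo compacts; comparing them relates two powers of the
    shift by an invertible factor, and [shift_inj] equates the exponents. *)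
Lemma Ind_uniq T a b a' b' : Ind T a b -> Ind T a' b' -> (a + b' = a' + b)%N.
Proof.
move=> [u iu k1] [u' iu' k2].
have [u1 iu1 e1] := shift_push a' iu; have [u2 iu2 e2] := shift_push a iu'.
have [v [h1 h2]] := iu2.
apply/esym/(@shift_inj (v * u1)).
  by apply: rinvertibleM => //; exists u2.
have k3 : kk Z (u1 * s ^+ (a' + b) - u2 * s ^+ (a + b')).
  rewrite !exprD !mulrA -e1 -e2; apply: (kk_trans (y := s ^+ a' * (s ^+ a * T))).
    by apply: kkC; rewrite -(mulrA (s ^+ a') u) -mulrBr; exact: kkMl.
  rewrite mulrA -exprD addnC exprD -!mulrA -mulrBr; exact: kkMl.
by have := kkMl v k3; rewrite mulrBr !mulrA h2 mul1r.
Qed.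

(** The perturbation is absorbed into the invertible factor, which becomes $u+s^a(T'-T)t^b$; the
    compact remainder does not change. *)
Lemma Ind_near T a b : Ind T a b ->
  exists2 e : R, 0 < e & forall T', nrm (T' - T) < e -> Ind T' a b.
Proof.
move=> [u iu k].
have [e e0 he] := rinvertible_near (banach_rnorm A) iu; exists e => // T' hT.
exists (u + s ^+ a * (T' - T) * t ^+ b).
  apply: he; rewrite addrAC subrr add0r /=; apply: le_lt_trans hT.
  apply: le_trans (nrmM _ _) _; apply: le_trans (ler_wpM2l (nrm_ge0 _) (tz_tX1 Z b)) _.
  by rewrite mulr1 nrm_sX.
rewrite mulrDl -!mulrA tz_tsX mulr1 mulrBr opprD opprB addrA.
have -> : s ^+ a * T' - u * s ^+ b + (s ^+ a * T - s ^+ a * T') = s ^+ a * T - u * s ^+ b.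
  by rewrite addrC addrA subrK.
by [].
Qed.

(** For large [N] the compact idempotent factors exactly through the first [N] coordinates. It is
    thus equivalent to an idempotent matrix, and by rank factorization to the standard projection
    onto [d] coordinates. *)
Lemma kk_idempotent q : q * q = q -> kk Z q -> exists d x y, x * y = q /\ y * x = P d.
Proof.
move=> qq kq; have q0 : 0 < nrm q + 1 by rewrite ltr_wpDl// nrm_ge0.
have [N hN] := kq (2^-1 / (nrm q + 1)) ltac:(by rewrite divr_gt0// invr_gt0).
pose z := q * (s ^+ N * t ^+ N * q).
have hz : nrm z < 1.
  apply: le_lt_trans (nrmM _ _) _.
  apply: (@le_lt_trans _ _ ((nrm q + 1) * (2^-1 / (nrm q + 1)))).
    apply: ler_pM; rewrite ?nrm_ge0 ?lerDl//.
    by rewrite -mulrA; apply: le_trans (nrm_sX _ _ _) hN.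
  by rewrite mulrC divfK ?gt_eqF// invf_lt1// ltr1n.
have [g [g1 g2]] := neumann (N := banach_rnorm A) hz.
have qz : q * z = z by rewrite /z mulrA qq.
have zq : z * q = z by rewrite /z -!mulrA qq.
have qg : q * g = g * q.
  by apply: rinv_comm g1 g2 _; rewrite mulrBr mulrBl mulr1 mul1r qz zq.
pose x := q * P N; pose y := P N * q * g.
have xy : x * y = q.
  rewrite /x /y !mulrA -(mulrA q) tz_PP.
  have -> : q * P N * q = q - z.
    rewrite tzPdef mulrBr mulr1 mulrBl qq /z !mulrA //.
  by rewrite -{1}(qz) -{1}[q]mulr1 -mulrBr -mulrA g1 mulr1.
have [M hM] := eta_corner Z N (q * g * q).
have yx : y * x = eta Z M by rewrite -hM /x /y !mulrA.
have qx : q * x = x by rewrite /x mulrA qq.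
clearbody x y.
have MM : M *m M = M.
  have e : eta Z (M *m M - M) = 0.
    by rewrite etaD etaN etaM -yx -mulrA (mulrA x) xy qx subrr.
  have sub N' : eta Z (N' : 'M[C]_N) = 0 -> N' = 0.
    move=> h; apply/matrixP => i j; rewrite [RHS]mxE.
    have /eta_eq0/colP/(_ i) : eta Z (N' *m delta_mx j (0 : 'I_1)) = 0 by rewrite etaM h mul0r.
    rewrite !mxE (bigD1 j)//= big1 ?addr0 ?mxE ?eqxx ?mulr1// => l ne.
    by rewrite mxE (negbTE ne) mulr0.
  by apply/eqP; rewrite -subr_eq0; apply/eqP/sub.
have [c [r []]] := idempotent_mx_factor MM; move: (\rank M) c r => d c r cr rc.
exists d, (x * eta Z c), (eta Z r * y); split.
  by rewrite -mulrA (mulrA _ _ y) -etaM cr -yx -(mulrA y) (mulrA x) !xy qq.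
rewrite -mulrA (mulrA y) yx -!etaM -cr -!mulmxA rc mulmx1 rc eta1 //.
Qed.

Let normalize q f x y : q * q = q -> f * f = f -> x * y = q -> y * x = f ->
  exists x' y', [/\ x' * y' = q, y' * x' = f, q * x' = x', x' * f = x' & f * y' = y' /\ y' * q = y'].
Proof.
move=> qq ff xy yx.
have xfy : x * (f * y) = q by rewrite -yx -mulrA (mulrA x) xy qq.
have yqx : y * (q * x) = f by rewrite -xy -mulrA (mulrA y) yx ff.
exists (q * x * f), (f * y * q); split.
- by rewrite -!mulrA (mulrA f f) ff (mulrA f y) (mulrA x) xfy !qq.
- by rewrite -!mulrA (mulrA q q) qq (mulrA q x) (mulrA y) yqx !ff.
- by rewrite !mulrA qq.
- by rewrite -mulrA ff.
by split; [rewrite !mulrA ff|rewrite -mulrA qq].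
Qed.

Let compl_idem x y : y * x = 1 ->
  [/\ (1 - x * y) * (1 - x * y) = 1 - x * y, y * (1 - x * y) = 0 & (1 - x * y) * x = 0].
Proof.
move=> yx; have h : y * (1 - x * y) = 0 by rewrite mulrBr mulr1 mulrA yx mul1r subrr.
split=> //; last by rewrite mulrBl mul1r -mulrA yx mulr1 subrr.
by rewrite {1}mulrBl mul1r -mulrA h mulr0 subr0.
Qed.

(** For large [N] the element $V=t^NT$ has a right inverse, so its kernel projection [q] is a
    compact idempotent, equivalent to the projection onto [d] coordinates. Filling these coordinates
    with the kernel gives an invertible [w] with $V=t^dw$. *)
Lemma Fred_normal T : Fred T ->
  exists N d w, inv w /\ kk Z (T - s ^+ N * t ^+ d * w).
Proof.
move=> [S [ST TS]].
have [N hN] := TS 2^-1 ltac:(by rewrite invr_gt0).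
pose z := - (t ^+ N * (T * S - 1) * s ^+ N).
have kz : kk Z z by apply/kkN/kkMr/kkMl.
have hz : nrm z < 1.
  rewrite nrmN; apply: le_lt_trans (nrmM _ _) _.
  apply: le_lt_trans (ler_wpM2l (nrm_ge0 _) (tz_sX1 Z N)) _; rewrite mulr1.
  by apply: le_lt_trans hN _; rewrite invf_lt1// ltr1n.
have [h [h1 h2]] := neumann (N := banach_rnorm A) hz.
have zE : 1 - z = t ^+ N * T * S * s ^+ N.
  rewrite /z opprK mulrBr mulr1 mulrBl tz_tsX addrC subrK !mulrA //.
pose Rr := S * s ^+ N * h; pose V := t ^+ N * T.
have VR : V * Rr = 1 by rewrite /V /Rr !mulrA -zE h1.
have [qq Vq qR] := compl_idem VR.
have kh : kk Z (h - 1).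
  have -> : h - 1 = z * h by rewrite -[X in _ - X]h1 mulrBl mul1r subKr.
  exact: kkMr.
have kq : kk Z (1 - Rr * V).
  rewrite /Rr /V; apply: (kk_trans (y := S * s ^+ N * 1 * (t ^+ N * T))); last first.
    by apply: kk_mul (kk_refl _); apply: kk_mul (kk_refl _) _; exact: kkC.
  rewrite mulr1 -mulrA (mulrA (s ^+ N)); apply: kkC; apply: kk_trans ST.
  rewrite -mulrBr; apply: kkMl; rewrite -{2}[T]mul1r -mulrBl; apply: kkMr; exact: kk_st.
have VV : V = t ^+ N * T by [].
have [q qE] : exists q, q = 1 - Rr * V by exists (1 - Rr * V).
rewrite -qE in qq Vq qR kq; clearbody Rr V.
have [d [x0 [y0 [xy0 yx0]]]] := kk_idempotent qq kq.
have [x [y [xy yx qx xP [Py yq]]]] := normalize qq (tz_PP Z d) xy0 yx0.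
pose w := s ^+ d * V + y; pose w' := Rr * t ^+ d + x.
have w'w : w' * w = 1.
  rewrite /w /w' mulrDl !mulrDr xy.
  have -> : Rr * t ^+ d * y = 0 by rewrite -Py -mulrA (mulrA _ _ y) tz_tP mul0r mulr0.
  have -> : x * (s ^+ d * V) = 0 by rewrite -xP -mulrA (mulrA _ _ V) tz_Ps mul0r mulr0.
  have -> : Rr * t ^+ d * (s ^+ d * V) = Rr * V.
    by rewrite -mulrA (mulrA (t ^+ d)) tz_tsX mul1r.
  by rewrite addr0 add0r qE addrC subrK.
have ww' : w * w' = 1.
  rewrite /w /w' mulrDl !mulrDr yx.
  have -> : s ^+ d * V * x = 0 by rewrite -qx -mulrA (mulrA V) Vq mul0r mulr0.
  have -> : y * (Rr * t ^+ d) = 0 by rewrite -yq -mulrA (mulrA q) qR mul0r mulr0.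
  have -> : s ^+ d * V * (Rr * t ^+ d) = s ^+ d * t ^+ d.
    by rewrite -mulrA (mulrA V) VR mul1r.
  by rewrite addr0 add0r -tz_split.
have VE : V = t ^+ d * w.
  by rewrite /w mulrDr mulrA tz_tsX mul1r -Py mulrA tz_tP mul0r addr0.
exists N, d, w; split; first by exists w'.
rewrite -mulrA -VE VV mulrA; apply: kkC; rewrite -{2}[T]mul1r -mulrBl.
by apply: kkMr; exact: kk_st.
Qed.

Lemma Ind_normal T N d w : inv w -> kk Z (T - s ^+ N * t ^+ d * w) -> Ind T d N.
Proof.
move=> iw k; have [w1 iw1 e1] := shift_push N iw; exists w1 => //.
rewrite -e1; apply: (kk_trans (y := s ^+ d * (s ^+ N * t ^+ d * w))).
  by rewrite -mulrBr; exact: kkMl.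
rewrite !mulrA -exprD addnC exprD -!mulrA -mulrBr; apply: kkMl.
by rewrite mulrA -{2}[w]mul1r -mulrBl; apply: kkMr; exact: kk_st.
Qed.

Lemma Ind_exists T : Fred T -> exists a b, Ind T a b.
Proof. by move=> /Fred_normal[N [d [w [iw k]]]]; exists d, N; exact: Ind_normal k. Qed.

Lemma Ind_zero T a : Fred T -> Ind T a a -> exists2 u, inv u & kk Z (T - u).
Proof.
move=> FT hT; have [N [d [w [iw k]]]] := Fred_normal FT; exists w => //.
have dN : d = N by have := Ind_uniq hT (Ind_normal iw k); lia.
subst d; apply: kk_trans k _; rewrite -{2}[w]mul1r -mulrBl.
by apply: kkMr; exact: kk_st.
Qed.

(** Matching the complement of the range of [S] with that of [s] gives an invertible $w=St+x'$ with
    $ws=S$. *)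
Lemma Ind_isometry S T x y : T * S = 1 -> x * y = 1 - S * T -> y * x = p -> Ind S 0 1.
Proof.
move=> TS xy0 yx0; have [qq Tq qS] := compl_idem TS.
have [q qE] : exists q, q = 1 - S * T by exists (1 - S * T).
rewrite -qE in qq Tq qS xy0.
have [x' [y' [xy yx qx xp [py yq]]]] := normalize qq (tz_pp Z) xy0 yx0.
pose w := S * t + x'; pose w' := s * T + y'.
exists w; last first.
  rewrite expr0 expr1 mul1r /w mulrDl -mulrA tz_ts mulr1 -xp -mulrA tz_ps mulr0 addr0.
  exact: kk_refl.
exists w'; split; rewrite /w /w' mulrDl !mulrDr.
  have -> : S * t * y' = 0 by rewrite -py -mulrA (mulrA t) tz_tp mul0r mulr0.
  have -> : x' * (s * T) = 0 by rewrite -xp -mulrA (mulrA p) tz_ps mul0r mulr0.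
  have -> : S * t * (s * T) = S * T by rewrite -mulrA (mulrA t) tz_ts mul1r.
  by rewrite xy addr0 add0r qE addrC subrK.
have -> : s * T * x' = 0 by rewrite -qx -mulrA (mulrA T) Tq mul0r mulr0.
have -> : y' * (S * t) = 0 by rewrite -yq -mulrA (mulrA q) qS mul0r mulr0.
have -> : s * T * (S * t) = s * t by rewrite -mulrA (mulrA T) TS mul1r.
by rewrite yx addr0 add0r tzpdef addrC subrK.
Qed.

End Index.

(** * Index of matrices *)

Section MatrixIndex.
Variables (R : realType) (A : banachAlgType R[i]) (Z : toeplitz A).
Local Notation s := (tz_s Z).
Local Notation t := (tz_t Z).
Local Notation p := (tzp Z).
Local Notation inv := (@rinvertible A).

(* A decomposition of 1 into k orthogonal copies of itself: M_k(A) is then isomorphic to A. *)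
Record cuntz k := Cuntz {
  cz_u : 'I_k -> A; cz_v : 'I_k -> A;
  cz_vu : forall i j, cz_v i * cz_u j = (i == j)%:R;
  cz_uv : \sum_i cz_u i * cz_v i = 1 }.

(** A ring isomorphism from the matrices onto [A], inverse to [theta_inv]; the index of a matrix is
    read off its image. *)
Definition theta k (z : cuntz k) (M : 'M[A]_k) : A :=
  \sum_i \sum_j cz_u z i * M i j * cz_v z j.

Definition theta_inv k (z : cuntz k) (x : A) : 'M[A]_k :=
  \matrix_(i, j) (cz_v z i * x * cz_u z j).

Section Theta.
Variables (k : nat) (z : cuntz k).

Lemma thetaK : cancel (theta z) (theta_inv z).
Proof.
move=> M; apply/matrixP => i j; rewrite mxE mulr_sumr mulr_suml (bigD1 i)//=.
rewrite [X in _ + X]big1 ?addr0 => [|i' ne]; last first.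
  rewrite mulr_sumr mulr_suml big1// => j' _.
  by rewrite !mulrA cz_vu eq_sym (negbTE ne) !mul0r.
rewrite mulr_sumr mulr_suml (bigD1 j)//= big1 ?addr0 => [|j' ne].
  by rewrite !mulrA cz_vu eqxx mul1r -mulrA cz_vu eqxx mulr1.
by rewrite -!mulrA cz_vu (negbTE ne) !mulr0.
Qed.

Lemma theta_invK : cancel (theta_inv z) (theta z).
Proof.
move=> x; rewrite /theta -[RHS]mul1r -[RHS]mulr1 -[in RHS](cz_uv z) !mulr_suml.
apply: eq_bigr => i _; rewrite mulr_sumr; apply: eq_bigr => j _.
by rewrite mxE !mulrA.
Qed.

Lemma theta_invM x y : theta_inv z (x * y) = theta_inv z x *m theta_inv z y.
Proof.
apply/matrixP => i j; rewrite !mxE -[x in LHS]mulr1 -(cz_uv z) mulr_sumr !(mulr_suml, mulr_sumr).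
by apply: eq_bigr => l _; rewrite !mxE !mulrA.
Qed.

Lemma thetaM M N : theta z (M *m N) = theta z M * theta z N.
Proof. by apply: (can_inj theta_invK); rewrite theta_invM !thetaK. Qed.

Lemma thetaD M N : theta z (M + N) = theta z M + theta z N.
Proof.
rewrite /theta -big_split; apply: eq_bigr => i _; rewrite -big_split; apply: eq_bigr => j _.
by rewrite mxE mulrDr mulrDl.
Qed.

Lemma thetaN M : theta z (- M) = - theta z M.
Proof.
rewrite /theta -sumrN; apply: eq_bigr => i _; rewrite -sumrN; apply: eq_bigr => j _.
by rewrite mxE mulrN mulNr.
Qed.

Lemma thetaB M N : theta z (M - N) = theta z M - theta z N.
Proof. by rewrite thetaD thetaN. Qed.

Lemma theta1 : theta z 1%:M = 1.
Proof.
rewrite /theta -[RHS](cz_uv z); apply: eq_bigr => i _.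
rewrite (bigD1 i)//= mxE eqxx mulr1n mulr1 big1 ?addr0// => j ne.
by rewrite mxE eq_sym (negbTE ne) mulr0n mulr0 mul0r.
Qed.

Lemma theta_inv1 : theta_inv z 1 = 1%:M.
Proof. by rewrite -[RHS]thetaK theta1. Qed.

Lemma theta_unit M : invertible_mx M <-> inv (theta z M).
Proof.
split=> [[N [h1 h2]]|[x [h1 h2]]].
  by exists (theta z N); rewrite -!thetaM h1 h2 theta1.
exists (theta_inv z x); rewrite -[M]thetaK -!theta_invM h1 h2 theta_inv1 //.
Qed.

Definition mx_kk (M : 'M[A]_k) := forall i j, kk Z (M i j).

Lemma theta_kk M : mx_kk M -> kk Z (theta z M).
Proof. by move=> kM; do 2!(apply: kk_sum => ? _); apply/kkMr/kkMl. Qed.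

Lemma theta_inv_kk x : kk Z x -> mx_kk (theta_inv z x).
Proof. by move=> kx i j; rewrite mxE; apply/kkMr/kkMl. Qed.

Lemma theta_kkP M N : mx_kk (M - N) <-> kk Z (theta z M - theta z N).
Proof.
rewrite -thetaB; split=> [/theta_kk//|/theta_inv_kk].
by rewrite thetaK.
Qed.

End Theta.

Lemma pad_mxM k l (M N : 'M[A]_k) : (k <= l)%N ->
  pad_mx l (M *m N) = pad_mx l M *m pad_mx l N.
Proof.
move=> kl; rewrite -(subnKC kl) !pad_mx_block mulmx_block.
by rewrite !(mul0mx, mulmx0, addr0, add0r, mulmx1).
Qed.

Lemma pad_mx_kk k l (M N : 'M[A]_k) : mx_kk (M - N) -> mx_kk (pad_mx l M - pad_mx l N).
Proof.
move=> h i j; rewrite !mxE /ext_mx; case: insub => [i'|]; last exact: kk_refl.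
by case: insub => [j'|]; [have := h i' j'; rewrite !mxE|exact: kk_refl].
Qed.

(** Padding turns the copy of [s] in the small matrices into an element with a left inverse and a
    complement equivalent to [p], hence of the index of [s] by [Ind_isometry]. Padding the relation
    that defines the index therefore leaves the exponents unchanged. *)
Lemma Ind_pad k l (zk : cuntz k) (zl : cuntz l) (M : 'M[A]_k) a b a' b' : (k <= l)%N ->
  Ind Z (theta zk M) a b -> Ind Z (theta zl (pad_mx l M)) a' b' -> (a + b' = a' + b)%N.
Proof.
move=> kl [u iu ku] hX.
pose si := theta_inv zk s; pose ti := theta_inv zk t.
pose U := theta_inv zk u.
have iU : invertible_mx U by apply/(theta_unit zk); rewrite theta_invK.
pose pw (n : nat) : 'M[A]_k := theta_inv zk (s ^+ n).
have kM : mx_kk (pw a *m M - U *m pw b).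
  by apply/(theta_kkP zk); rewrite !thetaM !theta_invK.
pose S := theta zl (pad_mx l si); pose T := theta zl (pad_mx l ti).
have TS : T * S = 1.
  by rewrite /T /S -thetaM -pad_mxM// -theta_invM tz_ts theta_inv1 pad_mx1// theta1.
have pwE n : theta zl (pad_mx l (pw n)) = S ^+ n.
  elim: n => [|n ih]; first by rewrite /pw expr0 theta_inv1 pad_mx1// theta1 expr0.
  by rewrite /pw exprS theta_invM pad_mxM// thetaM -/(pw n) ih exprS.
have kX : kk Z (S ^+ a * theta zl (pad_mx l M) - theta zl (pad_mx l U) * S ^+ b).
  by rewrite -!pwE -!thetaM -!pad_mxM//; apply/theta_kkP/pad_mx_kk.
pose w i : 'I_l := widen_ord kl i.
(* The elements [x] and [y] implement the equivalence of [p] with the complement of [S], which is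
   supported by the first [k] blocks. *)
pose x := \sum_i cz_u zl (w i) * (cz_v zk i * p).
pose y := \sum_i (p * cz_u zk i) * cz_v zl (w i).
have yx : y * x = p.
  rewrite /y /x mulr_suml (eq_bigr (fun i => p * (cz_u zk i * cz_v zk i) * p)) => [|i _].
    by rewrite -mulr_suml -mulr_sumr cz_uv mulr1 tz_pp.
  rewrite mulr_sumr (bigD1 i)//= [X in _ + X]big1 ?addr0 => [|j ne].
    by rewrite mulrA -(mulrA _ (cz_v zl _)) cz_vu eqxx mulr1 !mulrA.
  rewrite mulrA -(mulrA _ (cz_v zl _)) cz_vu.
  have -> : (w i == w j) = (i == j) by [].
  by rewrite eq_sym (negbTE ne) mulr0 mul0r.
have xy : x * y = 1 - S * T.
  have -> : 1 - S * T = theta zl (pad_mx l (1%:M : 'M[A]_k) - pad_mx l (theta_inv zk (s * t))).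
    by rewrite thetaB pad_mx1// theta1 theta_invM pad_mxM// thetaM.
  apply: (can_inj (theta_invK zl)); rewrite thetaK; apply/matrixP => i j.
  have vx1 i1 : cz_v zl (w i1) * x = cz_v zk i1 * p.
    rewrite mulr_sumr (bigD1 i1)//= mulrA cz_vu eqxx mul1r big1 ?addr0// => i2 ne.
    by rewrite mulrA cz_vu (_ : (w i1 == w i2) = (i1 == i2))// eq_sym (negbTE ne) mul0r.
  have yu1 j1 : y * cz_u zl (w j1) = p * cz_u zk j1.
    rewrite mulr_suml (bigD1 j1)//= -mulrA cz_vu eqxx mulr1 big1 ?addr0// => j2 ne.
    by rewrite -mulrA cz_vu (_ : (w j2 == w j1) = (j2 == j1))// (negbTE ne) mulr0.
  have vx0 (i0 : 'I_l) : (k <= i0)%N -> cz_v zl i0 * x = 0.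
    move=> h; rewrite mulr_sumr big1// => i1 _; rewrite mulrA cz_vu; case: eqP => [e|_].
      by have := ltn_ord i1; rewrite ltnNge -[val i1]/(val (w i1)) -e h.
    by rewrite mul0r.
  have yu0 (j0 : 'I_l) : (k <= j0)%N -> y * cz_u zl j0 = 0.
    move=> h; rewrite mulr_suml big1// => j1 _; rewrite -mulrA cz_vu; case: eqP => [e|_].
      by have := ltn_ord j1; rewrite ltnNge -[val j1]/(val (w j1)) e h.
    by rewrite mulr0.
  have assoc (a1 a2 a3 a4 : A) : a1 * (a2 * a3) * a4 = a1 * a2 * (a3 * a4).
    by rewrite !mulrA.
  clearbody x y; rewrite !mxE assoc.
  have [ik|ik] := leqP k i; first by rewrite vx0// mul0r !ext_mx_ge ?ik// subrr.
  have [jk|jk] := leqP k j; first by rewrite yu0// mulr0 !ext_mx_ge ?jk ?orbT// subrr.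
  pose i1 := Ordinal ik; pose j1 := Ordinal jk.
  have ei : i = w i1 by apply: val_inj.
  have ej : j = w j1 by apply: val_inj.
  rewrite (ext_mxE _ i1 j1) (ext_mxE _ i1 j1) ei ej vx1 yu1 -mulrA (mulrA p) tz_pp.
  by rewrite !mxE tzpdef mulrBl mul1r mulrBr cz_vu !mulrA.
have hS := Ind_isometry TS xy yx.
have hSX := Ind_mul (Ind_exp a hS) hX.
have hU : Ind Z (theta zl (pad_mx l U) * S ^+ b) (0 + 0) (0 + b * 1).
  apply: Ind_mul (Ind_exp b hS); apply: Ind_unit; apply/theta_unit.
  exact: invertible_pad_mx.
have := Ind_uniq (Ind_congr kX hSX) hU; lia.
Qed.

End MatrixIndex.

(** * Bounded maps between function spaces *)

Section BoundedMaps.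
Variable R : realType.
Local Notation C := R[i].

Definition bounded_map (V W : normedModType C) (f : V -> W) :=
  linear f /\ exists2 K : R, 0 <= K & forall x, nrm (f x) <= K * nrm x.

Lemma bounded_map_comp (U V W : normedModType C) (f : V -> W) (g : U -> V) :
  bounded_map f -> bounded_map g -> bounded_map (f \o g).
Proof.
move=> [lf [K K0 hK]] [lg [L L0 hL]]; split.
  by move=> a x y /=; rewrite lg lf.
exists (K * L); first exact: mulr_ge0.
by move=> x /=; apply: le_trans (hK _) _; rewrite -mulrA ler_wpM2l.
Qed.

Variable X : completeNormedModType C.

Lemma bounded_map_continuous (f : X -> X) : bounded_map f -> continuous f.
Proof.
move=> [lf [K K0 hK]].
pose g : {linear X -> X} := HB.pack f (GRing.isLinear.Build C X X *:%R f lf).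
apply: (@bounded_linear_continuous _ _ _ g); apply/linear_boundedP.
exists K%:C%C; split; first by rewrite ger0_real// ler0c.
move=> r /ltW Kr x; apply: le_trans (ler_wpM2r (normr_ge0 x) Kr).
by rewrite !nrmE -rmorphM lecR.
Qed.

Definition bop_of (f : X -> X) (hf : bounded_map f) : bounded_op X :=
  BoundedOp hf.1 (bounded_map_continuous hf).

Lemma bop_le (S : bounded_op X) x : nrm (S x) <= nrm S * nrm x.
Proof.
have := opnorm_le S x; rewrite -bop_normE !nrmE -rmorphM lecR; exact.
Qed.

Lemma bopZ (S : bounded_op X) a x : S (a *: x) = a *: S x.
Proof. exact: linearZ. Qed.

Lemma bopD (S : bounded_op X) x y : S (x + y) = S x + S y.
Proof. exact: linearD. Qed.

Lemma bop0 (S : bounded_op X) : S 0 = 0.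
Proof. exact: linear0. Qed.

Lemma bopB (S : bounded_op X) x y : S (x - y) = S x - S y.
Proof. exact: linearB. Qed.

Lemma bop_sum (S : bounded_op X) (I : Type) (r : seq I) (P : pred I) (F : I -> X) :
  S (\sum_(i <- r | P i) F i) = \sum_(i <- r | P i) S (F i).
Proof. exact: linear_sum. Qed.

Lemma bop_bounded_map (S : bounded_op X) : bounded_map S.
Proof.
split; first exact: bounded_op_linear.
by exists (nrm S); [exact: nrm_ge0|exact: bop_le].
Qed.

Lemma bop_nrm_le (S : bounded_op X) (K : R) : 0 <= K ->
  (forall x, nrm (S x) <= K * nrm x) -> nrm S <= K.
Proof.
move=> K0 hK; rewrite -lecR -nrmE bop_normE; apply: opnorm_ub; first by rewrite ler0c.
by move=> x; rewrite !nrmE -rmorphM lecR.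
Qed.

Lemma bop1_le1 : nrm (1 : bounded_op X) <= 1.
Proof. by apply: bop_nrm_le => // x; rewrite bounded_op1 mul1r. Qed.

End BoundedMaps.

Section Lift.
Variables (R : realType) (s s' : fspec R).
Local Notation C := R[i].

Record fs_map := FsMap {
  fm_fun :> fspace s -> fs_pt s' -> C;
  fm_D : forall x y z, fm_fun (x + y) z = fm_fun x z + fm_fun y z;
  fm_Z : forall a x z, fm_fun (a *: x) z = a * fm_fun x z;
  fm_K : R;
  fm_K0 : 0 <= fm_K;
  fm_bound : forall x t, fs_p t (fm_fun x) <= fm_K * nrm x;
  fm_P : forall x : fspace s, fs_P x -> fs_mem (fm_fun x) }.

Variable L : fs_map.

(** Membership of the image is only assumed on the dense subspace [P]; the bound [fm_K] extends it
    to limits. *)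
Lemma fm_mem (x : fspace s) : fs_mem (L x).
Proof.
move=> e e0; have e2 : 0 < e / 2 by rewrite divr_gt0.
have K1 : 0 < fm_K L + 1 by rewrite ltr_wpDl// fm_K0.
have [y Py xy] := fs_dense x (divr_gt0 e2 K1).
have [z Pz yz] := fm_P L Py e2; exists z => // t.
have -> : (fun u => L x u - z u) = (fun u => L (x - y) u + (L y u - z u)).
  by apply/funext => u; rewrite addrA -(fm_D L) subrK.
apply: le_trans (fs_pD _ _ _) _; rewrite [leRHS]splitr lerD//.
apply: le_trans (fm_bound L _ _) _.
apply: (@le_trans _ _ ((fm_K L + 1) * (e / 2 / (fm_K L + 1)))).
  by rewrite ler_pM ?fm_K0 ?nrm_ge0 ?lerDl.
by rewrite mulrC divfK// gt_eqF.
Qed.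

Definition fs_lift (x : fspace s) : fspace s' := FSpace (fm_mem x).

Lemma fs_lift_bounded : bounded_map (fs_lift : fspace_of s -> fspace_of s').
Proof.
split.
  move=> a x y; apply: fspaceP => z /=.
  by rewrite -(fm_Z L) -(fm_D L).
exists (fm_K L); first exact: fm_K0.
move=> x; apply: nrm_le_p => [|t]; last exact: fm_bound.
by rewrite mulr_ge0 ?fm_K0 ?nrm_ge0.
Qed.

Lemma fs_lift_le x : nrm (fs_lift x : fspace s') <= fm_K L * nrm x.
Proof.
apply: nrm_le_p => [|t]; last exact: fm_bound.
by rewrite mulr_ge0 ?fm_K0 ?nrm_ge0.
Qed.

End Lift.

Section Pull.
Variables (R : realType) (s s' : fspec R).
Local Notation C := R[i].

Definition pull (rho : fs_pt s' -> option (fs_pt s)) (x : fs_pt s -> C) z : C :=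
  if rho z is Some y then x y else 0.

Record pull_map := PullMap {
  pm_rho :> fs_pt s' -> option (fs_pt s);
  pm_bound : forall t, exists t', forall x, fs_p t (pull pm_rho x) <= fs_p t' x;
  pm_P : forall x, fs_P x -> fs_mem (pull pm_rho x) }.

Variable rho : pull_map.

Lemma pull_D (x y : fspace s) z : pull rho (x + y) z = pull rho x z + pull rho y z.
Proof. by rewrite /pull; case: (rho z) => // ; rewrite addr0. Qed.

Lemma pull_Z a (x : fspace s) z : pull rho (a *: x) z = a * pull rho x z.
Proof. by rewrite /pull; case: (rho z) => // ; rewrite mulr0. Qed.

Lemma pull_bound (x : fspace s) t : fs_p t (pull rho x) <= 1 * nrm x.
Proof.
have [t' h] := pm_bound rho t; rewrite mul1r.
by apply: le_trans (h x) (p_le_nrm _ _).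
Qed.

Definition pull_fs : fs_map s s' := @FsMap _ s s' (fun x => pull rho x) pull_D pull_Z _ ler01 pull_bound (fun x => @pm_P rho x).

End Pull.

Section PullOp.
Variables (R : realType) (s : fspec R).

Definition lift_op (L : fs_map s s) : bounded_op (fspace_of s) := bop_of (fs_lift_bounded L).

Lemma lift_opE L (x : fspace s) z : (lift_op L x : fspace s) z = L x z.
Proof. by []. Qed.

Definition pull_op (rho : pull_map s s) := lift_op (pull_fs rho).

Lemma pull_op_le1 rho : nrm (pull_op rho) <= 1.
Proof. by apply: bop_nrm_le => // x; exact: (fs_lift_le (pull_fs rho)). Qed.

Lemma pull_opE rho (x : fspace s) z : (pull_op rho x : fspace s) z = pull rho x z.
Proof. by []. Qed.

Lemma fop_ext (S T : bounded_op (fspace_of s)) :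
  (forall (x : fspace s) z, (S x : fspace s) z = (T x : fspace s) z) -> S = T.
Proof. by move=> h; apply: bounded_opP => x; apply: fspaceP => z; exact: h. Qed.

End PullOp.

(** * The space l1 and its shifts *)

Section EllOne.
Variable R : realType.
Local Notation C := R[i].
Implicit Types (x y : nat -> C).

Definition l1_p (N : nat) x : R := \sum_(n < N) cn (x n).

Definition l1_P x := exists N, forall n, (N <= n)%N -> x n = 0.

Let l1_pD N x y : l1_p N (fun z => x z + y z) <= l1_p N x + l1_p N y.
Proof. by rewrite -big_split; apply: ler_sum => n _; exact: cnD. Qed.

Let l1_pZ N a x : l1_p N (fun z => a * x z) = cn a * l1_p N x.
Proof. by rewrite /l1_p mulr_sumr; apply: eq_bigr => n _; rewrite cnM. Qed.

Let l1_pfin N : exists zs : seq nat, exists2 K : R, 0 <= K &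
  forall u, l1_p N u <= K * \sum_(z <- zs) cn (u z).
Proof.
exists (iota 0 N), 1 => // u; rewrite mul1r /l1_p.
by rewrite -(big_mkord xpredT (fun n => cn (u n))) /index_iota subn0.
Qed.

Let l1_psep z : exists N, exists2 K : R, 0 <= K & forall u, cn (u z) <= K * l1_p N u.
Proof.
exists z.+1, 1 => // u; rewrite mul1r /l1_p big_ord_recr /= lerDr.
by apply: sumr_ge0 => n _; exact: cn_ge0.
Qed.

Let l1_P0 : l1_P (fun=> 0). Proof. by exists 0%N. Qed.

Let l1_PD x y : l1_P x -> l1_P y -> l1_P (fun z => x z + y z).
Proof.
move=> [N hN] [M hM]; exists (maxn N M) => n; rewrite geq_max => /andP[Nn Mn].
by rewrite hN// hM// addr0.
Qed.

Let l1_PZ a x : l1_P x -> l1_P (fun z => a * x z).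
Proof. by move=> [N hN]; exists N => n /hN ->; rewrite mulr0. Qed.

Lemma l1_p_mono N M x : (N <= M)%N -> l1_p N x <= l1_p M x.
Proof.
move=> NM; rewrite /l1_p -(subnKC NM) big_split_ord /= lerDl.
by apply: sumr_ge0 => n _; exact: cn_ge0.
Qed.

Let l1_Pbd x : l1_P x -> exists M, forall N, l1_p N x <= M.
Proof.
move=> [N hN]; exists (l1_p N x) => M; have [NM|MN] := leqP N M; last exact/l1_p_mono/ltnW.
rewrite /l1_p -(subnKC NM) big_split_ord /= gerDl le_eqVlt big1 ?eqxx// => n _.
by rewrite hN ?leq_addr// cn0.
Qed.

Definition ell1 : fspec R :=
  FSpec l1_pD l1_pZ l1_pfin l1_psep l1_P0 l1_PD l1_PZ l1_Pbd.

Notation l1 := (fspace ell1).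
Implicit Types (f g : l1).

Lemma l1_p_ge0 N x : 0 <= l1_p N x.
Proof. by apply: sumr_ge0 => n _; exact: cn_ge0. Qed.

Lemma l1_le f M : (forall N, l1_p N f <= M) -> nrm f <= M.
Proof. by move=> h; apply: nrm_le_p => //; exact: le_trans (l1_p_ge0 0 f) (h 0%N). Qed.

Lemma l1_p_le N f : l1_p N f <= nrm f.
Proof. exact: (p_le_nrm (s := ell1)). Qed.

Lemma l1_near f (e : R) : 0 < e -> exists N, nrm f <= l1_p N f + e.
Proof.
move=> e0; apply: contrapT => h.
have : nrm f <= nrm f - e.
  apply: l1_le => N; rewrite lerBrDr leNgt; apply/negP => /ltW h'.
  by apply: h; exists N.
lra.
Qed.

Lemma l1_p_uniq (r : seq nat) : uniq r ->
  exists M, forall x, \sum_(k <- r) cn (x k) <= l1_p M x.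
Proof.
move=> hu.
have [M hM] : exists M, forall k, k \in r -> (k < M)%N.
  by exists (\max_(k <- r) k).+1 => k kr; rewrite ltnS; exact: leq_bigmax_seq.
exists M => x.
have -> : l1_p M x = \sum_(k <- iota 0 M) cn (x k).
  by rewrite /l1_p -(big_mkord xpredT (fun n => cn (x n))) /index_iota subn0.
rewrite [leRHS](bigID (fun k => k \in r)) /= -[leLHS]addr0 lerD//.
  rewrite -[leRHS]big_filter le_eqVlt; apply/orP; left; apply/eqP; apply: perm_big.
  apply: uniq_perm => //; first by rewrite filter_uniq// iota_uniq.
  move=> k; rewrite mem_filter mem_iota add0n /= andb_idr//; exact: hM.
by apply: sumr_ge0 => k _; exact: cn_ge0.
Qed.

(* Injective partial maps of the index set give contractions. *)
Lemma l1_pull_p (rho rho' : nat -> option nat) :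
  (forall n k, rho n = Some k -> rho' k = Some n) ->
  forall N, exists M, forall x, l1_p N (pull (s := ell1) (s' := ell1) rho x) <= l1_p M x.
Proof.
move=> h N.
have hu : uniq (pmap rho (iota 0 N)).
  elim: (iota 0 N) (iota_uniq 0 N) => //= n r ih /andP[nr /ih ur].
  rewrite /oapp; case e: (rho n) => [k|] //=; rewrite ur andbT.
  apply: contra nr; rewrite mem_pmap => /mapP[n' n'r e'].
  by have := h _ _ (esym e'); rewrite (h _ _ e) => -[->].
have [M hM] := l1_p_uniq hu; exists M => x; apply: le_trans (hM x).
rewrite le_eqVlt; apply/orP; left; apply/eqP.
rewrite /l1_p -(big_mkord xpredT (fun n => cn (pull (s := ell1) (s' := ell1) rho x n))) /index_iota subn0.
elim: (iota 0 N) => [|n r ih]; first by rewrite !big_nil.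
rewrite big_cons ih /= /oapp /pull; case: (rho n) => [k|]; first by rewrite big_cons.
by rewrite cn0 add0r.
Qed.

Lemma l1_pull_P (rho rho' : nat -> option nat) :
  (forall n k, rho n = Some k -> rho' k = Some n) ->
  forall x, l1_P x -> fs_mem (s := ell1) (pull (s := ell1) (s' := ell1) rho x).
Proof.
move=> h x [N hN]; apply: fs_memP.
exists (\max_(k < N) (odflt 0%N (rho' k))).+1 => n nk; rewrite /pull.
case e: (rho n) => [k|] //; apply: hN; rewrite leqNgt; apply/negP => kN.
move: nk; rewrite ltnNge => /negP; apply.
have := @leq_bigmax _ (fun k : 'I_N => odflt 0%N (rho' k)) (Ordinal kN).
by rewrite /= (h _ _ e).
Qed.

Definition l1_pull (rho rho' : nat -> option nat)
    (h : forall n k, rho n = Some k -> rho' k = Some n) : pull_map ell1 ell1 :=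
  @PullMap _ ell1 ell1 rho (l1_pull_p h) (l1_pull_P h).

Local Notation B := (bounded_op (fspace_of ell1)).

Let sucP n k : (if n is n'.+1 then Some n' else None) = Some k -> Some k.+1 = Some n.
Proof. by case: n => // n [->]. Qed.

Let predP n k : Some n.+1 = Some k -> (if k is k'.+1 then Some k' else None) = Some n.
Proof. by case=> <-. Qed.

Definition l1_s : B := pull_op (l1_pull sucP).
Definition l1_t : B := pull_op (l1_pull predP).

Let sE f n : (l1_s f : l1) n = if n is n'.+1 then f n' else 0.
Proof. by rewrite pull_opE /pull /=; case: n. Qed.

Let tE f n : (l1_t f : l1) n = f n.+1.
Proof. by []. Qed.

Let pE f n : ((1 - l1_s * l1_t) f : l1) n = if n is 0%N then f 0%N else 0.
Proof.
change (((f : l1) - l1_s (l1_t f)) n = if n is 0%N then f 0%N else 0).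
by rewrite fvalB sE; case: n => [|n]; rewrite ?subr0 ?tE ?subrr.
Qed.

Let delta0_P : l1_P (fun n => (n == 0%N)%:R).
Proof. by exists 1%N; case. Qed.

Definition l1_e0 : l1 := FSpace (fs_memP (s := ell1) delta0_P).

Let pf f : ((1 - l1_s * l1_t) f : l1) = f 0%N *: l1_e0.
Proof.
by apply: fspaceP => n; rewrite pE fvalZ /=; case: n => [|n] /=; rewrite ?mulr1// mulr0.
Qed.

Lemma l1_tX_val N f n : ((l1_t ^+ N) f : l1) n = f (N + n)%N.
Proof.
elim: N n => [|N ih] n; first by rewrite expr0.
rewrite exprS; change ((l1_t ((l1_t ^+ N) f) : l1) n = f (N.+1 + n)%N).
by rewrite tE ih addnS.
Qed.

Lemma l1_p_tail N M f : l1_p M ((l1_t ^+ N) f : l1) + l1_p N f = l1_p (N + M) f.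
Proof.
rewrite /l1_p big_split_ord addrC; congr (_ + _).
by apply: eq_bigr => n _; rewrite l1_tX_val.
Qed.

Lemma l1_tail f (e : R) : 0 < e -> exists N, nrm ((l1_t ^+ N) f) <= e.
Proof.
move=> /(l1_near f)[N hN]; exists N; apply: l1_le => M.
by have := l1_p_tail N M f; have := l1_p_le (N + M) f; lra.
Qed.

Let ts1 : l1_t * l1_s = 1.
Proof. by apply: fop_ext => f n; rewrite bounded_opM tE sE bounded_op1. Qed.

Let rank1 (c : B) : exists a : C,
  (1 - l1_s * l1_t) * c * (1 - l1_s * l1_t) = a *: (1 - l1_s * l1_t).
Proof.
exists ((c l1_e0 : l1) 0%N); apply: bounded_opP => f.
change ((1 - l1_s * l1_t) (c ((1 - l1_s * l1_t) f)) =
  (c l1_e0 : l1) 0%N *: (1 - l1_s * l1_t) f).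
rewrite (pf f) !bopZ; apply: fspaceP => n.
by rewrite !fvalZ (pf (c l1_e0)) !fvalZ mulrCA.
Qed.

Let p_neq0 : 1 - l1_s * l1_t != 0.
Proof.
apply/eqP => h; have := pE l1_e0 0; rewrite h /= => /eqP.
by rewrite eq_sym oner_eq0.
Qed.

(** After composition with the rank-one projection only the vector [x l1_e0] matters, and tails of a
    single vector tend to zero. *)
Let decay (x : B) (e : R) : 0 < e -> exists N, nrm (l1_t ^+ N * x * (1 - l1_s * l1_t)) <= e.
Proof.
move=> e0; have [N hN] := l1_tail (x l1_e0) e0; exists N.
apply: bop_nrm_le => [|f]; first exact: ltW.
have -> : (l1_t ^+ N * x * (1 - l1_s * l1_t)) f =
    (f : l1) 0%N *: (l1_t ^+ N) (x (l1_e0 : fspace_of ell1)).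
  rewrite -mulrA !bounded_opM -!linearZ /=; congr ((l1_t ^+ N) (x _)); exact: pf.
rewrite nrmZ mulrC ler_pM ?nrm_ge0 ?cn_ge0//.
by have := l1_p_le 1 f; rewrite /l1_p big_ord_recl big_ord0 addr0.
Qed.

Definition l1_toeplitz : toeplitz B :=
  Toeplitz ts1 (pull_op_le1 _) (pull_op_le1 _) (bop1_le1 _) rank1 p_neq0 decay.

End EllOne.

(** * Self-similar function spaces have a swindle *)

Section SelfSimilar.
Variables (R : realType) (s : fspec R).
Local Notation Z := (fs_pt s).
Local Notation F := (fspace s).
Local Notation A := (bounded_op (fspace_of s)).
Implicit Types (x : A) (v : F).

Definition pullable (rho : Z -> option Z) :=
  (forall t, exists t', forall u, fs_p t (pull (s := s) (s' := s) rho u) <= fs_p t' u) /\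
  forall u, fs_P u -> fs_mem (pull (s := s) (s' := s) rho u).

Definition pull_of rho (h : pullable rho) : A := pull_op (PullMap h.1 h.2).

Lemma pull_ofE rho (h : pullable rho) v z :
  (pull_of h v : F) z = if rho z is Some y then v y else 0.
Proof. by []. Qed.

(* Copies of the set D of points, indexed by nat and jointly embedded in D. *)
Record selfsim := SelfSim {
  ss_D : Z -> bool;
  ss_cod : nat -> Z -> Z;
  ss_dec : Z -> option (nat * Z);
  ss_decP : forall z k y, ss_dec z = Some (k, y) -> z = ss_cod k y /\ ss_D y;
  ss_codK : forall k y, ss_D y -> ss_dec (ss_cod k y) = Some (k, y);
  ss_e : pullable (fun z => if ss_D z then Some z else None);
  ss_t : forall k, pullable (fun z => if ss_D z then Some (ss_cod k z) else None);
  ss_s : forall k, pullable (fun z =>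
    if ss_dec z is Some (l, y) then if l == k then Some y else None else None);
  ss_sp : pullable (fun z => if ss_dec z is Some (l.+1, y) then Some (ss_cod l y) else None);
  ss_tp : pullable (fun z => if ss_dec z is Some (l, y) then Some (ss_cod l.+1 y) else None);
  ss_fin : forall u, fs_P u -> exists K, forall k z, (K <= k)%N -> ss_D z -> u (ss_cod k z) = 0;
  ss_bound : forall (K : R) v (w : nat -> F), 0 <= K ->
    (forall k, nrm (w k) <= K * nrm (pull_of (ss_t k) v)) ->
    forall t, fs_p t (fun z => if ss_dec z is Some (k, y) then w k y else 0) <= K * nrm v }.

Variable d : selfsim.
Local Notation D := (ss_D d).
Local Notation cod := (ss_cod d).
Local Notation dec := (ss_dec d).

Definition ss_op := pull_of (ss_e d).
Let tt k := pull_of (ss_t d k).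
Let sk k := pull_of (ss_s d k).
Let sp := pull_of (ss_sp d).
Let tp := pull_of (ss_tp d).

Lemma ss_opE v z : (ss_op v : F) z = if D z then v z else 0.
Proof. by rewrite pull_ofE; case: (D z). Qed.

Let ttE k v z : (tt k v : F) z = if D z then v (cod k z) else 0.
Proof. by rewrite pull_ofE; case: (D z). Qed.

Lemma ss_opee : ss_op * ss_op = ss_op.
Proof. by apply: fop_ext => v z; rewrite bounded_opM !ss_opE; case: (D z). Qed.

Definition ss_rep_val (x : A) (v : F) z : R[i] :=
  if dec z is Some (k, y) then (x (tt k v) : F) y else 0.

Let rep_bound x v t : fs_p t (ss_rep_val x v) <= nrm x * nrm v.
Proof.
apply: (@ss_bound d (nrm x) v (fun k => x (tt k v) : F)); first exact: nrm_ge0.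
by move=> k; exact: bop_le.
Qed.

(** On the generating subspace only finitely many copies are nonzero by [ss_fin], so the repetition
    is a finite sum of elements of the space. *)
Let rep_P x v : fs_P v -> fs_mem (ss_rep_val x v).
Proof.
move=> Pv; have [K hK] := ss_fin d Pv.
suff <- : fval (\sum_(k < K) (sk k (x (tt k v)) : F)) = ss_rep_val x v by exact: fvalP.
apply/funext => z; rewrite fval_sum /ss_rep_val.
case e: (dec z) => [[k y]|]; last first.
  by rewrite big1// => k _; rewrite pull_ofE e.
have [kK|Kk] := ltnP k K.
  rewrite (@big_only1 _ _ _ _ (Ordinal kK))// => [|l ne _].
    by rewrite pull_ofE e (_ : (k == Ordinal kK) = true)//; exact: eqxx.
  by rewrite pull_ofE e; move: ne; rewrite -val_eqE /= eq_sym => /negbTE ->.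
rewrite big1 => [|l _].
  have -> : tt k v = 0.
    apply: fspaceP => z'; rewrite ttE; case: ifP => // Dz; exact: hK.
  by rewrite linear0.
rewrite pull_ofE e; case: eqP => // kl; move: Kk (ltn_ord l); rewrite kl; lia.
Qed.

Let rep_D x v w z : ss_rep_val x (v + w) z = ss_rep_val x v z + ss_rep_val x w z.
Proof.
rewrite /ss_rep_val; case: (dec z) => [[k y]|]; last by rewrite addr0.
by rewrite !bopD.
Qed.

Let rep_Z x a v z : ss_rep_val x (a *: v) z = a * ss_rep_val x v z.
Proof.
rewrite /ss_rep_val; case: (dec z) => [[k y]|]; last by rewrite mulr0.
by rewrite !bopZ.
Qed.

Definition ss_rep x : A :=
  lift_op (FsMap (rep_D x) (rep_Z x) (nrm_ge0 x) (rep_bound x) (@rep_P x)).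

Let repE x v z : (ss_rep x v : F) z = if dec z is Some (k, y) then (x (tt k v) : F) y else 0.
Proof. by []. Qed.

Let corner0 x v z : ss_op * x = x -> ~~ D z -> (x v : F) z = 0.
Proof. by move=> <- Dz; rewrite bounded_opM ss_opE (negbTE Dz). Qed.

(** The maps [sk 0] and [tt 0] insert and extract copy 0, while [sp] and [tp] shift all copies by
    one place; the repetition is therefore one copy together with a shifted repetition. *)
Lemma ss_swindle : swindle ss_op.
Proof.
apply: (@Swindle _ _ ss_op ss_rep (sk 0) (tt 0) sp tp).
- move=> x y; apply: fop_ext => v z; rewrite fvalD !repE.
  by case: (dec z) => [[k w]|] //; rewrite addr0.
- move=> x y [ex xe] [ey ye]; apply: fop_ext => v z; rewrite bounded_opM !repE.
  case: (dec z) => [[k w]|] //; rewrite bounded_opM; congr ((x _ : F) w).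
  apply: fspaceP => z'; rewrite ttE; have [Dz|Dz] := boolP (D z').
    by have := repE y v (cod k z'); rewrite ss_codK// => ->.
  exact: corner0.
- move=> x [ex xe]; apply: fop_ext => v z; rewrite fvalD !bounded_opM repE !pull_ofE.
  case e: (dec z) => [[[|k] w]|]; cbv beta iota; rewrite ?eqxx ?addr0 ?add0r//.
  have [zE Dw] := ss_decP e; have := repE x (tp v) (cod k w); rewrite ss_codK// => ->.
  congr ((x _ : F) w).
  by apply: fspaceP => z'; rewrite !ttE; case: ifP => // Dz; rewrite pull_ofE ss_codK.
- move=> x [ex xe]; apply: fop_ext => v z; rewrite !bounded_opM ttE.
  have [Dz|Dz] := boolP (D z); last by rewrite corner0.
  by rewrite pull_ofE ss_codK.
- move=> x [ex xe]; apply: fop_ext => v z; rewrite !bounded_opM ttE.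
  by have [Dz|Dz] := boolP (D z) => //; rewrite pull_ofE ss_codK.
- move=> x [ex xe]; apply: fop_ext => v z; rewrite !bounded_opM pull_ofE.
  case e: (dec z) => [[k w]|] //; have [zE Dw] := ss_decP e.
  by rewrite pull_ofE ss_codK.
- move=> x [ex xe]; apply: fop_ext => v z; rewrite !bounded_opM pull_ofE.
  case e: (dec z) => [[k w]|]; last by rewrite repE e.
  have [zE Dw] := ss_decP e.
  by rewrite pull_ofE ss_codK// zE.
Qed.

End SelfSimilar.

(** * Matrix units, swindle and gliding humps in l1 *)

Section EllOneOperators.
Variable R : realType.
Local Notation C := R[i].
Local Notation l1 := (fspace (ell1 R)).
Local Notation B := (bounded_op (fspace_of (ell1 R))).
Implicit Types (f g : l1).

Lemma bop_sumE (X : completeNormedModType C) (I : Type) (r : seq I) (P : pred I)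
    (F : I -> bounded_op X) (x : X) :
  (\sum_(i <- r | P i) F i) x = \sum_(i <- r | P i) F i x.
Proof. by elim/big_rec2: _ => // i S y _ <-. Qed.

Section Residues.
Variable (k : nat).
Hypothesis k0 : (0 < k)%N.

Let vP (i : 'I_k) n m : Some (n * k + i)%N = Some m ->
  (if (m %% k == i)%N then Some (m %/ k)%N else None) = Some n.
Proof.
by move=> [<-]; rewrite modnMDl modn_small// eqxx divnMDl// divn_small// addn0.
Qed.

Let uP (i : 'I_k) n m : (if (n %% k == i)%N then Some (n %/ k)%N else None) = Some m ->
  Some (m * k + i)%N = Some n.
Proof. by case: eqP => // <- [<-]; rewrite -divn_eq. Qed.

Let v i : B := pull_op (l1_pull R (@vP i)).
Let u i : B := pull_op (l1_pull R (@uP i)).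

Let vE i f n : (v i f : l1) n = f (n * k + i)%N. Proof. by []. Qed.

Let uE i f n : (u i f : l1) n = if (n %% k == i)%N then f (n %/ k)%N else 0.
Proof. by rewrite pull_opE /pull /=; case: eqP. Qed.

Let vu i j : v i * u j = (i == j)%:R.
Proof.
apply: fop_ext => f n; rewrite bounded_opM vE uE modnMDl modn_small//.
rewrite divnMDl// divn_small// addn0; have [->|ne] := eqVneq i j; first by rewrite eqxx.
by rewrite (negbTE (ne : val i != val j)).
Qed.

Let uv : \sum_i u i * v i = 1.
Proof.
apply: fop_ext => f n; rewrite bop_sumE fval_sum.
rewrite (@big_only1 _ _ _ _ (Ordinal (ltn_pmod n k0)))// => [|j ne _]; rewrite bounded_opM uE.
  by rewrite eqxx vE /= -divn_eq.
by case: eqP => // e; case/eqP: ne; apply: val_inj.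
Qed.

(** The residue classes modulo [k] split the index set into [k] copies of itself. *)
Definition l1_cuntz : cuntz B k := Cuntz vu uv.

End Residues.

Let cod (k n : nat) : nat := pickle (k, n).
Let dec (z : nat) : option (nat * nat) := pickle_inv z.

Let decP z k y : dec z = Some (k, y) -> z = cod k y /\ true.
Proof. by move=> e; have := @pickle_invK (nat * nat)%type z; rewrite /dec in e *; rewrite e. Qed.

Let codK k y : true -> dec (cod k y) = Some (k, y).
Proof. by move=> _; exact: pickleK_inv. Qed.

Let pullP (rho rho' : nat -> option nat) :
  (forall n k, rho n = Some k -> rho' k = Some n) -> pullable (s := ell1 R) rho.
Proof. by move=> h; split; [exact: (l1_pull_p R h)|exact: (l1_pull_P h)]. Qed.

Let eP : pullable (s := ell1 R) (fun z : nat => if true then Some z else None).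
Proof. by apply: (pullP (rho' := Some)) => n k [->]. Qed.

Let tP k : pullable (s := ell1 R) (fun z : nat => if true then Some (cod k z) else None).
Proof.
apply: (pullP (rho' := fun z => if dec z is Some (l, y) then if l == k then Some y else None else None)).
by move=> n m [<-]; rewrite codK// eqxx.
Qed.

Let sP k : pullable (s := ell1 R) (fun z : nat =>
  if dec z is Some (l, y) then if l == k then Some y else None else None).
Proof.
apply: (pullP (rho' := fun z => Some (cod k z))) => n m.
by case e: (dec n) => [[l y]|] //; case: eqP => // <- [<-]; have [->] := decP e.
Qed.

Let spP : pullable (s := ell1 R) (fun z : nat =>
  if dec z is Some (l.+1, y) then Some (cod l y) else None).
Proof.
apply: (pullP (rho' := fun z => if dec z is Some (l, y) then Some (cod l.+1 y) else None)) => n m.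
case e: (dec n) => [[[|l] y]|] // [<-]; rewrite codK//; have [->] := decP e; done.
Qed.

Let tpP : pullable (s := ell1 R) (fun z : nat =>
  if dec z is Some (l, y) then Some (cod l.+1 y) else None).
Proof.
apply: (pullP (rho' := fun z => if dec z is Some (l.+1, y) then Some (cod l y) else None)) => n m.
case e: (dec n) => [[l y]|] // [<-]; rewrite codK//; have [->] := decP e; done.
Qed.

Let dec_bound N : exists K, forall n k y, (n < N)%N -> dec n = Some (k, y) -> (k < K)%N.
Proof.
exists (\max_(n < N) (odflt (0, 0)%N (dec n)).1).+1 => n k y nN e; rewrite ltnS.
have := @leq_bigmax _ (fun n : 'I_N => (odflt (0, 0)%N (dec n)).1) (Ordinal nN).
by rewrite /= e.
Qed.

Let fin u : l1_P u -> exists K, forall k z, (K <= k)%N -> true -> u (cod k z) = 0 :> C.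
Proof.
move=> [N hN]; have [K hK] := dec_bound N; exists K => k z Kk _; apply: hN.
by rewrite leqNgt; apply/negP => /hK/(_ (codK k z isT)); rewrite ltnNge Kk.
Qed.

(** The copies occupy disjoint sets of indices, so their norms add up inside the norm of [f]; this
    additivity gives the bound for repetitions. *)
Let sum_t K f : \sum_(k < K) nrm (pull_of (tP k) f : l1) <= nrm f.
Proof.
apply/ler_addgt0Pr => e e0; have K0 : 0 < K.+1%:R :> R by rewrite ltr0n.
have /choice[N hN] k : exists N, nrm (pull_of (tP k) f) <=
    l1_p N (pull_of (tP k) f : l1) + e / K.+1%:R.
  exact/l1_near/divr_gt0.
pose M := \max_(k < K) N k.
apply: (@le_trans _ _ (\sum_(k < K) (l1_p M (pull_of (tP k) f : l1) + e / K.+1%:R))).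
  apply: ler_sum => k _; apply: le_trans (hN k) _; rewrite lerD2r; apply: l1_p_mono.
  exact: leq_bigmax.
rewrite big_split /= lerD//; last first.
  rewrite sumr_const card_ord -[leLHS]mulr_natr mulrAC ler_pdivrMr//.
  by rewrite ler_wpM2l ?ler_nat// ltW.
have hu : uniq [seq cod k n | k <- iota 0 K, n <- iota 0 M].
  rewrite allpairs_uniq ?iota_uniq// => -[a b] [a' b'] _ _ /= h.
  by have := codK a b isT; rewrite h codK// => -[-> ->].
have [L hL] := l1_p_uniq R hu; apply: le_trans (l1_p_le L f); apply: le_trans (hL f).
rewrite [X in _ <= \sum_(_ <- X) _](_ : _ = [seq cod p.1 p.2 | p <- [seq (k, n) | k <- iota 0 K, n <- iota 0 M]]); last by rewrite map_allpairs.
rewrite big_map big_allpairs -(big_mkord xpredT (fun k => l1_p M (pull_of (tP k) f : l1))) /index_iota subn0.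
apply: ler_sum => k _; rewrite /l1_p -(big_mkord xpredT (fun n => cn ((pull_of (tP k) f : l1) n))).
by rewrite /index_iota subn0.
Qed.

Let bound (K : R) f (w : nat -> l1) : 0 <= K ->
  (forall k, nrm (w k) <= K * nrm (pull_of (tP k) f)) ->
  forall N, l1_p N (fun z => if dec z is Some (k, y) then w k y else 0) <= K * nrm f.
Proof.
move=> K0 hw N; have [L hL] := dec_bound N.
apply: (@le_trans _ _ (\sum_(k < L) l1_p N (pull_of (sP k) (w k) : l1))).
  rewrite exchange_big /=; apply: ler_sum => n _.
  case e: (dec n) => [[k y]|]; last by rewrite cn0; apply: sumr_ge0 => k _; exact: cn_ge0.
  rewrite (bigD1 (Ordinal (hL _ _ _ (ltn_ord n) e)))//= /pull /= e eqxx lerDl.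
  by apply: sumr_ge0 => l _; exact: cn_ge0.
apply: (@le_trans _ _ (\sum_(k < L) K * nrm (pull_of (tP k) f : l1))); last first.
  by rewrite -mulr_sumr ler_wpM2l.
apply: ler_sum => k _; apply: le_trans (hw k); apply: le_trans (l1_p_le _ _) _.
apply: le_trans (bop_le _ _) _; rewrite -[leRHS]mul1r ler_wpM2r ?nrm_ge0//.
exact: pull_op_le1.
Qed.

Definition l1_selfsim : selfsim (ell1 R) :=
  @SelfSim R (ell1 R) (fun=> true) cod dec decP codK eP tP sP spP tpP fin bound.

Lemma l1_swindle : swindle (1 : B).
Proof.
have <- : ss_op l1_selfsim = 1 by apply: fop_ext => f n; rewrite ss_opE.
exact: ss_swindle.
Qed.

(** Averaged over the two signs, adding [b] does not decrease the modulus of [a]; used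
    coordinatewise to choose the sign of the next hump. *)
Lemma cn_sign_max (a b : C) : 2 * cn a <= cn (a + b) + cn (a - b).
Proof.
have := cnD (a + b) (a - b); rewrite addrACA subrr addr0 -mulr2n -(mulr_natl a) cnM.
by have -> : cn (2 : C) = 2 by rewrite -[2 : C](rmorph_nat (real_complex R)) cn_real ger0_norm.
Qed.

(* Gliding hump: an unconditionally bounded series in l_1 has uniformly small tails. *)
Lemma l1_unconditional (I : eqType) (psi : I -> l1) (M : R) :
  (forall (J : seq I) (th : I -> C), uniq J -> (forall j, cn (th j) <= 1) ->
    nrm (\sum_(j <- J) th j *: psi j) <= M) ->
  forall e : R, 0 < e -> exists N, forall (J : seq I) (th : I -> C), uniq J ->
    (forall j, cn (th j) <= 1) ->
    nrm ((l1_t R ^+ N) (\sum_(j <- J) th j *: psi j : fspace_of _)) <= e.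
Proof.
move=> hM e e0; apply: contrapT => /forallNP h.
(* If tails were not uniformly small, each round would add at least [e / 2] to the norm of a
   combination, eventually exceeding [M]. *)
have hump K : exists J (th : I -> C) N, [/\ uniq J, forall j, cn (th j) <= 1 &
    K%:R * (e / 2) <= l1_p N (\sum_(j <- J) th j *: psi j)].
  elim: K => [|K [J [th [N [uJ hth hN]]]]].
    by exists [::], (fun=> 0), 0%N; split=> // [j|]; rewrite ?cn0// mul0r l1_p_ge0.
  have [N2 N2N hN2] : exists2 N2, (N <= N2)%N &
      \sum_(j <- J) nrm ((l1_t R ^+ N2) (psi j : fspace_of _)) <= e / 4.
    have : forall d : R, 0 < d -> exists2 N2, (N <= N2)%N & forall n, (N2 <= n)%N ->
       \sum_(j <- J) nrm ((l1_t R ^+ n) (psi j : fspace_of _)) <= d.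
      elim: (J) => [|j r ih] d d0; first by exists N => // n _; rewrite big_nil ltW.
      have d2 : 0 < d / 2 by rewrite divr_gt0.
      have [N1 NN1 hN1] := ih _ d2; have [N3 hN3] := l1_tail (psi j) d2.
      exists (maxn N1 N3) => [|n]; first by rewrite leq_max NN1.
      rewrite geq_max => /andP[n1 n3]; rewrite big_cons [leRHS](splitr d) lerD ?hN1//.
      apply: le_trans hN3; rewrite -(subnK n3) exprD bounded_opM.
      apply: le_trans (bop_le _ _) _; rewrite -[leRHS]mul1r ler_wpM2r ?nrm_ge0//.
      exact: (tz_tX1 (l1_toeplitz R)).
    by move=> /(_ (e / 4))[|N2 NN2 hN2]; [rewrite divr_gt0|exists N2 => //; exact: hN2].
  have /existsNP[J' /existsNP[th' /not_implyP[uJ' /not_implyP[hth' /negP]]]] := h N2.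
  rewrite -ltNge => hump.
  (* Indices already in use are dropped, at a cost of at most [e / 4] beyond [N2]; another [e / 4]
     is lost by truncating at [N3], so [e / 2] of the new tail remains. *)
  pose J2 := [seq j <- J' | j \notin J].
  pose z : l1 := \sum_(j <- J) th j *: psi j; pose y : l1 := \sum_(j <- J2) th' j *: psi j.
  have hy : 3 / 4 * e <= nrm ((l1_t R ^+ N2) (y : fspace_of _)).
    pose y' : l1 := \sum_(j <- J' | j \in J) th' j *: psi j.
    have yE : \sum_(j <- J') th' j *: psi j = y' + y.
      by rewrite /y big_filter (bigID (fun j => j \in J)).
    have : nrm ((l1_t R ^+ N2) (y' : fspace_of _)) <= e / 4.
      apply: le_trans hN2; rewrite (bop_sum (l1_t R ^+ N2)); apply: le_trans (nrm_sum _ _ _) _.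
      rewrite -big_filter.
      apply: (@le_trans _ _ (\sum_(j <- [seq i <- J' | i \in J]) nrm ((l1_t R ^+ N2) (psi j : fspace_of _)))).
        apply: ler_sum => j _; rewrite bopZ nrmZ -[leRHS]mul1r ler_wpM2r ?nrm_ge0//.
      have pj : perm_eq [seq i <- J' | i \in J] [seq i <- J | i \in J'].
        apply: uniq_perm; rewrite ?filter_uniq// => j.
        by rewrite !mem_filter andbC.
      rewrite (perm_big _ pj) /= big_filter [leRHS](bigID (fun j => j \in J')) /= lerDl.
      by apply: sumr_ge0 => j _; exact: nrm_ge0.
    move: hump; rewrite yE bopD => hump h1.
    have := lt_le_trans hump (nrmD _ _); lra.
  have [N3 hN3] : exists N3, e / 2 <= l1_p N3 ((l1_t R ^+ N2) (y : fspace_of _) : l1).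
    have [N3] := l1_near ((l1_t R ^+ N2) (y : fspace_of _) : l1) (divr_gt0 e0 (ltr0n _ 4)).
    by exists N3; lra.
  (* Before [N2] the old mass of [z] survives one of the two signs, after [N2] the new mass of [y]
     does; the sum over both signs bounds the better one from below. *)
  have key : 2 * (K%:R * (e / 2)) + 2 * (e / 2) <=
      l1_p (N2 + N3) (z + y) + l1_p (N2 + N3) (z - y).
    apply: (@le_trans _ _ (\sum_(n < N2) 2 * cn (z n) +
        \sum_(n < N3) 2 * cn (y (N2 + n)%N))).
      rewrite -!mulr_sumr lerD// ler_wpM2l//.
        by apply: le_trans hN _; exact: l1_p_mono.
      apply: le_trans hN3 _; rewrite le_eqVlt; apply/orP; left; apply/eqP.
      by apply: eq_bigr => n _; rewrite l1_tX_val.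
    rewrite /l1_p -big_split big_split_ord /= lerD//; apply: ler_sum => n _.
      exact: cn_sign_max.
    by rewrite (cnB (z _)) (addrC (z _)) cn_sign_max.
  have disj j : j \in J2 -> (j \in J) = false by rewrite mem_filter => /andP[/negbTE].
  have [sg [sg1 hsg]] : exists sg : C, cn sg <= 1 /\
      K.+1%:R * (e / 2) <= l1_p (N2 + N3) (z + sg *: y).
    have [h1|h1] := leP (K.+1%:R * (e / 2)) (l1_p (N2 + N3) (z + y)).
      by exists 1; rewrite cn1 scale1r.
    exists (-1); rewrite cnN cn1 scaleN1r; split=> //.
    by move: key h1; rewrite -natr1 mulrDl mul1r; lra.
  exists (J ++ J2), (fun j => if j \in J then th j else sg * th' j), (N2 + N3)%N; split.
  - rewrite cat_uniq uJ filter_uniq// andbT; apply/hasPn => j /disj; exact: negbT.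
  - move=> j; case: ifP => // _; rewrite cnM -[leRHS]mul1r.
    by apply: ler_pM; rewrite ?cn_ge0.
  - rewrite big_cat /=; have -> : \sum_(j <- J) (if j \in J then th j else sg * th' j) *: psi j = z.
      by rewrite big_seq [RHS]big_seq; apply: eq_bigr => j ->.
    have -> // : \sum_(j <- J2) (if j \in J then th j else sg * th' j) *: psi j = sg *: y.
    rewrite scaler_sumr big_seq [RHS]big_seq; apply: eq_bigr => j /disj ->.
    by rewrite scalerA.
have [K hK] : exists K : nat, M < K%:R * (e / 2).
  have e2 : 0 < e / 2 by rewrite divr_gt0.
  exists (Num.bound `|M / (e / 2)|); rewrite -ltr_pdivrMr//.
  exact: le_lt_trans (ler_norm _) (archi_boundP (normr_ge0 _)).
have [J [th [N [uJ hth hN]]]] := hump K.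
have := le_trans (le_trans hN (l1_p_le _ _)) (hM J th uJ hth); lra.
Qed.

End EllOneOperators.

(* Names of the copies of the basic lines: [Base] carries the K-theory, the
   copies [LSlot] absorb finite-rank fibres, and the copies [WSlot F] hold functions
   vanishing on [club F]. *)
Inductive slot (W : omega1) := Base | LSlot of nat | WSlot of (W -> W) & nat.
Arguments Base {W}.
Arguments LSlot {W}.

HB.instance Definition _ (W : omega1) := gen_eqMixin (slot W).

(** The number of increments at scale [s]. The ratio [msz s / (s * s!)] is [msz s.-1] for positive
    [s], so the earlier scales are dominated at exactly the rate that the weight $1/s!$ gives to the
    later ones. *)
Fixpoint msz s : nat := if s is s'.+1 then (msz s' * s * s`!)%N else 2.

Lemma msz_gt0 s : (0 < msz s)%N.
Proof. by elim: s => //= s ih; rewrite !muln_gt0 ih fact_gt0. Qed.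

Lemma msz_even s : msz s = (2 * (msz s)./2)%N.
Proof.
rewrite mul2n; elim: s => // s ih; apply/esym/even_halfK.
by rewrite /= !oddM (_ : odd (msz s) = false)// ih odd_double.
Qed.

Lemma msz_mono s r : (s <= r)%N -> (msz s <= msz r)%N.
Proof.
move=> /subnK <-; elim: (r - s)%N => // d ih; apply: leq_trans ih _.
by rewrite addSn /= -mulnA leq_pmulr// muln_gt0 fact_gt0.
Qed.

Lemma mszS s : msz s.+1 = (msz s * s.+1 * (s.+1)`!)%N. Proof. by []. Qed.

Arguments msz : simpl never.

(** * Variation of functions on $\omega_1$ *)

Section Variation.
Variables (R : realType) (W : omega1).
Local Notation C := R[i].
Local Notation "a <o b" := (olt a b) (at level 70).
Local Notation "a <=o b" := (~~ olt b a) (at level 70).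
Implicit Types (f g : W -> C).

Definition var0 M f (a : nat -> W) : R := \sum_(k < M) cn (f (a k.+1) - f (a k)).

Definition var M f (a : nat -> W) : R := var0 M f a + cn (f (a M)).

Lemma var0_ge0 M f a : 0 <= var0 M f a.
Proof. by apply: sumr_ge0 => k _; exact: cn_ge0. Qed.

Lemma var_ge0 M f a : 0 <= var M f a.
Proof. by rewrite addr_ge0 ?var0_ge0 ?cn_ge0. Qed.

Lemma var0D M f g a : var0 M (fun b => f b + g b) a <= var0 M f a + var0 M g a.
Proof.
rewrite -big_split; apply: ler_sum => k _ /=.
have -> : f (a k.+1) + g (a k.+1) - (f (a k) + g (a k)) =
  (f (a k.+1) - f (a k)) + (g (a k.+1) - g (a k)) by ring.
exact: cnD.
Qed.

Lemma varD M f g a : var M (fun b => f b + g b) a <= var M f a + var M g a.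
Proof. by rewrite /var addrACA lerD ?var0D ?cnD. Qed.

Lemma var0Z M c f a : var0 M (fun b => c * f b) a = cn c * var0 M f a.
Proof. by rewrite mulr_sumr; apply: eq_bigr => k _; rewrite -mulrBr cnM. Qed.

Lemma varZ M c f a : var M (fun b => c * f b) a = cn c * var M f a.
Proof. by rewrite /var mulrDr var0Z cnM. Qed.

Lemma var_zero M a : var M (fun=> 0) a = 0.
Proof.
have -> : (fun=> 0) = (fun b : W => 0 * 0 : C) by apply/funext => b; rewrite mulr0.
by rewrite varZ cn0 mul0r.
Qed.

Lemma var_le_vals M f (a : nat -> W) : var M f a <= 2 * \sum_(k < M.+1) cn (f (a k)).
Proof.
have h : var0 M f a <= \sum_(k < M) cn (f (a k.+1)) + \sum_(k < M) cn (f (a k)).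
  by rewrite -big_split; apply: ler_sum => k _; exact: cn_subr.
have h1 : \sum_(k < M.+1) cn (f (a k)) = cn (f (a 0%N)) + \sum_(k < M) cn (f (a k.+1)).
  by rewrite big_ord_recl.
have h2 : \sum_(k < M.+1) cn (f (a k)) = \sum_(k < M) cn (f (a k)) + cn (f (a M)).
  by rewrite big_ord_recr.
have := cn_ge0 (f (a 0%N)); rewrite /var; lra.
Qed.

Lemma val_le_var M f (a : nat -> W) k : (k <= M)%N -> cn (f (a k)) <= var M f a.
Proof.
move=> kM; rewrite /var -(subnK kM); elim: (M - k)%N => [|d ih].
  by rewrite add0n lerDr var0_ge0.
apply: le_trans ih _; rewrite addSn /var0 big_ord_recr /= -addrA lerD2l.
by have := cnD (f (a (d + k)%N) - f (a (d + k).+1)) (f (a (d + k).+1)); rewrite subrK cnB.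
Qed.

Lemma var_bounded M f a (c : R) : (forall b, cn (f b) <= c) ->
  var M f a <= (2 * M)%:R * c + c.
Proof.
move=> h; rewrite lerD//; apply: (@le_trans _ _ (\sum_(k < M) 2 * c)).
  apply: ler_sum => k _; apply: le_trans (cn_subr _ _) _.
  by rewrite mulr_natl mulr2n lerD.
by rewrite sumr_const card_ord -[leLHS]mulr_natr natrM mulrAC mulrC mulrCA mulrA.
Qed.

Definition below (b b' : W) : C := (~~ olt b b')%:R.

Lemma cn_bool (q : bool) : cn (q%:R : C) = q%:R.
Proof. by case: q; rewrite ?cn1 ?cn0. Qed.

Lemma below_var b M (a : nat -> W) : (forall k, a k <=o a k.+1) ->
  var M (below b) a <= 1.
Proof.
move=> ha; rewrite /var; elim: M => [|M ih].
  by rewrite /var0 big_ord0 add0r cn_bool; case: (~~ _).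
rewrite /var0 big_ord_recr /=; apply: le_trans ih; rewrite -addrA lerD2l.
rewrite /below; have [h|h] := boolP (olt b (a M.+1)); rewrite /= ?sub0r ?cnN ?cn0 ?addr0//.
have -> : olt b (a M) = false.
  by apply/negbTE; apply: ole_trans (ha M) h.
by rewrite subrr cn0 cn1 add0r.
Qed.

(* The interval ]a, b], where a missing lower bound stands for -oo. *)
Definition inI (a : option W) (b b' : W) : bool :=
  (if a is Some a' then olt a' b' else true) && ~~ olt b b'.

Lemma inIE (a b b' : W) : a <=o b ->
  ((inI (Some a) b b')%:R : C) = below b b' - below a b'.
Proof.
rewrite /inI /below => ab; have [h|h] := boolP (olt a b') => /=.
  by rewrite subr0.
have -> : olt b b' = false by apply/negbTE; apply: ole_trans h ab.
by rewrite subrr.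
Qed.

Lemma inI_empty (a b b' : W) : b <o a -> inI (Some a) b b' = false.
Proof.
move=> ba; apply/negbTE/negP => /andP[ab' b'b].
by have := olt_trans ba (olt_le_trans ab' b'b); rewrite olt_irr.
Qed.

Lemma inI_var (a : option W) b M (s : nat -> W) : (forall k, s k <=o s k.+1) ->
  var0 M (fun b' => (inI a b b')%:R) s <= 2.
Proof.
move=> hs; have v0 c : var0 M (below c) s <= 1.
  by apply: le_trans (below_var c M hs); rewrite lerDl cn_ge0.
case: a => [a|]; last first.
  apply: le_trans (v0 b) _; lra.
have [ba|ab] := boolP (olt b a).
  rewrite (_ : (fun b' => _) = (fun=> 0 * 0)); last first.
    by apply/funext => b'; rewrite inI_empty// mulr0.
  by rewrite var0Z cn0 mul0r.
rewrite (_ : (fun b' => _) = (fun b' => below b b' + -1 * below a b')); last first.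
  by apply/funext => b'; rewrite inIE// mulN1r.
apply: le_trans (var0D _ _ _ _) _; rewrite var0Z cnN cn1 mul1r.
by have := v0 a; have := v0 b; lra.
Qed.

(* A combination of K successive intervals with coefficients of modulus at most 1. *)
Section Steps.
Variables (K : nat) (a b : nat -> W) (th : nat -> C).
Hypothesis th1 : forall j, cn (th j) <= 1.
Hypothesis ab : forall i j, (i < j)%N -> b i <=o a j.

Definition steps b' : C := \sum_(j < K) th j * (inI (Some (a j)) (b j) b')%:R.

Lemma steps_le1 b' : cn (steps b') <= 1.
Proof.
rewrite /steps; have [/existsP[j hj]|/existsPn h] := boolP [exists j : 'I_K, inI (Some (a j)) (b j) b'].
  rewrite (@big_only1 _ _ _ _ j)// => [|i ne _]; first by rewrite hj mulr1.
  suff -> : inI (Some (a i)) (b i) b' = false by rewrite mulr0.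
  apply/negbTE/negP => /andP[ai bi]; move: hj => /andP[aj bj].
  have [ij|ji|/val_inj e] := ltngtP i j; last by rewrite e eqxx in ne.
    by have := ole_lt_trans (ole_trans bi (ab ij)) aj; rewrite olt_irr.
  by have := ole_lt_trans (ole_trans bj (ab ji)) ai; rewrite olt_irr.
by rewrite big1 ?cn0// => j _; rewrite (negbTE (h j)) mulr0.
Qed.

(** This bound counts the sample points, [steps_var_count] the intervals; the first serves the small
    scales, the second the large ones. *)
Lemma steps_var_size M s : var M steps s <= (2 * M)%:R + 1.
Proof. by have := var_bounded M s steps_le1; rewrite mulr1. Qed.

Lemma steps_var_count M (s : nat -> W) : (forall k, s k <=o s k.+1) -> var M steps s <= (2 * K)%:R + 1.
Proof.
move=> hs; rewrite lerD ?steps_le1// /steps.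
elim: (K) => [|K' ih].
  rewrite muln0; have -> : (fun b' => \sum_(j < 0) th j * (inI (Some (a j)) (b j) b')%:R) = (fun=> 0 * 0).
    by apply/funext => b'; rewrite big_ord0 mulr0.
  by rewrite var0Z cn0 mul0r.
have -> : (fun b' => \sum_(j < K'.+1) th j * (inI (Some (a j)) (b j) b')%:R) =
  (fun b' => \sum_(j < K') th j * (inI (Some (a j)) (b j) b')%:R +
    th K' * (inI (Some (a K')) (b K') b')%:R).
  by apply/funext => b'; rewrite big_ord_recr.
apply: le_trans (var0D _ _ _ _) _; rewrite var0Z.
have -> : (2 * K'.+1)%:R = (2 * K')%:R + 2 :> R by rewrite -natrD; congr _%:R; lia.
rewrite lerD//.
apply: le_trans (ler_pM (cn_ge0 _) (var0_ge0 _ _ _) (th1 _) (inI_var _ _ _ hs)) _.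
by rewrite mul1r.
Qed.

End Steps.

End Variation.

Lemma fs_functional_eq (R : realType) (s : fspec R) (f g : fspace s -> R[i]) (K L : R) :
  (forall x y, f (x + y) = f x + f y) -> (forall c x, f (c *: x) = c * f x) ->
  (forall x y, g (x + y) = g x + g y) -> (forall c x, g (c *: x) = c * g x) ->
  (forall x, cn (f x) <= K * nrm x) -> (forall x, cn (g x) <= L * nrm x) ->
  (forall x : fspace s, fs_P x -> f x = g x) -> forall x, f x = g x.
Proof.
move=> fD fZ gD gZ fK gL h x.
apply/eqP; rewrite -subr_eq0 -cn_eq0 eq_le cn_ge0 andbT; apply/ler_addgt0Pr => e e0.
pose M := `|K| + `|L| + 1; have M0 : 0 < M by rewrite ltr_wpDl ?addr_ge0.
have [y Py xy] := fs_dense x (divr_gt0 e0 M0).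
have fB u v : f (u - v) = f u - f v by rewrite fD -scaleN1r fZ mulN1r.
have gB u v : g (u - v) = g u - g v by rewrite gD -scaleN1r gZ mulN1r.
have -> : f x - g x = f (x - y) - g (x - y) by rewrite fB gB (h _ Py); ring.
apply: le_trans (cn_subr _ _) _; rewrite add0r.
apply: (@le_trans _ _ (M * nrm (x - y))); last first.
  by apply: le_trans (ler_wpM2l (ltW M0) xy) _; rewrite mulrC divfK// gt_eqF.
apply: le_trans (lerD (fK _) (gL _)) _; rewrite -mulrDl ler_wpM2r ?nrm_ge0//.
have := ler_norm K; have := ler_norm L; rewrite /M; lra.
Qed.

(** * The space X *)

Section Space.
Variables (R : realType) (m n : nat) (W : omega1).
Local Notation C := R[i].
Local Notation "a <o b" := (olt a b) (at level 70).
Local Notation "a <=o b" := (~~ olt b a) (at level 70).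
Local Notation I := 'I_(m + n).+1.

Definition line := (slot W * I * nat)%type.
Definition point := (line * W)%type.

Record xindex := XIndex {
  xi_slot : slot W; xi_s : nat; xi_seq : nat -> W;
  xi_mono : forall k, xi_seq k <=o xi_seq k.+1; xi_N : nat }.

(** Each type owns a residue class of scales, hence infinitely many. The interleaving of these
    classes is what makes operators between different types negligible. *)
Definition ty (s : nat) : I := inZp s.

(** The variation of an $\ell_1$-valued function at scale [s]. Slots and scales are joined only
    through the supremum over [t], so distinct slots combine as in a $c_0$-sum, and a line is
    measured only at the scales of its type. *)
Definition xp (t : xindex) (x : point -> C) : R :=
  ((xi_s t)`!)%:R^-1 * \sum_(l < xi_N t)
    var (msz (xi_s t)) (fun b => x ((xi_slot t, ty (xi_s t), l : nat), b)) (xi_seq t).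

(** Scalar fibres for the types below [m], $\ell_1$ fibres for the next [n]. The last type has no
    base lines; it keeps the set of types inhabited and supplies [LSlot] lines even when [n] is
    0. *)
Definition base (i : I) (l : nat) : bool := ((i < m)%N && (l == 0%N)) || (m <= i < m + n)%N.

(* The intervals whose indicator on a given line is a generator. *)
Definition ok (lam : line) (a : option W) (b : W) : Prop :=
  match lam.1.1 with
  | Base => base lam.1.2 lam.2
  | LSlot _ => (m <= lam.1.2)%N && (lam.2 == 0%N)
  | WSlot F _ => base lam.1.2 lam.2 /\ forall al, club F al -> ~~ inI a b al
  end.

Definition wfun (lam : line) a b : point -> C :=
  fun z => ((z.1 == lam) && inI a b z.2)%:R.

Inductive xspan : (point -> C) -> Prop :=
| xspan0 : xspan (fun=> 0)
| xspanD x y : xspan x -> xspan y -> xspan (fun z => x z + y z)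
| xspanZ c x : xspan x -> xspan (fun z => c * x z)
| xspan_gen lam a b : ok lam a b -> xspan (wfun lam a b).

Let fact_inv_ge0 s : 0 <= ((s`!)%:R : R)^-1.
Proof. by rewrite invr_ge0. Qed.

Let xpD t x y : xp t (fun z => x z + y z) <= xp t x + xp t y.
Proof.
rewrite -mulrDr ler_wpM2l// -big_split; apply: ler_sum => l _; exact: varD.
Qed.

Let xpZ t a x : xp t (fun z => a * x z) = cn a * xp t x.
Proof.
by rewrite /xp mulrCA; congr (_ * _); rewrite mulr_sumr; apply: eq_bigr => l _; rewrite varZ.
Qed.

Let xpfin t : exists zs : seq point, exists2 K : R, 0 <= K &
  forall u, xp t u <= K * \sum_(z <- zs) cn (u z).
Proof.
exists [seq ((xi_slot t, ty (xi_s t), l), xi_seq t k) | l <- iota 0 (xi_N t), k <- iota 0 (msz (xi_s t)).+1].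
exists (((xi_s t)`!)%:R^-1 * 2) => [|u]; first by rewrite mulr_ge0.
have E M (F : nat -> R) : \sum_(l <- iota 0 M) F l = \sum_(l < M) F l.
  by rewrite -(big_mkord xpredT F) /index_iota subn0.
rewrite -mulrA ler_wpM2l// big_allpairs_dep (E _ (fun l => \sum_(k <- iota 0 (msz (xi_s t)).+1)
  cn (u ((xi_slot t, ty (xi_s t), l), xi_seq t k)))) mulr_sumr; apply: ler_sum => l _.
by apply: le_trans (var_le_vals _ _ _) _; rewrite E.
Qed.

Definition cst_index (g : slot W) s al N : xindex :=
  @XIndex g s (fun=> al) (fun k => ole_refl al) N.

Lemma ty_val (i : I) : ty i = i.
Proof. by apply: val_inj; rewrite /= modn_small. Qed.

Lemma xp_val g i l al (u : point -> C) :
  cn (u ((g, i, l), al)) <= ((i : nat)`!)%:R * xp (cst_index g i al l.+1) u.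
Proof.
rewrite /xp /= mulrA divff ?mul1r; last by rewrite pnatr_eq0 -lt0n fact_gt0.
rewrite big_ord_recr /= ty_val.
apply: (@le_trans _ _ (var (msz i) (fun b => u (g, i, l, b)) (fun=> al))); last first.
  by rewrite lerDr; apply: sumr_ge0 => k _; exact: var_ge0.
exact: (@val_le_var _ _ _ (fun b => u (g, i, l, b)) (fun=> al) 0).
Qed.

Let xpsep z : exists t, exists2 K : R, 0 <= K & forall u, cn (u z) <= K * xp t u.
Proof.
case: z => -[[g i] l] al; exists (cst_index g i al l.+1), (i : nat)`!%:R => // u.
exact: xp_val.
Qed.

Lemma wfun_line lam a b g i l :
  (fun be => wfun lam a b ((g, i, l), be)) =
  (fun be => (((g, i, l) == lam)%:R : C) * (inI a b be)%:R).
Proof. by apply/funext => be; rewrite /wfun /=; case: (_ == _); rewrite ?mul1r ?mul0r. Qed.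

Let fact_inv_le1 s : ((s`!)%:R : R)^-1 <= 1.
Proof. by rewrite invf_le1 ?ltr0n ?fact_gt0// ler1n fact_gt0. Qed.

(* Seminorms of functions supported by one line of each pair of a slot and a type. *)
Lemma xp_line t (u : point -> C) (l0 : nat) (c : R) : 0 <= c ->
  (forall l be, l != l0 -> u ((xi_slot t, ty (xi_s t), l), be) = 0) ->
  var (msz (xi_s t)) (fun be => u ((xi_slot t, ty (xi_s t), l0), be)) (xi_seq t) <= c ->
  xp t u <= ((xi_s t)`!)%:R^-1 * c.
Proof.
move=> c0 h1 h2; rewrite ler_wpM2l//.
have zero l : l != l0 ->
    var (msz (xi_s t)) (fun b => u (xi_slot t, ty (xi_s t), l, b)) (xi_seq t) = 0.
  by move=> ne; rewrite (_ : (fun b => _) = fun=> 0) ?var_zero//; apply/funext => b; rewrite h1.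
have [lN|Nl] := ltnP l0 (xi_N t).
  by rewrite (bigD1 (Ordinal lN))//= big1 ?addr0// => l ne; rewrite zero.
rewrite big1// => l _; rewrite zero//; apply: contraTneq (ltn_ord l) => ->.
by rewrite -leqNgt.
Qed.

Let xspan_bd x : xspan x -> exists M, forall t, xp t x <= M.
Proof.
elim=> [|{}x y _ [M hM] _ [M' hM']|c {}x _ [M hM]|lam a b _].
- exists 0 => t; have -> : (fun=> 0) = (fun _ : point => 0 * 0 : C) by apply/funext => z; rewrite mul0r.
  by rewrite xpZ cn0 mul0r.
- by exists (M + M') => t; apply: le_trans (xpD _ _ _) _; rewrite lerD.
- by exists (cn c * M) => t; rewrite xpZ ler_wpM2l// cn_ge0.
exists 3 => t; apply: (@le_trans _ _ (((xi_s t)`!)%:R^-1 * 3)); last first.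
  by rewrite -[leRHS]mul1r ler_wpM2r.
apply: (@xp_line t _ lam.2) => // [l be ne|].
  rewrite /wfun; case: eqP => //= e; by move: ne; rewrite -e eqxx.
rewrite wfun_line varZ cn_bool -[leRHS]mul1r ler_pM ?var_ge0//; first by case: (_ == _).
have h := inI_var R a b (msz (xi_s t)) (@xi_mono t); rewrite /var.
rewrite cn_bool; have : ((inI a b (xi_seq t (msz (xi_s t))))%:R : R) <= 1 by case: inI.
lra.
Qed.

Definition xspec : fspec R :=
  FSpec xpD xpZ xpfin xpsep xspan0 xspanD xspanZ xspan_bd.

Notation X := (fspace xspec).
Notation A := (bounded_op (fspace_of xspec)).

Lemma x_val_le (x : X) g i l al : cn (x ((g, i, l), al)) <= ((i : nat)`!)%:R * nrm x.
Proof.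
apply: le_trans (xp_val _ _ _ _ _) _; rewrite ler_wpM2l//.
exact: (p_le_nrm (s := xspec)).
Qed.

Definition gen lam a b : X :=
  if pselect (ok lam a b) is left h then FSpace (fs_memP (s := xspec) (xspan_gen h)) else 0.

Lemma genE lam a b z : ok lam a b -> gen lam a b z = wfun lam a b z.
Proof. by rewrite /gen; case: pselect. Qed.

Lemma gen_bad lam a b : ~ ok lam a b -> gen lam a b = 0.
Proof. by rewrite /gen; case: pselect. Qed.

Lemma xspan_ind_fs (Q : X -> Prop) : Q 0 -> (forall x y, Q x -> Q y -> Q (x + y)) ->
  (forall c x, Q x -> Q (c *: x)) -> (forall lam a b, ok lam a b -> Q (gen lam a b)) ->
  forall x : X, fs_P x -> Q x.
Proof.
move=> h0 hD hZ hg.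
suff h u : xspan u -> exists2 x : X, Q x & forall z, x z = u z.
  by move=> x /h[y Qy yx]; rewrite (_ : x = y)//; apply: fspaceP => z; rewrite yx.
elim=> [|x y _ [x' Qx hx] _ [y' Qy hy]|c x _ [x' Qx hx]|lam a b hok].
- by exists 0.
- by exists (x' + y'); [exact: hD|move=> z; rewrite fvalD hx hy].
- by exists (c *: x'); [exact: hZ|move=> z; rewrite fvalZ hx].
by exists (gen lam a b); [exact: hg|move=> z; exact: genE].
Qed.

Lemma functional_eq (f g : X -> C) (K L : R) :
  (forall x y, f (x + y) = f x + f y) -> (forall c x, f (c *: x) = c * f x) ->
  (forall x y, g (x + y) = g x + g y) -> (forall c x, g (c *: x) = c * g x) ->
  (forall x, cn (f x) <= K * nrm x) -> (forall x, cn (g x) <= L * nrm x) ->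
  (forall lam a b, ok lam a b -> f (gen lam a b) = g (gen lam a b)) -> forall x, f x = g x.
Proof.
move=> fD fZ gD gZ fK gL fg; apply: (fs_functional_eq fD fZ gD gZ fK gL) => y.
apply: (xspan_ind_fs (Q := fun y => f y = g y)) => //.
- have := fZ 0 0; have := gZ 0 0; rewrite !scale0r !mul0r => -> ->//.
- by move=> u v hu hv; rewrite fD gD hu hv.
- by move=> c u hu; rewrite fZ gZ hu.
Qed.

End Space.

Lemma l1_sum_le (R : realType) K (w : nat -> fspace (ell1 R)) (B : R) :
  (forall N, \sum_(k < K) l1_p N (w k) <= B) -> \sum_(k < K) nrm (w k) <= B.
Proof.
move=> h; apply/ler_addgt0Pr => e e0; have K0 : 0 < K.+1%:R :> R by rewrite ltr0n.
have /choice[N hN] k : exists N, nrm (w k) <= l1_p N (w k) + e / K.+1%:R.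
  exact/l1_near/divr_gt0.
pose M := \max_(k < K) N k.
apply: (@le_trans _ _ (\sum_(k < K) (l1_p M (w k) + e / K.+1%:R))).
  apply: ler_sum => k _; apply: le_trans (hN k) _; rewrite lerD2r; apply: l1_p_mono.
  exact: leq_bigmax.
rewrite big_split /= lerD//.
rewrite sumr_const card_ord -[leLHS]mulr_natr mulrAC ler_pdivrMr//.
by rewrite ler_wpM2l ?ler_nat// ltW.
Qed.

(** * Operators on X: slot substitutions, fibres and fibrewise maps *)

Section SpaceMaps.
Variables (R : realType) (m n : nat) (W : omega1).
Local Notation C := R[i].
Local Notation "a <o b" := (olt a b) (at level 70).
Local Notation "a <=o b" := (~~ olt b a) (at level 70).
Local Notation I := 'I_(m + n).+1.
Local Notation xspec := (xspec R m n W).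
Local Notation X := (fspace xspec).
Local Notation A := (bounded_op (fspace_of xspec)).
Local Notation l1 := (fspace (ell1 R)).
Local Notation B := (bounded_op (fspace_of (ell1 R))).
Local Notation line := (line m n W).
Local Notation point := (point m n W).
Local Notation gen := (@gen R m n W).
Local Notation slot := (slot W).

Section SlotPull.
Variable h : slot -> I -> nat -> option slot.
Hypothesis h1 : forall g i, exists g', forall l, h g i l = None \/ h g i l = Some g'.
Hypothesis h2 : forall g i l a b, ok (g, i, l) a b ->
  (forall g', h g' i l <> Some g) \/
  exists g', (forall g'', h g'' i l = Some g <-> g'' = g') /\ ok (g', i, l) a b.

Definition slot_rho (z : point) : option point :=
  omap (fun g => ((g, z.1.1.2, z.1.2), z.2)) (h z.1.1.1 z.1.1.2 z.1.2).

Let rho_bound t : exists t', forall u,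
  fs_p (f := xspec) t (pull (s := xspec) (s' := xspec) slot_rho u) <= fs_p (f := xspec) t' u.
Proof.
have [g' hg'] := h1 (xi_slot t) (ty m n (xi_s t)).
exists (XIndex g' (xi_s t) (@xi_mono W t) (xi_N t)) => u.
rewrite ler_wpM2l ?invr_ge0//; apply: ler_sum => l _ /=.
have [e|e] := hg' l.
  rewrite (_ : (fun b => _) = fun=> 0) ?var_zero ?var_ge0//.
  by apply/funext => b; rewrite /pull /slot_rho /= e.
rewrite le_eqVlt; apply/orP; left; apply/eqP; congr (var _ _ _).
by apply/funext => b; rewrite /pull /slot_rho /= e.
Qed.

Let rho_P u : fs_P (f := xspec) u -> fs_mem (pull (s := xspec) (s' := xspec) slot_rho u).
Proof.
move=> Pu; apply: fs_memP; elim: Pu => [|x y _ hx _ hy|c x _ hx|[[g i] l] a b hok].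
- rewrite (_ : pull (s := xspec) (s' := xspec) _ _ = fun=> 0); first exact: xspan0.
  by apply/funext => z; rewrite /pull; case: slot_rho.
- rewrite (_ : pull (s := xspec) (s' := xspec) _ _ = fun z => pull (s := xspec) (s' := xspec) slot_rho x z + pull (s := xspec) (s' := xspec) slot_rho y z); first exact: xspanD.
  by apply/funext => z; rewrite /pull; case: slot_rho => //; rewrite addr0.
- rewrite (_ : pull (s := xspec) (s' := xspec) _ _ = fun z => c * pull (s := xspec) (s' := xspec) slot_rho x z); first exact: xspanZ.
  by apply/funext => z; rewrite /pull; case: slot_rho => //; rewrite mulr0.
have [no|[g' [hg' ok']]] := h2 hok.
  rewrite (_ : pull (s := xspec) (s' := xspec) _ _ = fun=> 0); first exact: xspan0.
  apply/funext => -[[[g1 i1] l1'] b1]; rewrite /pull /slot_rho /=.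
  case e: (h g1 i1 l1') => [g2|] //=; rewrite /wfun /=.
  case: eqP => // -[e1 e2 e3]; subst g2 i1 l1'; by case: (no g1).
rewrite (_ : pull (s := xspec) (s' := xspec) _ _ = wfun R (g', i, l) a b); first exact: xspan_gen.
apply/funext => -[[[g1 i1] l1'] b1]; rewrite /pull /slot_rho /wfun /=.
case e: (h g1 i1 l1') => [g2|] //=; last first.
  by case: eqP => //= -[e1 e2 e3]; subst; rewrite (hg' g').2 in e.
congr (((_ && _) : bool)%:R); apply/eqP/eqP => -[e1 e2 e3]; subst.
  by rewrite (hg' g1).1.
by rewrite (hg' g').2 // in e; case: e => ->.
Qed.

(** By [h1] a seminorm of the substituted function is bounded by a seminorm at a single slot; by
    [h2] a generator becomes zero or a generator. *)
Lemma slot_pullable : pullable (s := xspec) slot_rho.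
Proof. by split; [exact: rho_bound|exact: rho_P]. Qed.

Definition slot_op : A := pull_of slot_pullable.

Lemma slot_opE (x : X) g i l al : (slot_op x : X) ((g, i, l), al) =
  if h g i l is Some g' then x ((g', i, l), al) else 0.
Proof. by rewrite pull_ofE /slot_rho /=; case: (h g i l). Qed.

End SlotPull.

Section Filter.
Variable q : slot -> I -> bool.

Let filt g i (l : nat) := if q g i then Some g else None.

Let filt1 g i : exists g', forall l, filt g i l = None \/ filt g i l = Some g'.
Proof. by exists g => l; rewrite /filt; case: (q g i); [right|left]. Qed.

Let filt2 g i l a b : ok (g, i, l) a b -> (forall g', filt g' i l <> Some g) \/
  exists g', (forall g'', filt g'' i l = Some g <-> g'' = g') /\ ok (g', i, l) a b.
Proof.
move=> hok; rewrite /filt; have [qg|qg] := boolP (q g i); last first.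
  by left => g'; case: ifP => // qg' [e]; move: qg; rewrite -e qg'.
right; exists g; split=> // g''; split=> [|->]; last by rewrite qg.
by case: ifP => // _ [].
Qed.

Definition filt_op : A := slot_op filt1 filt2.

Lemma filt_opE (x : X) g i l al :
  (filt_op x : X) ((g, i, l), al) = if q g i then x ((g, i, l), al) else 0.
Proof. by rewrite slot_opE /filt; case: (q g i). Qed.

End Filter.

Section Move.
Variables (g0 g1 : slot) (q : I -> nat -> bool).
Hypothesis hq : forall i l a b, q i l -> ok (g0, i, l) a b -> ok (g1, i, l) a b.

Let mv g i l := if (g == g1) && q i l then Some g0 else None.

Let mv1 g i : exists g', forall l, mv g i l = None \/ mv g i l = Some g'.
Proof. by exists g0 => l; rewrite /mv; case: (_ && _); [right|left]. Qed.

Let mv2 g i l a b : ok (g, i, l) a b -> (forall g', mv g' i l <> Some g) \/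
  exists g', (forall g'', mv g'' i l = Some g <-> g'' = g') /\ ok (g', i, l) a b.
Proof.
move=> hok; rewrite /mv; have [e|ne] := eqVneq g g0; last first.
  by left=> g'; case: ifP => // _ [] e; rewrite e eqxx in ne.
subst g; have [qi|qi] := boolP (q i l); last by left => g'; rewrite andbF.
right; exists g1; split; last exact: hq.
move=> g''; rewrite andbT; split=> [|->]; last by rewrite eqxx.
by case: eqP.
Qed.

Definition move_op : A := slot_op mv1 mv2.

Lemma move_opE (x : X) g i l al : (move_op x : X) ((g, i, l), al) =
  if (g == g1) && q i l then x ((g0, i, l), al) else 0.
Proof. by rewrite slot_opE /mv; case: (_ && _). Qed.

End Move.

Section Fibre.
Variables (i : I) (al : W).

Let pi_val (x : X) l : C := x ((Base, i, l), al).

Let pi_bound x N : l1_p N (pi_val x) <= ((i : nat)`!)%:R * nrm x.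
Proof.
have := p_le_nrm (s := xspec) (cst_index Base i al N) x.
rewrite /= /xp /= -ler_pdivlMl ?invr_gt0 ?ltr0n ?fact_gt0// invrK => h; apply: le_trans h.
apply: ler_sum => l _; rewrite /pi_val ty_val.
exact: (@val_le_var _ _ _ (fun b => x (Base, i, l : nat, b)) (fun=> al) 0).
Qed.

Let pi_P (x : X) : fs_P x -> fs_mem (s := ell1 R) (pi_val x).
Proof.
apply: (xspan_ind_fs (Q := fun x => fs_mem (s := ell1 R) (pi_val x))).
- exact: fs_mem0.
- by move=> u v hu hv; exact: (fs_memD hu hv).
- by move=> c u hu; exact: (fs_memZ c hu).
move=> lam a b hok; apply: fs_memP; exists lam.2.+1 => l hl.
rewrite /pi_val genE// /wfun /=; case: eqP => //= e; move: hl.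
by rewrite -e /= ltnn.
Qed.

Definition pi_map : fs_map xspec (ell1 R) :=
  @FsMap _ xspec (ell1 R) pi_val (fun x y z => erefl) (fun a x z => erefl) _
    (ler0n _ _) pi_bound pi_P.

Definition fib (x : X) : l1 := fs_lift pi_map x.

Lemma fibE x l : fib x l = x ((Base, i, l), al). Proof. by []. Qed.

Lemma fib_le x : nrm (fib x) <= ((i : nat)`!)%:R * nrm x.
Proof. exact: (fs_lift_le pi_map). Qed.

Lemma fibD x y : fib (x + y) = fib x + fib y. Proof. exact: fspaceP. Qed.
Lemma fibZ c x : fib (c *: x) = c *: fib x. Proof. exact: fspaceP. Qed.

End Fibre.

Section Tensor.
Variables (i : I) (hi : (m <= i < m + n)%N) (a : option W) (b : W).

Let tens_val (y : l1) (z : point) : C :=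
  if z.1.1 == (Base, i) then y z.1.2 * (inI a b z.2)%:R else 0.

Let tens_bound y t : xp (R := R) (m := m) (n := n) t (tens_val y) <= 3 * nrm y.
Proof.
rewrite /xp; have [[e1 e2]|ne] := pselect (xi_slot t = Base /\ ty m n (xi_s t) = i); last first.
  rewrite big1 ?mulr0 => [|l _]; first by rewrite mulr_ge0 ?nrm_ge0.
  rewrite (_ : (fun b => _) = fun=> 0) ?var_zero//; apply/funext => be.
  rewrite /tens_val /=; case: eqP => // -[e1 e2]; by case: ne.
apply: (@le_trans _ _ (1 * (3 * nrm y))); last by rewrite mul1r.
apply: ler_pM; rewrite ?invr_ge0//.
- by apply: sumr_ge0 => l _; exact: var_ge0.
- by rewrite invf_le1 ?ltr0n ?fact_gt0// ler1n fact_gt0.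
apply: (@le_trans _ _ (\sum_(l < xi_N t) 3 * cn (y l))); last first.
  by rewrite -mulr_sumr ler_wpM2l//; exact: (l1_p_le (xi_N t) y).
apply: ler_sum => l _; rewrite (_ : (fun b => _) = fun be => y l * (inI a b be)%:R); last first.
  by apply/funext => be; rewrite /tens_val /= e1 e2 eqxx.
rewrite varZ mulrC ler_wpM2r ?cn_ge0// /var.
have h := inI_var R a b (msz (xi_s t)) (@xi_mono _ t).
rewrite cn_bool; have : ((inI a b (xi_seq t (msz (xi_s t))))%:R : R) <= 1 by case: inI.
lra.
Qed.

Let tens_ok l : ok ((Base, i, l) : line) a b.
Proof. by rewrite /ok /= /base hi orbT. Qed.

Let tens_P (y : l1) : fs_P y -> fs_mem (s := xspec) (tens_val y).
Proof.
move=> [N hN].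
suff <- : fval (\sum_(l < N) y l *: gen (Base, i, l : nat) a b) = tens_val y by exact: fvalP.
apply/funext => -[[[g i'] l] be]; rewrite fval_sum.
have -> : tens_val y ((g, i', l), be) =
  if (g, i') == (Base, i) then y l * (inI a b be)%:R else 0 by [].
case: eqP => [[-> ->]|ne]; last first.
  rewrite big1// => l' _; rewrite fvalZ genE// /wfun /=.
  by case: eqP => [[e1 e2 _]|]; rewrite ?mulr0//; case: ne; rewrite e1 e2.
have [lN|Nl] := ltnP l N; last first.
  rewrite hN// mul0r big1// => l' _; rewrite fvalZ genE// /wfun /=.
  case: eqP => [[e]|]; rewrite ?mulr0//; by move: Nl; rewrite e leqNgt ltn_ord.
rewrite (@big_only1 _ _ _ _ (Ordinal lN))// => [|l' ne _]; rewrite fvalZ genE// /wfun /=.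
  by rewrite eqxx.
case: eqP => [[e]|]; rewrite ?mulr0//; by case/eqP: ne; apply: val_inj.
Qed.

Let tens_D (x y : l1) z : tens_val (x + y) z = tens_val x z + tens_val y z.
Proof. by rewrite /tens_val; case: ifP => _; rewrite ?addr0// fvalD mulrDl. Qed.

Let tens_Z c (x : l1) z : tens_val (c *: x) z = c * tens_val x z.
Proof. by rewrite /tens_val; case: ifP => _; rewrite ?mulr0// fvalZ mulrA. Qed.

Definition tens_map : fs_map (ell1 R) xspec :=
  @FsMap _ (ell1 R) xspec tens_val tens_D tens_Z 3 (ler0n _ _) tens_bound tens_P.

Definition tens (y : l1) : X := fs_lift tens_map y.

Lemma tensE y z : tens y z = if z.1.1 == (Base, i) then y z.1.2 * (inI a b z.2)%:R else 0.
Proof. by []. Qed.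

Lemma tens_le y : nrm (tens y) <= 3 * nrm y.
Proof. exact: (fs_lift_le tens_map). Qed.

Lemma tensD x y : tens (x + y) = tens x + tens y.
Proof. by apply: fspaceP => z; rewrite fvalD -tens_D. Qed.

Lemma tensZ c x : tens (c *: x) = c *: tens x.
Proof. by apply: fspaceP => z; rewrite fvalZ -tens_Z. Qed.

End Tensor.

Section Sigma.
Variables (i : I) (hi : (m <= i < m + n)%N) (f : B).

Let sg_val (x : X) (z : point) : C :=
  if z.1.1 == (Base, i) then (f (fib i z.2 x : fspace_of _) : l1) z.1.2 else 0.

Let sg_D x y z : sg_val (x + y) z = sg_val x z + sg_val y z.
Proof. by rewrite /sg_val; case: ifP => _; rewrite ?addr0// fibD bopD. Qed.

Let sg_Z c x z : sg_val (c *: x) z = c * sg_val x z.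
Proof. by rewrite /sg_val; case: ifP => _; rewrite ?mulr0// fibZ bopZ. Qed.

Let sg_bound x t : xp (R := R) (m := m) (n := n) t (sg_val x) <= nrm f * nrm x.
Proof.
rewrite /xp; have [[e1 e2]|ne] := pselect (xi_slot t = Base /\ ty m n (xi_s t) = i); last first.
  rewrite big1 ?mulr0 => [|l _]; first by rewrite mulr_ge0 ?nrm_ge0.
  rewrite (_ : (fun b => _) = fun=> 0) ?var_zero//; apply/funext => be.
  rewrite /sg_val /=; case: eqP => // -[e1 e2]; by case: ne.
set s := xi_s t; set M := msz s; set a := xi_seq t.
(* The increments of the $\ell_1$-valued function along the sequence, with the last value as final
   term; [f] acts on each of them, and the sum of their norms is the variation. *)
pose w k : l1 := if (k < M)%N then fib i (a k.+1) x - fib i (a k) x else fib i (a M) x.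
have hw : \sum_(k < M.+1) nrm (w k) <= (s`!)%:R * nrm x.
  apply: l1_sum_le => N.
  have := p_le_nrm (s := xspec) (XIndex Base s (@xi_mono _ t) N) x.
  rewrite /= /xp /= -ler_pdivlMl ?invr_gt0 ?ltr0n ?fact_gt0// invrK => h; apply: le_trans h.
  rewrite exchange_big /=; apply: ler_sum => l _; rewrite e2 /var big_ord_recr /= {2}/w ltnn lerD//.
  by apply: ler_sum => k _; rewrite /w ltn_ord.
rewrite -ler_pdivlMl ?invr_gt0 ?ltr0n ?fact_gt0// invrK mulrCA.
apply: le_trans (ler_wpM2l (nrm_ge0 f) hw); rewrite mulr_sumr.
apply: (@le_trans _ _ (\sum_(k < M.+1) l1_p (xi_N t) (f (w k : fspace_of _) : l1))); last first.
  by apply: ler_sum => k _; apply: le_trans (l1_p_le _ _) (bop_le _ _).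
rewrite exchange_big /=; apply: ler_sum => l _; rewrite /var big_ord_recr /= {2}/w ltnn.
rewrite /sg_val /= e1 e2 eqxx lerD//; apply: ler_sum => k _; rewrite /w ltn_ord.
have -> : f (fib i (a k.+1) x - fib i (a k) x : fspace_of _) =
  f (fib i (a k.+1) x : fspace_of _) - f (fib i (a k) x : fspace_of _) by exact: linearB.
by [].
Qed.

Let sg_P (x : X) : fs_P x -> fs_mem (s := xspec) (sg_val x).
Proof.
apply: (xspan_ind_fs (Q := fun x => fs_mem (s := xspec) (sg_val x))).
- rewrite (_ : sg_val 0 = fun=> 0); first exact: fs_mem0.
  by apply/funext => z; have := sg_Z 0 0 z; rewrite scale0r mul0r.
- move=> u v hu hv; rewrite (_ : sg_val _ = fun z => sg_val u z + sg_val v z).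
    exact: (fs_memD hu hv).
  by apply/funext => z; rewrite sg_D.
- move=> c u hu; rewrite (_ : sg_val _ = fun z => c * sg_val u z).
    exact: (fs_memZ c hu).
  by apply/funext => z; rewrite sg_Z.
move=> [[g i'] l] a b hok.
have [[e1 e2]|ne] := pselect (g = Base /\ i' = i); last first.
  rewrite (_ : sg_val _ = fun=> 0); first exact: fs_mem0.
  apply/funext => z; rewrite /sg_val; case: ifP => // _.
  rewrite (_ : fib _ _ _ = 0) ?linear0//; apply: fspaceP => k; rewrite fibE genE// /wfun /=.
  by case: eqP => //= -[e1 e2 e3]; case: ne.
subst g i'; pose d : l1 := fib i b (gen (Base, i, l) None b).
have okl c c' : ok ((Base, i, l) : line) c c' by rewrite /ok /= /base hi orbT.
suff -> : sg_val (gen (Base, i, l) a b) = tens hi a b (f (d : fspace_of _)) by exact: fvalP.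
apply/funext => z; rewrite tensE /sg_val; case: ifP => // _.
rewrite (_ : fib _ _ _ = (inI a b z.2)%:R *: d).
  by rewrite bopZ fvalZ mulrC.
apply: fspaceP => k; rewrite fvalZ !fibE !genE// /wfun /=.
have -> : inI None b b by rewrite /inI olt_irr.
by case: (_ == _) => /=; rewrite ?mulr1 ?mulr0.
Qed.

Definition sigma : A :=
  lift_op (@FsMap _ xspec xspec sg_val sg_D sg_Z _ (nrm_ge0 f) sg_bound sg_P).

Lemma sigmaE (x : X) g i' l al : (sigma x : X) ((g, i', l), al) =
  if (g, i') == (Base, i) then (f (fib i al x : fspace_of _) : l1) l else 0.
Proof. by []. Qed.

Lemma sigma_le : nrm sigma <= nrm f.
Proof.
by apply: bop_nrm_le => [|x]; [exact: nrm_ge0|exact: (fs_lift_le (@FsMap _ xspec xspec sg_val sg_D sg_Z _ (nrm_ge0 f) sg_bound sg_P))].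
Qed.

End Sigma.
End SpaceMaps.

(** * Functions vanishing on a closed unbounded set *)

Section ClubRetract.
Variables (R : realType) (m n : nat) (W : omega1).
Local Notation C := R[i].
Local Notation "a <o b" := (olt a b) (at level 70).
Local Notation "a <=o b" := (~~ olt b a) (at level 70).
Local Notation I := 'I_(m + n).+1.
Local Notation xspec := (xspec R m n W).
Local Notation X := (fspace xspec).
Local Notation A := (bounded_op (fspace_of xspec)).
Local Notation gen := (@gen R m n W).
Variable G : W -> W.

Let retract_ex (b : W) : exists al, [/\ club G al, b <=o al &
  forall be, club G be -> b <=o be -> al <=o be].
Proof.
have [|al [ca ba] h] := @olt_min W (fun al => club G al /\ b <=o al).
  by have [al ca ba] := club_unbounded G b; exists al; split=> //; exact: oltW.
by exists al; split=> // be cb bb; exact: h.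
Qed.

Definition retract b : W := sval (cid (retract_ex b)).

Lemma retract_club b : club G (retract b).
Proof. by rewrite /retract; case: cid => /= al []. Qed.

Lemma retract_ge b : b <=o retract b.
Proof. by rewrite /retract; case: cid => /= al []. Qed.

Lemma retract_least b be : club G be -> b <=o be -> retract b <=o be.
Proof. by rewrite /retract; case: cid => /= al [_ _ h]; exact: h. Qed.

Lemma retract_mono b c : b <=o c -> retract b <=o retract c.
Proof.
by move=> bc; apply: retract_least (retract_club c) (ole_trans bc (retract_ge c)).
Qed.

(** The bound [b'] is the largest closure point not above [b], which exists because closure points
    are closed under suprema; no closure point lies strictly above [b'] and not above [b]. *)
Lemma retract_below b : exists b' : option W,
  (forall al, club G al -> ~~ inI b' b al) /\
  forall be, (~~ olt b be)%:R - (~~ olt b (retract be))%:R = (inI b' b be)%:R :> C.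
Proof.
have [[k [ck kb]]|no] := pselect (exists k, club G k /\ k <=o b); last first.
  have no' al : club G al -> olt b al by move=> ca; apply/negPn/negP => h; apply: no; exists al.
  exists None; split=> [al /no' h|be]; first by rewrite /inI /= h.
  by rewrite /inI /= (no' _ (retract_club be)) subr0.
have [|b' hb' lb'] := @olt_min W (fun c => forall k, club G k /\ k <=o b -> k <=o c).
  by exists b => ? [].
have cb' : club G b'.
  apply: (@club_sup W G (fun k => club G k /\ k <=o b)) => //; first by exists k.
  by move=> ? [].
have b'b : b' <=o b by apply: lb' => ? [].
exists (Some b'); split=> [al ca|be].
  by rewrite /inI; apply/negP => /andP[b'a ab]; move: (hb' al (conj ca ab)); rewrite b'a.
rewrite /inI; have [h|h] := boolP (olt b' be) => /=.
  suff -> : olt b (retract be) by rewrite subr0.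
  apply/negPn/negP => rb; have := hb' _ (conj (retract_club be) rb).
  by move=> /(ole_trans (retract_ge be)); rewrite h.
have -> : olt b (retract be) = false by apply/negbTE; exact: ole_trans (retract_least cb' h) b'b.
by have -> : olt b be = false by [apply/negbTE; exact: ole_trans h b'b]; rewrite subrr.
Qed.

Let v_val (x : X) (z : point m n W) : C :=
  if z.1.1.1 == WSlot G 0 then
    x ((Base, z.1.1.2, z.1.2), z.2) - x ((Base, z.1.1.2, z.1.2), retract z.2) else 0.

Let v_D x y z : v_val (x + y) z = v_val x z + v_val y z.
Proof. by rewrite /v_val; case: ifP => _; rewrite ?addr0// !fvalD; ring. Qed.

Let v_Z c x z : v_val (c *: x) z = c * v_val x z.
Proof. by rewrite /v_val; case: ifP => _; rewrite ?mulr0// !fvalZ mulrBr. Qed.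

Let v_bound x t : xp (R := R) (m := m) (n := n) t (v_val x) <= 2 * nrm x.
Proof.
have [e|ne] := pselect (xi_slot t = WSlot G 0); last first.
  rewrite /xp big1 ?mulr0 => [|l _]; first by rewrite mulr_ge0 ?nrm_ge0.
  rewrite (_ : (fun b => _) = fun=> 0) ?var_zero//; apply/funext => be.
  by rewrite /v_val /=; case: eqP.
have mr k : retract (xi_seq t k) <=o retract (xi_seq t k.+1) by apply/retract_mono/xi_mono.
have h1 := p_le_nrm (s := xspec) (XIndex Base (xi_s t) (@xi_mono W t) (xi_N t)) x.
have h2 := p_le_nrm (s := xspec) (XIndex Base (xi_s t) mr (xi_N t)) x.
apply: (@le_trans _ _ (nrm x + nrm x)); last lra.
apply: le_trans (lerD h1 h2); rewrite /= /xp /= -mulrDr ler_wpM2l ?invr_ge0//.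
rewrite -big_split; apply: ler_sum => l _ /=.
have -> : (fun b => v_val x (xi_slot t, ty m n (xi_s t), l : nat, b)) =
  (fun b => x (Base, ty m n (xi_s t), l : nat, b) + -1 * x (Base, ty m n (xi_s t), l : nat, retract b)).
  by apply/funext => b; rewrite /v_val /= e eqxx mulN1r.
apply: le_trans (varD _ _ _ _) _; rewrite lerD2l varZ cnN cn1 mul1r.
by [].
Qed.

Let v_P (x : X) : fs_P x -> fs_mem (s := xspec) (v_val x).
Proof.
apply: (xspan_ind_fs (Q := fun x => fs_mem (s := xspec) (v_val x))).
- rewrite (_ : v_val 0 = fun=> 0); first exact: fs_mem0.
  by apply/funext => z; have := v_Z 0 0 z; rewrite scale0r mul0r.
- move=> u v hu hv; rewrite (_ : v_val _ = fun z => v_val u z + v_val v z).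
    exact: (fs_memD hu hv).
  by apply/funext => z; rewrite v_D.
- move=> c u hu; rewrite (_ : v_val _ = fun z => c * v_val u z).
    exact: (fs_memZ c hu).
  by apply/funext => z; rewrite v_Z.
move=> [[g i] l] a b hok.
have [e|ne] := eqVneq g Base; last first.
  rewrite (_ : v_val _ = fun=> 0); first exact: fs_mem0.
  apply/funext => z; rewrite /v_val; case: ifP => // _; rewrite !genE// /wfun /=.
  have ne' (i' : I) (l' : nat) : ((Base, i', l') == (g, i, l)) = false.
    by apply/eqP => -[e]; rewrite -e eqxx in ne.
  by rewrite !ne' subr0.
subst g; have hb : base i l by [].
have [b' [nb hb']] := retract_below b.
have okW (c : option W) d : (forall al, club G al -> ~~ inI c d al) ->
  ok ((WSlot G 0, i, l) : line m n W) c d by [].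
suff [y hy] : exists y : X, forall z, y z = v_val (gen (Base, i, l) a b) z.
  by rewrite (_ : v_val _ = fval y); [exact: fvalP|apply/funext => z].
pose q (z : point m n W) := (z.1 == (WSlot G 0, i, l)).
have vE z : v_val (gen (Base, i, l) a b) z =
    (q z)%:R * ((inI a b z.2)%:R - (inI a b (retract z.2))%:R).
  rewrite /v_val !genE// /wfun /q; case: z => -[[g i'] l'] be /=.
  rewrite !xpair_eqE /=; have -> : (Base == Base :> slot W) by [].
  by case: (g == _); case: (i' == i); case: (l' == l); rewrite /= ?mul0r ?mul1r ?subrr.
have gE c d z : (forall al, club G al -> ~~ inI c d al) ->
    gen (WSlot G 0, i, l) c d z = (q z)%:R * (inI c d z.2)%:R.
  by move=> h; rewrite genE// /wfun /q; case: (_ == _); rewrite ?mul1r ?mul0r.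
case: a hok vE => [a|] hok vE; last first.
  by exists (gen (WSlot G 0, i, l) b' b) => z; rewrite vE gE// -hb'.
have [ba|ab] := boolP (olt b a).
  by exists 0 => z; rewrite vE fval0 !inI_empty// subrr mulr0.
have [a' [na ha']] := retract_below a.
exists (gen (WSlot G 0, i, l) b' b - gen (WSlot G 0, i, l) a' a) => z.
rewrite vE fvalB !gE// -mulrBr -hb' -ha' !inIE// /below; congr (_ * _); ring.
Qed.

(** The difference between a function and its retraction vanishes on the closed unbounded set, and
    [retract_below] turns generators into combinations of generators allowed in [WSlot G 0]. *)
Definition club_defect : A :=
  lift_op (@FsMap _ xspec xspec v_val v_D v_Z 2 (ler0n _ _) v_bound v_P).

Lemma club_defectE (x : X) g i l al : (club_defect x : X) ((g, i, l), al) =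
  if g == WSlot G 0 then x ((Base, i, l), al) - x ((Base, i, l), retract al) else 0.
Proof. by []. Qed.

End ClubRetract.

(** * Support, continuity and growth estimates in X *)

Section Growth.
Variables (R : realType) (m n : nat) (W : omega1).
Local Notation C := R[i].
Local Notation "a <o b" := (olt a b) (at level 70).
Local Notation "a <=o b" := (~~ olt b a) (at level 70).
Local Notation I := 'I_(m + n).+1.
Local Notation xspec := (xspec R m n W).
Local Notation X := (fspace xspec).
Local Notation A := (bounded_op (fspace_of xspec)).
Local Notation gen := (@gen R m n W).

Lemma le_inv_nat (r c : R) : (forall k : nat, r <= c * k.+1%:R^-1) -> r <= 0.
Proof.
move=> h; rewrite leNgt; apply/negP => r0.
have [k hk] : exists k : nat, `|c| / r < k%:R.
  by exists (Num.bound (`|c| / r)); apply: archi_boundP; rewrite divr_ge0// ltW.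
move: hk; rewrite ltr_pdivrMr// => hk.
have := h k; rewrite ler_pdivlMr ?ltr0n// mulrC -natr1 mulrDl mul1r.
by have := ler_norm c; lra.
Qed.

(** Finite combinations of generators vanish beyond some point, and a sequence of such points has an
    upper bound. *)
Lemma x_vanish (x : X) : exists b, forall lam be, b <o be -> x (lam, be) = 0.
Proof.
have hP (y : X) : fs_P y -> exists b, forall lam be, b <o be -> y (lam, be) = 0.
  apply: (xspan_ind_fs (Q := fun y => exists b, forall lam be, b <o be -> y (lam, be) = 0)).
  - by exists (omega0 W).
  - move=> u v [b hb] [c hc]; have [d [bd cd _]] := omaxP b c.
    by exists d => lam be h; rewrite fvalD hb ?hc ?addr0//; exact: ole_lt_trans h.
  - by move=> c u [b hb]; exists b => lam be h; rewrite fvalZ hb ?mulr0.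
  move=> lam a b hok; exists b => lam' be h; rewrite genE// /wfun /inI /= h.
  by rewrite !andbF.
have /choice[b hb] (k : nat) : exists b, exists2 y : X, nrm (x - y) <= k.+1%:R^-1 &
    forall lam be, b <o be -> y (lam, be) = 0.
  have [|y Py xy] := @fs_dense _ _ x k.+1%:R^-1; first by rewrite invr_gt0.
  by have [b hb] := hP _ Py; exists b, y.
have [b' hb'] := olt_bound b; exists b' => -[[g i] l] be h.
apply/eqP; rewrite -cn_eq0 eq_le cn_ge0 andbT; apply: (@le_inv_nat _ ((i : nat)`!)%:R) => k.
have [y xy hy] := hb k.
have -> : x (g, i, l, be) = (x - y) (g, i, l, be).
  by rewrite fvalB hy ?subr0//; exact: olt_trans (hb' k) h.
by apply: le_trans (x_val_le _ _ _ _ _) _; rewrite ler_wpM2l.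
Qed.

(** At a limit point every generator is constant on some left neighbourhood, endpoint included, and
    this left continuity passes to limits in norm. *)
Lemma x_left (x : X) lam al : olimit al ->
  (forall be, be <o al -> x (lam, be) = 0) -> x (lam, al) = 0.
Proof.
move=> [[b0 b0a] lim] h0; case: lam h0 => -[g i] l h0.
have hP (y : X) : fs_P y -> exists2 b, b <o al & forall be, b <o be -> be <o al ->
    y ((g, i, l), be) = y ((g, i, l), al).
  apply: (xspan_ind_fs (Q := fun y => exists2 b, b <o al & forall be, b <o be -> be <o al ->
    y ((g, i, l), be) = y ((g, i, l), al))).
  - by exists b0.
  - move=> u v [b ba hb] [c ca hc]; have [d [bd cd hd]] := omaxP b c.
    exists d; first exact: hd.
    by move=> be h1 h2; rewrite !fvalD hb ?hc//; exact: ole_lt_trans h1.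
  - by move=> c u [b ba hb]; exists b => // be h1 h2; rewrite !fvalZ hb.
  move=> lam a b hok.
  have [e|ne] := eqVneq (g, i, l) lam; last first.
    by exists b0 => // be _ _; rewrite !genE// /wfun /= (negbTE ne).
  have key (c : W) : exists2 d, d <o al & forall be, d <o be -> be <o al -> olt c be = olt c al.
    have [ca|ca] := boolP (olt c al).
      by exists c => // be h _; rewrite h.
    exists b0 => // be _ h; apply/negbTE; exact: ole_trans (oltW h) ca.
  have [d da hd] := key b.
  have [d' d'a hd'] : exists2 d, d <o al & forall be, d <o be -> be <o al ->
      (if a is Some a' then olt a' be else true) = (if a is Some a' then olt a' al else true).
    by case: (a) => [a'|]; [exact: key|exists b0].
  have [d1 [dd1 d'd1 hd1]] := omaxP d d'; exists d1; first exact: hd1.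
  move=> be h1 h2; rewrite !genE// /wfun /inI /= hd ?hd'//; exact: ole_lt_trans h1.
apply/eqP; rewrite -cn_eq0 eq_le cn_ge0 andbT.
apply: (@le_inv_nat _ (2 * ((i : nat)`!)%:R)) => k.
have [|y Py xy] := @fs_dense _ _ x k.+1%:R^-1; first by rewrite invr_gt0.
have [b ba hb] := hP _ Py; have [be bbe bea] := lim _ ba.
have -> : x (g, i, l, al) = (x - y) (g, i, l, al) - (x - y) (g, i, l, be).
  by rewrite !fvalB (h0 _ bea) (hb _ bbe bea); ring.
apply: le_trans (cn_subr _ _) _; rewrite mulrAC [2 * _]mulr_natl mulr2n mulrDl.
by rewrite lerD// mulrC; apply: le_trans (x_val_le _ _ _ _ _) _; rewrite ler_wpM2l.
Qed.

Section StepNorms.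
Variables (lam : line m n W) (K : nat) (a b : nat -> W) (th : nat -> C).
Hypothesis hok : forall j, ok lam (Some (a j)) (b j).
Hypothesis th1 : forall j, cn (th j) <= 1.
Hypothesis ab : forall i j, (i < j)%N -> b i <=o a j.

Definition step_fun : X := \sum_(j < K) th j *: gen lam (Some (a j)) (b j).

Lemma step_funE g i l be :
  step_fun ((g, i, l), be) = ((g, i, l) == lam)%:R * steps K a b th be.
Proof.
rewrite /step_fun fval_sum /steps mulr_sumr; apply: eq_bigr => j _.
by rewrite fvalZ genE// /wfun /=; case: (_ == _); rewrite /= ?mul1r// mul0r mulr0.
Qed.

Let step_xp t (c : R) : 0 <= c ->
  var (msz (xi_s t)) (steps K a b th) (xi_seq t) <= c ->
  xp t step_fun <= ((xi_s t)`!)%:R^-1 * c.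
Proof.
move=> c0 hc; apply: (@xp_line R m n W t _ lam.2) => // [l be ne|].
  by rewrite step_funE; case: eqP => [e|]; rewrite ?mul0r//; rewrite -e /= eqxx in ne.
rewrite (_ : (fun be => _) = fun be => ((xi_slot t, ty m n (xi_s t), lam.2) == lam)%:R * steps K a b th be).
  by rewrite varZ cn_bool -[leRHS]mul1r ler_pM ?var_ge0//; case: (_ == _).
by apply/funext => be; rewrite step_funE.
Qed.

Let step_xp_ty t : ty m n (xi_s t) != lam.1.2 -> xp t step_fun <= 0.
Proof.
move=> ne; rewrite /xp big1 ?mulr0// => l _.
rewrite (_ : (fun be => _) = fun=> 0) ?var_zero//; apply/funext => be; rewrite step_funE.
by case: eqP => [e|]; rewrite ?mul0r//; rewrite -e /= eqxx in ne.
Qed.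

Let fact_gt s : (s < s.+1`!)%N.
Proof. by rewrite factS; apply: leq_pmulr; rewrite fact_gt0. Qed.

Let fac_le1 s : ((s`!)%:R : R)^-1 <= 1.
Proof. by rewrite invf_le1 ?ltr0n ?fact_gt0// ler1n fact_gt0. Qed.

Let small_r r s : (r <= s)%N -> ((r`!)%:R : R)^-1 * ((2 * msz r)%:R + 1) <= (3 * msz s)%:R.
Proof.
move=> rs; rewrite natr1 -[leRHS]mul1r ler_pM ?invr_ge0// ler_nat.
by have := msz_mono rs; have := msz_gt0 r; lia.
Qed.

(** Scales up to [s] see at most [msz s] increments of a function bounded by 1. At larger scales the
    number of intervals bounds the variation, and the weight is at most $1/(s+1)!$. *)
Lemma step_norm s : K = msz s.+1 -> nrm step_fun <= (3 * msz s.+1)%:R / s.+1%:R.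
Proof.
move=> KE; apply: nrm_le_p => [|t /=]; first by rewrite divr_ge0.
have [rs|sr] := leqP (xi_s t) s.
  apply: le_trans (step_xp (addr_ge0 (ler0n _ _) ler01) (steps_var_size K th1 ab _ _)) _.
  apply: le_trans (small_r rs) _.
  rewrite ler_pdivlMr ?ltr0n// -natrM ler_nat mszS -!mulnA leq_mul// leq_mul//.
  by rewrite leq_pmulr// fact_gt0.
apply: le_trans (step_xp (addr_ge0 (ler0n _ _) ler01) (steps_var_count K th1 ab _ (@xi_mono _ t))) _.
rewrite mulrC; apply: ler_pM; rewrite ?invr_ge0 ?addr_ge0//.
  by rewrite natr1 ler_nat KE; move: (msz s.+1) (msz_gt0 s.+1) => M; lia.
rewrite lef_pV2 ?posrE ?ltr0n ?fact_gt0// ler_nat.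
by apply: leq_trans (fact_gt s) _; apply: leq_fact.
Qed.

(** The critical scale [s.+1] does not measure this line, since its type is different. Scales below
    it gain through [msz s], scales above it through the factorial, which gives the additional
    factor $1/(s+1)!$. *)
Lemma step_norm_ty s : (2 * K)%N = msz s.+1 -> ty m n s.+1 != lam.1.2 ->
  nrm step_fun <= (3 * msz s.+1)%:R / (s.+1 * s.+1`!)%:R.
Proof.
move=> KE nty; apply: nrm_le_p => [|t /=]; first by rewrite divr_ge0.
have [rs|sr|rs] := ltngtP (xi_s t) s.+1.
- apply: le_trans (step_xp (addr_ge0 (ler0n _ _) ler01) (steps_var_size K th1 ab _ _)) _.
  apply: le_trans (@small_r (xi_s t) s rs) _.
  by rewrite ler_pdivlMr ?ltr0n ?muln_gt0 ?fact_gt0// -natrM ler_nat mszS -!mulnA.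
- apply: le_trans (step_xp (addr_ge0 (ler0n _ _) ler01) (steps_var_count K th1 ab _ (@xi_mono _ t))) _.
  rewrite mulrC; apply: ler_pM; rewrite ?invr_ge0 ?addr_ge0//.
    by rewrite natr1 ler_nat KE; move: (msz s.+1) (msz_gt0 s.+1) => M; lia.
  rewrite lef_pV2 ?posrE ?ltr0n ?muln_gt0 ?fact_gt0// ler_nat.
  apply: leq_trans (leq_fact sr); rewrite [in leqRHS]factS leq_mul2r; apply/orP; right; lia.
- apply: le_trans (step_xp_ty _) _; first by rewrite rs.
  by rewrite divr_ge0.
Qed.

End StepNorms.

(** A seminorm looks at one slot and one type, hence at no more than one summand; the constant
    counts two jumps and the final value. *)
Lemma gens_norm (J : eqType) (r : seq J) (lam : J -> line m n W) (a : J -> option W)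
    (b : J -> W) (th : J -> C) : uniq r -> (forall j, cn (th j) <= 1) ->
  {in r &, injective (fun j => (lam j).1)} ->
  nrm (\sum_(j <- r) th j *: gen (lam j) (a j) (b j) : X) <= 3.
Proof.
move=> ur th1 inj; apply: nrm_le_p => // t /=.
have [[j jr ej]|no] := pselect (exists2 j, j \in r & (lam j).1 = (xi_slot t, ty m n (xi_s t))); last first.
  rewrite /xp big1 ?mulr0// => l _.
  rewrite (_ : (fun be => _) = fun=> 0) ?var_zero//; apply/funext => be; rewrite fval_sum.
  rewrite big_seq big1// => j jr; rewrite fvalZ.
  have [hok|bad] := pselect (ok (lam j) (a j) (b j)); last by rewrite gen_bad// fval0 mulr0.
  rewrite genE// /wfun /=; case: eqP => [e|]; rewrite ?mulr0//.
  by case: no; exists j => //; rewrite -e.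
have val l be : (\sum_(j <- r) th j *: gen (lam j) (a j) (b j) : X) ((xi_slot t, ty m n (xi_s t), l), be)
    = th j * gen (lam j) (a j) (b j) ((xi_slot t, ty m n (xi_s t), l), be).
  rewrite fval_sum (bigD1_seq j)//= [X in _ + X]big1_seq ?addr0// => k /andP[kj kr].
  have [hok|bad] := pselect (ok (lam k) (a k) (b k)); last by rewrite gen_bad// mulr0.
  rewrite genE// /wfun /=; case: eqP => [e|]; rewrite ?mulr0//.
  by move: kj; rewrite (inj k j)// ?eqxx// ej -e.
apply: (@le_trans _ _ (((xi_s t)`!)%:R^-1 * 3)); last first.
  by rewrite -[leRHS]mul1r ler_wpM2r// invf_le1 ?ltr0n ?fact_gt0// ler1n fact_gt0.
have [hok|bad] := pselect (ok (lam j) (a j) (b j)); last first.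
  rewrite /xp big1 ?mulr0 ?mulr_ge0 ?invr_ge0// => l _.
  rewrite (_ : (fun be => _) = fun=> 0) ?var_zero//; apply/funext => be.
  by rewrite val gen_bad// fval0 mulr0.
apply: (@xp_line R m n W t _ (lam j).2) => // [l be ne|].
  by rewrite val genE// /wfun /=; case: eqP => [e|]; rewrite ?mulr0//; rewrite -e eqxx in ne.
rewrite (_ : (fun be => _) = fun be => th j * (inI (a j) (b j) be)%:R); last first.
  by apply/funext => be; rewrite val genE// /wfun /= -ej -surjective_pairing eqxx.
rewrite varZ -[leRHS]mul1r ler_pM ?cn_ge0 ?var_ge0//.
have h := inI_var R (a j) (b j) (msz (xi_s t)) (@xi_mono _ t); rewrite /var.
rewrite cn_bool; have : ((inI (a j) (b j) (xi_seq t (msz (xi_s t))))%:R : R) <= 1 by case: inI.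
lra.
Qed.

Lemma gen_norm lam a b : nrm (gen lam a b) <= 3.
Proof.
have := @gens_norm unit [:: tt] (fun=> lam) (fun=> a) (fun=> b) (fun=> 1) isT.
by rewrite big_seq1 scale1r; apply=> [j|[] []//]; rewrite cn1.
Qed.

End Growth.

Lemma phases (R : realType) (J : Type) (v : J -> R[i]) :
  exists th : J -> R[i], (forall j, cn (th j) <= 1) /\ forall j, th j * v j = (cn (v j))%:C%C.
Proof.
have /choice[th hth] j : exists w, cn w <= 1 /\ w * v j = (cn (v j))%:C%C.
  by have [w w1 e] := cn_phase (v j); exists w; rewrite w1.
by exists th; split=> j; case: (hth j).
Qed.

Lemma cn_sum_real (R : realType) (J : Type) (r : seq J) (c : J -> R) (d : R) :
  (forall j, d <= c j) -> (size r)%:R * d <= cn (\sum_(j <- r) (c j)%:C%C).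
Proof.
move=> h; rewrite -rmorph_sum cn_real; apply: le_trans (ler_norm _).
elim: r => [|j r ih]; first by rewrite big_nil mul0r.
by rewrite big_cons /= -natr1 mulrDl mul1r addrC lerD.
Qed.

Lemma cn_sum_ord (R : realType) K (c : 'I_K -> R) (d : R) :
  (forall j, d <= c j) -> K%:R * d <= cn (\sum_(j < K) (c j)%:C%C).
Proof.
move=> h; rewrite -rmorph_sum cn_real; apply: le_trans (ler_norm _).
by rewrite mulr_natl -[K in _ *+ K]card_ord -sumr_const; apply: ler_sum => j _.
Qed.

Lemma enumerable_bounded (T : eqType) (P : T -> Prop) (N : nat) :
  (forall r : seq T, uniq r -> (forall x, x \in r -> P x) -> (size r <= N)%N) -> enumerable P.
Proof.
move=> h; pose Q k := `[< exists r : seq T, [/\ uniq r, forall x, x \in r -> P x & size r = k] >].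
have exQ : exists k, Q k by exists 0%N; apply/asboolP; exists [::].
have bQ k : Q k -> (k <= N)%N by move=> /asboolP[r [ur pr <-]]; exact: h.
case: (ex_maxnP exQ bQ) => k /asboolP[r [ur pr sr]] mx.
exists (fun i => onth r i) => x Px.
suff xr : x \in r by exists (index x r); rewrite onthE (nth_map x) ?index_mem// nth_index.
apply/negPn/negP => xr; have := mx k.+1; rewrite ltnn => hk.
suff : false by []. apply: hk; apply/asboolP; exists (x :: r); split; rewrite /= ?xr ?sr//.
by move=> y; rewrite inE => /orP[/eqP->//|]; exact: pr.
Qed.

(** * Operators are local on a closed unbounded set *)

Section Locality.
Variables (R : realType) (m n : nat) (W : omega1).
Local Notation C := R[i].
Local Notation "a <o b" := (olt a b) (at level 70).
Local Notation "a <=o b" := (~~ olt b a) (at level 70).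
Local Notation I := 'I_(m + n).+1.
Local Notation xspec := (xspec R m n W).
Local Notation X := (fspace xspec).
Local Notation A := (bounded_op (fspace_of xspec)).
Local Notation gen := (@gen R m n W).
Local Notation line := (line m n W).
Variable S : A.

Definition ev (x : X) i l al : C := (S x : X) ((Base, i, l), al).

Lemma ev_le x (i : I) l al : cn (ev x i l al) <= ((i : nat)`!)%:R * nrm S * nrm x.
Proof. by apply: le_trans (x_val_le _ _ _ _ _) _; rewrite -mulrA ler_wpM2l// bop_le. Qed.

Lemma ev_sum (J : Type) (r : seq J) (F : J -> X) i l al :
  ev (\sum_(j <- r) F j) i l al = \sum_(j <- r) ev (F j) i l al.
Proof. by rewrite /ev (bop_sum S) fval_sum. Qed.

Lemma evZ c x i l al : ev (c *: x) i l al = c * ev x i l al.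
Proof. by rewrite /ev bopZ. Qed.

Lemma evD x y i l al : ev (x + y) i l al = ev x i l al + ev y i l al.
Proof. by rewrite /ev bopD. Qed.

(** Otherwise successive far intervals would each contribute at least a fixed amount at [be]. After
    aligning phases, [msz s.+1] of them contribute proportionally to their number, while [step_norm]
    bounds the norm of the combination by a fraction of order $1/(s+1)$ of it. *)
Let evanescent lam i l be : exists a0, forall a b, a0 <=o a -> ok lam (Some a) b ->
  ev (gen lam (Some a) b) i l be = 0.
Proof.
apply: contrapT => /forallNP h.
have [k hk] : exists k : nat, forall a0, exists p : W * W, [/\ a0 <=o p.1, ok lam (Some p.1) p.2 &
    k.+1%:R^-1 <= cn (ev (gen lam (Some p.1) p.2) i l be)].
  apply: contrapT => /forallNP hk.
  have /choice[c hc] k : exists a0, forall p : W * W, a0 <=o p.1 -> ok lam (Some p.1) p.2 ->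
      cn (ev (gen lam (Some p.1) p.2) i l be) < k.+1%:R^-1.
    have /existsNP[a0 /forallNP ha0] := hk k; exists a0 => p h1 h2.
    by rewrite ltNge; apply/negP => h3; exact: (ha0 p).
  have [a0 ha0] := olt_bound c; apply: (h a0) => a b h1 h2.
  apply/eqP; rewrite -cn_eq0 eq_le cn_ge0 andbT; apply: (@le_inv_nat _ _ 1) => k.
  rewrite mul1r ltW//; apply: (hc k (a, b)) => //=.
  by apply: ole_trans h1; exact: oltW.
have [nx hnx] := choice hk.
have /choice[mx hmx] : forall p : W * W, exists c, p.1 <=o c /\ p.2 <=o c.
  by move=> [a b]; have [c [ac bc _]] := omaxP a b; exists c.
pose c j := iter j (fun c => mx (nx c)) (omega0 W).
pose a j := (nx (c j)).1; pose b j := (nx (c j)).2.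
have ca j : c j <=o a j by case: (hnx (c j)).
have cS j : c j <=o c j.+1 by apply: ole_trans (ca j) _; case: (hmx (nx (c j))).
have cm i' j : (i' <= j)%N -> c i' <=o c j.
  move=> /subnK <-; elim: (j - i')%N => [|d ih]; first exact: ole_refl.
  by apply: ole_trans ih _; rewrite addSn.
have ab i' j : (i' < j)%N -> b i' <=o a j.
  move=> ij; apply: ole_trans (ca j); apply: ole_trans (cm _ _ ij).
  by case: (hmx (nx (c i'))).
have hok j : ok lam (Some (a j)) (b j) by case: (hnx (c j)).
have [th [th1 hth]] := phases (fun j => ev (gen lam (Some (a j)) (b j)) i l be).
have : (k.+1%:R^-1 : R) <= 0.
  apply: (@le_inv_nat _ _ (((i : nat)`!)%:R * nrm S * 3)) => s.
  have := ev_le (step_fun lam (msz s.+1) a b th) i l be.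
  have hs := step_norm hok th1 ab (erefl (msz s.+1)).
  move=> /le_trans/(_ (ler_wpM2l _ hs)) => /(_ (mulr_ge0 (ler0n _ _) (nrm_ge0 S))).
  rewrite /step_fun ev_sum (eq_bigr (fun j : 'I_(msz s.+1) =>
    (cn (ev (gen lam (Some (a j)) (b j)) i l be))%:C%C)); last first.
    by move=> j _; rewrite evZ hth.
  have : (msz s.+1)%:R * k.+1%:R^-1 <= cn (\sum_(j < msz s.+1)
      (cn (ev (gen lam (Some (a j)) (b j)) i l be))%:C%C).
    by apply: cn_sum_ord => j; case: (hnx (c j)).
  move=> h1 h2; have := le_trans h1 h2.
  have M0 : 0 < (msz s.+1)%:R :> R by rewrite ltr0n msz_gt0.
  rewrite -ler_pdivlMl// => /le_trans; apply.
  rewrite natrM le_eqVlt; apply/orP; left; apply/eqP; field.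
  by rewrite nat1r pnatr_eq0 (gt_eqF M0).
by rewrite leNgt invr_gt0 ltr0n.
Qed.

(** For a given right end [b] only countably many left ends give a nonempty interval, and each image
    vanishes beyond some point. *)
Let forget lam : exists F : W -> W, forall b a al i l, F b <o al -> ok lam a b ->
  ev (gen lam a b) i l al = 0.
Proof.
suff /choice[F hF] b : exists c, forall a al i l, c <o al -> ok lam a b ->
  ev (gen lam a b) i l al = 0 by exists F.
pose P (a : option W) := if a is Some a' then is_true (a' <o b) else True.
have /choice[v hv] a := x_vanish (S (gen lam a b) : X).
have [|c hc] := @enumerable_ub W (fun d => exists2 a, P a & d = v a).
  apply: enumerable_image; have [f hf] := olt_enum b.
  exists (fun k => if k is k'.+1 then omap Some (f k') else Some None) => -[a /hf[k fk]|_].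
    by exists k.+1; rewrite fk.
  by exists 0%N.
exists c => a al i l cal hok.
have [Pa|nPa] := pselect (P a).
  by apply: hv; apply: olt_trans cal; apply: hc; exists a.
case: a hok nPa => [a|] hok nPa; last by case: nPa.
have -> : gen lam (Some a) b = 0.
  apply: fspaceP => z; rewrite genE// /wfun /inI.
  have [az|] := boolP (olt a z.2); last by rewrite andbF.
  have ba : b <=o a by apply/negP.
  by rewrite (ole_lt_trans ba az) andbF.
by rewrite /ev linear0.
Qed.

Definition relevant be (lam : line) := exists i l a b, ok lam a b /\ ev (gen lam a b) i l be <> 0.

(** Generators on distinct slots combine with norm at most 3, so only boundedly many slots can
    contribute a given positive amount to a given coordinate at [be]; each slot has countably many
    lines. *)
Let relevant_enum be : enumerable (relevant be).
Proof.
pose P (q : I * nat * nat) (g : slot W) := exists p : I * nat * option W * W,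
  ok (g, p.1.1.1, p.1.1.2) p.1.2 p.2 /\
  q.2.+1%:R^-1 <= cn (ev (gen (g, p.1.1.1, p.1.1.2) p.1.2 p.2) q.1.1 q.1.2 be).
have eP q : enumerable (P q).
  pose D := ((q.1.1 : nat)`!)%:R * nrm S * 3 * q.2.+1%:R.
  apply: (@enumerable_bounded _ _ (Num.bound `|D|)) => r ur hr.
  have /choice[p hp] g : exists p : I * nat * option W * W, g \in r ->
      ok (g, p.1.1.1, p.1.1.2) p.1.2 p.2 /\
      q.2.+1%:R^-1 <= cn (ev (gen (g, p.1.1.1, p.1.1.2) p.1.2 p.2) q.1.1 q.1.2 be).
    have [gr|] := boolP (g \in r); last by exists (q.1.1, 0%N, None, be).
    by have [p hp] := hr g gr; exists p.
  pose lam g := (g, (p g).1.1.1, (p g).1.1.2).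
  pose v g := ev (gen (lam g) (p g).1.2 (p g).2) q.1.1 q.1.2 be.
  have [th [th1 hth]] := phases v.
  have inj : {in r &, injective (fun g => (lam g).1)} by move=> g g' _ _ [].
  have hn := @gens_norm R m n W _ r lam (fun g => (p g).1.2) (fun g => (p g).2) th ur th1 inj.
  have := ev_le (\sum_(g <- r) th g *: gen (lam g) (p g).1.2 (p g).2) q.1.1 q.1.2 be.
  move=> /le_trans/(_ (ler_wpM2l _ hn)) => /(_ (mulr_ge0 (ler0n _ _) (nrm_ge0 S))).
  rewrite ev_sum (eq_bigr (fun g => (cn (v g))%:C%C)); last by move=> g _; rewrite evZ hth.
  have : (size r)%:R * q.2.+1%:R^-1 <= cn (\sum_(g <- r) (cn (v g))%:C%C).
    have -> : \sum_(g <- r) (cn (v g))%:C%C = \sum_(g <- r) (Num.max (cn (v g)) q.2.+1%:R^-1)%:C%C.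
      rewrite big_seq [RHS]big_seq; apply: eq_bigr => g gr.
      by rewrite max_l//; case: (hp g gr).
    by apply: cn_sum_real => g; rewrite le_max lexx orbT.
  move=> h1 h2; have := le_trans h1 h2; rewrite ler_pdivrMr ?ltr0n// -/D => h3.
  rewrite -(ler_nat R); apply: le_trans h3 (le_trans (ler_norm _) (ltW (archi_boundP _))).
  exact: normr_ge0.
have e1 : enumerable (fun g => exists k, (fun k g => if unpickle k is Some q then P q g else False) k g).
  apply: enumerable_bigcup => k; case: (unpickle k) => [q|]; first exact: eP.
  by exists (fun=> None).
apply: (enumerable_sub _ (enumerable_dep (B := fun g lam => exists p : I * nat, lam = (g, p.1, p.2)) e1 _)).
  move=> [[g i'] l'] [i [l [a [b [hok /eqP ne]]]]].
  rewrite -cn_eq0 in ne; have pos : 0 < cn (ev (gen (g, i', l') a b) i l be) by rewrite lt_def ne cn_ge0.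
  exists g; last by exists (i', l').
  have [k hk] : exists k : nat, (cn (ev (gen (g, i', l') a b) i l be))^-1 < k%:R.
    by exists (Num.bound (cn (ev (gen (g, i', l') a b) i l be))^-1); apply: archi_boundP; rewrite invr_ge0 ltW.
  exists (pickle (i, l, k)); rewrite pickleK; exists (i', l', a, b); split=> //=.
  rewrite -[leRHS]invrK lef_pV2 ?posrE ?invr_gt0 ?ltr0n//.
  by apply: le_trans (ltW hk) _; rewrite ler_nat.
move=> g _; exists (fun k => omap (fun p : I * nat => (g, p.1, p.2)) (unpickle k)) => lam [p ->].
by exists (pickle p); rewrite pickleK.
Qed.

(** What locality at [al] needs from one line. Each line has its own club of such [al], and
    [club_diagonal] combines the clubs of the relevant lines. *)
Definition tame (lam : line) al := [/\
  forall i l a b, ok lam a b -> b <o al -> ev (gen lam a b) i l al = 0,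
  forall i l a b, ok lam (Some a) b -> al <=o a -> ev (gen lam (Some a) b) i l al = 0 &
  forall F k, lam.1.1 = WSlot F k -> club F al].

Let tame_club lam : exists F : W -> W, forall al, club F al -> tame lam al.
Proof.
have [F1 hF1] := forget lam.
have /choice[a0 ha0] (q : I * nat * W) := evanescent lam q.1.1 q.1.2 q.2.
have /choice[F2 hF2] be : exists c, forall i l, a0 (i, l, be) <o c.
  pose f k := if unpickle k is Some p then a0 (p.1, p.2, be) else be.
  have [c hc] := olt_bound f; exists c => i l.
  by have := hc (pickle (i, l)); rewrite /f pickleK.
have [F12 i12 h12] := club_and F1 F2.
pose F3 := if lam.1.1 is WSlot F _ then F else F12.
have [F i3 hF] := club_and F12 F3; exists F => al cF.
have lim := club_limit i3 cF.
have [c12 c3] := hF _ cF; have [c1 c2] := h12 _ c12; split.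
- by move=> i l a b hok ba; apply: hF1 hok; exact: c1.2.
- move=> i l a b hok aal; apply: x_left lim _ => be hbe.
  apply: (ha0 (i, l, be)) => //=; apply: ole_trans aal; apply: oltW.
  exact: olt_trans (hF2 be i l) (c2.2 _ hbe).
by move=> F' k e; move: c3; rewrite /F3 e.
Qed.

Definition loc al := forall i l lam a b, ok lam a b ->
  ev (gen lam a b) i l al = (inI a b al)%:R * ev (gen lam None al) i l al /\
  (forall F k, lam.1.1 = WSlot F k -> ev (gen lam a b) i l al = 0).

(** There are uncountably many lines, but only countably many matter at each point, so a diagonal
    intersection handles those relevant below [al]; for the others [x_left] transfers vanishing
    below [al] to [al]. *)
Lemma locality : exists2 G, inflationary G & forall al, club G al -> loc al.
Proof.
have /choice[H hH] := tame_club.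
have [|G iG hG] := @club_diagonal W (fun be F => exists2 lam, relevant be lam & F = H lam).
  by move=> be; exact/enumerable_image/relevant_enum.
exists G => // al cG i l lam a b hok.
have lim := club_limit iG cG.
have [[be bal rel]|irr] := pselect (exists2 be, be <o al & relevant be lam); last first.
  have z a' b' : ok lam a' b' -> ev (gen lam a' b') i l al = 0.
    move=> hok'; apply: x_left lim _ => be bal; apply: contrapT => ne.
    by apply: irr; exists be => //; exists i, l, a', b'.
  rewrite z//; split=> //; have [hok'|bad] := pselect (ok lam None al); first by rewrite z ?mulr0.
  by rewrite gen_bad// /ev linear0 mulr0.
have [t1 t2 t3] : tame lam al by apply: hH; apply: hG cG bal _; exists lam.
have [inn|out] := boolP (inI a b al); last first.
  suff -> : ev (gen lam a b) i l al = 0 by rewrite mul0r.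
  move: out; rewrite /inI negb_and negbK => /orP[|ba]; last exact: t1.
  by case: a hok => // a hok h; exact: t2.
rewrite mul1r; split; last first.
  by move=> F k e; move: hok; rewrite /ok e => -[_ /(_ _ (t3 _ _ e))]; rewrite inn.
have full c d : ok lam c d.
  move: hok t3; rewrite /ok; case: (lam.1.1) => [//|//|F k] [_ h] /(_ _ _ erefl)/h.
  by rewrite inn.
have alb : al <=o b by move: inn => /andP[].
(* Splitting the interval at [al]: the pieces that start at [al] or end before it contribute nothing
   at [al]. *)
have -> : gen lam a b = gen lam None al + gen lam (Some al) b -
    (if a is Some a' then gen lam None a' else 0).
  apply: fspaceP => z; rewrite fvalB fvalD.
  have -> : gen lam None al z + gen lam (Some al) b z = wfun R lam None b z.
    by rewrite !genE// /wfun; case: (_ == _); rewrite /= ?addr0// inIE// /below addrC subrK.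
  case: a hok inn => [a|] hok inn; last by rewrite subr0 genE.
  rewrite !genE// /wfun; case: (_ == _); rewrite /= ?subrr// inIE//.
  by apply: ole_trans alb; apply: oltW; case/andP: inn.
have -> : ev (gen lam None al + gen lam (Some al) b - (if a is Some a' then gen lam None a' else 0)) i l al =
  ev (gen lam None al) i l al + ev (gen lam (Some al) b) i l al -
  ev (if a is Some a' then gen lam None a' else 0) i l al.
  by rewrite !evD -scaleN1r evZ mulN1r.
rewrite t2 ?ole_refl// addr0.
case: a hok inn => [a|] hok inn; last by rewrite /ev linear0 subr0.
by rewrite (t1 i l None a) ?subr0//; case/andP: inn.
Qed.

End Locality.

Lemma sum_even_le (R : realType) (f : nat -> R) K M : M = (2 * K)%N -> (forall k, 0 <= f k) ->
  \sum_(j < K) f (2 * j)%N <= \sum_(k < M) f k.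
Proof.
move=> -> f0; elim: K => [|K ih]; first by rewrite muln0 !big_ord0.
rewrite big_ord_recr /= (_ : (2 * K.+1 = (2 * K).+2)%N); last by lia.
by rewrite !big_ord_recr /= -addrA lerD// lerDl.
Qed.

(** * Coefficients are eventually constant and respect types *)

Section EventuallyConstant.
Variables (R : realType) (m n : nat) (W : omega1).
Local Notation C := R[i].
Local Notation "a <o b" := (olt a b) (at level 70).
Local Notation "a <=o b" := (~~ olt b a) (at level 70).
Local Notation I := 'I_(m + n).+1.
Local Notation xspec := (xspec R m n W).
Local Notation X := (fspace xspec).
Local Notation A := (bounded_op (fspace_of xspec)).
Local Notation gen := (@gen R m n W).
Local Notation line := (line m n W).
Local Notation ty := (ty m n).

Lemma var0_le_nrm (x : X) (a : nat -> W) s (i : I) l :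
  (forall k, a k <=o a k.+1) -> ty s = i ->
  \sum_(k < msz s) cn (x ((Base, i, l), a k.+1) - x ((Base, i, l), a k)) <= (s`!)%:R * nrm x.
Proof.
move=> ha <-; have := p_le_nrm (s := xspec) (XIndex Base s ha l.+1) x.
rewrite /= /xp /= -ler_pdivlMl ?invr_gt0 ?ltr0n ?fact_gt0// invrK => h; apply: le_trans h.
rewrite big_ord_recr /=; apply: (@le_trans _ _ (var (msz s) (fun b => x ((Base, ty s, l), b)) a)).
  by rewrite /var lerDl cn_ge0.
by rewrite lerDr; apply: sumr_ge0 => k _; exact: var_ge0.
Qed.

(** A sequence of scales of type [i] tending to infinity. *)
Let idx (i : I) q : nat := (i + (m + n).+1 * q.+1)%N.

Let idx_ty i q : ty (idx i q) = i.
Proof. by apply: val_inj; rewrite /= /idx mulnC addnC modnMDl modn_small. Qed.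

Let idxE i q : idx i q = (idx i q).-1.+1.
Proof. by rewrite prednK// /idx; lia. Qed.

Let idx_ge i q : (q < idx i q)%N.
Proof. by rewrite /idx; nia. Qed.

Variables (S : A) (G : W -> W).
Hypothesis hG : forall al, club G al -> loc S al.

Definition coef (lam : line) i l al := ev S (gen lam None al) i l al.

Variables (lam : line) (i : I) (l : nat).
Hypothesis full : forall a b, ok lam a b.

(** Persistent oscillation by [d] would give the image of a single generator, of norm at most 3, a
    variation of at least [d] times half of [msz s] at every scale [s] of type [i]. Since $s\cdot
    s!$ divides [msz s], this is unbounded after weighting by $1/s!$. *)
Let coef_cauchy (d : R) : 0 < d -> exists ga, forall al be, club G al -> club G be ->
  ga <o al -> ga <o be -> cn (coef lam i l al - coef lam i l be) <= d.
Proof.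
move=> d0; apply: contrapT => /forallNP h.
have /choice[nx hnx] ga : exists p : W * W, [/\ club G p.1, club G p.2, ga <o p.1, p.1 <=o p.2 &
    d < cn (coef lam i l p.2 - coef lam i l p.1)].
  have /existsNP[al /existsNP[be /not_implyP[ca /not_implyP[cb /not_implyP[ga1 /not_implyP[ga2 /negP]]]]]] := h ga.
  rewrite -ltNge => hd; have [ab|ba] := boolP (olt be al).
    by exists (be, al); split=> //=; exact: oltW.
  by exists (al, be); split=> //=; rewrite cnB.
pose c j := iter j (fun c => (nx c).2) (omega0 W).
pose sq k := if odd k then (nx (c k./2)).2 else (nx (c k./2)).1.
have sqe j : sq (2 * j)%N = (nx (c j)).1 by rewrite /sq mul2n odd_double doubleK.
have sqo j : sq (2 * j).+1 = (nx (c j)).2 by rewrite /sq mul2n /= odd_double /= uphalf_double.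
have split k : exists j, k = (2 * j)%N \/ k = (2 * j).+1.
  by exists k./2; have := odd_double_half k; case: (odd k); rewrite mul2n /= ?add0n ?add1n; [right|left].
have mono k : sq k <=o sq k.+1.
  have [j [->|->]] := split k; first by rewrite sqe sqo; case: (hnx (c j)).
  have -> : (2 * j).+2 = (2 * j.+1)%N by lia.
  by rewrite sqo sqe; apply: oltW; case: (hnx (c j.+1)).
have sqc k : club G (sq k).
  by have [j [->|->]] := split k; rewrite ?sqe ?sqo; case: (hnx (c j)).
have [b hb] := olt_bound sq.
have vE k : (S (gen lam None b) : X) ((Base, i, l), sq k) = coef lam i l (sq k).
  have := (hG (sqc k) i l (full None b)).1; rewrite /ev => ->.
  by rewrite /inI /= oltW// mul1r.
have : d <= 0; last by rewrite leNgt d0.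
apply: (@le_inv_nat _ _ (6 * nrm S)) => q.
have := var0_le_nrm (S (gen lam None b)) l mono (idx_ty i q).
move=> h1.
pose f k : R := cn ((S (gen lam None b) : X) ((Base, i, l), sq k.+1) -
  (S (gen lam None b) : X) ((Base, i, l), sq k)).
have h2 := le_trans (@sum_even_le R f _ _ (msz_even _) (fun k => cn_ge0 _)) h1.
have h3 : (msz (idx i q))./2%:R * d <= ((idx i q)`!)%:R * (nrm S * 3).
  apply: le_trans (_ : _ <= _) (ler_wpM2l (ler0n _ _) (le_trans (bop_le S _) (ler_wpM2l (nrm_ge0 S) (gen_norm R lam None b)))).
  apply: le_trans h2; rewrite mulr_natl -[X in _ *+ X]card_ord -sumr_const; apply: ler_sum => j _.
  by rewrite /f !vE sqe sqo ltW//; case: (hnx (c j)).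
have h4 : (idx i q * (idx i q)`!)%:R * d <= 2 * (((idx i q)`!)%:R * (nrm S * 3)).
  apply: le_trans (ler_wpM2l (ler0n _ 2) h3); rewrite mulrA ler_wpM2r ?(ltW d0)//.
  by rewrite -natrM -msz_even ler_nat idxE mszS -mulnA leq_pmull// msz_gt0.
have f0 : 0 < ((idx i q)`!)%:R :> R by rewrite ltr0n fact_gt0.
have h5 : (idx i q)%:R * d <= 6 * nrm S.
  rewrite -(ler_pM2r f0) mulrAC -natrM; apply: le_trans h4 _.
  by rewrite le_eqVlt; apply/orP; left; apply/eqP; ring.
rewrite ler_pdivlMr ?ltr0n//; apply: le_trans h5; rewrite mulrC ler_wpM2r ?(ltW d0)// ler_nat.
exact: idx_ge.
Qed.

(** Oscillations below every $1/(k+1)$ die out beyond countably many points. For different types,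
    alternating intervals have small norm by [step_norm_ty], while their image jumps by the modulus
    of the constant at every increment of a scale of type [i]. *)
Lemma coef_constant : exists ga c, (forall al, club G al -> ga <o al -> coef lam i l al = c) /\
  (lam.1.2 != i -> c = 0).
Proof.
have inv_gt0 (k : nat) : 0 < k.+1%:R^-1 :> R by rewrite invr_gt0.
have /choice[ga hga] := fun k => coef_cauchy (inv_gt0 k).
have [g hg] := olt_bound ga; have [a0 ca0 ga0] := club_unbounded G g.
have cst al : club G al -> g <o al -> coef lam i l al = coef lam i l a0.
  move=> cal gal; apply/eqP; rewrite -subr_eq0 -cn_eq0 eq_le cn_ge0 andbT.
  apply: (@le_inv_nat _ _ 1) => k; rewrite mul1r.
  by apply: (hga k) => //; exact: olt_trans (hg k) _.
exists g, (coef lam i l a0); split=> // nty.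
have [nx hnx] : exists nx : W -> W, forall b, club G (nx b) /\ b <o nx b.
  have /choice[nx hnx] b : exists al, club G al /\ b <o al.
    by have [al ? ?] := club_unbounded G b; exists al.
  by exists nx.
pose a k := iter k nx a0.
have aS k : a k <o a k.+1 by case: (hnx (a k)).
have alt j k : (j < k)%N -> a j <o a k.
  elim: k => // k ih; rewrite ltnS leq_eqVlt => /orP[/eqP->//|/ih h].
  exact: olt_trans h (aS k).
have ale j k : (j <= k)%N -> a j <=o a k.
  by rewrite leq_eqVlt => /orP[/eqP->|/alt/oltW//]; exact: ole_refl.
have mono k : a k <=o a k.+1 by apply: ale.
have ca k : club G (a k) by case: k => // k; case: (hnx (a k)).
have gak k : g <o a k by case: k => [|k] //; exact: olt_trans ga0 (alt 0%N k.+1 isT).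
set c := coef lam i l a0 in cst *.
apply/eqP; rewrite -cn_eq0 eq_le cn_ge0 andbT; apply: (@le_inv_nat _ _ (3 * nrm S)) => q.
(* Every second gap of the sequence [a] is filled, so the values of [S y] alternate between 0 and
   [c] and each of the [msz s] increments contributes the modulus of [c]. *)
pose s := idx i q; pose K := (msz s)./2.
pose y : X := step_fun lam K (fun j => a (2 * j)%N) (fun j => a (2 * j).+1) (fun=> 1).
have th1 (j : nat) : cn (1 : C) <= 1 by rewrite cn1.
have hab i' j : (i' < j)%N -> a (2 * i').+1 <=o a (2 * j)%N by move=> ij; apply: ale; lia.
have yn : nrm y <= (3 * msz s)%:R / (s * s`!)%:R.
  rewrite /s idxE; apply: (@step_norm_ty R m n W lam K _ _ _ (fun j => full _ _) th1 hab) => //.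
    by rewrite -idxE /K -msz_even.
  by rewrite -idxE idx_ty eq_sym.
have vE k : (k <= 2 * K)%N -> (S y : X) ((Base, i, l), a k) = (odd k)%:R * c.
  move=> kK; rewrite -[LHS]/(ev S y i l (a k)) /y /step_fun ev_sum.
  rewrite (eq_bigr (fun j : 'I_K => (k == (2 * j).+1)%:R * c)) => [|j _]; last first.
    rewrite evZ mul1r (hG (ca k) i l (full (Some (a (2 * j)%N)) (a (2 * j).+1))).1.
    rewrite -[ev _ _ _ _ _]/(coef lam i l (a k)) cst//; congr (((_ : bool)%:R) * _).
    rewrite /inI; have [lt|gt|->] := ltngtP k (2 * j).+1.
    - by apply/negbTE/negP => /andP[h _]; have := ale k (2 * j)%N lt; rewrite h.
    - by rewrite (alt _ _ gt) andbF.
    - by rewrite aS (ole_refl (a (2 * j).+1)).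
  have [ok|ek] := boolP (odd k).
    have kE : k = (2 * k./2).+1 by rewrite -{1}(odd_double_half k) ok mul2n.
    have hk : (k./2 < K)%N by lia.
    rewrite (@big_only1 _ _ _ _ (Ordinal hk))// => [|j ne _]; first by rewrite /= -kE eqxx.
    case: eqP => [e|]; last by rewrite mul0r.
    by case/eqP: ne; apply: val_inj => /=; lia.
  rewrite big1 ?mul0r// => j _; case: eqP => [e|]; last by rewrite mul0r.
  by move: ek; rewrite e /= mul2n odd_double.
have h1 := var0_le_nrm (S y) l mono (idx_ty i q).
have h2 : (msz s)%:R * cn c <= (s`!)%:R * (nrm S * ((3 * msz s)%:R / (s * s`!)%:R)).
  apply: le_trans (ler_wpM2l (ler0n _ _) (le_trans (bop_le S _) (ler_wpM2l (nrm_ge0 S) yn))).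
  apply: le_trans h1; rewrite mulr_natl -[X in _ *+ X](card_ord (msz s)) -sumr_const.
  apply: ler_sum => k _; have kM := ltn_ord k; rewrite -/s {2}msz_even -/K in kM.
  rewrite !vE//; last exact: ltnW.
  rewrite /= -mulrBl cnM; case: (odd k) => /=; rewrite ?sub0r ?subr0 ?cnN cn1 mul1r //.
have M0 : 0 < (msz s)%:R :> R by rewrite ltr0n msz_gt0.
have f0 : 0 < (s`!)%:R :> R by rewrite ltr0n fact_gt0.
have s0 : 0 < s%:R :> R by rewrite ltr0n /s idxE.
have h3 : cn c <= 3 * nrm S / s%:R.
  rewrite -(ler_pM2l M0); apply: le_trans h2 _; rewrite !natrM le_eqVlt; apply/orP; left.
  by apply/eqP; field; rewrite (gt_eqF f0) (gt_eqF s0).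
apply: le_trans h3 _; rewrite ler_wpM2l ?mulr_ge0 ?nrm_ge0// lef_pV2 ?posrE//.
by rewrite ler_nat; exact: idx_ge.
Qed.

End EventuallyConstant.

(** * The characters chi and the fibre maps Phi *)

Section Fibres.
Variables (R : realType) (m n : nat) (W : omega1).
Local Notation C := R[i].
Local Notation "a <o b" := (olt a b) (at level 70).
Local Notation "a <=o b" := (~~ olt b a) (at level 70).
Local Notation I := 'I_(m + n).+1.
Local Notation xspec := (xspec R m n W).
Local Notation X := (fspace xspec).
Local Notation A := (bounded_op (fspace_of xspec)).
Local Notation l1 := (fspace (ell1 R)).
Local Notation B := (bounded_op (fspace_of (ell1 R))).
Local Notation gen := (@gen R m n W).
Local Notation line := (line m n W).
Local Notation Z := (l1_toeplitz R).
Implicit Types (S T : A).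

(** The slots other than [WSlot] are countably many, so one closed unbounded set serves the
    coefficients of all their full lines. *)
Definition nslot (o : option nat) : slot W := if o is Some nu then LSlot nu else Base.

Definition settled S (c : line -> I -> nat -> C) al := loc S al /\
  forall o i' l' i l, let lam : line := (nslot o, i', l') in (forall a b, ok lam a b) ->
    coef S lam i l al = c lam i l /\ (i' != i -> c lam i l = 0).

Lemma settled_exists S : exists p : (line -> I -> nat -> C) * (W -> W),
  inflationary p.2 /\ forall al, club p.2 al -> settled S p.1 al.
Proof.
have [G0 iG0 hG0] := locality S.
pose Q := (option nat * I * nat * I * nat)%type.
pose lam (q : Q) : line := (nslot q.1.1.1.1, q.1.1.1.2, q.1.1.2).
have /choice[gc hgc] (q : Q) : exists p : W * C, (forall a b, ok (lam q) a b) ->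
    (forall al, club G0 al -> p.1 <o al -> coef S (lam q) q.1.2 q.2 al = p.2) /\
    (q.1.1.1.2 != q.1.2 -> p.2 = 0).
  have [full|no] := pselect (forall a b, ok (lam q) a b); last by exists (omega0 W, 0).
  by have [ga [c [h1 h2]]] := coef_constant hG0 q.1.2 q.2 full; exists (ga, c).
have [g hg] := olt_bound (fun k => if unpickle k is Some q then (gc q).1 else omega0 W).
have [G iG hG] := club_and G0 (fun=> g).
pose c (mu : line) i l : C := if mu.1.1 is LSlot nu then (gc (Some nu, mu.1.2, mu.2, i, l)).2
  else (gc (None, mu.1.2, mu.2, i, l)).2.
exists (c, G); split=> // al cal; have [c0 [[b0 b0a] cg]] := hG _ cal; split; first exact: hG0.
move=> o i' l' i l mu full; have [h1 h2] := hgc (o, i', l', i, l) full.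
have -> : (c, G).1 mu i l = (gc (o, i', l', i, l)).2 by rewrite /= /c /mu; case: (o).
split=> //; apply: h1 => //; apply: olt_trans (cg _ b0a).
by have := hg (pickle (o, i', l', i, l)); rewrite pickleK.
Qed.

Definition sconst S := (sval (cid (settled_exists S))).1.
Definition sclub S := (sval (cid (settled_exists S))).2.

Lemma sclub_infl S : inflationary (sclub S).
Proof. by rewrite /sclub; case: cid => /= p []. Qed.

Lemma sclub_settled S al : club (sclub S) al -> settled S (sconst S) al.
Proof. by rewrite /sclub /sconst; case: cid => /= p [_ h]; exact: h. Qed.

Lemma sclub_common (Ss : seq A) : exists al, forall k, club (sclub (nth 0 Ss k)) al.
Proof.
have [G iG hG] := club_countable (fun k => sclub (nth 0 Ss k)).
by have [al cal _] := club_unbounded G (omega0 W); exists al => k; exact: hG.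
Qed.

Let spt_ex S : exists al, club (sclub S) al.
Proof. by have [al cal _] := club_unbounded (sclub S) (omega0 W); exists al. Qed.

Definition spt S : W := sval (cid (spt_ex S)).

Lemma sptP S : club (sclub S) (spt S).
Proof. by rewrite /spt; case: cid. Qed.

Definition ee : A := filt_op R (fun g (_ : I) => g != Base).

Lemma eeE (x : X) g i l al : (ee x : X) ((g, i, l), al) = if g != Base then x ((g, i, l), al) else 0.
Proof. exact: filt_opE. Qed.

Lemma coE (x : X) g i l al :
  ((1 - ee) x : X) ((g, i, l), al) = if g == Base then x ((g, i, l), al) else 0.
Proof.
have -> : ((1 - ee) x : X) = x - (ee x : X) by [].
by rewrite fvalB eeE; case: (g == Base); rewrite ?subr0 ?subrr.
Qed.

Lemma ee_ee : ee * ee = ee.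
Proof. by apply: fop_ext => x [[[g i] l] al]; rewrite bounded_opM !eeE; case: (_ != _). Qed.

Lemma co_gen lam a b : (1 - ee) (gen lam a b) = if lam.1.1 == Base then gen lam a b else 0.
Proof.
have [hok|bad] := pselect (ok lam a b); last by rewrite gen_bad// linear0; case: ifP.
apply: fspaceP => -[[[g i] l] al]; rewrite coE.
have -> : fval (if lam.1.1 == Base then gen lam a b else 0) ((g, i, l), al) =
  if lam.1.1 == Base then gen lam a b ((g, i, l), al) else 0 by case: ifP.
rewrite genE// /wfun; have [e|ne] := eqVneq (g, i, l) lam; first by rewrite -e.
by rewrite !if_same.
Qed.

Section LowTypes.
Variables (i : I) (hi : (i < m)%N).

Definition chi S : C := sconst S (Base, i, 0%N) i 0%N.

Lemma base_low l : base i l = (l == 0%N).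
Proof. by rewrite /base hi [(m <= i)%N]leqNgt hi /= orbF. Qed.

(** Checked on generators: [WSlot] lines drop out by locality, and [LSlot] lines and base lines of
    other types have zero coefficients because their type is not [i]. Only the line itself
    remains. *)
Lemma chiE S al (x : X) : club (sclub S) al ->
  (S x : X) ((Base, i, 0%N), al) = chi S * x ((Base, i, 0%N), al).
Proof.
move=> cal; have [hloc hcst] := sclub_settled cal.
apply: (@functional_eq R m n W (fun x => (S x : X) ((Base, i, 0%N), al))
  (fun x => chi S * x ((Base, i, 0%N), al)) (((i : nat)`!)%:R * nrm S) (cn (chi S) * ((i : nat)`!)%:R)).
- by move=> u v; rewrite bopD.
- by move=> c u; rewrite bopZ.
- by move=> u v; rewrite fvalD mulrDr.
- by move=> c u; rewrite fvalZ mulrCA.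
- by move=> u; exact: ev_le.
- by move=> u; rewrite cnM -mulrA ler_wpM2l ?cn_ge0 ?x_val_le.
move=> [[g i'] l] a b hok; have [h1 h2] := hloc i 0%N _ _ _ hok.
rewrite -[LHS]/(ev S _ i 0%N al) [gen (g, i', l) a b _]genE// /wfun /=.
have key o : g = nslot o -> ev S (gen (g, i', l) a b) i 0%N al =
    (inI a b al)%:R * sconst S (nslot o, i', l) i 0%N /\
    (i' != i -> sconst S (nslot o, i', l) i 0%N = 0).
  move=> e; subst g; have full c d : ok ((nslot o, i', l) : line) c d by move: hok; case: (o).
  by rewrite h1; have [<- h] := hcst o i' l i 0%N full.
case: g hok key h2 h1 => [|nu|F k] hok key h2 h1.
- have [-> hz] := key None erefl; have [e|ne] := eqVneq i' i; last first.
    by rewrite hz// mulr0 (_ : (_ == _) = false) ?mulr0//; apply/eqP => -[e _]; rewrite e eqxx in ne.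
  subst i'; move: hok; rewrite /ok /= base_low => /eqP ->; rewrite eqxx /= mulrC //.
- have [-> hz] := key (Some nu) erefl; have ne : i' != i.
    by apply/eqP => e; move: hok; rewrite /ok /= e => /andP[]; lia.
  by rewrite hz// mulr0 (_ : (_ == _) = false) ?mulr0//; apply/eqP => -[].
- by rewrite (h2 F k)// (_ : (_ == _) = false) ?mulr0//; apply/eqP => -[].
Qed.

Let probe al : gen (Base, i, 0%N) None al ((Base, i, 0%N), al) = 1.
Proof. by rewrite genE /wfun ?eqxx /inI /= ?olt_irr// /ok /= base_low. Qed.

Lemma chi_probe S al : club (sclub S) al -> chi S = (S (gen (Base, i, 0%N) None al) : X) ((Base, i, 0%N), al).
Proof. by move=> /chiE ->; rewrite probe mulr1. Qed.

Lemma chiD S T : chi (S + T) = chi S + chi T.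
Proof.
have [al h] := sclub_common [:: S; T; S + T].
have hS : club (sclub S) al := h 0%N; have hT : club (sclub T) al := h 1%N.
have hST : club (sclub (S + T)) al := h 2%N.
by rewrite (chi_probe hS) (chi_probe hT) (chi_probe hST) -fvalD.
Qed.

Lemma chiM S T : chi (S * T) = chi S * chi T.
Proof.
have [al h] := sclub_common [:: S; T; S * T].
have hS : club (sclub S) al := h 0%N; have hT : club (sclub T) al := h 1%N.
have hST : club (sclub (S * T)) al := h 2%N.
by rewrite (chi_probe hT) (chi_probe hST) bounded_opM (chiE _ hS).
Qed.

Lemma chi1 : chi 1 = 1.
Proof. by rewrite (chi_probe (sptP 1)) bounded_op1 probe. Qed.

Lemma chi_val S c : (forall x al, (S x : X) ((Base, i, 0%N), al) = c * x ((Base, i, 0%N), al)) -> chi S = c.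
Proof. by move=> h; rewrite (chi_probe (sptP S)) h probe mulr1. Qed.

End LowTypes.

Lemma l1_delta_P (k : nat) : fs_P (f := ell1 R) (fun n => (n == k)%:R).
Proof. by exists k.+1 => j jk; rewrite gtn_eqF. Qed.

Definition delta k : l1 := FSpace (fs_memP (@l1_delta_P k)).

Lemma l1_functional_eq (f g : l1 -> C) (K L : R) :
  (forall x y, f (x + y) = f x + f y) -> (forall c x, f (c *: x) = c * f x) ->
  (forall x y, g (x + y) = g x + g y) -> (forall c x, g (c *: x) = c * g x) ->
  (forall x, cn (f x) <= K * nrm x) -> (forall x, cn (g x) <= L * nrm x) ->
  (forall k, f (delta k) = g (delta k)) -> forall x, f x = g x.
Proof.
move=> fD fZ gD gZ fK gL fg; apply: (fs_functional_eq fD fZ gD gZ fK gL) => y [N hN].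
have -> : y = \sum_(k < N) y k *: delta k.
  apply: fspaceP => j; rewrite fval_sum; have [jN|Nj] := ltnP j N.
    rewrite (@big_only1 _ _ _ _ (Ordinal jN))// => [|k ne _]; rewrite fvalZ /=.
      by rewrite eqxx mulr1.
    by rewrite (_ : (j == k) = false) ?mulr0//; apply/negbTE; rewrite eq_sym.
  rewrite hN// big1// => k _; rewrite fvalZ /= (_ : (j == k) = false) ?mulr0//.
  by apply/negbTE; rewrite gtn_eqF//; exact: leq_trans (ltn_ord k) Nj.
have f0 : f 0 = 0 by have := fZ 0 0; rewrite scale0r mul0r.
have g0 : g 0 = 0 by have := gZ 0 0; rewrite scale0r mul0r.
by elim/big_rec: _ => [|k u _ hu]; rewrite ?f0 ?g0// fD gD fZ gZ fg hu.
Qed.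

Section HighTypes.
Variables (i : I) (hi : (m <= i < m + n)%N).

Lemma tens0 a b : tens hi a b 0 = 0 :> X.
Proof.
by apply: fspaceP => z; rewrite tensE; case: ifP => // _; rewrite mul0r.
Qed.

Let phi_map S al (y : l1) : l1 := fib i al (S (tens hi None al y : fspace_of _)).

Let phi_bounded S al : bounded_map (phi_map S al : fspace_of _ -> fspace_of _).
Proof.
split=> [c y z|].
  by rewrite /phi_map tensD tensZ (bopD S) (bopZ S) fibD fibZ.
exists (((i : nat)`!)%:R * (nrm S * 3)) => [|y]; first by rewrite !mulr_ge0 ?nrm_ge0.
apply: le_trans (fib_le _ _ _) _; rewrite -!mulrA ler_wpM2l//.
by apply: le_trans (bop_le _ _) _; rewrite ler_wpM2l ?nrm_ge0 ?tens_le.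
Qed.

Definition phi_at S al : B := bop_of (phi_bounded S al).

Lemma phi_atE S al (y : l1) : (phi_at S al y : l1) = fib i al (S (tens hi None al y : fspace_of _)).
Proof. by []. Qed.

Definition Phi S : B := phi_at S (spt S).

Let ok_full l a b : ok ((Base, i, l) : line) a b.
Proof. by rewrite /ok /= /base hi orbT. Qed.

Let tens_delta al k : tens hi None al (delta k) = gen (Base, i, k) None al.
Proof.
apply: fspaceP => -[[[g i'] l] be]; rewrite tensE genE// /wfun /=.
rewrite !xpair_eqE; case: (_ && _) => /=; rewrite ?mul0r//.
by case: (l == k); rewrite ?mul1r ?mul0r.
Qed.

(** On vectors [delta k] both sides are coefficients of base lines, which do not depend on the
    closure point; boundedness does the rest. *)
Lemma PhiE S al : club (sclub S) al -> Phi S = phi_at S al.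
Proof.
move=> cal; have cs := sptP S; apply: fop_ext => y l; move: y.
apply: (@l1_functional_eq (fun y => (Phi S y : l1) l) (fun y => (phi_at S al y : l1) l)
  (nrm (Phi S)) (nrm (phi_at S al))).
- by move=> u v; rewrite bopD.
- by move=> c u; rewrite bopZ.
- by move=> u v; rewrite bopD.
- by move=> c u; rewrite bopZ.
- move=> u; apply: le_trans (bop_le _ _); apply: le_trans (l1_p_le l.+1 _).
  by rewrite /l1_p big_ord_recr /= lerDr; apply: sumr_ge0 => ? _; exact: cn_ge0.
- move=> u; apply: le_trans (bop_le _ _); apply: le_trans (l1_p_le l.+1 _).
  by rewrite /l1_p big_ord_recr /= lerDr; apply: sumr_ge0 => ? _; exact: cn_ge0.
move=> k; rewrite !phi_atE !tens_delta !fibE.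
have [_ h1] := sclub_settled cal; have [_ h2] := sclub_settled cs.
rewrite -[LHS]/(coef S (nslot None, i, k) i l (spt S)) -[RHS]/(coef S (nslot None, i, k) i l al).
by rewrite (h1 None i k i l (ok_full k)).1 (h2 None i k i l (ok_full k)).1.
Qed.

(** Both sides are bounded and linear, and on generators locality reduces the left side to
    coefficients at [al]; base lines of other types contribute zero. *)
Lemma fib_co S al (x : X) : club (sclub S) al ->
  fib i al (S ((1 - ee) x)) = (Phi S (fib i al x : fspace_of _) : l1).
Proof.
move=> cal; rewrite (PhiE cal); have [hloc hcst] := sclub_settled cal.
apply: fspaceP => l; rewrite fibE phi_atE fibE; move: x.
apply: (@functional_eq R m n W (fun x => (S ((1 - ee) x) : X) ((Base, i, l), al))
  (fun x => (S (tens hi None al (fib i al x) : fspace_of _) : X) ((Base, i, l), al))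
  (((i : nat)`!)%:R * (nrm S * nrm (1 - ee))) (((i : nat)`!)%:R * (nrm S * (3 * ((i : nat)`!)%:R)))).
- by move=> u v; rewrite (bopD (1 - ee)) (bopD S).
- by move=> c u; rewrite (bopZ (1 - ee)) (bopZ S).
- by move=> u v; rewrite fibD tensD (bopD S).
- by move=> c u; rewrite fibZ tensZ (bopZ S).
- move=> u; apply: le_trans (x_val_le _ _ _ _ _) _; rewrite -!mulrA ler_wpM2l//.
  by apply: le_trans (bop_le _ _) _; rewrite ler_wpM2l ?nrm_ge0 ?bop_le.
- move=> u; apply: le_trans (x_val_le _ _ _ _ _) _; rewrite -!mulrA ler_wpM2l//.
  apply: le_trans (bop_le _ _) _; rewrite ler_wpM2l ?nrm_ge0//.
  by apply: le_trans (tens_le _ _ _ _) _; rewrite ler_wpM2l ?fib_le.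
move=> [[g i'] k] a b hok; rewrite co_gen /=.
have [e|ne] := eqVneq g Base; last first.
  have -> : fib i al (gen (g, i', k) a b) = 0.
    apply: fspaceP => z; rewrite fibE genE// /wfun /=.
    by case: eqP => // -[e]; rewrite -e eqxx in ne.
  by rewrite tens0 (bop0 S).
subst g; have [h1 _] := hloc i l _ _ _ hok.
rewrite -[LHS]/(ev S _ i l al) h1.
have [e|ne] := eqVneq i' i; last first.
  have full c d : ok ((nslot None, i', k) : line) c d by [].
  rewrite -[ev _ _ _ _ _]/(coef S (nslot None, i', k) i l al).
  have [-> ->] := hcst None i' k i l full => //.
  have -> : fib i al (gen (Base, i', k) a b) = 0.
    apply: fspaceP => z; rewrite fibE genE// /wfun /=.
    by case: eqP => // -[e]; rewrite e eqxx in ne.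
  by rewrite mulr0 tens0 (bop0 S).
subst i'; have -> : fib i al (gen (Base, i, k) a b) = (inI a b al)%:R *: delta k.
  apply: fspaceP => z; rewrite fibE genE// fvalZ /wfun /= !xpair_eqE !eqxx /=.
  by case: (z == k); rewrite /= ?mulr1 ?mulr0.
by rewrite tensZ tens_delta (bopZ S).
Qed.

End HighTypes.
End Fibres.

(** * Phi is multiplicative modulo compacts *)

Section FibreAlgebra.
Variables (R : realType) (m n : nat) (W : omega1).
Local Notation C := R[i].
Local Notation "a <o b" := (olt a b) (at level 70).
Local Notation "a <=o b" := (~~ olt b a) (at level 70).
Local Notation I := 'I_(m + n).+1.
Local Notation xspec := (xspec R m n W).
Local Notation X := (fspace xspec).
Local Notation A := (bounded_op (fspace_of xspec)).
Local Notation l1 := (fspace (ell1 R)).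
Local Notation B := (bounded_op (fspace_of (ell1 R))).
Local Notation gen := (@gen R m n W).
Local Notation line := (line m n W).
Local Notation Z := (l1_toeplitz R).
Local Notation ee := (ee R m n W).
Local Notation t := (l1_t R).
Implicit Types (S T : A).

Section OneType.
Variables (i : I) (hi : (m <= i < m + n)%N).
Local Notation Phi := (Phi hi).

Let lslot (j : nat * I) : line := (LSlot j.1, j.2, 0%N).

Let psi S al j : l1 := fib i al (S (gen (lslot j) None al : fspace_of _)).

Let D : R := (((m + n).+1)`!)%:R.

Let D0 : 0 < D. Proof. by rewrite ltr0n fact_gt0. Qed.

Let val_le_D (x : X) (g : slot W) (i' : I) l al : cn (x ((g, i', l), al)) <= D * nrm x.
Proof.
apply: le_trans (x_val_le _ _ _ _ _) _; rewrite ler_wpM2r ?nrm_ge0// ler_nat.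
by apply: leq_fact; exact/ltnW/ltn_ord.
Qed.

Let fib_sum (J : Type) (r : seq J) (F : J -> X) al :
  fib i al (\sum_(j <- r) F j) = \sum_(j <- r) fib i al (F j).
Proof. by apply: fspaceP => l; rewrite fibE !fval_sum. Qed.

Let psi_bounded S al (J : seq (nat * I)) (th : nat * I -> C) : uniq J ->
  (forall j, cn (th j) <= 1) ->
  nrm (\sum_(j <- J) th j *: psi S al j) <= ((i : nat)`!)%:R * (nrm S * 3).
Proof.
move=> uJ th1.
have -> : \sum_(j <- J) th j *: psi S al j =
    fib i al (S (\sum_(j <- J) th j *: gen (lslot j) None al : X)).
  rewrite (bop_sum S) fib_sum; apply: eq_bigr => j _.
  by rewrite (bopZ S) fibZ.
apply: le_trans (fib_le _ _ _) _; rewrite ler_wpM2l//.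
apply: le_trans (bop_le _ _) _; rewrite ler_wpM2l ?nrm_ge0//.
apply: (@gens_norm R m n W _ J lslot (fun=> None) (fun=> al) th) => //.
by move=> [nu i1] [nu' i2] _ _ [-> ->].
Qed.

Let expand S al (x : X) : club (sclub S) al -> fs_P x -> exists J0 : seq (nat * I),
  forall J, uniq J -> {subset J0 <= J} ->
  fib i al (S (ee x : X)) = \sum_(j <- J) x (lslot j, al) *: psi S al j.
Proof.
move=> cal; have [hloc _] := sclub_settled cal.
apply: (xspan_ind_fs (Q := fun x => exists J0 : seq (nat * I), forall J, uniq J ->
  {subset J0 <= J} -> fib i al (S (ee x : X)) = \sum_(j <- J) x (lslot j, al) *: psi S al j)).
- exists [::] => J _ _; rewrite big1 => [|j _]; last by rewrite fval0 scale0r.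
  by rewrite (bop0 ee) (bop0 S); apply: fspaceP => l; rewrite fibE.
- move=> u v [J1 h1] [J2 h2]; exists (J1 ++ J2) => J uJ sJ.
  rewrite (bopD ee) (bopD S) fibD (h1 J)// ?(h2 J)//.
  + by rewrite -big_split; apply: eq_bigr => j _; rewrite fvalD scalerDl.
  + by move=> j hj; apply: sJ; rewrite mem_cat hj orbT.
  + by move=> j hj; apply: sJ; rewrite mem_cat hj.
- move=> c u [J1 h1]; exists J1 => J uJ sJ; rewrite (bopZ ee) (bopZ S) fibZ (h1 J)//.
  by rewrite scaler_sumr; apply: eq_bigr => j _; rewrite fvalZ scalerA.
move=> [[g i'] l] a b hok.
have eg : ee (gen (g, i', l) a b : X) = if g == Base then 0 else gen (g, i', l) a b.
  have -> : ee (gen (g, i', l) a b : X) = (gen (g, i', l) a b : X) - (1 - ee) (gen (g, i', l) a b : X).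
    have -> : (1 - ee) (gen (g, i', l) a b : X) =
      (gen (g, i', l) a b : X) - ee (gen (g, i', l) a b : X) by [].
    by rewrite opprB addrC subrK.
  by rewrite co_gen /=; case: (g == Base); rewrite ?subrr ?subr0.
rewrite eg; case: g hok eg => [|nu|F k] hok _ /=.
- exists [::] => J _ _; rewrite big1 => [|j _]; last first.
    by rewrite genE// /wfun /= (_ : _ == _ = false) ?scale0r//; apply/eqP => -[].
  by rewrite eqxx (bop0 S); apply: fspaceP => z; rewrite fibE.
- have l0 : l = 0%N by move: hok; rewrite /ok /= => /andP[_ /eqP].
  subst l; exists [:: (nu, i')] => J uJ sJ.
  rewrite (bigD1_seq (nu, i'))//=; last by apply: sJ; rewrite inE.
  rewrite big1 ?addr0 => [|[nu' i''] ne]; last first.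
    rewrite genE// /wfun /= (_ : _ == _ = false) ?scale0r//; apply/eqP => -[e1 e2].
    by rewrite e1 e2 eqxx in ne.
  rewrite (_ : (LSlot nu == Base) = false); last by apply/eqP.
  apply: fspaceP => z; rewrite fvalZ !fibE genE// /wfun /= eqxx /=.
  by have [h _] := hloc i z _ _ _ hok; rewrite /ev in h; rewrite h.
exists [::] => J _ _; rewrite big1 => [|j _]; last first.
  by rewrite genE// /wfun /= (_ : _ == _ = false) ?scale0r//; apply/eqP => -[].
rewrite (_ : (WSlot F k == Base) = false); last by apply/eqP.
apply: fspaceP => z; rewrite fibE fval0.
by have [_ h] := hloc i z _ _ _ hok; exact: (h F k).
Qed.

(** At [al] the slots [WSlot] contribute nothing, and the [LSlot] lines combine as in $c_0$. Their
    images in the fibre thus form an unconditionally bounded series in $\ell_1$, whose tails are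
    uniformly small by [l1_unconditional]. *)
Lemma fibre_tail S al : club (sclub S) al -> forall e : R, 0 < e -> exists N, forall x : X,
  nrm ((t ^+ N) (fib i al (S (ee x : X)) : fspace_of _)) <= e * nrm x.
Proof.
move=> cal e e0; have d0 : 0 < e / D by rewrite divr_gt0.
have [N hN] := l1_unconditional (psi_bounded S al) d0; exists N.
have hP (x : X) : fs_P x -> nrm ((t ^+ N) (fib i al (S (ee x : X)) : fspace_of _)) <= e * nrm x.
  move=> Px; have [J0 hJ] := expand cal Px.
  have [->|x0] := eqVneq x 0.
    rewrite (bop0 ee) (bop0 S) (_ : fib i al 0 = 0); last by apply: fspaceP => l; rewrite fibE.
    by rewrite (bop0 (t ^+ N)) !nrm0 mulr0.
  have nx : 0 < nrm x by rewrite lt_def nrm_ge0 andbT; apply: contra x0 => /eqP/nrm_eq0 ->.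
  (* Normalization making all coefficients of modulus at most 1; [D] is a common bound for the
     factorial weights of all types. *)
  pose c : C := (D * nrm x)%:C%C; have Dx : 0 < D * nrm x by rewrite mulr_gt0.
  have c0 : c != 0 by rewrite -cn_eq0 cn_real gt_eqF// normr_gt0 gt_eqF.
  have cc : cn c = D * nrm x by rewrite cn_real ger0_norm// ltW.
  pose th j := c^-1 * x (lslot j, al).
  have th1 j : cn (th j) <= 1 by rewrite cnM cnV cc mulrC ler_pdivrMr// mul1r val_le_D.
  have := hN (undup J0) th (undup_uniq _) th1.
  have -> : \sum_(j <- undup J0) th j *: psi S al j = c^-1 *: fib i al (S (ee x : X)).
    rewrite (hJ (undup J0)) ?undup_uniq//; last by move=> j; rewrite mem_undup.
    by rewrite scaler_sumr; apply: eq_bigr => j _; rewrite scalerA.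
  rewrite (bopZ (t ^+ N)) nrmZ cnV cc mulrC ler_pdivrMr// => /le_trans; apply.
  by rewrite mulrA divfK ?gt_eqF.
move=> x; apply/ler_addgt0Pr => d dd0.
pose K := ((i : nat)`!)%:R * (nrm S * nrm ee) + e; have K0 : 0 < K.
  by rewrite ltr_wpDl// !mulr_ge0 ?nrm_ge0.
have [y Py xy] := fs_dense x (divr_gt0 dd0 K0).
have -> : fib i al (S (ee x : X)) = fib i al (S (ee (x - y) : X)) + fib i al (S (ee y : X)).
  by rewrite -fibD -(bopD S) -(bopD ee) subrK.
rewrite (bopD (t ^+ N)); apply: le_trans (nrmD _ _) _.
have h1 : nrm ((t ^+ N) (fib i al (S (ee (x - y) : X)) : fspace_of _)) <=
    ((i : nat)`!)%:R * (nrm S * nrm ee) * nrm (x - y).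
  apply: le_trans (bop_le _ _) _; apply: le_trans (ler_wpM2r (nrm_ge0 _) (tz_tX1 Z N)) _.
  rewrite mul1r -!mulrA; apply: le_trans (fib_le _ _ _) _; rewrite ler_wpM2l//.
  by apply: le_trans (bop_le _ _) _; rewrite ler_wpM2l ?nrm_ge0 ?bop_le.
have h2 : nrm y <= nrm x + nrm (x - y).
  have e1 : x + (y - x) = y by rewrite addrC subrK.
  have := nrmD x (y - x); rewrite e1 => /le_trans; apply.
  by rewrite nrmB.
have h3 := hP _ Py.
have h4 : K * nrm (x - y) <= d by rewrite mulrC -ler_pdivlMr.
have h5 := ler_wpM2l (ltW e0) h2.
rewrite /K in h4; lra.
Qed.

Lemma PhiD S T : Phi (S + T) = Phi S + Phi T.
Proof.
have [al h] := sclub_common [:: S; T; S + T].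
have hS : club (sclub S) al := h 0%N; have hT : club (sclub T) al := h 1%N.
have hST : club (sclub (S + T)) al := h 2%N.
rewrite (PhiE hi hS) (PhiE hi hT) (PhiE hi hST); apply: bounded_opP => y.
exact: fspaceP.
Qed.

Let tens_fib al (y : l1) : fib i al (tens hi None al y : X) = y.
Proof.
by apply: fspaceP => l; rewrite fibE tensE /= eqxx /inI olt_irr mulr1.
Qed.

Lemma Phi_val S (f : B) : (forall (y : l1) al,
  fib i al (S (tens hi None al y : X)) = (f (y : fspace_of _) : l1)) -> Phi S = f.
Proof. by move=> h; apply: bounded_opP => y; rewrite -(h y (spt S)). Qed.

Lemma Phi1 : Phi (1 : A) = 1.
Proof. by apply: Phi_val => y al; rewrite bounded_op1 tens_fib. Qed.

Lemma Phi_le S : nrm (Phi S) <= ((i : nat)`!)%:R * 3 * nrm S.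
Proof.
apply: bop_nrm_le => [|y]; first by rewrite mulr_ge0 ?nrm_ge0.
apply: le_trans (fib_le _ _ _) _; rewrite -!mulrA ler_wpM2l//.
apply: le_trans (bop_le _ _) _; rewrite mulrCA ler_wpM2l ?nrm_ge0//.
exact: tens_le.
Qed.

(** The defect is the fibre of [S * ee * T], and [fibre_tail] bounds its tails uniformly, which is
    compactness in the sense of [kk]. *)
Lemma PhiM S T : kk Z (Phi (S * T) - Phi S * Phi T).
Proof.
have [al h] := sclub_common [:: S; T; S * T].
have hS : club (sclub S) al := h 0%N; have hT : club (sclub T) al := h 1%N.
have hST : club (sclub (S * T)) al := h 2%N.
move=> e e0.
have K0 : 0 < nrm T * 3 + 1 by rewrite ltr_wpDl// mulr_ge0 ?nrm_ge0.
have [N hN] := fibre_tail hS (divr_gt0 e0 K0); exists N.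
apply: bop_nrm_le => [|y]; first exact: ltW.
pose x : X := T (tens hi None al y : X).
have -> : (t ^+ N * (Phi (S * T) - Phi S * Phi T)) y = (t ^+ N) (fib i al (S (ee x : X)) : fspace_of _).
  rewrite bounded_opM; congr ((t ^+ N) _).
  have -> : (Phi (S * T) - Phi S * Phi T) y =
    (Phi (S * T) y : l1) - (Phi S (Phi T y) : l1) by [].
  rewrite (PhiE hi hST) (PhiE hi hT) (phi_atE hi (S * T)) (phi_atE hi T).
  rewrite -/x -(fib_co hi x hS) bounded_opM -/x.
  have -> : S x = S (ee x : X) + S ((1 - ee) x : X).
    have -> : (1 - ee) x = x - (ee x : X) by [].
    by rewrite -(bopD S) addrC subrK.
  by rewrite fibD addrK.
apply: le_trans (hN x) _.
apply: (@le_trans _ _ (e / (nrm T * 3 + 1) * ((nrm T * 3 + 1) * nrm y))); last first.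
  by rewrite mulrA divfK// gt_eqF.
rewrite ler_wpM2l ?divr_ge0 ?(ltW e0) ?(ltW K0)//.
apply: le_trans (bop_le _ _) _; apply: le_trans (ler_wpM2l (nrm_ge0 _) (tens_le _ _ _ _)) _.
by rewrite mulrA ler_wpM2r ?nrm_ge0// lerDl.
Qed.

Lemma Phi_sigma (f : B) : Phi (sigma W hi f) = f.
Proof.
apply: Phi_val => y al; apply: fspaceP => l.
by rewrite fibE sigmaE eqxx tens_fib.
Qed.

End OneType.

Lemma Phi_sigma_ne (i j : I) (hi : (m <= i < m + n)%N) (hj : (m <= j < m + n)%N) (f : B) :
  i != j -> Phi hi (sigma W hj f) = 0.
Proof.
move=> ij; apply: Phi_val => y al; apply: fspaceP => l; rewrite fibE sigmaE.
by case: eqP => // -[e]; rewrite e eqxx in ij.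
Qed.

Lemma sigmaD (i : I) (hi : (m <= i < m + n)%N) (f g : B) : sigma W hi (f + g) = sigma W hi f + sigma W hi g :> A.
Proof.
apply: fop_ext => x [[[g' i'] l] al]; rewrite fvalD !sigmaE.
by case: ifP => _; rewrite ?addr0// -fvalD.
Qed.

Lemma sigmaM (i : I) (hi : (m <= i < m + n)%N) (f g : B) : sigma W hi (f * g) = sigma W hi f * sigma W hi g :> A.
Proof.
apply: fop_ext => x [[[g' i'] l] al]; rewrite bounded_opM !sigmaE; case: ifP => // _.
rewrite bounded_opM; congr ((f _ : l1) l); apply: fspaceP => k.
by rewrite fibE sigmaE eqxx.
Qed.

Lemma sigma_orth (i j : I) (hi : (m <= i < m + n)%N) (hj : (m <= j < m + n)%N) (f g : B) :
  i != j -> sigma W hi f * sigma W hj g = 0 :> A.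
Proof.
move=> ij; apply: fop_ext => x [[[g' i'] l] al]; rewrite bounded_opM sigmaE; case: ifP => // _.
rewrite (_ : fib i al _ = 0) ?(bop0 f)//; apply: fspaceP => k; rewrite fibE sigmaE.
by case: eqP => // -[e]; rewrite e eqxx in ij.
Qed.

Definition pp (i : I) : A := filt_op R (fun g i' => (g == Base) && (i' == i)).

Lemma ppE i (x : X) g i' l al : (pp i x : X) ((g, i', l), al) =
  if (g == Base) && (i' == i) then x ((g, i', l), al) else 0.
Proof. exact: filt_opE. Qed.

Lemma pp_pp i : pp i * pp i = pp i.
Proof. by apply: fop_ext => x [[[g i'] l] al]; rewrite bounded_opM !ppE; case: (_ && _). Qed.

Lemma pp_orth i j : i != j -> pp i * pp j = 0.
Proof.
move=> ij; apply: fop_ext => x [[[g i'] l] al]; rewrite bounded_opM !ppE.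
by case: (g == Base) => //=; have [->|//] := eqVneq i' i; rewrite (negbTE ij).
Qed.

Lemma pp_sigma i (j : I) (hj : (m <= j < m + n)%N) (f : B) : i != j ->
  pp i * sigma W hj f = 0 /\ sigma W hj f * pp i = 0.
Proof.
move=> ij; split; apply: fop_ext => x [[[g i'] l] al]; rewrite bounded_opM.
  rewrite ppE; case: ifP => // /andP[/eqP -> /eqP ->]; rewrite sigmaE.
  by case: eqP => // -[e]; rewrite e eqxx in ij.
rewrite sigmaE; case: ifP => // _.
rewrite (_ : fib j al _ = 0) ?(bop0 f)//; apply: fspaceP => k; rewrite fibE ppE.
by rewrite eqxx /= eq_sym (negbTE ij).
Qed.

Lemma chi_pp (i j : I) (hi : (i < m)%N) : chi i (pp j) = (i == j)%:R.
Proof.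
apply: (chi_val hi) => x al; rewrite ppE eqxx /=.
by case: (i == j); rewrite ?mul1r ?mul0r.
Qed.

Lemma chi_sigma (i j : I) (hi : (i < m)%N) (hj : (m <= j < m + n)%N) (f : B) : chi i (sigma W hj f) = 0.
Proof.
apply: (chi_val hi) => x al; rewrite sigmaE mul0r; case: eqP => // -[e].
by move: hi; rewrite e ltnNge (proj1 (andP hj)).
Qed.

Lemma Phi_pp (i j : I) (hi : (m <= i < m + n)%N) : i != j -> Phi hi (pp j) = 0.
Proof.
move=> ij; apply: Phi_val => y al; apply: fspaceP => l; rewrite fibE ppE eqxx /=.
by rewrite (negbTE ij).
Qed.

End FibreAlgebra.

(** * Operators with vanishing symbols lie in the ideal of ee *)

Section Membership.
Variables (R : realType) (m n : nat) (W : omega1).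
Local Notation C := R[i].
Local Notation I := 'I_(m + n).+1.
Local Notation xspec := (xspec R m n W).
Local Notation X := (fspace xspec).
Local Notation A := (bounded_op (fspace_of xspec)).
Local Notation l1 := (fspace (ell1 R)).
Local Notation B := (bounded_op (fspace_of (ell1 R))).
Local Notation gen := (@gen R m n W).
Local Notation line := (line m n W).
Local Notation point := (point m n W).
Local Notation Z := (l1_toeplitz R).
Local Notation ee := (ee R m n W).
Local Notation slot := (slot W).
Implicit Types (S T : A).

Lemma x_zero (x : X) lam al : (forall a b, ~ ok lam a b) -> x (lam, al) = 0.
Proof.
move=> bad; move: x; case: lam bad => -[g i] l bad.
apply: (@functional_eq R m n W (fun x => x ((g, i, l), al)) (fun=> 0) (((i : nat)`!)%:R) 0).
- by [].
- by [].
- by move=> *; rewrite addr0.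
- by move=> *; rewrite mulr0.
- by move=> x; exact: x_val_le.
- by move=> x; rewrite cn0 mul0r.
move=> lam a b hok; rewrite genE// /wfun /=; case: eqP => // e; subst lam.
by case: (bad a b).
Qed.

Lemma lix_subproof (i : 'I_m) : (i < (m + n).+1)%N.
Proof. by have := ltn_ord i; lia. Qed.

Definition lix (i : 'I_m) : I := Ordinal (lix_subproof i).

Lemma lixP i : (lix i < m)%N. Proof. exact: (ltn_ord i). Qed.

Lemma hix_subproof (j : 'I_n) : (m + j < (m + n).+1)%N.
Proof. by have := ltn_ord j; lia. Qed.

Definition hix (j : 'I_n) : I := Ordinal (hix_subproof j).

Lemma hixP j : (m <= hix j < m + n)%N.
Proof. by apply/andP; split; [exact: leq_addr|rewrite /= ltn_add2l; exact: (ltn_ord j)]. Qed.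

Lemma lix_inj i i' : (lix i == lix i') = (i == i'). Proof. by []. Qed.

Lemma hix_inj j j' : (hix j == hix j') = (j == j').
Proof. by rewrite -val_eqE /= eqn_add2l. Qed.

Lemma lix_hix i j : lix i != hix j.
Proof. by rewrite -val_eqE /=; have := ltn_ord i; lia. Qed.

Section Transport.
Variable j : 'I_n.
Let q (i : I) (l : nat) := (i == hix j) && (l == 0%N).

Let back_ok i l a b : q i l -> ok ((LSlot 0, i, l) : line) a b -> ok ((Base, i, l) : line) a b.
Proof. by move=> /andP[/eqP -> _] _; rewrite /ok /= /base hixP orbT. Qed.

Let fwd_ok i l a b : q i l -> ok ((Base, i, l) : line) a b -> ok ((LSlot 0, i, l) : line) a b.
Proof. by move=> /andP[/eqP -> /eqP ->] _; rewrite /ok /= leq_addr. Qed.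

Definition back : A := move_op R back_ok.
Definition fwd : A := move_op R fwd_ok.

Lemma backE (x : X) g i l al : (back x : X) ((g, i, l), al) =
  if [&& g == Base, i == hix j & l == 0%N] then x ((LSlot 0, i, l), al) else 0.
Proof. exact: move_opE. Qed.

Lemma fwdE (x : X) g i l al : (fwd x : X) ((g, i, l), al) =
  if [&& g == LSlot 0, i == hix j & l == 0%N] then x ((Base, i, l), al) else 0.
Proof. exact: move_opE. Qed.

Lemma LSlot_Base nu : (LSlot nu == Base :> slot) = false.
Proof. by apply/eqP. Qed.

Lemma WSlot_Base F nu : (WSlot F nu == Base :> slot) = false.
Proof. by apply/eqP. Qed.

Lemma l1_pE (f : l1) k : (tzp Z f : l1) k = if k == 0%N then f 0%N else 0.
Proof.
have -> : (tzp Z f : l1) = f - (l1_s R (l1_t R f) : l1) by [].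
by rewrite fvalB; case: k => [|k]; rewrite /= ?subr0 ?subrr.
Qed.

(** The rank-one projection acts on one line of the fibre, and this line is isomorphic to the
    [LSlot] line to which [fwd] sends it. *)
Lemma sigma_p : sigma W (hixP j) (tzp Z) = back * ee * fwd.
Proof.
apply: fop_ext => x [[[g i] l] al]; rewrite -mulrA !bounded_opM sigmaE backE eeE fwdE.
rewrite LSlot_Base xpair_eqE; case: (g == Base); rewrite ?andTb ?andFb//.
have [->|ne1] := eqVneq i (hix j); rewrite ?andTb ?andFb// l1_pE.
have [->|ne] := eqVneq l 0%N; last by [].
by rewrite !eqxx fibE.
Qed.

(** A compact [k] is the limit of [tzP Z N * k], a sum of terms containing the factor [tzp Z], to
    which [sigma_p] applies. *)
Lemma cideal_sigma k : kk Z k -> cideal ee (sigma W (hixP j) k).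
Proof.
have s0 : sigma W (hixP j) 0 = 0 :> A.
  by apply: (@addrI _ (sigma W (hixP j) 0)); rewrite -sigmaD !addr0.
have sB f g : sigma W (hixP j) (f - g) = sigma W (hixP j) f - sigma W (hixP j) g :> A.
  by apply: (@addIr _ (sigma W (hixP j) g)); rewrite -sigmaD !subrK.
move=> kk_k; apply: cideal_closed => e e0; have [N hN] := kk_k _ e0.
exists (sigma W (hixP j) (tzP Z N * k)).
  rewrite tzPE mulr_suml.
  have -> : sigma W (hixP j) (\sum_(i < N) l1_s R ^+ i * tzp Z * l1_t R ^+ i * k) =
      \sum_(i < N) sigma W (hixP j) (l1_s R ^+ i * tzp Z * l1_t R ^+ i * k) :> A.
    by elim/big_rec2: _ => // i y1 y2 _ <-; rewrite sigmaD.
  apply: cideal_sum => i _; rewrite -mulrA (sigmaM _ _ (_ * tzp Z)) (sigmaM _ _ _ (tzp Z)) sigma_p.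
  have assoc (a b c d f : A) : a * (b * c * d) * f = a * b * c * (d * f) by rewrite !mulrA.
  by rewrite assoc; exact: cidealM.
rewrite -sB; apply: le_trans (sigma_le _ _ _) _; rewrite tzPdef mulrBl mul1r subKr -mulrA.
by apply: le_trans (nrm_sX Z N _) hN.
Qed.

End Transport.

Section VanishOnClub.
Variable G : W -> W.

Let wback_ok i l a b : true -> ok ((WSlot G 0, i, l) : line) a b -> ok ((Base, i, l) : line) a b.
Proof. by move=> _ []. Qed.

Let wback : A := move_op R (q := fun _ _ => true) wback_ok.

(** The values of [T] vanish on the closed unbounded set, so [club_defect] copies them unchanged
    into the slot [WSlot G 0]; [ee] fixes them there and [wback] returns them. *)
Lemma cideal_vanish T : (forall (x : X) g i l al, g != Base -> (T x : X) ((g, i, l), al) = 0) ->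
  (forall (x : X) i l al, club G al -> (T x : X) ((Base, i, l), al) = 0) -> cideal ee T.
Proof.
move=> h1 h2; have -> : T = wback * ee * (club_defect R m n G * T); last exact: cidealM.
apply: fop_ext => x [[[g i] l] al]; rewrite !bounded_opM move_opE andbT.
have [->|ne] := eqVneq g Base; last exact: h1.
by rewrite eeE WSlot_Base club_defectE eqxx (h2 _ _ _ (retract G al)) ?subr0//; exact: retract_club.
Qed.

End VanishOnClub.

(** Terms containing [ee] are in the ideal. The remaining corner, minus the fibrewise action of the
    compact [Phi] parts, vanishes on the closed unbounded set of [S] by [chiE] and [fib_co], so
    [cideal_vanish] applies. *)
Lemma mem_cideal S : (forall i, chi (lix i) S = 0) -> (forall j, kk Z (Phi (hixP j) S)) ->
  cideal ee S.
Proof.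
move=> h1 h2.
have -> : S = S * ee + ee * S * (1 - ee) + (1 - ee) * S * (1 - ee).
  rewrite -addrA -mulrDl -mulrDl addrC [ee + _]addrC subrK mul1r.
  by rewrite -mulrDr subrK mulr1.
apply: cidealD.
  apply: cidealD; last by have := cidealM ee 1 (S * (1 - ee)); rewrite mul1r mulrA.
  by have := cidealM ee S 1; rewrite mulr1.
pose N : A := (1 - ee) * S * (1 - ee); pose K := \sum_j sigma W (hixP j) (Phi (hixP j) S).
rewrite -/N -(subrK K N); apply: cidealD; last by apply: cideal_sum => j _; exact: cideal_sigma.
have KE (x : X) g i l al : (K x : X) ((g, i, l), al) =
    \sum_j (sigma W (hixP j) (Phi (hixP j) S) x : X) ((g, i, l), al).
  by rewrite /K bop_sumE fval_sum.
have NE (x : X) g i l al : ((N - K) x : X) ((g, i, l), al) =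
    (if g == Base then (S ((1 - ee) x) : X) ((g, i, l), al) else 0) - (K x : X) ((g, i, l), al).
  have -> : ((N - K) x : X) = (N x : X) - K x by [].
  by rewrite fvalB /N -mulrA bounded_opM coE bounded_opM.
apply: (@cideal_vanish (sclub S)) => [x g i l al ne|x i l al cal].
  rewrite NE (negbTE ne) KE big1 ?subr0// => j _; rewrite sigmaE xpair_eqE (negbTE ne) //.
rewrite NE eqxx KE.
have [hi|nhi] := boolP (m <= i < m + n)%N.
  have [j0 ij] : exists j0, i = hix j0.
    have hj : (i - m < n)%N by lia.
    by exists (Ordinal hj); apply: val_inj => /=; lia.
  subst i; rewrite (@big_only1 _ _ _ _ j0)// => [|j ne _]; rewrite sigmaE.
    by rewrite eqxx -(fib_co (hixP j0) x cal) fibE subrr.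
  by rewrite xpair_eqE eqxx hix_inj eq_sym (negbTE ne).
rewrite big1 ?subr0 => [|j _]; last first.
  rewrite sigmaE xpair_eqE eqxx /=; case: eqP => // e; by rewrite e hixP in nhi.
have [/andP[hi /eqP l0]|nb] := boolP ((i < m)%N && (l == 0%N)).
  have ii : i = lix (Ordinal hi) by apply: val_inj.
  by rewrite l0 ii (chiE (lixP _) _ cal) h1 mul0r.
by apply: x_zero => a b; rewrite /ok /= /base (negbTE nb) (negbTE nhi).
Qed.

End Membership.

(** * The swindle of ee and infinite dimension *)

Section SlotSwindle.
Variables (R : realType) (m n : nat) (W : omega1).
Local Notation C := R[i].
Local Notation I := 'I_(m + n).+1.
Local Notation xspec := (xspec R m n W).
Local Notation X := (fspace xspec).
Local Notation A := (bounded_op (fspace_of xspec)).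
Local Notation gen := (@gen R m n W).
Local Notation line := (line m n W).
Local Notation point := (point m n W).
Local Notation ee := (ee R m n W).
Local Notation slot := (slot W).

Section SlotMap.
Variable f : slot -> option slot.
Hypothesis f_inj : forall g g' g0, f g = Some g0 -> f g' = Some g0 -> g = g'.
Hypothesis f_ok : forall g g0 i l a b, f g = Some g0 ->
  ok ((g0, i, l) : line) a b -> ok ((g, i, l) : line) a b.

Let h (g : slot) (_ : I) (_ : nat) := f g.

Let h1 g i : exists g', forall l, h g i l = None \/ h g i l = Some g'.
Proof. by case e: (f g) => [g'|]; [exists g' => l; right|exists g => l; left]. Qed.

Let h2 g i l a b : ok (g, i, l) a b -> (forall g', h g' i l <> Some g) \/
  exists g', (forall g'', h g'' i l = Some g <-> g'' = g') /\ ok (g', i, l) a b.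
Proof.
move=> hok; have [[g' hg']|no] := pselect (exists g', f g' = Some g).
  right; exists g'; split; last exact: f_ok hok.
  by move=> g''; split=> [e|->//]; exact: f_inj e hg'.
by left=> g' e; apply: no; exists g'.
Qed.

Lemma slotmap_pullable : pullable (s := xspec) (slot_rho h).
Proof. exact: slot_pullable. Qed.

End SlotMap.

(** The pairing of natural numbers splits the copies of every slot other than [Base] into infinitely
    many families, each as large as the whole. *)
Let codS (k : nat) (g : slot) : slot := match g with
  | Base => Base | LSlot nu => LSlot (pickle (k, nu)) | WSlot F nu => WSlot F (pickle (k, nu)) end.

Let decS (g : slot) : option (nat * slot) := match g with
  | Base => None
  | LSlot nu => omap (fun p : nat * nat => (p.1, LSlot p.2)) (pickle_inv nu)
  | WSlot F nu => omap (fun p : nat * nat => (p.1, WSlot F p.2)) (pickle_inv nu) end.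

Let codSK k g : g != Base -> decS (codS k g) = Some (k, g).
Proof. by case: g => [|nu|F nu]; rewrite ?eqxx //= pickleK_inv. Qed.

Let pinv nu (k nu' : nat) : pickle_inv nu = Some (k, nu') -> nu = pickle (k, nu').
Proof. by move=> e; have := @pickle_invK (nat * nat)%type nu; rewrite e. Qed.

Let decSP g k g' : decS g = Some (k, g') -> g = codS k g' /\ g' != Base.
Proof.
case: g => [|nu|F nu] //=; case e: (pickle_inv nu) => [[k' nu']|] //= -[<- <-].
  by rewrite (pinv e) LSlot_Base.
by rewrite (pinv e) WSlot_Base.
Qed.

Let codS_ok k g i l a b : ok ((codS k g, i, l) : line) a b <-> ok ((g, i, l) : line) a b.
Proof. by case: g. Qed.

Let codS_inj k g g' : g != Base -> codS k g = codS k g' -> g = g'.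
Proof.
move=> g0 e; have e1 := codSK k g0.
have g'0 : g' != Base.
  by apply: contra_neq g0 => e'; move: e; rewrite e'; case: (g).
by move: e1; rewrite e codSK// => -[].
Qed.

Let rhoE (f : slot -> option slot) (rho : point -> option point) :
  (forall g g' g0, f g = Some g0 -> f g' = Some g0 -> g = g') ->
  (forall g g0 i l a b, f g = Some g0 -> ok ((g0, i, l) : line) a b -> ok ((g, i, l) : line) a b) ->
  (forall g i l al, rho ((g, i, l), al) = omap (fun g0 => ((g0, i, l), al)) (f g)) ->
  pullable (s := xspec) rho.
Proof.
move=> fi fo hr; have -> : rho = slot_rho (fun g (_ : I) (_ : nat) => f g).
  by apply/funext => -[[[g i] l] al]; rewrite hr.
exact: slotmap_pullable.
Qed.

Let D (z : point) : bool := z.1.1.1 != Base.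
Let cod (k : nat) (z : point) : point := ((codS k z.1.1.1, z.1.1.2, z.1.2), z.2).
Let dec (z : point) : option (nat * point) :=
  omap (fun p : nat * slot => (p.1, ((p.2, z.1.1.2, z.1.2), z.2))) (decS z.1.1.1).

Let decP z k y : dec z = Some (k, y) -> z = cod k y /\ D y.
Proof.
case: z => -[[g i] l] al; rewrite /dec /=; case e: (decS g) => [[k' g']|] //= -[<- <-].
by have [-> h] := decSP e.
Qed.

Let codK k y : D y -> dec (cod k y) = Some (k, y).
Proof. by case: y => -[[g i] l] al h; rewrite /dec /= codSK. Qed.

Let eP : pullable (s := xspec) (fun z => if D z then Some z else None).
Proof.
apply: (rhoE (f := fun g => if g != Base then Some g else None)).
- by move=> g g' g0; case: ifP => // _ [->]; case: ifP => // _ [->].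
- by move=> g g0 i l a b; case: ifP => // _ [->].
- by move=> g i l al; rewrite /D /=; case: ifP.
Qed.

Let tP k : pullable (s := xspec) (fun z => if D z then Some (cod k z) else None).
Proof.
apply: (rhoE (f := fun g => if g != Base then Some (codS k g) else None)).
- move=> g g' g0; case: ifP => // h [<-]; case: ifP => // _ [] e.
  exact/(@codS_inj k)/esym.
- by move=> g g0 i l a b; case: ifP => // _ [<-] /codS_ok.
- by move=> g i l al; rewrite /D /=; case: ifP.
Qed.

Let sP k : pullable (s := xspec) (fun z =>
  if dec z is Some (l, y) then if l == k then Some y else None else None).
Proof.
apply: (rhoE (f := fun g => if decS g is Some (l, y) then if l == k then Some y else None else None)).
- move=> g g' g0; case e: (decS g) => [[l y]|] //; case: eqP => // lk [<-].
  case e': (decS g') => [[l' y']|] //; case: eqP => // lk' [yy].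
  by have [-> _] := decSP e; have [-> _] := decSP e'; rewrite yy lk lk'.
- move=> g g0 i l a b; case e: (decS g) => [[l' y]|] //; case: eqP => // lk [<-].
  by have [-> _] := decSP e; rewrite codS_ok.
- move=> g i l al; rewrite /dec /=; case: (decS g) => [[l' y]|] //=.
  by case: ifP.
Qed.

Let spP : pullable (s := xspec) (fun z =>
  if dec z is Some (l.+1, y) then Some (cod l y) else None).
Proof.
apply: (rhoE (f := fun g => if decS g is Some (l.+1, y) then Some (codS l y) else None)).
- move=> g g' g0; case e: (decS g) => [[[|l] y]|] // [<-].
  case e': (decS g') => [[[|l'] y']|] // [yy].
  have [-> h] := decSP e; have [-> h'] := decSP e'.
  by have := codSK l h; rewrite -yy codSK// => -[-> ->].
- move=> g g0 i l a b; case e: (decS g) => [[[|l'] y]|] // [<-].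
  by have [-> _] := decSP e; rewrite !codS_ok.
- move=> g i l al; rewrite /dec /=; by case: (decS g) => [[[|l'] y]|].
Qed.

Let tpP : pullable (s := xspec) (fun z =>
  if dec z is Some (l, y) then Some (cod l.+1 y) else None).
Proof.
apply: (rhoE (f := fun g => if decS g is Some (l, y) then Some (codS l.+1 y) else None)).
- move=> g g' g0; case e: (decS g) => [[l y]|] // [<-].
  case e': (decS g') => [[l' y']|] // [yy].
  have [-> h] := decSP e; have [-> h'] := decSP e'.
  by have := codSK l.+1 h; rewrite -yy codSK// => -[-> ->].
- move=> g g0 i l a b; case e: (decS g) => [[l' y]|] // [<-].
  by have [-> _] := decSP e; rewrite !codS_ok.
- move=> g i l al; rewrite /dec /=; by case: (decS g) => [[l' y]|].
Qed.

Let fin u : xspan (R := R) u -> exists K, forall k z, (K <= k)%N -> D z -> u (cod k z) = 0.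
Proof.
elim=> [|x y _ [K hK] _ [K' hK']|c x _ [K hK]|lam a b hok].
- by exists 0%N.
- exists (maxn K K') => k z; rewrite geq_max => /andP[Kk K'k] Dz.
  by rewrite hK// hK'// addr0.
- by exists K => k z Kk Dz; rewrite hK// mulr0.
exists (if decS lam.1.1 is Some (k, _) then k.+1 else 0%N) => k z hk Dz.
rewrite /wfun; case: eqP => //= e; move: hk; rewrite -e /= codSK//.
by rewrite ltnn.
Qed.

(** A seminorm sees one slot, which belongs to at most one family, so bounds on single families
    suffice. *)
Let bound (K : R) (v : X) (w : nat -> X) : 0 <= K ->
  (forall k, nrm (w k) <= K * nrm (pull_of (tP k) v)) ->
  forall t, xp t (fun z => if dec z is Some (k, y) then w k y else 0) <= K * nrm v.
Proof.
move=> K0 hw t; case e: (decS (xi_slot t)) => [[k g]|].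
  have -> : xp t (fun z => if dec z is Some (k, y) then w k y else 0) =
      xp (XIndex g (xi_s t) (@xi_mono _ t) (xi_N t)) (w k).
    rewrite /xp /=; congr (_ * _); apply: eq_bigr => l _; congr (var _ _ _).
    by apply/funext => b; rewrite /dec /= e.
  apply: le_trans (p_le_nrm (s := xspec) _ _) _; apply: le_trans (hw k) _.
  rewrite ler_wpM2l//; apply: le_trans (bop_le _ _) _.
  by rewrite -[leRHS]mul1r ler_wpM2r ?nrm_ge0 ?pull_op_le1.
rewrite /xp big1 ?mulr0 ?mulr_ge0 ?nrm_ge0// => l _.
by rewrite (_ : (fun b => _) = fun=> 0) ?var_zero//; apply/funext => b; rewrite /dec /= e.
Qed.

Definition x_selfsim : selfsim xspec :=
  @SelfSim R xspec D cod dec decP codK eP tP sP spP tpP fin bound.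

Lemma ee_swindle : swindle ee.
Proof.
have -> : ee = ss_op x_selfsim; last exact: ss_swindle.
by apply: fop_ext => v [[[g i] l] al]; rewrite ss_opE eeE.
Qed.

(** If [N] vectors spanned generators on [N.+1] different [LSlot] lines, evaluation on these lines
    would factor the identity matrix of size [N.+1] through size [N]. *)
Lemma x_infinite : infinite_dimensional (fspace_of xspec).
Proof.
move=> N b; apply: contrapT => /forallNP h.
pose lam (nu : nat) : line := (LSlot nu, ord_max, 0%N).
have hok nu : ok (lam nu) None (omega0 W) by rewrite /ok /= leq_addr.
have /choice[c hc] (nu : nat) : exists c : 'I_N -> C,
    gen (lam nu) None (omega0 W) = \sum_(i < N) c i *: (b i : X).
  by have /existsNP[c /contrapT] := h (gen (lam nu) None (omega0 W)); exists c.
pose M : 'M[C]_(N.+1, N) := \matrix_(i, j) c i j.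
pose P : 'M[C]_(N, N.+1) := \matrix_(i, j) (b i : X) (lam j, omega0 W).
have MP : M *m P = 1%:M.
  apply/matrixP => i j; rewrite !mxE.
  have := congr1 (fun x : X => x (lam j, omega0 W)) (hc i).
  rewrite fval_sum genE// /wfun /inI /= olt_irr andbT => e.
  rewrite (_ : (i == j) = (lam j == lam i)); last first.
    by apply/eqP/eqP => [->//|[/val_inj ->]].
  by rewrite e; apply: eq_bigr => k _; rewrite !mxE.
have := mxrankM_maxl M P; rewrite MP mxrank1 => h1.
by have := leq_trans h1 (rank_leq_col M); rewrite ltnn.
Qed.

End SlotSwindle.

(** * Operators realizing the index *)

Section IndexOperators.
Variables (R : realType) (m n : nat) (W : omega1).
Local Notation I := 'I_(m + n).+1.
Local Notation xspec := (xspec R m n W).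
Local Notation X := (fspace xspec).
Local Notation A := (bounded_op (fspace_of xspec)).
Local Notation line := (line m n W).
Local Notation Z := (l1_toeplitz R).
Local Notation slot := (slot W).
Variable j : 'I_n.

Let up (g : slot) (i : I) (_ : nat) : option slot :=
  if i == hix m j then if g is LSlot nu then Some (LSlot nu.+1) else Some g else Some g.

Let dn (g : slot) (i : I) (_ : nat) : option slot :=
  if i == hix m j then match g with LSlot 0 => None | LSlot nu.+1 => Some (LSlot nu) | _ => Some g end
  else Some g.

Let up1 g i : exists g', forall l, up g i l = None \/ up g i l = Some g'.
Proof.
rewrite /up; case: (i == hix m j); last by exists g; right.
by case: g => [|nu|F nu]; [exists Base|exists (LSlot nu.+1)|exists (WSlot F nu)]; right.
Qed.

Let dn1 g i : exists g', forall l, dn g i l = None \/ dn g i l = Some g'.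
Proof.
rewrite /dn; case: (i == hix m j); last by exists g; right.
by case: g => [|[|nu]|F nu]; [exists Base; right|exists Base; left|exists (LSlot nu); right|exists (WSlot F nu); right].
Qed.

Let up2 g i l a b : ok (g, i, l) a b -> (forall g', up g' i l <> Some g) \/
  exists g', (forall g'', up g'' i l = Some g <-> g'' = g') /\ ok (g', i, l) a b.
Proof.
move=> hok; rewrite /up; case: (i == hix m j); last first.
  by right; exists g; split=> // g''; split=> [[]|->].
case: g hok => [|[|nu]|F nu] hok.
- by right; exists Base; split=> // -[|nu|F nu]; split=> // -[].
- by left=> -[|nu|F nu].
- right; exists (LSlot nu); split=> // -[|nu'|F nu']; split=> //; first by case=> ->.
  by case=> ->.
- by right; exists (WSlot F nu); split=> // -[|nu'|F' nu']; split=> // -[-> ->].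
Qed.

Let dn2 g i l a b : ok (g, i, l) a b -> (forall g', dn g' i l <> Some g) \/
  exists g', (forall g'', dn g'' i l = Some g <-> g'' = g') /\ ok (g', i, l) a b.
Proof.
move=> hok; rewrite /dn; case: (i == hix m j); last first.
  by right; exists g; split=> // g''; split=> [[]|->].
case: g hok => [|nu|F nu] hok; right.
- by exists Base; split=> // -[|[|nu]|F nu]; split=> // -[].
- by exists (LSlot nu.+1); split=> // -[|[|nu']|F nu']; split=> // -[->].
- by exists (WSlot F nu); split=> // -[|[|nu']|F' nu']; split=> // -[-> ->].
Qed.

(** Moves the [LSlot] copies of type [hix m j] down by one number, annihilating copy 0; [slot_dn] is
    its right inverse. The annihilated copy is where [fwd] and [back] store one line of the
    fibre. *)
Definition slot_up : A := slot_op R up1 up2.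
Definition slot_dn : A := slot_op R dn1 dn2.

Local Notation y := (fwd R m W j).
Local Notation x := (back R m W j).

Let upE (v : X) g i l al : (slot_up v : X) ((g, i, l), al) =
  if up g i l is Some g' then v ((g', i, l), al) else 0.
Proof. exact: slot_opE. Qed.

Let dnE (v : X) g i l al : (slot_dn v : X) ((g, i, l), al) =
  if dn g i l is Some g' then v ((g', i, l), al) else 0.
Proof. exact: slot_opE. Qed.

Lemma up_dn : slot_up * slot_dn = 1.
Proof.
apply: fop_ext => v [[[g i] l] al]; rewrite bounded_opM bounded_op1 upE /up.
have [e|ne] := eqVneq i (hix m j); last by rewrite dnE /dn (negbTE ne).
by case: g => [|nu|F nu]; rewrite dnE /dn e eqxx.
Qed.

Lemma yx_dn_up : y * x = 1 - slot_dn * slot_up.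
Proof.
apply: fop_ext => v [[[g i] l] al].
have -> : ((1 - slot_dn * slot_up) v : X) = v - (slot_dn (slot_up v) : X) by [].
rewrite fvalB bounded_opM fwdE backE dnE /dn.
have [e|ne] := eqVneq i (hix m j); last by rewrite andbF upE /up (negbTE ne) subrr.
rewrite e eqxx andTb.
case: g => [|[|nu]|F nu]; cbv beta iota.
- by rewrite upE /up eqxx subrr (_ : (Base == LSlot 0 :> slot) = false)//; apply/eqP.
- rewrite !eqxx subr0 /=; have [->|l0] := eqVneq l 0%N => //=.
  by apply/esym/x_zero => a b; rewrite /ok /= (negbTE l0) andbF.
- by rewrite upE /up eqxx subrr (_ : (LSlot nu.+1 == LSlot 0 :> slot) = false)//; apply/eqP.
- by rewrite upE /up eqxx subrr (_ : (WSlot F nu == LSlot 0 :> slot) = false)//; apply/eqP.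
Qed.

Lemma xy_sigma : x * y = sigma W (hixP m j) (tzp Z).
Proof.
rewrite sigma_p; apply: fop_ext => v [[[g i] l] al].
rewrite -mulrA !bounded_opM !backE eeE LSlot_Base; by case: ifP.
Qed.

Lemma x_dn : x * slot_dn = 0.
Proof.
apply: fop_ext => v [[[g i] l] al]; rewrite bounded_opM backE.
by case: ifP => // /and3P[_ ij _]; rewrite dnE /dn ij.
Qed.

Lemma up_y : slot_up * y = 0.
Proof.
apply: fop_ext => v [[[g i] l] al]; rewrite bounded_opM upE /up.
have zero g' : g' <> LSlot 0 -> (y v : X) ((g', i, l), al) = 0.
  by move=> ne; rewrite fwdE; case: eqP.
have [e|ne] := eqVneq i (hix m j); first by case: g => [|nu|F nu]; rewrite zero.
by rewrite fwdE (negbTE ne) andbF.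
Qed.

Lemma sigma_x : sigma W (hixP m j) (tzp Z) * x = x.
Proof.
rewrite sigma_p; apply: fop_ext => v [[[g i] l] al].
rewrite -!mulrA !bounded_opM !backE; case: ifP => // /and3P[_ /eqP -> /eqP ->].
by rewrite eeE LSlot_Base fwdE !eqxx backE !eqxx.
Qed.

Lemma y_sigma : y * sigma W (hixP m j) (tzp Z) = y.
Proof.
rewrite sigma_p; apply: fop_ext => v [[[g i] l] al].
rewrite -mulrA !bounded_opM fwdE; case: ifP => [/and3P[/eqP -> /eqP -> /eqP ->]|e]; last by rewrite fwdE e.
by rewrite backE !eqxx eeE LSlot_Base !fwdE !eqxx.
Qed.

Lemma Phi_up (k : 'I_n) : Phi (hixP m k) slot_up = 1.
Proof.
apply: Phi_val => f al; apply: fspaceP => l; rewrite fibE upE /up.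
by case: (_ == hix m j); rewrite tensE /= eqxx /inI olt_irr mulr1.
Qed.

Lemma Phi_x (k : 'I_n) : Phi (hixP m k) x = 0.
Proof.
apply: Phi_val => f al; apply: fspaceP => l; rewrite fibE backE.
by case: ifP => // _; rewrite tensE xpair_eqE LSlot_Base.
Qed.

End IndexOperators.

(** * From the abstract model to its K-groups *)

Lemma zmod_iso_rV (U : zmodType) m (f : U -> 'rV[int]_m) :
  (forall x y, f (x + y) = f x + f y) -> (forall x, f x = 0 -> x = 0) ->
  (forall i, exists u, f u = delta_mx 0 i) -> zmod_isomorphic U 'rV[int]_m.
Proof.
move=> fD f0 fs.
have fz : f 0 = 0 by apply: (@addrI _ (f 0)); rewrite -fD !addr0.
have fN x : f (- x) = - f x by apply: (@addIr _ (f x)); rewrite -fD !addNr.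
have fM : zmod_morphism f by move=> x y; rewrite fD fN.
pose g : {additive U -> 'rV[int]_m} := HB.pack f (GRing.isZmodMorphism.Build U 'rV[int]_m f fM).
exists g; have /choice[u hu] := fs.
pose h (v : 'rV[int]_m) : U := \sum_i u i *~ v 0 i.
have gh : cancel h g.
  move=> v; rewrite /h raddf_sum [RHS]row_sum_delta; apply: eq_bigr => i _.
  by rewrite raddfMz /= hu -scaler_int intz.
exists h => // x; apply/eqP; rewrite -subr_eq0; apply/eqP/f0.
by rewrite fD fN; apply/eqP; rewrite subr_eq0; apply/eqP; exact: gh.
Qed.

(* What remains of the operator algebra after the fibre analysis: modulo the ideal of
   km_e, which has an infinite swindle, the algebra is C^m times n copies of B modulo kk. *)
Record kmodel (R : realType) (A B : banachAlgType R[i]) (Z : toeplitz B) m n := KModel {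
  km_e : A;
  km_ee : km_e * km_e = km_e;
  km_sw : swindle km_e;
  km_chi : 'I_m -> A -> R[i];
  km_chiD : forall i x y, km_chi i (x + y) = km_chi i x + km_chi i y;
  km_chiM : forall i x y, km_chi i (x * y) = km_chi i x * km_chi i y;
  km_chi1 : forall i, km_chi i 1 = 1;
  km_chiZ : forall i c x, km_chi i (c *: x) = c * km_chi i x;
  km_phi : 'I_n -> A -> B;
  km_phiD : forall j x y, km_phi j (x + y) = km_phi j x + km_phi j y;
  km_phiM : forall j x y, kk Z (km_phi j (x * y) - km_phi j x * km_phi j y);
  km_phi1 : forall j, km_phi j 1 = 1;
  km_phiZ : forall j c x, km_phi j (c *: x) = c *: km_phi j x;
  km_phi_le : forall j, exists2 K : R, 0 <= K & forall x, nrm (km_phi j x) <= K * nrm x;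
  km_p : 'I_m -> A;
  km_pp : forall i i', km_p i * km_p i' = if i == i' then km_p i else 0;
  km_sg : 'I_n -> B -> A;
  km_sgD : forall j f g, km_sg j (f + g) = km_sg j f + km_sg j g;
  km_sgM : forall j j' f g, km_sg j f * km_sg j' g = if j == j' then km_sg j (f * g) else 0;
  km_psg : forall i j f, km_p i * km_sg j f = 0;
  km_sgp : forall i j f, km_sg j f * km_p i = 0;
  km_chi_p : forall i i', km_chi i (km_p i') = (i == i')%:R;
  km_chi_sg : forall i j f, km_chi i (km_sg j f) = 0;
  km_phi_p : forall j i, km_phi j (km_p i) = 0;
  km_phi_sg : forall j j' f, km_phi j (km_sg j' f) = if j == j' then f else 0;
  km_mem : forall x, (forall i, km_chi i x = 0) -> (forall j, kk Z (km_phi j x)) -> cideal km_e x;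
  km_index : forall j, exists up dn x y,
    [/\ up * dn = 1, x * y = km_sg j (tzp Z), y * x = 1 - dn * up, x * dn = 0 &
     [/\ up * y = 0, km_sg j (tzp Z) * x = x, y * km_sg j (tzp Z) = y,
      forall j', km_phi j' up = 1 & forall j', km_phi j' x = 0]] }.

Section Model.
Variables (R : realType) (A B : banachAlgType R[i]) (Z : toeplitz B) (m n : nat).
Variable M : kmodel A Z m n.
Local Notation C := R[i].
Local Notation e := (km_e M).
Local Notation chi := (km_chi M).
Local Notation phi := (km_phi M).
Local Notation p := (km_p M).
Local Notation sg := (km_sg M).

(** With [PG], a right inverse of the symbol maps. Both are multiplicative without being unital, and
    their ranges annihilate each other. *)
Definition SG (f : 'I_n -> B) : A := \sum_j sg j (f j).
Definition PG (c : 'I_m -> C) : A := \sum_i c i *: p i.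

Let chi0 i : chi i 0 = 0.
Proof. by apply: (@addrI _ (chi i 0)); rewrite -km_chiD !addr0. Qed.

Let phi0 j : phi j 0 = 0.
Proof. by apply: (@addrI _ (phi j 0)); rewrite -km_phiD !addr0. Qed.

Let sg0 j : sg j 0 = 0.
Proof. by apply: (@addrI _ (sg j 0)); rewrite -km_sgD !addr0. Qed.

Lemma chi_sum i (I : Type) (r : seq I) (F : I -> A) :
  chi i (\sum_(a <- r) F a) = \sum_(a <- r) chi i (F a).
Proof. by elim/big_rec2: _ => // a y x _ <-; rewrite km_chiD. Qed.

Lemma phi_sum j (I : Type) (r : seq I) (F : I -> A) :
  phi j (\sum_(a <- r) F a) = \sum_(a <- r) phi j (F a).
Proof. by elim/big_rec2: _ => // a y x _ <-; rewrite km_phiD. Qed.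

Lemma chiN i x : chi i (- x) = - chi i x.
Proof. by apply: (@addIr _ (chi i x)); rewrite -km_chiD !addNr chi0. Qed.

Lemma phiN j x : phi j (- x) = - phi j x.
Proof. by apply: (@addIr _ (phi j x)); rewrite -km_phiD !addNr phi0. Qed.

Lemma SG_D f g : SG (fun j => f j + g j) = SG f + SG g.
Proof. by rewrite /SG -big_split; apply: eq_bigr => j _; rewrite km_sgD. Qed.

Lemma SG0 : SG (fun=> 0) = 0.
Proof. by rewrite /SG big1// => j _; rewrite sg0. Qed.

Lemma SG_M f g : SG f * SG g = SG (fun j => f j * g j).
Proof.
rewrite /SG mulr_suml; apply: eq_bigr => j _; rewrite mulr_sumr.
rewrite (@big_only1 _ _ _ _ j)// => [|j' ne _]; first by rewrite km_sgM eqxx.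
by rewrite km_sgM eq_sym (negbTE ne).
Qed.

Lemma PG_D c d : PG (fun i => c i + d i) = PG c + PG d.
Proof. by rewrite /PG -big_split; apply: eq_bigr => i _; rewrite scalerDl. Qed.

Lemma PG0 : PG (fun=> 0) = 0.
Proof. by rewrite /PG big1// => i _; rewrite scale0r. Qed.

Lemma PG_M c d : PG c * PG d = PG (fun i => c i * d i).
Proof.
rewrite /PG mulr_suml; apply: eq_bigr => i _; rewrite mulr_sumr.
rewrite (@big_only1 _ _ _ _ i)// => [|i' ne _]; rewrite -scalAl -scalAr km_pp.
  by rewrite eqxx scalerA.
by rewrite eq_sym (negbTE ne) !scaler0.
Qed.

Lemma PG_SG c f : PG c * SG f = 0.
Proof.
rewrite /PG /SG mulr_suml big1// => i _; rewrite mulr_sumr big1// => j _.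
by rewrite -scalAl km_psg scaler0.
Qed.

Lemma SG_PG c f : SG f * PG c = 0.
Proof.
rewrite /PG /SG mulr_suml big1// => j _; rewrite mulr_sumr big1// => i _.
by rewrite -scalAr km_sgp scaler0.
Qed.

Lemma chi_PG i c : chi i (PG c) = c i.
Proof.
rewrite /PG chi_sum (@big_only1 _ _ _ _ i)// => [|i' ne _]; rewrite km_chiZ km_chi_p.
  by rewrite eqxx mulr1.
by rewrite eq_sym (negbTE ne) mulr0.
Qed.

Lemma chi_SG i f : chi i (SG f) = 0.
Proof. by rewrite /SG chi_sum big1// => j _; rewrite km_chi_sg. Qed.

Lemma phi_PG j c : phi j (PG c) = 0.
Proof. by rewrite /PG phi_sum big1// => i _; rewrite km_phiZ km_phi_p scaler0. Qed.

Lemma phi_SG j f : phi j (SG f) = f j.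
Proof.
rewrite /SG phi_sum (@big_only1 _ _ _ _ j)// => [|j' ne _]; rewrite km_phi_sg ?eqxx//.
by rewrite eq_sym (negbTE ne).
Qed.

Definition SGm k l (F : 'I_n -> 'M[B]_(k, l)) : 'M[A]_(k, l) :=
  \matrix_(a, b) SG (fun j => F j a b).
Definition PGm k l (F : 'I_m -> 'M[C]_(k, l)) : 'M[A]_(k, l) :=
  \matrix_(a, b) PG (fun i => F i a b).
Definition chm i k l (U : 'M[A]_(k, l)) : 'M[C]_(k, l) := map_mx (chi i) U.
Definition phm j k l (U : 'M[A]_(k, l)) : 'M[B]_(k, l) := map_mx (phi j) U.

Let SG_sum (I : Type) (r : seq I) (F : I -> 'I_n -> B) :
  SG (fun j => \sum_(a <- r) F a j) = \sum_(a <- r) SG (F a).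
Proof.
elim: r => [|a r ih].
  by rewrite big_nil -SG0; congr SG; apply/funext => j; rewrite big_nil.
by rewrite big_cons -ih -SG_D; congr SG; apply/funext => j; rewrite big_cons.
Qed.

Let PG_sum (I : Type) (r : seq I) (F : I -> 'I_m -> C) :
  PG (fun j => \sum_(a <- r) F a j) = \sum_(a <- r) PG (F a).
Proof.
elim: r => [|a r ih].
  by rewrite big_nil -PG0; congr PG; apply/funext => j; rewrite big_nil.
by rewrite big_cons -ih -PG_D; congr PG; apply/funext => j; rewrite big_cons.
Qed.

Lemma SGmM k l q (F : 'I_n -> 'M[B]_(k, l)) (G : 'I_n -> 'M[B]_(l, q)) :
  SGm F *m SGm G = SGm (fun j => F j *m G j).
Proof.
apply/matrixP => a b; rewrite !mxE; under [X in SG X]eq_fun do rewrite mxE.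
by rewrite SG_sum; apply: eq_bigr => c _; rewrite !mxE SG_M.
Qed.

Lemma PGmM k l q (F : 'I_m -> 'M[C]_(k, l)) (G : 'I_m -> 'M[C]_(l, q)) :
  PGm F *m PGm G = PGm (fun i => F i *m G i).
Proof.
apply/matrixP => a b; rewrite !mxE; under [X in PG X]eq_fun do rewrite mxE.
by rewrite PG_sum; apply: eq_bigr => c _; rewrite !mxE PG_M.
Qed.

Lemma SGmD k l (F G : 'I_n -> 'M[B]_(k, l)) : SGm F + SGm G = SGm (fun j => F j + G j).
Proof.
apply/matrixP => a b; rewrite !mxE -SG_D; congr SG; apply/funext => j; by rewrite mxE.
Qed.

Lemma PGmD k l (F G : 'I_m -> 'M[C]_(k, l)) : PGm F + PGm G = PGm (fun j => F j + G j).
Proof.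
apply/matrixP => a b; rewrite !mxE -PG_D; congr PG; apply/funext => j; by rewrite mxE.
Qed.

Lemma SGm0 k l : SGm (fun=> 0 : 'M[B]_(k, l)) = 0.
Proof. by apply/matrixP => a b; rewrite !mxE -[RHS]SG0; congr SG; apply/funext => j; rewrite mxE. Qed.

Lemma PGm0 k l : PGm (fun=> 0 : 'M[C]_(k, l)) = 0.
Proof. by apply/matrixP => a b; rewrite !mxE -[RHS]PG0; congr PG; apply/funext => j; rewrite mxE. Qed.

Lemma PGm_SGm k l q (F : 'I_m -> 'M[C]_(k, l)) (G : 'I_n -> 'M[B]_(l, q)) : PGm F *m SGm G = 0.
Proof. by apply/matrixP => a b; rewrite !mxE big1// => c _; rewrite !mxE PG_SG. Qed.

Lemma SGm_PGm k l q (F : 'I_m -> 'M[C]_(l, q)) (G : 'I_n -> 'M[B]_(k, l)) : SGm G *m PGm F = 0.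
Proof. by apply/matrixP => a b; rewrite !mxE big1// => c _; rewrite !mxE SG_PG. Qed.

Lemma chmM i k l q (U : 'M[A]_(k, l)) (V : 'M[A]_(l, q)) : chm i (U *m V) = chm i U *m chm i V.
Proof.
apply/matrixP => a b; rewrite !mxE chi_sum; apply: eq_bigr => c _.
by rewrite !mxE km_chiM.
Qed.

Lemma chm1 i k : chm i (1%:M : 'M[A]_k) = 1%:M.
Proof.
by apply/matrixP => a b; rewrite !mxE; case: (a == b); rewrite ?km_chi1// chi0.
Qed.

Lemma phm1 j k : phm j (1%:M : 'M[A]_k) = 1%:M.
Proof.
by apply/matrixP => a b; rewrite !mxE; case: (a == b); rewrite ?km_phi1// phi0.
Qed.

Lemma phmM j k (U V : 'M[A]_k) : mx_kk Z (phm j (U *m V) - phm j U *m phm j V).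
Proof.
move=> a b; rewrite !mxE phi_sum -sumrB; apply: kk_sum => c _.
by rewrite !mxE; exact: km_phiM.
Qed.

Lemma chm_PGm i k l (F : 'I_m -> 'M[C]_(k, l)) : chm i (PGm F) = F i.
Proof. by apply/matrixP => a b; rewrite !mxE chi_PG. Qed.

Lemma chm_SGm i k l (F : 'I_n -> 'M[B]_(k, l)) : chm i (SGm F) = 0.
Proof. by apply/matrixP => a b; rewrite !mxE chi_SG. Qed.

Lemma phm_PGm j k l (F : 'I_m -> 'M[C]_(k, l)) : phm j (PGm F) = 0.
Proof. by apply/matrixP => a b; rewrite !mxE phi_PG. Qed.

Lemma phm_SGm j k l (F : 'I_n -> 'M[B]_(k, l)) : phm j (SGm F) = F j.
Proof. by apply/matrixP => a b; rewrite !mxE phi_SG. Qed.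

Lemma chmD i k l (U V : 'M[A]_(k, l)) : chm i (U + V) = chm i U + chm i V.
Proof. by apply/matrixP => a b; rewrite !mxE km_chiD. Qed.

Lemma phmD j k l (U V : 'M[A]_(k, l)) : phm j (U + V) = phm j U + phm j V.
Proof. by apply/matrixP => a b; rewrite !mxE km_phiD. Qed.

Lemma chmN i k l (U : 'M[A]_(k, l)) : chm i (- U) = - chm i U.
Proof. by apply/matrixP => a b; rewrite !mxE chiN. Qed.

Lemma phmN j k l (U : 'M[A]_(k, l)) : phm j (- U) = - phm j U.
Proof. by apply/matrixP => a b; rewrite !mxE phiN. Qed.

Lemma mx_mem k (U : 'M[A]_k) : (forall i, chm i U = 0) -> (forall j, mx_kk Z (phm j U)) ->
  mx_cideal e U.
Proof.
move=> h1 h2 a b; apply: km_mem => [i|j]; last by have := h2 j a b; rewrite mxE.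
by have /matrixP/(_ a b) := h1 i; rewrite !mxE.
Qed.

(* The swindle of B, carried out in all its copies at once. *)
Section Swindle.
Variable sw : swindle (1 : B).
Local Notation rep := (sw_rep sw).

Let corner1 x : corner (1 : B) x. Proof. by split; rewrite ?mul1r ?mulr1. Qed.

Definition reps k l (F : 'I_n -> 'M[B]_(k, l)) j : 'M[B]_(k, l) := map_mx rep (F j).

Let rep_sum (I : Type) (r : seq I) (F : I -> B) :
  rep (\sum_(a <- r) F a) = \sum_(a <- r) rep (F a).
Proof.
have rep0 : rep 0 = 0 by apply: (@addrI _ (rep 0)); rewrite -sw_D !addr0.
by elim/big_rec2: _ => // a y x _ <-; rewrite sw_D.
Qed.

Lemma repsM k (F G : 'I_n -> 'M[B]_k) : SGm (reps F) *m SGm (reps G) = SGm (reps (fun j => F j *m G j)).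
Proof.
rewrite SGmM; congr SGm; apply/funext => j; apply/matrixP => a b; rewrite !mxE rep_sum.
by apply: eq_bigr => c _; rewrite !mxE (sw_M sw (corner1 _) (corner1 _)).
Qed.

Lemma repsD k (F G : 'I_n -> 'M[B]_k) : SGm (reps F) + SGm (reps G) = SGm (reps (fun j => F j + G j)).
Proof.
rewrite SGmD; congr SGm; apply/funext => j; apply/matrixP => a b.
by rewrite !mxE sw_D.
Qed.

Lemma reps0 k : SGm (reps (fun=> 0 : 'M[B]_k)) = 0.
Proof.
rewrite -[RHS]SGm0; congr SGm; apply/funext => j; apply/matrixP => a b; rewrite !mxE.
by apply: (@addrI _ (rep 0)); rewrite -sw_D !addr0.
Qed.

Let S0 := SG (fun=> sw_s0 sw). Let T0 := SG (fun=> sw_t0 sw).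
Let S1 := SG (fun=> sw_s1 sw). Let T1 := SG (fun=> sw_t1 sw).

Let reps_eqs k (F : 'I_n -> 'M[B]_k) :
  [/\ SGm (reps F) = S0%:M *m SGm F *m T0%:M + S1%:M *m SGm (reps F) *m T1%:M,
     T0%:M *m (S0%:M *m SGm F) = SGm F, T0%:M *m (S1%:M *m SGm (reps F)) = 0,
     T1%:M *m (S0%:M *m SGm F) = 0 & T1%:M *m (S1%:M *m SGm (reps F)) = SGm (reps F)].
Proof.
split; apply/matrixP => a b.
- rewrite [RHS]mxE !mxscal !scalmx !mxE !SG_M -SG_D; congr SG; apply/funext => j.
  by rewrite mxE; exact: sw_E.
- by rewrite !scalmx !mxE !SG_M; congr SG; apply/funext => j; exact: sw_00.
- rewrite !scalmx !mxE !SG_M -[RHS]SG0; congr SG; apply/funext => j.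
  by rewrite mxE; exact: sw_01.
- by rewrite !scalmx !mxE !SG_M -[RHS]SG0; congr SG; apply/funext => j; exact: sw_10.
- by rewrite !scalmx !mxE !SG_M; congr SG; apply/funext => j; rewrite mxE; exact: sw_11.
Qed.

Lemma kc_SGm k (k0 : (0 < k)%N) (F : 'I_n -> 'M[B]_k) (hF : SGm F *m SGm F = SGm F) :
  (forall j, F j *m F j = F j) -> kc (IdemMx k0 hF) = 0.
Proof.
move=> FF; have [q1 q2 q3 q4 q5] := reps_eqs F.
apply: kc_swindle q1 q2 q3 q4 q5; rewrite repsM; congr SGm; apply/funext => j.
by rewrite /reps FF.
Qed.

Lemma k1_SGm k (F G : 'I_n -> 'M[B]_k) : (0 < k)%N ->
  (forall j, F j + G j + F j *m G j = 0) -> (forall j, G j + F j + G j *m F j = 0) ->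
  invertible_mx (1%:M + SGm F) /\ k1triv (1%:M + SGm F).
Proof.
move=> k0 FG GF; have [q1 q2 q3 q4 q5] := reps_eqs F.
have mulE (X Y : 'M[A]_k) : (1%:M + X) *m (1%:M + Y) = 1%:M + (X + Y + X *m Y).
  by rewrite mulmxDl mulmxDr mulmx1 mul1mx mulmxDr mulmx1 addrA -!addrA [Y + _]addrCA.
have inv1 : invertible_mx (1%:M + SGm F).
  exists (1%:M + SGm G); rewrite !mulE !SGmM !SGmD.
  have -> : (fun j => F j + G j + F j *m G j) = fun=> 0 by apply/funext.
  have -> : (fun j => G j + F j + G j *m F j) = fun=> 0 by apply/funext.
  by rewrite SGm0 addr0.
split=> //; apply: k1_swindle k0 q1 q2 q3 q4 q5 inv1 _.
exists (1%:M + SGm (reps G)); rewrite !mulE !repsM !repsD.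
have -> : (fun j => F j + G j + F j *m G j) = fun=> 0 by apply/funext.
have -> : (fun j => G j + F j + G j *m F j) = fun=> 0 by apply/funext.
by rewrite reps0 addr0.
Qed.

End Swindle.
End Model.

(** * K0 of the model *)

Section ModelK0.
Variables (R : realType) (A B : banachAlgType R[i]) (Z : toeplitz B) (m n : nat).
Variable M : kmodel A Z m n.
Variable sw : swindle (1 : B).
Variable cz : forall k, (0 < k)%N -> cuntz B k.
Local Notation C := R[i].
Local Notation chi := (km_chi M).
Local Notation phi := (km_phi M).

Definition rk i (P : idem_mx A) : nat := \rank (chm M i P).

Let rk_le (F : fieldType) k l (P : 'M[F]_k) (Q : 'M[F]_l) (S : 'M[F]_(k, l)) (T : 'M[F]_(l, k)) :
  P *m P = P -> P = S *m T -> Q = T *m S -> (\rank P <= \rank Q)%N.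
Proof.
move=> PP PE QE; rewrite -PP PE.
have -> : S *m T *m (S *m T) = S *m Q *m T by rewrite QE !mulmxA.
by apply: leq_trans (mxrankM_maxl _ _) _; exact: mxrankM_maxr.
Qed.

Lemma rk_sim i P Q : sim0 P Q -> rk i P = rk i Q.
Proof.
move=> /asboolP[S [T [PE QE]]]; apply/eqP; rewrite eqn_leq.
have e1 : chm M i P = chm M i S *m chm M i T by rewrite -chmM -PE.
have e2 : chm M i Q = chm M i T *m chm M i S by rewrite -chmM -QE.
rewrite (rk_le _ e1 e2) ?(rk_le _ e2 e1)// -chmM idem_valP //.
Qed.

Lemma rk_diag i P Q : rk i (idem_diag P Q) = (rk i P + rk i Q)%N.
Proof.
rewrite /rk -rank_diag_block_mx; congr (\rank _).
have chi0 : chi i 0 = 0 by apply: (@addrI _ (chi i 0)); rewrite -km_chiD !addr0.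
rewrite /chm /= map_block_mx; congr (block_mx _ _ _ _).
  by apply/matrixP => a b; rewrite !mxE chi0.
by apply/matrixP => a b; rewrite !mxE chi0.
Qed.

Let vr i (v : V0 A) : nat := rk i (repr v).

Let vr_pi i P : vr i (\pi_(V0 A) P) = rk i P.
Proof. by apply: rk_sim; apply/asboolP/V0_piP; rewrite reprK. Qed.

Let vrD i u v : vr i (u + v) = (vr i u + vr i v)%N.
Proof.
have [P ->] := V0_surj u; have [Q ->] := V0_surj v.
transitivity (vr i (\pi_(V0 A) (idem_diag P Q))); first by congr (vr i _); exact: V0_addE.
by rewrite !vr_pi rk_diag.
Qed.

Definition k0_rank (u : K0 A) : 'rV[int]_m :=
  \row_i ((vr i (repr u).1)%:Z - (vr i (repr u).2)%:Z).

Let k0_pi (p : V0 A * V0 A) i :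
  k0_rank (\pi_(groth (V0 A)) p) 0 i = (vr i p.1)%:Z - (vr i p.2)%:Z.
Proof.
have [e he] := groth_repr p; rewrite mxE.
have H (a b c d f : nat) : (a + d + f = c + b + f)%N -> a%:Z - b%:Z = c%:Z - d%:Z by lia.
by have := congr1 (vr i) he; rewrite !vrD => /H.
Qed.

Lemma k0_rankD u v : k0_rank (u + v) = k0_rank u + k0_rank v.
Proof.
have [p ->] := groth_surj u; have [q ->] := groth_surj v; apply/rowP => i.
rewrite [LHS](_ : _ = k0_rank (\pi_(groth (V0 A)) (p + q)) 0 i); last by rewrite -groth_addE.
by rewrite [RHS]mxE !k0_pi /= !vrD; lia.
Qed.

Lemma k0_rank_kc P i : k0_rank (kc P) 0 i = (rk i P)%:Z.
Proof.
rewrite /kc k0_pi /= (vr_pi i P) (_ : vr i 0 = 0%N) ?subr0//.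
by have := vrD i 0 0; rewrite addr0; lia.
Qed.

Let PGm_idem k (c : 'I_m -> 'M[C]_k) : (forall i, c i *m c i = c i) -> PGm M c *m PGm M c = PGm M c.
Proof. by move=> h; rewrite PGmM; congr PGm; apply/funext. Qed.

(** The [phi] parts of [P] are idempotent modulo compacts and lift to idempotents [q]. Modulo the
    ideal [P] is the sum of its scalar part and [SGm M q], and the class of the latter vanishes by
    the swindle. *)
Lemma kc_PGm (P : idem_mx A) (h : PGm M (fun i => chm M i P) *m PGm M (fun i => chm M i P) =
    PGm M (fun i => chm M i P)) :
  kc P = kc (IdemMx (idem_dim_gt0 P) h).
Proof.
case: P h => k k0 P PP /= h; set z := cz k0.
have /choice[q hq] j : exists q : 'M[B]_k, q *m q = q /\ mx_kk Z (q - phm M j P).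
  have ka : kk Z (theta z (phm M j P) * theta z (phm M j P) - theta z (phm M j P)).
    rewrite -thetaM; apply/theta_kkP => a b; have := phmM M j P P a b.
    by rewrite PP !mxE -opprB => /kkN; rewrite opprK.
  have [b bb kb] := idempotent_lift ka; exists (theta_inv z b); split.
    by rewrite -theta_invM bb.
  by apply/(theta_kkP Z z); rewrite theta_invK.
have hS : SGm M q *m SGm M q = SGm M q.
  by rewrite SGmM; congr SGm; apply/funext => j; case: (hq j).
have hP0 : (PGm M (fun i => chm M i P) + SGm M q) *m (PGm M (fun i => chm M i P) + SGm M q) =
    PGm M (fun i => chm M i P) + SGm M q.
  by rewrite mulmxDl !mulmxDr PGm_SGm SGm_PGm addr0 add0r h hS.
rewrite (kc_cideal (km_ee M) (km_sw M) k0 PP hP0); last first.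
  apply: mx_mem => [i|j].
    by rewrite chmD chmN chmD chm_PGm chm_SGm addr0 subrr.
  rewrite phmD phmN phmD phm_PGm phm_SGm add0r => a b.
  by have [_ /(_ a b)] := hq j; rewrite !mxE -opprB => /kkN; rewrite opprK.
rewrite (kc_orth k0 h hS hP0 (PGm_SGm _ _ _) (SGm_PGm _ _ _)).
by rewrite (kc_SGm sw k0 hS) ?addr0// => j; case: (hq j).
Qed.

(** Complex idempotent matrices of equal rank are equivalent through their rank factorizations, and
    [PGm] carries the equivalence over. *)
Lemma kc_rank_eq (P Q : idem_mx A) : (forall i, rk i P = rk i Q) -> kc P = kc Q.
Proof.
move=> rPQ.
have ic (P' : idem_mx A) i : chm M i P' *m chm M i P' = chm M i P' by rewrite -chmM idem_valP.
rewrite (kc_PGm (PGm_idem (ic P))) (kc_PGm (PGm_idem (ic Q))).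
have /choice[ST hST] i : exists p : 'M[C]_(idem_dim P, idem_dim Q) * 'M[C]_(idem_dim Q, idem_dim P),
    chm M i P = p.1 *m p.2 /\ chm M i Q = p.2 *m p.1.
  have [c [r [cr rc]]] := idempotent_mx_factor (ic P i).
  have := idempotent_mx_factor (ic Q i); have := rPQ i; rewrite /rk => <-.
  move=> [c' [r' [cr' rc']]]; exists (c *m r', c' *m r) => /=; split.
    by rewrite !mulmxA -(mulmxA c) rc' mulmx1 cr.
  by rewrite !mulmxA -(mulmxA c') rc mulmx1 cr'.
apply: kc_sim; apply/asboolP => /=.
exists (PGm M (fun i => (ST i).1)), (PGm M (fun i => (ST i).2)); rewrite !PGmM.
by split; congr PGm; apply/funext => i; case: (hST i).
Qed.

Lemma model_K0 : zmod_isomorphic (K0 A) 'rV[int]_m.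
Proof.
apply: (@zmod_iso_rV _ _ k0_rank); first exact: k0_rankD.
  move=> u; have [P [Q ->]] := groth_diff u => h; apply/eqP; rewrite subr_eq0; apply/eqP.
  apply: kc_rank_eq => i.
  have e : k0_rank (kc P - kc Q) + k0_rank (kc Q) = k0_rank (kc P) by rewrite -k0_rankD subrK.
  move: e; rewrite h add0r => /rowP/(_ i); rewrite !k0_rank_kc => -[->] //.
move=> i; have hp : (km_p M i)%:M *m (km_p M i)%:M = (km_p M i)%:M :> 'M[A]_1.
  by rewrite -scalar_mxM km_pp eqxx.
exists (kc (IdemMx (isT : (0 < 1)%N) hp)); apply/rowP => i'.
rewrite k0_rank_kc mxE eqxx /= /rk /=.
have -> : chm M i' ((km_p M i)%:M : 'M[A]_1) = ((i' == i)%:R)%:M.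
  by apply/matrixP => a b; rewrite !mxE !ord1 !mulr1n km_chi_p.
case: (i' == i); last by rewrite (_ : (false%:R)%:M = 0) ?mxrank0// raddf0.
by rewrite mxrank1.
Qed.

End ModelK0.

(** * Scalar parts are connected to the identity *)

(** The determinant of $1+z(c-1)$ is a nonzero polynomial in [z]. Its finitely many roots cannot
    meet infinitely many arcs that are disjoint away from the endpoints, where the matrix is
    invertible. *)
Lemma arc_avoid (R : realType) k (c : 'M[R[i]]_k) : c \in unitmx ->
  exists y : R, forall t, 0 <= t <= 1 -> 1%:M + arc y t *: (c - 1%:M) \in unitmx.
Proof.
move=> ic; apply: contrapT => /forallNP h.
pose P : {poly R[i]} := \det (1%:M + 'X *: map_mx polyC (c - 1%:M)).
have PE x : P.[x] = \det (1%:M + x *: (c - 1%:M)).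
  rewrite /P -horner_evalE -det_map_mx; congr (\det _); apply/matrixP => a b.
  by rewrite !mxE /= horner_evalE !hornerE; case: (a == b); rewrite /= ?hornerE.
have P0 : P != 0.
  apply/eqP => e; have := PE 0; rewrite e horner0 scale0r addr0 det1 => /esym/eqP.
  by rewrite oner_eq0.
have /choice[t ht] (q : nat) : exists t : R, [/\ 0 < t < 1 & root P (arc (q%:R : R) t)].
  have /existsNP[t /not_implyP[/andP[t0 t1] /negP nu]] := h q%:R.
  have d0 : P.[arc (q%:R : R) t] = 0.
    by move: nu; rewrite PE unitmxE unitfE negbK => /eqP.
  exists t; split; last by apply/rootP.
  rewrite !lt_neqAle t0 t1 !andbT; apply/andP; split.
    apply/eqP => e; move: d0; rewrite -e arc0 PE scale0r addr0 det1 => /eqP.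
    by rewrite oner_eq0.
  apply/eqP => e; move: nu; rewrite e arc1 scale1r addrC subrK; exact/negP/negPn.
have inj : injective (fun q : nat => arc (q%:R : R) (t q)).
  move=> q q' [e1 e2]; have [/andP[t0 t1] _] := ht q.
  have tn0 : t q * (1 - t q) != 0 by rewrite mulf_neq0 ?gt_eqF// subr_gt0.
  move: e2; rewrite -e1 => /(mulIf tn0)/eqP; rewrite eqr_nat => /eqP //.
have := @max_poly_roots _ P [seq arc (q%:R : R) (t q) | q <- iota 0 (size P)] P0.
rewrite size_map size_iota ltnn map_inj_uniq// iota_uniq => absurd.
by apply/notF/absurd => //; apply/allP => _ /mapP[q _ ->]; case: (ht q).
Qed.

Section ModelPaths.
Variables (R : realType) (A B : banachAlgType R[i]) (Z : toeplitz B) (m n : nat).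
Variable M : kmodel A Z m n.
Local Notation C := R[i].

(** Each scalar part has its own arc to the identity; [PG] applies them simultaneously, and the
    inverses are carried along. *)
Lemma k1_PGm k (c d : 'I_m -> 'M[C]_k) :
  (forall i, c i *m d i = 1%:M) ->
  invertible_mx (1%:M + PGm M (fun i => c i - 1%:M)) /\
  k1triv (1%:M + PGm M (fun i => c i - 1%:M)).
Proof.
move=> cd.
have uc i : c i \in unitmx by case: (mulmx1_unit (cd i)).
have /choice[y hy] i := arc_avoid (uc i).
pose g (t : R) : 'M[A]_k := 1%:M + PGm M (fun i => arc (y i) t *: (c i - 1%:M)).
have g0 : g 0 = 1%:M.
  rewrite /g (_ : (fun i => _) = fun=> 0) ?PGm0 ?addr0//.
  by apply/funext => i; rewrite arc0 scale0r.
have g1 : g 1 = 1%:M + PGm M (fun i => c i - 1%:M).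
  by rewrite /g; congr (_ + PGm M _); apply/funext => i; rewrite arc1 scale1r.
have ig t : 0 <= t <= 1 -> invertible_mx (g t).
  move=> t01; exists (1%:M + PGm M (fun i => invmx (1%:M + arc (y i) t *: (c i - 1%:M)) - 1%:M)).
  have mulE (X Y : 'M[A]_k) : (1%:M + X) *m (1%:M + Y) = 1%:M + (X + Y + X *m Y).
    by rewrite mulmxDl mulmxDr mulmx1 mul1mx mulmxDr mulmx1 addrA -!addrA [Y + _]addrCA.
  have mulC (X Y : 'M[C]_k) : (1%:M + X) *m Y = 1%:M -> X + (Y - 1%:M) + X *m (Y - 1%:M) = 0.
    rewrite mulmxDl mul1mx => h; rewrite mulmxBr mulmx1 [X + _]addrC -addrA [X + _]addrC subrK.
    by rewrite addrAC h subrr.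
  have mulC' (X Y : 'M[C]_k) : Y *m (1%:M + X) = 1%:M -> (Y - 1%:M) + X + (Y - 1%:M) *m X = 0.
    rewrite mulmxDr mulmx1 => h; rewrite mulmxBl mul1mx -addrA [X + _]addrC subrK.
    by rewrite addrAC h subrr.
  rewrite /g !mulE !PGmM !PGmD.
  split; rewrite (_ : (fun i => _) = fun=> 0) ?PGm0 ?addr0//; apply/funext => i.
    by apply: mulC; rewrite mulmxV// hy.
  by apply: mulC'; rewrite mulVmx// hy.
have cg : continuous g.
  apply/continuous_mxP => a b; under eq_fun do rewrite !mxE.
  move=> t; apply: cvgD; first exact: cvg_cst.
  move: t; rewrite /PG; apply: continuous_sumA => i.
  under eq_fun do rewrite mxE.
  (* The quadratic dependence on [u] is written with products of elements that are affine in [u], so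
     that continuity follows from [continuous_scale_line] and [continuous_mulA]. *)
  have arcE (u : R) (z : C) (x : A) : (arc (y i) u * z) *: x =
      u%:C%C *: (z *: x) + (u%:C%C *: (1 : A)) * ((1 - u%:C%C *: (1 : A)) * (((0 +i* (y i))%C * z) *: x)).
    rewrite mulrBl mul1r -!scalAl !mul1r scalerBr !scalerA -scalerBl -scalerDl; congr (_ *: x).
    have -> : arc (y i) u = u%:C%C + (0 +i* (y i))%C * (u%:C%C * (1 - u%:C%C)).
      by apply/eqP; rewrite eq_complex /=; apply/andP; split; apply/eqP; ring.
    ring.
  set z := (c i - 1%:M) a b.
  suff : continuous (fun u => (arc (y i) u * z) *: km_p M i) by [].
  have -> : (fun u => (arc (y i) u * z) *: km_p M i) = (fun u : R => u%:C%C *: (z *: km_p M i) +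
      (u%:C%C *: (1 : A)) * ((1 - u%:C%C *: (1 : A)) * (((0 +i* (y i))%C * z) *: km_p M i))).
    by apply/funext => u; exact: arcE.
  have cl : continuous (fun u : R => 1 - u%:C%C *: (1 : A)).
    by move=> u; apply: cvgB; [exact: cvg_cst|exact: continuous_scale_line].
  move=> t; apply: cvgD; first exact: continuous_scale_line.
  move: t; apply: continuous_mulA; first exact: continuous_scale_line.
  by apply: continuous_mulA => //; exact: cst_continuous.
have p : inv_path (g 0) (g 1).
  by exists g; split=> //; exact: continuous_subspaceT.
rewrite -g1; split; first by apply: ig; rewrite lexx ler01.
apply: stab_path_trans (stab_path_sym (stab_pathE p)) _; rewrite g0; exact: stab_path_11.
Qed.

End ModelPaths.

Lemma mx_continuous_dist (R : realType) (A : banachAlgType R[i]) k (g : R -> 'M[A]_k) t (e : R) :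
  continuous g -> 0 < e ->
  exists2 d : R, 0 < d & forall u, `|u - t| < d -> mxnrm (g u - g t) <= e.
Proof.
move=> /continuous_mxP cg e0.
have q0 : 0 < (k * k)%:R + 1 :> R by rewrite ltr_wpDl// ler0n.
pose e' := e / ((k * k)%:R + 1); have e'0 : 0 < e' by rewrite divr_gt0.
have : \forall u \near t, forall ij : 'I_k * 'I_k, `|g t ij.1 ij.2 - g u ij.1 ij.2| < e'%:C%C.
  apply: (@filter_forall R _ (fun (ij : 'I_k * 'I_k) u => `|g t ij.1 ij.2 - g u ij.1 ij.2| < e'%:C%C) (nbhs t)) => -[i j] /=; have /cvgrPdist_lt/(_ e'%:C%C) := cg i j t.
  by apply; rewrite ltcR.
move=> /nbhs_ballP[d d0 hd]; exists d => // u ut.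
apply: (@le_trans _ _ ((k * k)%:R * e')).
  apply: mxnrm_le => i j; rewrite !mxE nrmB -lecR -nrmE ltW//.
  by apply: (hd u _ (i, j)); rewrite /ball /= distrC.
rewrite /e' mulrCA ler_piMr//; first exact: ltW.
by rewrite ler_pdivrMr// mul1r lerDl.
Qed.

(** * K1 of the model: the index homomorphism *)

Section ModelK1.
Variables (R : realType) (A B : banachAlgType R[i]) (Z : toeplitz B) (m n : nat).
Variable M : kmodel A Z m n.
Variable sw : swindle (1 : B).
Variable cz : forall k, (0 < k)%N -> cuntz B k.
Local Notation C := R[i].
Local Notation chi := (km_chi M).
Local Notation phi := (km_phi M).

Definition th j k (k0 : (0 < k)%N) (U : 'M[A]_k) : B := theta (cz k0) (phm M j U).

Lemma thM j k (k0 : (0 < k)%N) (U V : 'M[A]_k) :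
  kk Z (th j k0 (U *m V) - th j k0 U * th j k0 V).
Proof. by rewrite -thetaM; apply/theta_kkP/phmM. Qed.

Lemma th1 j k (k0 : (0 < k)%N) : th j k0 1%:M = 1.
Proof. by rewrite /th phm1 theta1. Qed.

Lemma thB j k (k0 : (0 < k)%N) (U V : 'M[A]_k) : th j k0 (U - V) = th j k0 U - th j k0 V.
Proof. by rewrite /th phmD phmN thetaB. Qed.

Lemma th_Fred j k (k0 : (0 < k)%N) (U : 'M[A]_k) : invertible_mx U -> Fred Z (th j k0 U).
Proof.
move=> [V [UV VU]]; exists (th j k0 V); split; apply: kkC.
  by have := thM j k0 V U; rewrite VU th1.
by have := thM j k0 U V; rewrite UV th1.
Qed.

Lemma th_le j k (k0 : (0 < k)%N) :
  exists2 K : R, 0 <= K & forall U, nrm (th j k0 U) <= K * mxnrm U.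
Proof.
have [K K0 hK] := km_phi_le M j.
exists (\sum_i \sum_i' nrm (cz_u (cz k0) i) * K * nrm (cz_v (cz k0) i')).
  by apply: sumr_ge0 => i _; apply: sumr_ge0 => i' _; rewrite !mulr_ge0// nrm_ge0.
move=> U; apply: le_trans (nrm_sum _ _ _) _; rewrite mulr_suml; apply: ler_sum => i _.
apply: le_trans (nrm_sum _ _ _) _; rewrite mulr_suml; apply: ler_sum => i' _.
apply: le_trans (nrmM _ _) _; rewrite mulrAC ler_wpM2r ?nrm_ge0//.
apply: le_trans (nrmM _ _) _; rewrite -mulrA ler_wpM2l ?nrm_ge0// mxE.
by apply: le_trans (hK _) _; rewrite ler_wpM2l// nrm_le_mxnrm.
Qed.

(** By [Ind_near] the index is locally constant along the path, and [clopen01] makes it constant. *)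
Lemma Ind_path j k (k0 : (0 < k)%N) (U V : 'M[A]_k) a b a' b' : inv_path U V ->
  Ind Z (th j k0 U) a b -> Ind Z (th j k0 V) a' b' -> (a + b' = a' + b)%N.
Proof.
move=> /inv_pathP[g [cg ig gU gV]] iU iV.
pose Q t := exists c d, Ind Z (th j k0 (g t)) c d /\ (a + d = c + b)%N.
suff [c [d [icd e]]] : Q 1 by rewrite gV in icd; have := Ind_uniq icd iV; lia.
apply: (@clopen01 R) => [t _|]; last by exists a, b; rewrite gU; split=> //; rewrite addnC.
have [c [d icd]] := Ind_exists (th_Fred j k0 (ig t)).
have [e e0 he] := Ind_near icd; have [K K0 hK] := th_le j k0.
have K1 : 0 < K + 1 by rewrite ltr_wpDl.
have [r r0 hr] := mx_continuous_dist t cg (divr_gt0 e0 K1); exists r => // u _ ut.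
have iu : Ind Z (th j k0 (g u)) c d.
  apply: he; rewrite -thB; apply: le_lt_trans (hK _) _.
  apply: (@le_lt_trans _ _ (K * (e / (K + 1)))); first by rewrite ler_wpM2l// hr.
  by rewrite mulrCA gtr_pMr// ltr_pdivrMr// mul1r ltrDl.
split=> -[c' [d' [i' e']]].
  by exists c, d; split=> //; have := Ind_uniq i' icd; lia.
by exists c, d; split=> //; have := Ind_uniq i' iu; lia.
Qed.

Lemma phm_pad j k l (U : 'M[A]_k) : phm M j (pad_mx l U) = pad_mx l (phm M j U).
Proof.
have phi0 : phi j 0 = 0 by apply: (@addrI _ (phi j 0)); rewrite -km_phiD !addr0.
apply/matrixP => a b; rewrite !mxE /ext_mx; case: insub => [a'|]; last first.
  by case: eqP; rewrite ?km_phi1 ?phi0.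
by case: insub => [b'|] //; rewrite mxE.
Qed.

Lemma idx_exists j (U : inv_mx A) : exists z : int,
  forall a b, Ind Z (th j (inv_dim_gt0 U) U) a b -> z = b%:Z - a%:Z.
Proof.
have [a [b i]] := Ind_exists (th_Fred j (inv_dim_gt0 U) (inv_valP U)).
by exists (b%:Z - a%:Z) => a' b' i'; have := Ind_uniq i i'; lia.
Qed.

(** The negative of the Fredholm index of the [phi j] part, so that the shift counts as 1. *)
Definition idx j U : int := projT1 (cid (idx_exists j U)).

Lemma idxE j U a b : Ind Z (th j (inv_dim_gt0 U) U) a b -> idx j U = b%:Z - a%:Z.
Proof. exact: (projT2 (cid (idx_exists j U))). Qed.

(** Both matrices are padded to a common size at which a path exists; [Ind_pad] compares the indices
    before and after padding, [Ind_path] along the path. *)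
Lemma idx_stab j (U V : inv_mx A) : stab_path U V -> idx j U = idx j V.
Proof.
move=> [K hK]; pose k := maxn K (maxn (inv_dim U) (inv_dim V)).
have Kk : (K <= k)%N by exact: leq_maxl.
have Uk : (inv_dim U <= k)%N by rewrite !leq_max leqnn orbT.
have Vk : (inv_dim V <= k)%N by rewrite !leq_max leqnn !orbT.
have k0 : (0 < k)%N by exact: leq_trans (inv_dim_gt0 U) Uk.
have p := hK k Kk; have [pU pV] := inv_path_inv p.
have [a [b i]] := Ind_exists (th_Fred j (inv_dim_gt0 U) (inv_valP U)).
have [a' [b' i']] := Ind_exists (th_Fred j (inv_dim_gt0 V) (inv_valP V)).
have [c [d q]] := Ind_exists (th_Fred j k0 pU).
have [c' [d' q']] := Ind_exists (th_Fred j k0 pV).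
rewrite (idxE i) (idxE i'); have := Ind_path p q q'.
move: q q'; rewrite /th !phm_pad => q q'.
have := Ind_pad Uk i q; have := Ind_pad Vk i' q'; lia.
Qed.

Definition k1_idx (u : K1 A) : 'rV[int]_n := \row_j idx j (repr u).

Lemma k1_idxE U j : k1_idx (k1c U) 0 j = idx j U.
Proof. by rewrite mxE; apply: idx_stab; apply/K1_piP; rewrite reprK. Qed.

Lemma k1c_pad (U : inv_mx A) k (k0 : (0 < k)%N) (h : (inv_dim U <= k)%N) :
  k1c U = k1c (InvMx k0 (invertible_pad_mx h (inv_valP U))).
Proof.
apply/K1_piP; apply: (@stab_pathI _ _ _ _ k) => //=; rewrite pad_mx_id.
by apply: inv_path_refl; apply: invertible_pad_mx (inv_valP U).
Qed.

(** At a common size the sum of two classes is the class of the product, and indices add under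
    products taken modulo compacts. *)
Lemma k1_idxD u v : k1_idx (u + v) = k1_idx u + k1_idx v.
Proof.
have [U ->] := K1_surj u; have [V ->] := K1_surj v.
have k0 : (0 < inv_dim U + inv_dim V)%N by rewrite addn_gt0 inv_dim_gt0.
rewrite -!/(k1c _) (k1c_pad k0 (leq_addr _ _)) (k1c_pad (U := V) k0 (leq_addl _ _)).
set iU := invertible_pad_mx _ _; set iV := invertible_pad_mx _ _.
rewrite -(k1_mul k0 iU iV (invertible_mxM iU iV)); apply/rowP => j.
rewrite [RHS]mxE !k1_idxE.
have [a [b i]] := Ind_exists (th_Fred j k0 iU).
have [a' [b' i']] := Ind_exists (th_Fred j k0 iV).
rewrite (@idxE _ (InvMx _ _) _ _ i) (@idxE _ (InvMx _ _) _ _ i').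
rewrite (@idxE _ (InvMx _ _) (a' + a) (b + b')); first by lia.
exact: Ind_congr (kkC (thM _ _ _ _)) (Ind_mul i i').
Qed.

End ModelK1.

(** * K1 of the model: injectivity and surjectivity *)

Section ModelK1Iso.
Variables (R : realType) (A B : banachAlgType R[i]) (Z : toeplitz B) (m n : nat).
Variable M : kmodel A Z m n.
Variable sw : swindle (1 : B).
Variable cz : forall k, (0 < k)%N -> cuntz B k.
Local Notation C := R[i].
Local Notation phi := (km_phi M).
Local Notation sg := (km_sg M).

(** Index zero makes the [phi] parts invertible up to compacts. An invertible [W] with the same
    symbols is a product of a matrix trivial by the swindle of [B] and one joined to the identity by
    arcs; [U] times the inverse of [W] is 1 modulo the ideal. *)
Lemma idx0_k1triv (U : inv_mx A) : (forall j, idx M cz j U = 0) -> k1triv U.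
Proof.
case: U => k k0 U iU /= h.
have /choice[q hq] j : exists q : 'M[B]_k, invertible_mx q /\ mx_kk Z (phm M j U - q).
  have [a [b i]] := Ind_exists (th_Fred M cz j k0 iU).
  have e : a = b by have := h j; rewrite (@idxE _ _ _ _ _ _ M cz j (InvMx k0 iU) a b i); lia.
  move: i; rewrite -e => i; have [v iv kv] := Ind_zero (th_Fred M cz j k0 iU) i.
  exists (theta_inv (cz k0) v); split; first by apply/(theta_unit (cz k0)); rewrite theta_invK.
  by apply/(theta_kkP Z (cz k0)); rewrite theta_invK.
have /choice[r hr] j : exists r : 'M[B]_k, q j *m r = 1%:M /\ r *m q j = 1%:M.
  by have [[r [h1 h2]] _] := hq j; exists r.
have mulE (X Y : 'M[B]_k) : X *m Y = 1%:M -> (X - 1%:M) + (Y - 1%:M) + (X - 1%:M) *m (Y - 1%:M) = 0.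
  move=> e; rewrite mulmxBr mulmx1 mulmxBl mul1mx e -[1%:M - Y]opprB -opprD.
  by rewrite [_ + (X - _)]addrC subrr.
have [iW1 tW1] : invertible_mx (1%:M + SGm M (fun j => q j - 1%:M)) /\
    k1triv (1%:M + SGm M (fun j => q j - 1%:M)).
  by apply: (k1_SGm M sw k0 (G := fun j => r j - 1%:M)) => j; apply: mulE; case: (hr j).
have [V [UV VU]] := iU.
have cd i : chm M i U *m chm M i V = 1%:M by rewrite -chmM UV chm1.
have [iW2 tW2] := k1_PGm M cd.
set W1 := 1%:M + SGm M _ in iW1 tW1; set W2 := 1%:M + PGm M _ in iW2 tW2.
have iW := invertible_mxM iW1 iW2; have tW := k1triv_mul k0 iW1 iW2 tW1 tW2.
have WE : W1 *m W2 = 1%:M + (SGm M (fun j => q j - 1%:M) + PGm M (fun i => chm M i U - 1%:M)).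
  by rewrite /W1 /W2 mulmxDl mul1mx mulmxDr mulmx1 SGm_PGm addr0 -addrA [PGm _ _ + _]addrC.
set W := W1 *m W2 in iW tW WE.
have cUW : mx_cideal (km_e M) (U - W).
  rewrite WE; apply: mx_mem => [i|j].
    by rewrite !(chmD, chmN) chm_PGm chm_SGm chm1 add0r [1%:M + _]addrC subrK subrr.
  rewrite !(phmD, phmN) phm_PGm phm_SGm phm1 addr0 [1%:M + _]addrC subrK; by case: (hq j).
have [W' [WW' W'W]] := iW; have iW' : invertible_mx W' by exists W.
have iUW : invertible_mx (U *m W') by exact: invertible_mxM.
have tUW : k1triv (U *m W').
  apply: (k1triv_cideal (km_ee M) (km_sw M) iUW).
  by rewrite -WW' -mulmxBl; exact: mx_cidealMr.
by have := k1triv_mul k0 iUW iW tUW tW; rewrite -mulmxA W'W mulmx1.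
Qed.

Lemma Ind_theta1 k0 b b' : Ind Z b 0 b' -> Ind Z (theta (cz (k0 : (0 < 1)%N)) b%:M) 0 b'.
Proof.
move=> ib; rewrite /theta big_ord1 big_ord1 mxE eqxx mulr1n.
have vu : cz_v (cz k0) ord0 * cz_u (cz k0) ord0 = 1 by rewrite cz_vu eqxx.
have uv : cz_u (cz k0) ord0 * cz_v (cz k0) ord0 = 1 by have := cz_uv (cz k0); rewrite big_ord1.
have iu : Ind Z (cz_u (cz k0) ord0) 0 0 by apply: Ind_unit; exists (cz_v (cz k0) ord0).
have iv : Ind Z (cz_v (cz k0) ord0) 0 0 by apply: Ind_unit; exists (cz_u (cz k0) ord0).
by have := Ind_mul (Ind_mul iu ib) iv; rewrite !addn0.
Qed.

(** The shift on fibre [j] is not invertible in [A], but its defect is equivalent to that of [dn]; a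
    matrix of size 2 lets the two defects cancel while the second diagonal entry has index zero. *)
Lemma k1_idx_surj j : exists u, k1_idx M cz u = delta_mx 0 j.
Proof.
have [up [dn [x [y [updn xy yx xdn [upy px yp phiup phix]]]]]] := km_index M j.
have sgN f : sg j (- f) = - sg j f.
  by apply: (@addIr _ (sg j f)); rewrite -km_sgD !addNr; apply: (@addIr _ (sg j 0)); rewrite -km_sgD !add0r.
have sM f g : sg j f * sg j g = sg j (f * g) by rewrite km_sgM eqxx.
have pE : sg j (tzp Z) = sg j 1 - sg j (tz_s Z * tz_t Z) by rewrite /tzp km_sgD sgN.
pose S := sg j (tz_s Z) + (1 - sg j 1); pose T := sg j (tz_t Z) + (1 - sg j 1).
have sg0 : sg j 0 = 0 by apply: (@addIr _ (sg j 0)); rewrite -km_sgD !add0r.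
set q := 1 - sg j 1 in S T *.
have fe f : sg j f * q = 0 by rewrite mulrBr mulr1 sM mulr1 subrr.
have ef f : q * sg j f = 0 by rewrite mulrBl mul1r sM mul1r subrr.
have qq : q * q = q by rewrite {1}/q mulrBl mul1r fe subr0.
have STE f g : (sg j f + q) * (sg j g + q) = sg j (f * g) + q.
  by rewrite mulrDl (mulrDr (sg j f)) (mulrDr q) fe ef addr0 add0r sM qq.
have ST : S * T + x * y = 1 by rewrite STE xy pE /q -addrA [1 - _ + _]addrA subrK addrC subrK.
have TS : T * S = 1 by rewrite STE tz_ts addrC subrK.
have Tx : T * x = 0 by rewrite -px mulrA mulrDl ef sM tz_tp sg0 addr0 mul0r.
have yS : y * S = 0 by rewrite -yp -mulrA mulrDr fe sM tz_ps sg0 addr0 mulr0.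
(* The range of [S] misses the summand [x * y], which [x] fills from the part annihilated by [up];
   the inverse [V] undoes this with [y] and [dn]. Under [phi] the matrix becomes diagonal with
   second entry 1. *)
pose U : 'M[A]_(1 + 1) := block_mx S%:M x%:M 0 up%:M.
pose V : 'M[A]_(1 + 1) := block_mx T%:M 0 y%:M dn%:M.
have iU : invertible_mx U.
  exists V; rewrite /U /V !mulmx_block !mul0mx !mulmx0 -!scalar_mxM -!raddfD /=.
  rewrite !add0r !addr0 ST TS Tx yS xdn upy updn yx subrK !raddf0.
  by rewrite -!scalar_mx_block.
exists (k1c (InvMx (isT : (0 < 1 + 1)%N) iU)); apply/rowP => j'.
rewrite k1_idxE !mxE eqxx /=.
have phi0 : phi j' 0 = 0 by apply: (@addrI _ (phi j' 0)); rewrite -km_phiD !addr0.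
have phmU : phm M j' U = pad_mx (1 + 1) ((phi j' S)%:M : 'M[B]_1).
  rewrite pad_mx_block /phm map_block_mx; congr block_mx; apply/matrixP => a b;
    by rewrite !mxE ?ord1 ?mulr1n ?phix ?phiup ?phi0.
have iS : Ind Z (phi j' S) 0 (j' == j).
  rewrite /S !km_phiD phiN !km_phi_sg km_phi1 eq_sym; case: eqP => _.
    by rewrite subrr addr0; exact: Ind_s.
  by rewrite oppr0 addr0 add0r; exact: Ind_unit (rinv1 _).
have [a [b i]] := Ind_exists (th_Fred M cz j' (isT : (0 < 1 + 1)%N) iU).
rewrite (@idxE _ _ _ _ _ _ M cz j' (InvMx _ iU) a b i).
move: i; rewrite /th phmU => i; have := Ind_pad (isT : (1 <= 1 + 1)%N) (Ind_theta1 (isT : (0 < 1)%N) iS) i.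
by rewrite add0n; case: (j' == j) => e; rewrite e; lia.
Qed.

Lemma model_K1 : zmod_isomorphic (K1 A) 'rV[int]_n.
Proof.
apply: (@zmod_iso_rV _ _ (k1_idx M cz)); first exact: k1_idxD.
  move=> u; have [U ->] := K1_surj u => h.
  have tU : k1triv U.
    apply: idx0_k1triv => j; have /rowP/(_ j) := h; by rewrite -/(k1c _) k1_idxE mxE.
  by move: U tU h => [k k0 U iU] tU _; apply/(k1trivP k0 iU).
exact: k1_idx_surj.
Qed.

End ModelK1Iso.

(** * The space X realizes the model *)

Section Instance.
Variables (R : realType) (m n : nat) (W : omega1).
Local Notation C := R[i].
Local Notation xspec := (xspec R m n W).
Local Notation X := (fspace xspec).
Local Notation A := (bounded_op (fspace_of xspec)).
Local Notation B := (bounded_op (fspace_of (ell1 R))).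
Local Notation Z := (l1_toeplitz R).

Let chZ (i : 'I_m) (c : C) (S : A) : chi (lix n i) (c *: S) = c * chi (lix n i) S.
Proof.
have -> : c *: S = (c *: (1 : A) : A) * S by apply: bounded_opP.
rewrite (chiM (lixP n i)); congr (_ * _); apply: (chi_val (lixP n i)) => x al.
by [].
Qed.

Let PhZ (j : 'I_n) (c : C) (S : A) : Phi (hixP m j) (c *: S) = c *: Phi (hixP m j) S.
Proof.
have [al h] := sclub_common [:: S; c *: S].
have hS : club (sclub S) al := h 0%N; have hT : club (sclub (c *: S)) al := h 1%N.
rewrite (PhiE (hixP m j) hS) (PhiE (hixP m j) hT); apply: bounded_opP => y.
exact: fspaceP.
Qed.

Let PhiK (j : 'I_n) : exists2 K : R, 0 <= K & forall S : A, nrm (Phi (hixP m j) S) <= K * nrm S.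
Proof.
exists (((hix m j : nat)`!)%:R * 3); first by rewrite mulr_ge0.
by move=> S; exact: Phi_le.
Qed.

Let ppM (i i' : 'I_m) : @pp R m n W (lix n i) * @pp R m n W (lix n i') = if i == i' then @pp R m n W (lix n i) else 0 :> A.
Proof.
case: eqP => [->|/eqP ne]; first exact: pp_pp.
by apply: pp_orth; rewrite lix_inj.
Qed.

Let sgM (j j' : 'I_n) (f g : B) : sigma W (hixP m j) f * sigma W (hixP m j') g =
  if j == j' then sigma W (hixP m j) (f * g) else 0 :> A.
Proof.
case: eqP => [->|/eqP ne]; first by rewrite sigmaM.
by apply: sigma_orth; rewrite hix_inj.
Qed.

Let Phs (j j' : 'I_n) (f : B) : Phi (hixP m j) (sigma W (hixP m j') f) = if j == j' then f else 0.
Proof.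
case: eqP => [->|/eqP ne]; first by rewrite Phi_sigma.
by apply: Phi_sigma_ne; rewrite hix_inj.
Qed.

Let chp (i i' : 'I_m) : chi (lix n i) (@pp R m n W (lix n i')) = (i == i')%:R.
Proof. by rewrite (chi_pp R W (lix n i') (lixP n i)) lix_inj. Qed.

Let Php (j : 'I_n) (i : 'I_m) : Phi (hixP m j) (@pp R m n W (lix n i)) = 0.
Proof. by apply: Phi_pp; rewrite eq_sym lix_hix. Qed.

Let index (j : 'I_n) : exists up dn x y : A,
  [/\ up * dn = 1, x * y = sigma W (hixP m j) (tzp Z), y * x = 1 - dn * up, x * dn = 0 &
   [/\ up * y = 0, sigma W (hixP m j) (tzp Z) * x = x, y * sigma W (hixP m j) (tzp Z) = y,
    forall j', Phi (hixP m j') up = 1 & forall j', Phi (hixP m j') x = 0]].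
Proof.
exists (slot_up R m W j), (slot_dn R m W j), (back R m W j), (fwd R m W j); split.
- exact: up_dn.
- exact: xy_sigma.
- exact: yx_dn_up.
- exact: x_dn.
split; [exact: up_y|exact: sigma_x|exact: y_sigma|exact: Phi_up|exact: Phi_x].
Qed.

Definition x_model : kmodel A Z m n :=
  @KModel R A B Z m n (ee R m n W) (ee_ee R m n W) (ee_swindle R m n W)
  (fun i => chi (lix n i)) (fun i => chiD (lixP n i)) (fun i => chiM (lixP n i)) (fun i => chi1 R W (lixP n i)) chZ
  (fun j => Phi (hixP m j)) (fun j => PhiD (hixP m j)) (fun j => PhiM (hixP m j)) (fun j => Phi1 R W (hixP m j)) PhZ PhiK
  (fun i => @pp R m n W (lix n i)) ppM
  (fun j => sigma W (hixP m j)) (fun j => sigmaD W (hixP m j)) sgM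
  (fun i j f => proj1 (pp_sigma W (hixP m j) f (lix_hix i j)))
  (fun i j f => proj2 (pp_sigma W (hixP m j) f (lix_hix i j)))
  chp (fun i j => chi_sigma W (lixP n i) (hixP m j)) Php Phs (@mem_cideal R m n W) index.

End Instance.

Theorem theorem5p2 (R : realType) (m n : nat) :
  exists X : completeNormedModType R[i],
    [/\ infinite_dimensional X,
        zmod_isomorphic (K0 (bounded_op X)) 'rV[int]_m &
        zmod_isomorphic (K1 (bounded_op X)) 'rV[int]_n].
Proof.
have [W] := omega1_exists; exists (fspace_of (xspec R m n W)).
split; first exact: x_infinite.
- exact: model_K0 (x_model R m n W) (l1_swindle R) (@l1_cuntz R).
- exact: model_K1 (x_model R m n W) (l1_swindle R) (@l1_cuntz R).
Qed.
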